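(* Let $m\ge 3$ be an integer. There is a constant $\delta>0$, depending on the Sobolev embedding theorem ($H^m(\mathbb T^3)\subset L^\infty(\mathbb T^3)$), such that the following holds. Let $0<\Omega<1$, $\varkappa>0$, $\mu\in\mathbb R$, and let $u_0\in H^{m+1}(\mathbb T^3)$, $u_1\in H^m(\mathbb T^3)$ be initial data with zero mean on $\mathbb T^3$ which satisfy $$\tfrac14\|u_0\|_{H^m}\le E_m(0)\qquad\text{and}\qquad E_m(0)\le \delta\,\Omega .$$ Then there exists $\varepsilon_0>0$ (which may depend on the initial data) such that for every $\varepsilon$ with $0<\varepsilon\le\varepsilon_0$ and every function $a$ with $a(t,\cdot)\in H^m(\mathbb T^3)$ for all $t\ge 0$ and $$\sup_{t\in[0,\infty)}\|a(t,\cdot)\|_{H^m}\le\varepsilon,$$ the classical solution $u$ of the Cauchy problem $$\partial_t^2u-\Delta u=-2\Omega\,\partial_tu+e^{-\varkappa t}a(t,x)(1+u)^\mu,\qquad (u(0,\cdot),\partial_tu(0,\cdot))=(u_0,u_1)$$ exists on $[0,\infty)\times\mathbb T^3$, and $$\|u(t)\|_{H^m}\le\sqrt2\,\delta\,\Omega\qquad\text{for all }t\ge0 .$$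
   Context: $\mathbb T^3=(\mathbb R/2\pi\mathbb Z)^3$ is the flat torus and all functions are real-valued. For an integer $m\ge0$, $H^m=H^m(\mathbb T^3)$ is the Sobolev space with norm $\|u\|_{H^m}^2=\sum_{|\vec\alpha|\le m}\|\partial_{\vec\alpha}u\|_{L^2(\mathbb T^3)}^2$, where $\vec\alpha$ runs over spatial multi-indices. The energy is $$E_m^2(t)=\sum_{|\vec\alpha|\le m}\frac12\int_{\mathbb T^3}\Big[(\partial_t\partial_{\vec\alpha}u)^2+\Omega\,(\partial_{\vec\alpha}u)(\partial_{\vec\alpha}\partial_tu)+\tfrac12\Omega^2(\partial_{\vec\alpha}u)^2+|\nabla(\partial_{\vec\alpha}u)|^2\Big]d^3x,\qquad E_m(t)\ge0,$$ so $E_m(0)$ is computed from the initial data $u(0)=u_0$, $\partial_tu(0)=u_1$. Solutions on $[0,T]$ are understood with the regularity $u\in L^\infty([0,T];H^{m+1})\cap C^{0,1}([0,T];H^m)$, where $C^{0,1}$ denotes Lipschitz functions; a global solution has this regularity on $[0,T]$ for every $T>0$.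
   Formalization: The function a is additionally assumed jointly measurable in (t,x); without this, e.g. for a(t,x)=c·1_E(t) with E non-measurable, the Cauchy problem has no solution in any sense. *)

(* Defs.v *)
From HB Require Import structures.
From mathcomp Require Import all_boot all_order all_algebra.
From mathcomp Require Import all_classical all_reals all_analysis.
Set Implicit Arguments.
Unset Strict Implicit.
Unset Printing Implicit Defensive.
Import Order.TTheory GRing.Theory Num.Theory.
Import numFieldNormedType.Exports.
Local Open Scope classical_set_scope.
Local Open Scope ring_scope.

(* Functions on the torus (R / 2 pi Z)^3 are functions on R^3 that are
   2 pi-periodic in each variable, integrated over the cube [0, 2 pi]^3. *)
Section Torus.
Context {R : realType}.
Local Notation R3 := (R * R * R)%type.
Implicit Types (f g phi : R3 -> R) (x : R3) (i j : 'I_3).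

Definition leb3 := ((@lebesgue_measure R \x @lebesgue_measure R)
                      \x @lebesgue_measure R)%E.

Definition cube : set R3 :=
  (`[0, 2 * pi] `*` `[0, 2 * pi]) `*` `[0, 2 * pi].

Definition unit_vec i : R3 := ((i == 0)%:R, (i == 1)%:R, (i == 2)%:R).

Definition torus_periodic f := forall x i, f (x + (2 * pi) *: unit_vec i) = f x.

Definition mean_zero f := \int[leb3]_(x in cube) f x = 0.

Definition L2 f := [/\ torus_periodic f, measurable_fun setT f
  & leb3.-integrable cube (EFin \o (fun x => f x ^+ 2))].

(* Classical derivatives. *)
Definition partial i f : R3 -> R := fun x => 'D_(unit_vec i) f x.

Definition laplacian f : R3 -> R := fun x => \sum_(i < 3) partial i (partial i f) x.

Definition smooth f := forall s : seq 'I_3,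
  continuous (foldr partial f s) /\
  (forall i x, derivable (foldr partial f s) x (unit_vec i)).

(* Multi-indices. *)
Definition mlen (al : 'I_3 -> nat) : nat := (\sum_(i < 3) al i)%N.

Definition munit i : 'I_3 -> nat := fun j => (j == i : nat).

Definition mpartial (al : 'I_3 -> nat) f : R3 -> R :=
  iter (al 0) (partial 0) (iter (al 1) (partial 1) (iter (al 2) (partial 2) f)).

(* g is the weak derivative of f of order al, and lies in L^2. *)
Definition is_weak_deriv (al : 'I_3 -> nat) f g := L2 g /\
  forall phi, smooth phi -> torus_periodic phi ->
    \int[leb3]_(x in cube) (f x * mpartial al phi x) =
    (-1) ^+ mlen al * \int[leb3]_(x in cube) (g x * phi x).

(* A representative of the weak derivative, which is unique up to a.e. equality;
   the zero function if there is none. *)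
Definition wderiv (al : 'I_3 -> nat) f : R3 -> R :=
  xget (cst 0) [set g | is_weak_deriv al f g].

Definition sobolev (m : nat) f :=
  L2 f /\ forall al, (mlen al <= m)%N -> exists g, is_weak_deriv al f g.

(* Since |al| <= m forces al i <= m, the sums below run over all multi-indices
   of length at most m. *)
Definition Hnorm (m : nat) f : R := Num.sqrt
  (\sum_(al : {ffun 'I_3 -> 'I_m.+1} | (mlen (fun i => al i) <= m)%N)
     \int[leb3]_(x in cube) (wderiv (fun i => al i) f x) ^+ 2).

(* The energy E_m of a state with value f and time derivative g. *)
Definition energy (m : nat) (Omega : R) f g : R := Num.sqrt
  (\sum_(al : {ffun 'I_3 -> 'I_m.+1} | (mlen (fun i => al i) <= m)%N)
     2^-1 * \int[leb3]_(x in cube)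
       (let Df := wderiv (fun i => al i) f in
        let Dg := wderiv (fun i => al i) g in
        Dg x ^+ 2 + Omega * (Df x * Dg x) + 2^-1 * Omega ^+ 2 * Df x ^+ 2
        + \sum_(i < 3) (wderiv (munit i) Df x) ^+ 2)).

(* u is in L^oo([0, T]; H^m); a.e. boundedness is the only requirement, since
   strong measurability is automatic for the (Lipschitz) curves considered. *)
Definition Linfty_sobolev (T : R) (m : nat) (u : R -> R3 -> R) :=
  exists C : R, {ae @lebesgue_measure R, forall t, 0 <= t <= T ->
    sobolev m (u t) /\ Hnorm m (u t) <= C}.

(* u is in C^{0,1}([0, T]; H^m) *)
Definition Lip_sobolev (T : R) (m : nat) (u : R -> R3 -> R) :=
  (forall t, 0 <= t <= T -> sobolev m (u t)) /\
  exists L : R, forall s t, 0 <= s <= T -> 0 <= t <= T ->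
    Hnorm m (fun x => u t x - u s x) <= L * `|t - s|.

Definition continuous_future (u : R -> R3 -> R) :=
  {within [set p : R * R3 | 0 <= p.1], continuous (fun p => u p.1 p.2)}.

(* v is the time derivative of u on [0, +oo[ x R^3, one-sided at t = 0. *)
Definition time_deriv (u v : R -> R3 -> R) := forall t x, 0 <= t ->
  h^-1 * (u (t + h) x - u t x) @[h --> within [set h | 0 <= t + h] (0 : R)^']
    --> v t x.

(* u, with time derivative v, is a solution on [0, +oo[ of
     u_tt - Laplacian u = - 2 Omega u_t + e^{-kappa t} a (1 + u)^mu,
     u(0) = u0, u_t(0) = u1.
   All derivatives are classical: for m >= 3 the regularity of sol_Linfty and
   sol_Lip together with the equation yields, by Sobolev embedding, the
   continuity required of u, u_t and the spatial derivatives up to order 2, and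
   a right-hand side that is bounded on bounded time intervals. As a is not
   assumed continuous in t, u_tt exists for almost every t only; since u_t is
   locally Lipschitz in t it is the integral of u_tt. If a is continuous then u
   is C^2 and the equation holds everywhere.
   Positivity of 1 + u makes the real power meaningful. *)
Record solution_with_deriv (m : nat) (Omega kappa mu : R) (a : R -> R3 -> R)
    (u0 u1 : R3 -> R) (u v : R -> R3 -> R) : Prop := SolutionWithDeriv {
  sol_Linfty : forall T, 0 < T -> Linfty_sobolev T m.+1 u ;
  sol_Lip : forall T, 0 < T -> Lip_sobolev T m u ;
  sol_continuous : continuous_future u ;
  sol_time_deriv : time_deriv u v ;
  sol_time_deriv_continuous : continuous_future v ;
  sol_time_deriv_Lip : forall T, 0 < T -> exists L : R, forall s t x,
    0 <= s <= T -> 0 <= t <= T -> `|v t x - v s x| <= L * `|t - s| ;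
  sol_partial : forall i,
    (forall t x, 0 <= t -> derivable (u t) x (unit_vec i)) /\
    continuous_future (fun t => partial i (u t)) ;
  sol_partial2 : forall i j,
    (forall t x, 0 <= t -> derivable (partial i (u t)) x (unit_vec j)) /\
    continuous_future (fun t => partial j (partial i (u t))) ;
  sol_positive : forall t x, 0 <= t -> 0 < 1 + u t x ;
  sol_initial : {ae leb3, forall x, u 0 x = u0 x /\ v 0 x = u1 x} ;
  sol_equation : {ae @lebesgue_measure R, forall t, 0 < t ->
    {ae leb3, forall x, derivable (fun s => v s x) t 1 /\
      'D_1 (fun s => v s x) t - laplacian (u t) x =
        - (2 * Omega * v t x) + expR (- (kappa * t)) * a t x * (1 + u t x) `^ mu}}
}.

Definition global_solution (m : nat) (Omega kappa mu : R) (a : R -> R3 -> R)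
    (u0 u1 : R3 -> R) (u : R -> R3 -> R) : Prop :=
  exists v, solution_with_deriv m Omega kappa mu a u0 u1 u v.

End Torus.

(* Main.v *)
Require Import Defs.
From HB Require Import structures.
From mathcomp Require Import all_boot all_order all_algebra.
From mathcomp Require Import all_classical all_reals all_analysis.
From mathcomp Require Import measurable_realfun zify ring lra.
Import Order.TTheory GRing.Theory Num.Theory.
Import numFieldNormedType.Exports.
Local Open Scope classical_set_scope.
Local Open Scope ring_scope.
Set Implicit Arguments.
Unset Strict Implicit.
Unset Printing Implicit Defensive.

(* On the torus the problem is solved mode by mode in the real orthogonal system
   [bas k x = cos (k.x) + sin (k.x)] (Hartley series). For k <> 0 the linear flow
   does not increase (z + Om y / 2)^2 + (Om^2 / 4 + |k|^2) y^2, and zero mean kills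
   the mode k = 0; since |k|^2 >= 1 the linear part stays strictly below the claimed
   bound. The forcing term is integrable in time thanks to exp (- kappa t) and is
   of size eps in the weighted l^2 norm that describes H^m, by the product estimate
   and the binomial series of (1 + u)^mu. Picard iteration of the Duhamel formula,
   contracting in L^2 by the pointwise Lipschitz bound of the power, gives the
   solution, and the same contraction gives uniqueness: the modes of any solution
   satisfy the Duhamel formula. The Duhamel kernels gain one derivative, which
   yields the H^(m+1) regularity. As [a] is only measurable and a representative
   of its Sobolev class, it is clipped at its sup bound, which changes it on a
   null set only. *)

(** The bound to be proved concerns the exact H^m norm, while products and powers are controlled
    only up to constants. Hence two weighted norms run in parallel: [hbd], with weight (1 +
    |k|^2)^m, suits products, and [Vbd] carries the exact symbol [Wm] of the H^m norm. The constants
    lost between them affect only the Duhamel term, where eps absorbs them, and the radius of the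
    ball on which the power is expanded, where [delta] absorbs them. Distances between iterates are
    measured with a weight growing exponentially in time, so a single iteration covers the whole
    half-line and no continuation argument occurs; the same weight replaces Gronwall's inequality in
    the uniqueness arguments. Since [a] has no continuity in time, u_tt exists only for almost every
    t. The mode equations are therefore used in integrated form; for an arbitrary solution they are
    obtained from difference quotients by dominated convergence. *)

(** * Real-valued integrals on a set of finite measure *)

Section FiniteMeasure.
Context {d : measure_display} {T : measurableType d} {R : realType}
  (mu : {measure set T -> \bar R}) (D : set T).
Hypothesis mD : measurable D.
Hypothesis muD : (mu D < +oo)%E.
Implicit Types f g h : T -> R.

Definition integ f := mu.-integrable D (EFin \o f).
Definition sqint f := measurable_fun D f /\ integ (fun x => f x ^+ 2).

Lemma integ_mfun f : integ f -> measurable_fun D f.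
Proof. by move=> /integrableP[/measurable_EFinP]. Qed.

Lemma integ_le f g : measurable_fun D f -> (forall x, D x -> `|f x| <= g x) ->
  integ g -> integ f.
Proof.
move=> mf fg ig; apply: (le_integrable mD _ _ ig).
  exact/measurable_EFinP.
move=> x Dx /=; rewrite lee_fin; apply: le_trans (fg x Dx) _; exact: ler_norm.
Qed.

Lemma integ_cst (c : R) : integ (fun=> c).
Proof.
apply: measurable_bounded_integrable => //.
by exists `|c|; split; [exact: num_real|move=> M /ltW cM x Dx /=].
Qed.

Lemma integ_bd f (M : R) : measurable_fun D f -> (forall x, D x -> `|f x| <= M) -> integ f.
Proof. move=> mf fM; apply: (integ_le mf fM); exact: integ_cst. Qed.

Lemma integD f g : integ f -> integ g -> integ (fun x => f x + g x).
Proof. exact: integrableD. Qed.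

Lemma integZ (c : R) f : integ f -> integ (fun x => c * f x).
Proof. exact: integrableZl. Qed.

Lemma integB f g : integ f -> integ g -> integ (fun x => f x - g x).
Proof. exact: integrableB. Qed.

Lemma integ_norm f : integ f -> integ (fun x => `|f x|).
Proof. exact: integrable_abse. Qed.

Lemma integ_sum (I : Type) (s : seq I) (F : I -> T -> R) :
  (forall i, integ (F i)) -> integ (fun x => \sum_(i <- s) F i x).
Proof.
move=> iF; elim: s => [|i s IH].
  by under eq_fun do rewrite big_nil; exact: integ_cst.
by under eq_fun do rewrite big_cons; exact: integD.
Qed.

Lemma Rint_sum (I : Type) (s : seq I) (F : I -> T -> R) :
  (forall i, integ (F i)) ->
  \int[mu]_(x in D) (\sum_(i <- s) F i x) = \sum_(i <- s) \int[mu]_(x in D) F i x.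
Proof.
move=> iF; elim: s => [|i s IH].
  under eq_Rintegral do rewrite big_nil; rewrite big_nil.
  by rewrite Rintegral_cst// mul0r.
under eq_Rintegral do rewrite big_cons; rewrite big_cons -IH.
apply: RintegralD => //; first exact: iF. exact: integ_sum.
Qed.

Lemma eq_Rint f g : (forall x, D x -> f x = g x) ->
  \int[mu]_(x in D) f x = \int[mu]_(x in D) g x.
Proof. by move=> fg; apply: eq_Rintegral => x /[!inE]; exact: fg. Qed.

Lemma RintD f g : integ f -> integ g ->
  \int[mu]_(x in D) (f x + g x) = \int[mu]_(x in D) f x + \int[mu]_(x in D) g x.
Proof. exact: RintegralD. Qed.

Lemma RintB f g : integ f -> integ g ->
  \int[mu]_(x in D) (f x - g x) = \int[mu]_(x in D) f x - \int[mu]_(x in D) g x.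
Proof. exact: RintegralB. Qed.

Lemma RintZ (c : R) f : integ f ->
  \int[mu]_(x in D) (c * f x) = c * \int[mu]_(x in D) f x.
Proof. exact: RintegralZl. Qed.

Lemma le_Rint f g : integ f -> integ g -> (forall x, D x -> f x <= g x) ->
  \int[mu]_(x in D) f x <= \int[mu]_(x in D) g x.
Proof. exact: le_Rintegral. Qed.

Lemma norm_Rint_le f g : integ f -> integ g -> (forall x, D x -> `|f x| <= g x) ->
  `|\int[mu]_(x in D) f x| <= \int[mu]_(x in D) g x.
Proof.
move=> If Ig fg; apply: le_trans (le_normr_Rintegral mD If) _.
by apply: le_Rint => //; exact: integ_norm.
Qed.

Lemma Rint_ae f g : measurable_fun D f -> measurable_fun D g ->
  {ae mu, forall x, D x -> f x = g x} ->
  \int[mu]_(x in D) f x = \int[mu]_(x in D) g x.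
Proof.
move=> mf mg fg; congr fine; apply: ae_eq_integral => //.
- exact/measurable_EFinP.
- exact/measurable_EFinP.
- by apply: filterS fg => x h /h /= ->.
Qed.

Lemma integ_ae f g : measurable_fun D g ->
  {ae mu, forall x, D x -> f x = g x} -> integ f -> integ g.
Proof.
move=> mg fg /integrableP[mf ifo]; apply/integrableP; split; first exact/measurable_EFinP.
rewrite (_ : (\int[mu]_(x in D) `|(EFin \o g) x| = \int[mu]_(x in D) `|(EFin \o f) x|)%E) //.
apply: ae_eq_integral => //.
- by apply: measurableT_comp => //; exact/measurable_EFinP.
- exact: measurableT_comp.
- by apply: filterS fg => x h /h /= ->.
Qed.

Lemma Rint_eq0 f : integ f -> (forall x, D x -> 0 <= f x) ->
  \int[mu]_(x in D) f x = 0 -> {ae mu, forall x, D x -> f x = 0}.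
Proof.
move=> /[dup] /integrableP[mf _] intf f0 if0.
have [+ _] := ae_eq_integral_abs mu mD mf.
have e : (\int[mu]_(x in D) `|(EFin \o f) x| = 0)%E.
  transitivity (\int[mu]_(x in D) (EFin \o f) x)%E.
    by apply: eq_integral => x /[!inE] Dx /=; rewrite ger0_norm// f0.
  rewrite -(fineK (integrable_fin_num mD intf)); congr EFin.
  exact: if0.
by move=> /(_ e); apply: filterS => x h /h /= [].
Qed.

Lemma Rint_dct (f_ : nat -> T -> R) f g :
  (forall n, measurable_fun D (f_ n)) -> measurable_fun D f ->
  {ae mu, forall x, D x -> f_ n x @[n --> \oo] --> f x} ->
  integ g -> (forall n, {ae mu, forall x, D x -> `|f_ n x| <= g x}) ->
  integ f /\ (\int[mu]_(x in D) f_ n x @[n --> \oo] --> \int[mu]_(x in D) f x).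
Proof.
move=> mf_ mf cf ig bg.
have [] := @dominated_convergence _ _ _ mu D mD (fun n => EFin \o f_ n) (EFin \o f) (EFin \o g).
- by move=> n; exact/measurable_EFinP.
- exact/measurable_EFinP.
- apply: filterS cf => x h /h cx; apply: cvg_EFin => //; exact: nearW.
- exact: ig.
- have := ae_foralln bg; apply: filterS => x h n Dx /=; rewrite lee_fin; exact: h.
move=> intf _ cvgi; split => //.
apply: fine_cvg; rewrite fineK; last exact: integrable_fin_num.
exact: cvgi.
Qed.

Lemma sqintM f g : sqint f -> sqint g -> integ (fun x => f x * g x).
Proof.
move=> [mf if2] [mg ig2]; apply: (integ_le (g := fun x => f x ^+ 2 + g x ^+ 2)).
- exact: measurable_funM.
- move=> x _; rewrite normrM -(real_normK (num_real (f x))) -(real_normK (num_real (g x))).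
  have := sqr_ge0 (`|f x| - `|g x|); have := normr_ge0 (f x); have := normr_ge0 (g x); nra.
- exact: integD.
Qed.

Lemma sqint_bd f (M : R) : measurable_fun D f -> (forall x, D x -> `|f x| <= M) -> sqint f.
Proof.
move=> mf fM; split => //; apply: (@integ_bd _ (M ^+ 2)).
  exact: measurable_funX.
move=> x Dx; rewrite normrX lerXn2r ?nnegrE// ?fM//.
exact: le_trans (fM _ Dx).
Qed.

Lemma sqint_cst (c : R) : sqint (fun=> c).
Proof. by apply: (@sqint_bd _ `|c|). Qed.

Lemma sqint_integ f : sqint f -> integ f.
Proof.
move=> sf; have := sqintM sf (sqint_cst 1).
by under eq_fun do rewrite mulr1.
Qed.

Lemma sqintD f g : sqint f -> sqint g -> sqint (fun x => f x + g x).
Proof.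
move=> /[dup] sf [mf if2] /[dup] sg [mg ig2]; split; first exact: measurable_funD.
have -> : (fun x => (f x + g x) ^+ 2) = (fun x => f x ^+ 2 + (2 * (f x * g x) + g x ^+ 2)).
  by apply/funext => x; ring.
apply: integD => //; apply: integD => //; apply: integZ; exact: sqintM.
Qed.

Lemma sqintZ (c : R) f : sqint f -> sqint (fun x => c * f x).
Proof.
move=> [mf if2]; split; first exact: measurable_funM.
by under eq_fun do rewrite exprMn; exact: integZ.
Qed.

Lemma sqintB f g : sqint f -> sqint g -> sqint (fun x => f x - g x).
Proof.
move=> sf sg; have := sqintD sf (sqintZ (-1) sg).
by under eq_fun do rewrite mulN1r.
Qed.

Lemma sqint_Mbd f g (M : R) : sqint f -> measurable_fun D g -> (forall x, D x -> `|g x| <= M) ->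
  sqint (fun x => f x * g x).
Proof.
move=> [mf if2] mg gM; split; first exact: measurable_funM.
apply: (integ_le (g := fun x => M ^+ 2 * f x ^+ 2)); last exact: integZ.
  by apply: measurable_funX; exact: measurable_funM.
move=> x Dx; rewrite normrX normrM exprMn mulrC.
apply: ler_pM; rewrite ?sqr_ge0//; last by rewrite real_normK// num_real.
by rewrite lerXn2r ?nnegrE// ?gM//; exact: le_trans (gM _ Dx).
Qed.

Lemma sqint_sum (I : Type) (s : seq I) (F : I -> T -> R) :
  (forall i, sqint (F i)) -> sqint (fun x => \sum_(i <- s) F i x).
Proof.
move=> iF; elim: s => [|i s IH].
  by under eq_fun do rewrite big_nil; exact: sqint_cst.
by under eq_fun do rewrite big_cons; exact: sqintD.
Qed.

Lemma sqint_ae f g : measurable_fun D g ->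
  {ae mu, forall x, D x -> f x = g x} -> sqint f -> sqint g.
Proof.
move=> mg fg [mf if2]; split => //; apply: (integ_ae _ _ if2).
  exact: measurable_funX.
by apply: filterS fg => x h /h ->.
Qed.

(** Fatou's lemma is applied to the absolute value in the extended reals, where integrability of the
    limit is not presupposed; the bound then yields integrability and the real inequality at
    once. *)
Lemma fatou_bd (f_ : nat -> T -> R) f (B : R) :
  (forall n, integ (f_ n)) -> (forall n x, D x -> 0 <= f_ n x) ->
  measurable_fun D f ->
  {ae mu, forall x, D x -> f_ n x @[n --> \oo] --> f x} ->
  (forall n, \int[mu]_(x in D) f_ n x <= B) ->
  {ae mu, forall x, D x -> 0 <= f x} ->
  integ f /\ \int[mu]_(x in D) f x <= B.
Proof.
move=> if_ f_0 mf cf bB f0.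
have mE : measurable_fun D (EFin \o f) by exact/measurable_EFinP.
have mL : measurable_fun D (fun x => limn_einf (fun n => (f_ n x)%:E)).
  apply: measurableT_comp => //; apply: measurable_fun_limn_esup => n.
  by apply: measurableT_comp => //; apply/measurable_EFinP; exact: integ_mfun.
have key : (\int[mu]_(x in D) `|(EFin \o f) x| <= B%:E)%E.
  rewrite (_ : (\int[mu]_(x in D) `|(EFin \o f) x| = \int[mu]_(x in D) limn_einf (fun n => (f_ n x)%:E))%E); last first.
    apply: ae_eq_integral => //; first exact: measurableT_comp.
    apply: filterS2 cf f0 => x cx fx Dx; rewrite /= ger0_norm ?fx//.
    have cE : EFin (f_ n x) @[n --> \oo] --> (f x)%:E.
      apply: cvg_EFin; [exact: nearW|exact: cx].
    rewrite is_cvg_limn_einfE; last by apply/cvg_ex; exists (f x)%:E.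
    by apply/esym/cvg_lim.
  apply: (le_trans (@fatou _ _ _ mu D mD (fun n x => (f_ n x)%:E) _ _)).
  - by move=> n; apply/measurable_EFinP; exact: integ_mfun.
  - by move=> n x Dx; rewrite lee_fin f_0.
  rewrite limn_einf_lim; apply: lime_le; first exact: is_cvg_einfs.
  apply: nearW => n; apply: (@le_trans _ _ (\int[mu]_(x in D) (f_ n x)%:E)%E).
    by apply: ereal_inf_lbound; exists n => //=.
  by rewrite -(fineK (integrable_fin_num mD (if_ n))) lee_fin bB.
have intf : integ f.
  by apply/integrableP; split => //; apply: le_lt_trans key _; rewrite ltry.
split => //; rewrite -lee_fin fineK ?integrable_fin_num//.
apply: le_trans key; apply: le_trans (le_abse_integral _ _ _) => //.
exact: lee_abs.
Qed.
Lemma ae_eq0_indic f : integ f ->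
  (forall E, measurable E -> integ (fun x => f x * \1_E x) /\
    \int[mu]_(x in D) (f x * \1_E x) = 0) ->
  {ae mu, forall x, D x -> f x = 0}.
Proof.
move=> If oE.
have : ae_eq mu D (EFin \o f) (EFin \o (fun=> 0)).
  apply: (integral_ae_eq mD If); first exact/measurable_EFinP.
  move=> E EC mE; have [iE oE'] := oE _ mE.
  rewrite [RHS]integral0_eq//.
  have -> : (\int[mu]_(x in E) (EFin \o f) x = \int[mu]_(x in D) (f x * \1_E x)%:E)%E.
    rewrite -{1}(setIidr EC) integral_mkcondr; apply: eq_integral => x _.
    by rewrite patchE indicE; case: (_ \in _); rewrite ?mulr1 ?mulr0.
  by rewrite -(fineK (integrable_fin_num mD iE)); congr EFin; exact: oE'.
by apply: filterS => x h /h [].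
Qed.
End FiniteMeasure.

(** * Products of sigma-finite measures *)

Section ProductSigmaFinite.
Context d1 d2 (T1 : measurableType d1) (T2 : measurableType d2) (R : realType).
Variables (m1 : {sigma_finite_measure set T1 -> \bar R})
  (m2 : {sigma_finite_measure set T2 -> \bar R}).

Let sigma_finite_prod : sigma_finite setT (m1 \x m2)%E.
Proof.
have /sigma_finiteP[F [TF ndF Foo]] := sigma_finiteT m1.
have /sigma_finiteP[G [TG ndG Goo]] := sigma_finiteT m2.
exists (fun n => F n `*` G n).
  rewrite -setXTT TF TG; apply/seteqP; split => [[x y] [[n _ Fx] [k _ Gy]]|[x y] [n _ []]].
    exists (maxn n k) => //; split => /=.
      by apply: (subsetPset _ _ (ndF _ _ (leq_maxl n k))).
    by apply: (subsetPset _ _ (ndG _ _ (leq_maxr n k))).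
  by split; exists n.
move=> k; have [? ?] := Foo k; have [? ?] := Goo k.
split; first exact: measurableX.
by rewrite product_measure1E// lte_mul_pinfty// ge0_fin_numE.
Qed.

Let pm : set (T1 * T2)%type -> \bar R := (m1 \x m2)%E.
HB.instance Definition _ := Measure.on pm.
HB.instance Definition _ :=
  @Measure_isSigmaFinite.Build _ _ _ pm sigma_finite_prod.

(** [leb3] is an iterated product, so Tonelli's theorem and the uniqueness of product measures are
    applied with a product as a factor; this packages that factor as a sigma-finite measure. *)
Definition prod_sf : {sigma_finite_measure set (T1 * T2)%type -> \bar R} := pm.

End ProductSigmaFinite.

(** * Fubini's theorem for bounded functions *)

Section Fubini.
Context {d1 d2 : measure_display} {T1 : measurableType d1} {T2 : measurableType d2}
  {R : realType} (m1 : {sigma_finite_measure set T1 -> \bar R})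
  (m2 : {sigma_finite_measure set T2 -> \bar R}) (A : set T1) (B : set T2).
Hypotheses (mA : measurable A) (mB : measurable B).
Hypotheses (fA : (m1 A < +oo)%E) (fB : (m2 B < +oo)%E).

Lemma finite_setX : ((m1 \x m2)%E (A `*` B) < +oo)%E.
Proof.
rewrite product_measure1E// lte_mul_pinfty//.
by rewrite ge0_fin_numE.
Qed.

(** A bounded function is integrable on a product of sets of finite measure, and extension by zero
    reduces the claim to Fubini's theorem on the whole spaces. *)
Lemma Rint_fubini (f : T1 * T2 -> R) (M : R) : measurable_fun (A `*` B) f ->
  (forall z, (A `*` B) z -> `|f z| <= M) ->
  \int[(m1 \x m2)%E]_(z in A `*` B) f z = \int[m1]_(x in A) \int[m2]_(y in B) f (x, y) /\
  \int[(m1 \x m2)%E]_(z in A `*` B) f z = \int[m2]_(y in B) \int[m1]_(x in A) f (x, y).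
Proof.
move=> mf bf; have mAB : measurable (A `*` B) by exact: measurableX.
have iF : (m1 \x m2)%E.-integrable (A `*` B) (EFin \o f).
  apply: (@integ_bd _ _ _ _ _ mAB _ _ M) => //; exact: finite_setX.
have iF' : (m1 \x m2)%E.-integrable setT ((EFin \o f) \_ (A `*` B)).
  by apply/(integrable_mkcond _ mAB).
have inn1 x : A x -> integ m2 B (fun y => f (x, y)).
  move=> Ax; apply: (@integ_bd _ _ _ _ _ mB fB _ M); last by move=> y By; apply: bf.
  have mf1 : measurable_fun setT (f \_ (A `*` B)) by exact/(measurable_restrictT _ mAB).
  have := measurable_funTS (D := B) (measurableT_comp mf1 (measurable_pair1 x)).
  apply: eq_measurable_fun => y /[!inE] By /=.
  by rewrite patchE mem_set.
have inn2 y : B y -> integ m1 A (fun x => f (x, y)).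
  move=> By; apply: (@integ_bd _ _ _ _ _ mA fA _ M); last by move=> x Ax; apply: bf.
  have mf1 : measurable_fun setT (f \_ (A `*` B)) by exact/(measurable_restrictT _ mAB).
  have := measurable_funTS (D := A) (measurableT_comp mf1 (measurable_pair2 y)).
  apply: eq_measurable_fun => x /[!inE] Ax /=.
  by rewrite patchE mem_set.
split.
  congr fine; rewrite [LHS]integral_mkcond -(integral12_prod_meas1 iF').
  rewrite [RHS]integral_mkcond; apply: eq_integral => x _.
  rewrite /fubini_F patchE; case: ifPn => [/[!inE] Ax|/negP Ax]; last first.
    rewrite integral0_eq// => y _; rewrite patchE memNset// => -[/= Ax' _].
    by apply: Ax; rewrite inE.
  rewrite fineK; last exact: (integrable_fin_num mB (inn1 _ Ax)).
  rewrite [RHS]integral_mkcond; apply: eq_integral => y _.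
  rewrite !patchE; congr (if _ then _ else _).
  by apply/idP/idP => /[!inE]; [case|].
congr fine; rewrite [LHS]integral_mkcond -(integral21_prod_meas1 iF').
rewrite [RHS]integral_mkcond; apply: eq_integral => y _.
rewrite /fubini_G patchE; case: ifPn => [/[!inE] Ax|/negP Ax]; last first.
  rewrite integral0_eq// => x _; rewrite patchE memNset// => -[/= _ Ax'].
  by apply: Ax; rewrite inE.
rewrite fineK; last exact: (integrable_fin_num mA (inn2 _ Ax)).
rewrite [RHS]integral_mkcond; apply: eq_integral => x _.
rewrite !patchE; congr (if _ then _ else _).
by apply/idP/idP => /[!inE]; [case|].
Qed.

(** For the integral of a derivative, the inner integral that vanishes is the one along the
    direction of differentiation, which may lie in either factor. *)
Lemma Rint_fubini0 (f : T1 * T2 -> R) (M : R) : measurable_fun (A `*` B) f ->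
  (forall z, (A `*` B) z -> `|f z| <= M) ->
  (forall x, A x -> \int[m2]_(y in B) f (x, y) = 0) \/
  (forall y, B y -> \int[m1]_(x in A) f (x, y) = 0) ->
  \int[(m1 \x m2)%E]_(z in A `*` B) f z = 0.
Proof.
move=> mf bf; have [e1 e2] := Rint_fubini mf bf.
case=> h; [rewrite e1|rewrite e2].
- rewrite (eq_Rintegral _ (g := fun=> 0)); last by move=> x /[!inE] Ax; rewrite h.
  by rewrite Rintegral_cst// mul0r.
- rewrite (eq_Rintegral _ (g := fun=> 0)); last by move=> x /[!inE] Ax; rewrite h.
  by rewrite Rintegral_cst// mul0r.
Qed.

End Fubini.

(** Rounding the second argument down to a grid of mesh 1/(n+1) gives a function that is measurable
    strip by strip; by continuity these functions converge pointwise. *)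
Lemma measurable_caratheodory d (T : measurableType d) (R : realType) (f : T * R -> R) :
  (forall q, measurable_fun setT (fun p => f (p, q))) ->
  (forall p, continuous (fun q => f (p, q))) -> measurable_fun setT f.
Proof.
move=> mf cf.
pose r n (z : R) : R := (Num.floor (z * n.+1%:R))%:~R / n.+1%:R.
apply: (@measurable_fun_cvg _ _ _ _ (fun n z => f (z.1, r n z.2))); last first.
  move=> [p z] _ /=.
  suff : r n z @[n --> \oo] --> z by move=> h; exact: (cvg_comp _ _ h (cf p z)).
  apply/cvgrPdist_le => e e0; near=> n.
  have n0 : 0 < n.+1%:R :> R by [].
  have -> : z - r n z = (z * n.+1%:R - (Num.floor (z * n.+1%:R))%:~R) / n.+1%:R.
    by rewrite /r mulrBl mulfK// gt_eqF.
  have /andP[h1 h2] := floor_itv (z * n.+1%:R).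
  rewrite ger0_norm; last by rewrite divr_ge0// subr_ge0.
  rewrite ler_pdivrMr//; apply: (@le_trans _ _ 1).
    by move: h2; rewrite intrD; lra.
  rewrite -ler_pdivrMl// mulr1; apply: ltW.
  near: n; exists (Num.truncn e^-1) => // n /= hn.
  by apply: lt_le_trans (truncnS_gt _) _; rewrite ler_nat.
move=> n _ Y mY; rewrite setTI.
rewrite (_ : _ @^-1` Y = \bigcup_(i : int)
   (((fun p => f (p, i%:~R / n.+1%:R)) @^-1` Y) `*` [set` `[i%:~R / n.+1%:R, (i+1)%:~R / n.+1%:R[ ])); last first.
  apply/seteqP; split => [[p z] /= h|[p z] [i _] /= [h]].
    exists (Num.floor (z * n.+1%:R)) => //; split => //=.
    by rewrite in_itv/= ler_pdivrMr// ltr_pdivlMr// floor_itv.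
  by rewrite in_itv/= ler_pdivrMr// ltr_pdivlMr// => /floor_def; rewrite /r => ->.
apply: countable_bigcupT_measurable; first exact: countableP.
move=> i; apply: measurableX; last exact: measurable_itv.
by rewrite -[X in measurable X]setTI; exact: mf.
Unshelve. all: by end_near. Qed.

Lemma ftc2 (R : realType) (F f : R -> R) (a b : R) : a <= b ->
  (forall x : R, is_derive x (1 : R) F (f x)) -> continuous f ->
  \int[lebesgue_measure]_(x in `[a, b]) f x = F b - F a.
Proof.
rewrite le_eqVlt => /predU1P[->|ab] dF cf.
  by rewrite set_itv1 Rintegral_set1 subrr.
have cF : continuous F.
  by move=> x; apply: differentiable_continuous; apply/derivable1_diffP; apply: ex_derive.
rewrite /Rintegral (@continuous_FTC2 _ f F)//.
- exact: continuous_subspaceT.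
- split; first by move=> x _; apply: ex_derive.
  + exact/cvg_at_right_filter/cF.
  + exact/cvg_at_left_filter/cF.
- by move=> x _; rewrite derive1E; apply: derive_val.
Qed.

Lemma continuous_pair (T U V : topologicalType) (f : T -> U) (g : T -> V) (x : T) :
  {for x, continuous f} -> {for x, continuous g} ->
  {for x, continuous (fun t => (f t, g t))}.
Proof. exact: cvg_pair. Qed.

(** * Directional derivatives and integrals over the cube *)

Section Torus.
Context {R : realType}.
Local Notation R3 := (R * R * R)%type.
Local Notation leb := (@lebesgue_measure R).
Implicit Types (f g phi : R3 -> R) (x p : R3) (i j : 'I_3) (s t : R).

Lemma line_quot f p v s :
  (fun h : R => h^-1 *: ((f \o shift (p + s *: v)) (h *: v) - f (p + s *: v))) =
  (fun h : R => h^-1 *: (((fun s => f (p + s *: v)) \o shift s) (h *: 1) - f (p + s *: v))).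
Proof.
apply/funext => h /=; congr (_ *: (f _ - _)).
by rewrite addrCA scalerDl (_ : h%:A = h) //; exact: mulr1.
Qed.

(** Moves a directional derivative to the real line, where the chain rule and the fundamental
    theorem of calculus apply. *)
Lemma is_derive_line f p v s (l : R) :
  is_derive (p + s *: v) v f l <-> is_derive s (1 : R) (fun s => f (p + s *: v)) l.
Proof.
split=> -[d e]; split.
- by move: d; rewrite /derivable line_quot.
- by rewrite -e /derive line_quot.
- by move: d; rewrite /derivable line_quot.
- by rewrite -e /derive line_quot.
Qed.

Lemma is_derive_partial f p i s : derivable f (p + s *: unit_vec i) (unit_vec i) ->
  is_derive s (1 : R) (fun s => f (p + s *: unit_vec i)) (partial i f (p + s *: unit_vec i)).
Proof. by move=> d; apply/is_derive_line; exact: derivableP. Qed.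

Lemma measurable_cube : measurable (@cube R).
Proof. by apply: measurableX; [apply: measurableX|]; exact: measurable_itv. Qed.

Lemma leb_J : leb `[0, 2 * pi] = (2 * pi)%:E.
Proof.
rewrite lebesgue_measure_itv /= lte_fin mulr_gt0 ?pi_gt0//.
by rewrite -EFinB subr0.
Qed.

Lemma leb_J_fin : (leb `[0%R, (2 * pi)%R] < +oo)%E.
Proof. by rewrite leb_J ltry. Qed.

Lemma leb2_fin : ((leb \x leb)%E (`[0%R, (2 * pi)%R] `*` `[0%R, (2 * pi)%R]) < +oo)%E.
Proof. by apply: finite_setX => //; exact: leb_J_fin. Qed.

Lemma leb3_cube : leb3 (@cube R) = ((2 * pi) ^+ 3)%:E.
Proof.
have e2 : ((leb \x leb)%E (`[0%R, (2 * pi)%R] `*` `[0%R, (2 * pi)%R]) = (2 * pi)%:E * (2 * pi)%:E)%E.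
  rewrite product_measure1E//.
  by congr (_ * _)%E; exact: leb_J.
rewrite /leb3 /cube product_measure1E//; last first.
  by apply: measurableX; exact: measurable_itv.
transitivity (((2 * (pi : R))%:E * (2 * pi)%:E) * (2 * pi)%:E)%E.
  by congr (_ * _)%E; [exact: e2|exact: leb_J].
by rewrite -!EFinM !exprS expr0 mulr1 mulrA.
Qed.

Lemma cube_fin : ((leb3 : {measure set _ -> \bar R}) (@cube R) < +oo)%E.
Proof. by rewrite [X in (X < _)%E]leb3_cube ltry. Qed.

(** The sigma-algebra is the product one, so continuity is used one variable at a time through the
    Caratheodory criterion. *)
Lemma measurable_cont3 f : continuous f -> measurable_fun setT f.
Proof.
move=> cf; apply: measurable_caratheodory => [z|[x y] z]; last first.
  apply: (continuous_comp (f := fun z => ((x, y), z))); last exact: cf.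
  apply: continuous_pair; [exact: cvg_cst|exact: cvg_id].
apply: (@measurable_caratheodory _ _ _ (fun p : R * R => f (p, z))) => [y|x y]; last first.
  apply: (continuous_comp (f := fun y => ((x, y), z))); last exact: cf.
  apply: continuous_pair; last exact: cvg_cst.
  apply: continuous_pair; [exact: cvg_cst|exact: cvg_id].
apply: continuous_measurable_fun => x.
suff : {for (x : R), continuous (f \o (fun x : R => ((x, y), z)))} by [].
apply: continuous_comp; last exact: cf.
apply: continuous_pair; last exact: cvg_cst.
apply: continuous_pair; [exact: cvg_id|exact: cvg_cst].
Qed.

Lemma compact_cube : compact (@cube R).
Proof. by apply: compact_setX; [apply: compact_setX|]; exact: segment_compact. Qed.

Lemma cont3_bounded f : continuous f -> exists M, forall x, cube x -> `|f x| <= M.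
Proof.
move=> cf; have := continuous_compact (continuous_subspaceT cf) compact_cube.
move=> /compact_bounded[M [Mr hM]]; exists (M + 1) => x cx.
by apply: (hM (M + 1)); [rewrite ltrDl|exists x].
Qed.

Lemma unit_vec_line p i s : (p + s *: unit_vec i : R3) =
  (p.1.1 + s * (i == 0)%:R, p.1.2 + s * (i == 1)%:R, p.2 + s * (i == 2)%:R).
Proof. by case: p => [[x y] z]. Qed.

Lemma Rint_partial_line f i p : (forall x, derivable f x (unit_vec i)) ->
  continuous (partial i f) -> torus_periodic f ->
  \int[leb]_(s in `[0, 2 * pi]) partial i f (p + s *: unit_vec i) = 0.
Proof.
move=> df cf pf.
have pi0 : 0 <= 2 * pi :> R by rewrite mulr_ge0// pi_ge0.
have dl (s : R) := @is_derive_partial f p i s (df _).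
rewrite (ftc2 pi0 dl).
  by rewrite pf scale0r addr0 subrr.
move=> s; apply: (continuous_comp (f := fun s => p + s *: unit_vec i)); last exact: cf.
by apply: cvgD; [exact: cvg_cst|apply: cvgZr_tmp; exact: cvg_id].
Qed.

Local Notation J := (`[0%R, (2 * pi)%R]%classic : set R).

Lemma Rint_J2_eq0 (h : R * R -> R) (M : R) : measurable_fun setT h ->
  (forall z, (J `*` J) z -> `|h z| <= M) ->
  (forall x : R, J x -> \int[leb]_(y in J) h (x, y) = 0) \/
  (forall y : R, J y -> \int[leb]_(t in J) h (t, y) = 0) ->
  \int[(leb \x leb)%E]_(z in J `*` J) h z = 0.
Proof.
move=> mh; apply: (@Rint_fubini0 _ _ _ _ R leb leb J J) => //; try exact: leb_J_fin.
exact: measurable_funTS.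
Qed.

Lemma Rint_cube_eq0 (h : R3 -> R) (M : R) : measurable_fun setT h ->
  (forall z, cube z -> `|h z| <= M) ->
  (forall p : R * R, (J `*` J) p -> \int[leb]_(y in J) h (p, y) = 0) \/
  (forall y : R, J y -> \int[(leb \x leb)%E]_(q in J `*` J) h (q, y) = 0) ->
  \int[leb3]_(z in cube) h z = 0.
Proof.
have mJ2 : measurable (J `*` J) by apply: measurableX; exact: measurable_itv.
move=> mh bh h0.
have mJ : measurable J by exact: measurable_itv.
exact: (@Rint_fubini0 _ _ _ _ R (prod_sf leb leb) leb (J `*` J) J mJ2 mJ leb2_fin leb_J_fin h M (measurable_funTS mh) bh h0).
Qed.

(** Integration along direction [i] gives zero by the fundamental theorem of calculus and
    periodicity; boundedness on the compact cube allows Fubini's theorem. *)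
Lemma Rint_partial_eq0 f i : (forall x, derivable f x (unit_vec i)) ->
  continuous (partial i f) -> torus_periodic f ->
  \int[leb3]_(x in cube) partial i f x = 0.
Proof.
move=> df cf pf; have [M hM] := cont3_bounded cf.
have mf := measurable_cont3 cf.
have mf1 z : measurable_fun setT (fun p : R * R => partial i f (p, z)).
  exact: measurableT_comp mf (measurable_pair2 z).
have ln := Rint_partial_line _ df cf pf.
have i3 : [\/ i = 2, i = 1 | i = 0].
  case: i {df cf hM mf mf1 ln} => [[|[|[|//]]]] Hi;
    [apply: Or33|apply: Or32|apply: Or31]; exact: val_inj.
apply: (@Rint_cube_eq0 _ M) => //.
case: i3 => ei; [left|right|right].
- move=> [x y] _; rewrite -[RHS](ln ((x, y), 0)); apply: eq_Rintegral => s _.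
  by rewrite unit_vec_line ei /= !mulr0 !addr0 mulr1 add0r.
- move=> z Bz; apply: (@Rint_J2_eq0 _ M) => //.
    by move=> xy h; apply: hM; split.
  left => x _; rewrite -[RHS](ln ((x, 0), z)); apply: eq_Rintegral => s _.
  by rewrite unit_vec_line ei /= !mulr0 !addr0 mulr1 add0r.
- move=> z Bz; apply: (@Rint_J2_eq0 _ M) => //.
    by move=> xy h; apply: hM; split.
  right => y _; rewrite -[RHS](ln ((0, y), z)); apply: eq_Rintegral => s _.
  by rewrite unit_vec_line ei /= !mulr0 !addr0 mulr1 add0r.
Qed.

End Torus.

(** * The integration toolkit specialised to the cube *)

Global Instance leb3_ae_filter (R : realType) :
  Filter (nbhs (almost_everywhere (@leb3 R))).
Proof. exact: (ae_filter_ringOfSetsType (leb3 : {measure set _ -> \bar R})). Qed.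

Notation mC := measurable_cube.
Notation fC := cube_fin.
Notation cinteg := (integ leb3 cube).
Notation csqint := (sqint leb3 cube).
Notation c_integ_cst := (@integ_cst _ _ _ leb3 cube mC fC).
Notation c_integ_bd := (@integ_bd _ _ _ leb3 cube mC fC).
Notation c_integ_sum := (@integ_sum _ _ _ leb3 cube mC fC).
Notation c_Rint_sum := (@Rint_sum _ _ _ leb3 cube mC fC).
Notation c_sqint_bd := (@sqint_bd _ _ _ leb3 cube mC fC).
Notation c_sqint_cst := (@sqint_cst _ _ _ leb3 cube mC fC).
Notation c_sqint_integ := (@sqint_integ _ _ _ leb3 cube mC fC).
Notation c_sqint_sum := (@sqint_sum _ _ _ leb3 cube mC fC).
Notation c_integ_le := (@integ_le _ _ _ leb3 cube mC).
Notation c_integD := (@integD _ _ _ leb3 cube mC).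
Notation c_integZ := (@integZ _ _ _ leb3 cube mC).
Notation c_integB := (@integB _ _ _ leb3 cube mC).
Notation c_Rint_ae := (@Rint_ae _ _ _ leb3 cube mC).
Notation c_integ_ae := (@integ_ae _ _ _ leb3 cube mC).
Notation c_Rint_eq0 := (@Rint_eq0 _ _ _ leb3 cube mC).
Notation c_Rint_dct := (@Rint_dct _ _ _ leb3 cube mC).
Notation c_sqintM := (@sqintM _ _ _ leb3 cube mC).
Notation c_sqintD := (@sqintD _ _ _ leb3 cube mC).
Notation c_sqintZ := (@sqintZ _ _ _ leb3 cube mC).
Notation c_sqintB := (@sqintB _ _ _ leb3 cube mC).
Notation c_sqint_Mbd := (@sqint_Mbd _ _ _ leb3 cube mC).
Notation c_sqint_ae := (@sqint_ae _ _ _ leb3 cube mC).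
Notation c_fatou_bd := (@fatou_bd _ _ _ leb3 cube mC).
Notation c_integ_mfun := (@integ_mfun _ _ _ leb3 cube).
Notation c_integ_norm := (@integ_norm _ _ _ leb3 cube).
Notation c_RintD := (@RintD _ _ _ leb3 cube mC).
Notation c_RintB := (@RintB _ _ _ leb3 cube mC).
Notation c_RintZ := (@RintZ _ _ _ leb3 cube mC).
Notation c_le_Rint := (@le_Rint _ _ _ leb3 cube mC).
Notation c_norm_Rint_le := (@norm_Rint_le _ _ _ leb3 cube mC).
Notation c_eq_Rint := (@eq_Rint _ _ _ leb3 cube).
Notation c_ae_eq0_indic := (@ae_eq0_indic _ _ _ leb3 cube mC).

(** * The Hartley system: orthogonality, coefficients, Bessel's inequality *)

Section Basis.
Context {R : realType}.
Local Notation R3 := (R * R * R)%type.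
Local Notation K := (int * int * int)%type.
Implicit Types (f g phi : R3 -> R) (x p : R3) (i j : 'I_3) (s t : R) (k l : K).

Definition kco k i : int :=
  k.1.1 *+ (i == 0) + k.1.2 *+ (i == 1) + k.2 *+ (i == 2).
Definition kr k i : R := (kco k i)%:~R.
Definition lam k : R := \sum_(i < 3) kr k i ^+ 2.
Definition dot k x : R := k.1.1%:~R * x.1.1 + k.1.2%:~R * x.1.2 + k.2%:~R * x.2.
Definition cas t : R := cos t + sin t.
(* The real orthogonal system behind the Hartley transform: the gradient of
   [bas k] is the vector k times [bas (- k)]. *)
Definition bas k x : R := cas (dot k x).

Lemma ord3P (P : 'I_3 -> Prop) : P 0 -> P 1 -> P 2 -> forall i, P i.
Proof.
move=> P0 P1 P2 [[|[|[|//]]]] Hi.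
- by rewrite (_ : Ordinal Hi = 0)//; exact: val_inj.
- by rewrite (_ : Ordinal Hi = 1)//; exact: val_inj.
- by rewrite (_ : Ordinal Hi = 2)//; exact: val_inj.
Qed.

Lemma sum_ord3 (V : nmodType) (F : 'I_3 -> V) : \sum_(i < 3) F i = F 0 + F 1 + F 2.
Proof.
rewrite !big_ord_recl big_ord0 addr0 addrA; congr (F _ + F _ + F _); exact: val_inj.
Qed.

Lemma kr0E k : kr k 0 = k.1.1%:~R.
Proof. by rewrite /kr /kco /= mulr1n !mulr0n !addr0. Qed.
Lemma kr1E k : kr k 1 = k.1.2%:~R.
Proof. by rewrite /kr /kco /= mulr1n !mulr0n !addr0 add0r. Qed.
Lemma kr2E k : kr k 2 = k.2%:~R.
Proof. by rewrite /kr /kco /= mulr1n !mulr0n !add0r. Qed.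

Lemma krN k i : kr (- k) i = - kr k i.
Proof.
by elim/ord3P: i; rewrite ?kr0E ?kr1E ?kr2E -rmorphN.
Qed.

Lemma krD k l i : kr (k + l) i = kr k i + kr l i.
Proof. by elim/ord3P: i; rewrite ?kr0E ?kr1E ?kr2E -rmorphD. Qed.

Lemma kr_eq0 k : (forall i, kr k i = 0) -> k = 0.
Proof.
case: k => -[a b] c h; move: (h 0) (h 1) (h 2); rewrite kr0E kr1E kr2E /=.
by move=> /eqP + /eqP + /eqP; rewrite !intr_eq0 => /eqP -> /eqP -> /eqP ->.
Qed.

Lemma lamN k : lam (- k) = lam k.
Proof. by apply: eq_bigr => i _; rewrite krN sqrrN. Qed.

Lemma lam_ge0 k : 0 <= lam k.
Proof. by apply: sumr_ge0 => i _; exact: sqr_ge0. Qed.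

Lemma lam_ge1 k : k != 0 -> 1 <= lam k.
Proof.
move=> k0; have [i ki] : exists i, kr k i != 0.
  apply: contrapT => h; move/eqP: k0; apply; apply: kr_eq0 => i.
  by apply: contrapT => hi; apply: h; exists i; exact/eqP.
rewrite /lam (bigD1 i)//= -[leLHS]addr0 lerD//; last first.
  by apply: sumr_ge0 => j _; exact: sqr_ge0.
rewrite -(real_normK (num_real _)) -[leLHS](expr1n _ 2) lerXn2r ?nnegrE//.
rewrite /kr -intr_norm -[leLHS]/(1%:~R) ler_int.
by move: ki; rewrite /kr intr_eq0; case: (kco k i) => // [[|n]]//.
Qed.

Lemma lam0 : lam 0 = 0.
Proof. by rewrite /lam big1// => i _; rewrite /kr /kco /= !mul0rn !addr0 expr0n. Qed.

Lemma dot_line k x i s : dot k (x + s *: unit_vec i) = dot k x + s * kr k i.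
Proof.
rewrite unit_vec_line /dot /=; elim/ord3P: i; rewrite ?kr0E ?kr1E ?kr2E /=; ring.
Qed.

Lemma dotN k x : dot (- k) x = - dot k x.
Proof. by rewrite /dot /= !rmorphN /=; ring. Qed.

Lemma dotD k l x : dot (k + l) x = dot k x + dot l x.
Proof. by rewrite /dot /= !rmorphD /=; ring. Qed.

Lemma is_derive_cas t : is_derive t (1 : R) cas (cos t - sin t).
Proof.
have -> : cos t - sin t = - sin t + cos t by rewrite addrC.
exact: is_deriveD.
Qed.

Lemma continuous_cas : continuous cas.
Proof. by move=> t; apply: cvgD; [exact: continuous_cos|exact: continuous_sin]. Qed.

Lemma cas_bd t : `|cas t| <= 2.
Proof.
apply: le_trans (ler_normD _ _) _; rewrite -[leRHS]/(1 + 1).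
by apply: lerD; rewrite ler_norml ?cos_geN1 ?cos_le1 ?sin_geN1 ?sin_le1.
Qed.

Lemma casN t : cas (- t) = cos t - sin t.
Proof. by rewrite /cas cosN sinN. Qed.

Lemma cas_periodic t (n : int) : cas (t + n%:~R * (2 * pi)) = cas t.
Proof.
suff h (m : nat) u : cas (u + m%:R * (2 * pi)) = cas u.
  case: n => m; first exact: h.
  by rewrite -[LHS](h m.+1) NegzE rmorphN mulNr addrNK.
elim: m u => [|m IH] u; first by rewrite mul0r addr0.
rewrite -[RHS]IH (_ : u + m.+1%:R * _ = u + m%:R * (2 * pi) + pi *+ 2); last first.
  by rewrite -(mulr_natl pi 2) -natr1; ring.
by rewrite /cas cosD2pi sinD2pi.
Qed.

Lemma bas_bd k x : `|bas k x| <= 2.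
Proof. exact: cas_bd. Qed.

Lemma continuous_dot k : continuous (dot k).
Proof.
have h1 : continuous (fun x : R3 => x.1.1).
  by move=> x; apply: (continuous_comp (f := fst) (g := fst)); exact: cvg_fst.
have h2 : continuous (fun x : R3 => x.1.2).
  by move=> x; apply: (continuous_comp (f := fst) (g := snd)); [exact: cvg_fst|exact: cvg_snd].
have h3 : continuous (fun x : R3 => x.2) by move=> x; exact: cvg_snd.
move=> x; apply: cvgD; first apply: cvgD.
- exact: cvgM (cvg_cst _) (h1 x).
- exact: cvgM (cvg_cst _) (h2 x).
- exact: cvgM (cvg_cst _) (h3 x).
Qed.

Lemma continuous_bas k : continuous (bas k).
Proof. by move=> x; apply: (continuous_comp (f := dot k) (g := cas)); [exact: continuous_dot|exact: continuous_cas]. Qed.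

Lemma bas_periodic k : torus_periodic (bas k).
Proof. by move=> x i; rewrite /bas dot_line mulrC cas_periodic. Qed.

Lemma is_derive_affine (a b t : R) : is_derive t (1 : R) (fun s => a + s * b) b.
Proof.
have q : h^-1 *: (((fun s : R => a + s * b) \o shift t) (h *: (1 : R)) - (a + t * b))
    @[h --> (0 : R)^'] --> b.
  apply: cvg_near_cst; near=> h.
  have h0 : h != 0 by near: h; exact: nbhs_dnbhs_neq.
  rewrite /= -[_ *: _]/(h^-1 * (a + (h * 1 + t) * b - (a + t * b))) mulr1.
  by field.
split; first by apply/cvg_ex; exists b.
exact: (cvg_lim _ q).
Unshelve. all: by end_near. Qed.

Lemma is_derive_bas k x i : is_derive x (unit_vec i) (bas k) (kr k i * bas (- k) x).
Proof.
have -> : x = x + 0 *: unit_vec i by rewrite scale0r addr0.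
apply/is_derive_line.
rewrite (_ : (fun s => _) = cas \o (fun s => dot k x + s * kr k i)); last first.
  by apply/funext => s /=; rewrite /bas dot_line.
rewrite scale0r addr0 /bas dotN casN mulrC.
have h := is_derive_affine (dot k x) (kr k i) 0.
have := is_derive1_comp (is_derive_cas _) h.
by rewrite mul0r addr0.
Qed.


Lemma partial_bas k i : partial i (bas k) = (fun x => kr k i * bas (- k) x).
Proof. by apply/funext => x; apply: derive_val; exact: is_derive_bas. Qed.

Lemma is_derive_Zbas c k x i :
  is_derive x (unit_vec i) (fun x => c * bas k x) (c * kr k i * bas (- k) x).
Proof.
rewrite -mulrA; apply: (@is_deriveZ _ _ _ (bas k) c).
exact: is_derive_bas.
Qed.

Lemma bas0 x : bas 0 x = 1.
Proof. by rewrite /bas /dot /= !mul0r !addr0 /cas cos0 sin0 addr0. Qed.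

(** Closes trigonometric polynomials under products, and is the source of orthogonality and of the
    convolution formula for the coefficients of a product. *)
Lemma bas_mul k l x : bas k x * bas l x =
  2^-1 * (bas (k - l) x + bas (l - k) x + bas (k + l) x - bas (- (k + l)) x).
Proof.
rewrite /bas !(dotN, dotD).
move: (dot k x) (dot l x) => a b.
rewrite (opprD a b) /cas !(cosD, sinD) !(cosN, sinN).
by field.
Qed.

Definition vol : R := (2 * pi) ^+ 3.

Lemma vol_gt0 : 0 < vol.
Proof. by rewrite exprn_gt0// mulr_gt0// pi_gt0. Qed.

Lemma measurable_bas k (D : set R3) : measurable_fun D (bas k).
Proof. by apply: measurable_funTS; apply: measurable_cont3; exact: continuous_bas. Qed.

Lemma sqint_bas k : csqint (bas k).
Proof. apply: (c_sqint_bd (M := 2)) => // *; [exact: measurable_bas|exact: bas_bd]. Qed.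

Lemma integ_bas k : cinteg (bas k).
Proof. apply: (c_integ_bd (M := 2)) => // *; [exact: measurable_bas|exact: bas_bd]. Qed.

(** For k <> 0 some component of k is nonzero, and up to that factor [bas k] is a partial derivative
    of [bas (- k)]; such derivatives integrate to zero. *)
Lemma Rint_bas k : \int[leb3]_(x in cube) bas k x = if k == 0 then vol else 0.
Proof.
case: ifPn => [/eqP ->|k0].
  under eq_Rintegral do rewrite bas0.
  rewrite Rintegral_cst; last exact: measurable_cube.
  by rewrite mul1r; exact: (congr1 fine (@leb3_cube R)).
have [i ki] : exists i, kr (- k) i != 0.
  apply: contrapT => h; move/eqP: k0; apply; apply: kr_eq0 => i.
  apply: contrapT => hi; apply: h; exists i; rewrite krN oppr_eq0; exact/eqP.
have dk x : derivable (bas (- k)) x (unit_vec i) by apply: ex_derive; exact: is_derive_bas.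
have cp : continuous (partial i (bas (- k))).
  rewrite partial_bas opprK => x; exact: cvgM (cvg_cst _) (@continuous_bas k x).
have := Rint_partial_eq0 dk cp (@bas_periodic _).
rewrite partial_bas opprK RintegralZl; last 2 first.
- exact: measurable_cube.
- exact: integ_bas.
by move=> /eqP; rewrite mulf_eq0 (negbTE ki) => /eqP.
Qed.

Lemma Rint_bas_mul k l :
  \int[leb3]_(x in cube) (bas k x * bas l x) = if k == l then vol else 0.
Proof.
under eq_Rintegral do rewrite bas_mul.
have ib := integ_bas.
rewrite c_RintZ; last by apply: c_integB; [apply: c_integD; [exact: c_integD|]|].
rewrite c_RintB//; last by apply: c_integD => //; exact: c_integD.
rewrite c_RintD//; last exact: c_integD.
rewrite c_RintD// !Rint_bas oppr_eq0 addrK subr_eq0 (subr_eq0 l) (eq_sym l).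
by case: eqP => _; rewrite ?addr0 ?mulr0//; field.
Qed.

(** [vol] is the squared L2 norm of every [bas k], so these are the coefficients of the expansion of
    f in the orthogonal system. *)
Definition coef k f : R := vol^-1 * \int[leb3]_(x in cube) (f x * bas k x).

Lemma integ_mul_bas f k   : cinteg f -> cinteg (fun x => f x * bas k x).
Proof.
move=> If; apply: (c_integ_le (g := fun x => 2 * `|f x|)).
- by apply: measurable_funM; [exact: c_integ_mfun If|exact: measurable_bas].
- by move=> x _; rewrite normrM mulrC ler_wpM2r// bas_bd.
- by apply: c_integZ _ _ _; exact: c_integ_norm.
Qed.

Lemma coefD f g k   : cinteg f -> cinteg g -> coef k (fun x => f x + g x) = coef k f + coef k g.
Proof.
move=> If Ig; rewrite /coef -mulrDr -c_RintD; try exact: integ_mul_bas.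
by under eq_Rintegral do rewrite mulrDl.
Qed.

Lemma coefZ c f k   : cinteg f -> coef k (fun x => c * f x) = c * coef k f.
Proof.
move=> If; rewrite /coef mulrCA -(c_RintZ c); last exact: integ_mul_bas.
by under eq_Rintegral do rewrite -mulrA.
Qed.

Lemma coefB f g k   : cinteg f -> cinteg g -> coef k (fun x => f x - g x) = coef k f - coef k g.
Proof.
move=> If Ig; rewrite /coef -mulrBr -c_RintB; try exact: integ_mul_bas.
by under eq_Rintegral do rewrite mulrBl.
Qed.

Lemma coef_ae f g k   : cinteg f -> cinteg g ->
  {ae leb3, forall x, cube x -> f x = g x} -> coef k f = coef k g.
Proof.
move=> If Ig fg; congr (_ * _); apply: (c_Rint_ae).
- exact: c_integ_mfun (integ_mul_bas _ If).
- exact: c_integ_mfun (integ_mul_bas _ Ig).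
- by apply: filterS fg => x h /h ->.
Qed.

Lemma coef_sum (I : Type) (s : seq I) (F : I -> R3 -> R) k : (forall a, cinteg (F a)) ->
  coef k (fun x => \sum_(a <- s) F a x) = \sum_(a <- s) coef k (F a).
Proof.
move=> iF; rewrite /coef -mulr_sumr -(c_Rint_sum); last by move=> i; exact: integ_mul_bas.
by under eq_Rintegral do rewrite mulr_suml.
Qed.

Lemma coef_bas k l : coef k (bas l) = (l == k)%:R.
Proof.
rewrite /coef Rint_bas_mul; case: eqP => _; last by rewrite mulr0.
by rewrite mulVf// gt_eqF// vol_gt0.
Qed.

Definition tpoly (s : seq K) (c : K -> R) x : R := \sum_(k <- s) c k * bas k x.

Lemma sqint_tpoly (s : seq K) (c : K -> R) : csqint (tpoly s c).
Proof. by apply: c_sqint_sum _ _ _ _ => k; apply: c_sqintZ _ _ _; exact: sqint_bas. Qed.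

Lemma coef_tpoly (s : seq K) (c : K -> R) k : uniq s -> coef k (tpoly s c) = if k \in s then c k else 0.
Proof.
move=> us; rewrite coef_sum; last by move=> l; apply: c_integZ _ _ _; exact: integ_bas.
under eq_bigr do rewrite (coefZ _ _ (integ_bas _)) coef_bas.
case: ifPn => ks; last first.
  rewrite big_seq big1// => l ls; case: eqP => [e|]; last by rewrite mulr0.
  by move: ks; rewrite -e ls.
rewrite (bigD1_seq k)//= eqxx mulr1 big1 ?addr0// => l /negbTE ->; exact: mulr0.
Qed.

Lemma Rint_mul_tpoly (s : seq K) (c : K -> R) f : csqint f ->
  \int[leb3]_(x in cube) (f x * tpoly s c x) = vol * \sum_(k <- s) c k * coef k f.
Proof.
move=> sf; rewrite mulr_sumr.
under eq_Rintegral do rewrite /tpoly mulr_sumr.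
have ifb k : cinteg (fun x => f x * bas k x) by apply: integ_mul_bas; exact: (c_sqint_integ sf).
rewrite (c_eq_Rint (g := fun x => \sum_(k <- s) c k * (f x * bas k x))); last first.
  by move=> x _; apply: eq_bigr => k _; rewrite mulrCA.
rewrite (c_Rint_sum); last by move=> k; apply: c_integZ _ _ _; exact: ifb.
apply: eq_bigr => k _; rewrite c_RintZ; last exact: ifb.
by rewrite /coef mulrCA mulVKf// gt_eqF// vol_gt0.
Qed.

Lemma Rint_sqr_tpoly (s : seq K) (c : K -> R) : uniq s ->
  \int[leb3]_(x in cube) (tpoly s c x ^+ 2) = vol * \sum_(k <- s) c k ^+ 2.
Proof.
move=> us; under eq_Rintegral do rewrite expr2.
rewrite Rint_mul_tpoly; last exact: sqint_tpoly.
congr (_ * _); rewrite big_seq [RHS]big_seq; apply: eq_bigr => k ks.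
by rewrite coef_tpoly// ks expr2.
Qed.

Lemma bessel (s : seq K) f : uniq s -> csqint f ->
  vol * \sum_(k <- s) coef k f ^+ 2 <= \int[leb3]_(x in cube) (f x ^+ 2).
Proof.
move=> us sf; set c := fun k => coef k f.
have := Rintegral_ge0 leb3 (D := cube) (f := fun x => (f x - tpoly s c x) ^+ 2).
move=> /(_ (fun x _ => sqr_ge0 _)).
rewrite (c_eq_Rint (g := fun x => f x ^+ 2 + (tpoly s c x ^+ 2 - 2 * (f x * tpoly s c x)))); last first.
  by move=> x _; ring.
have i1 := sf.2; have i2 := (sqint_tpoly s c).2.
have i3 := c_sqintM sf (sqint_tpoly s c).
have i4 := c_integZ 2 i3.
rewrite c_RintD//; last exact: (c_integB i2 i4).
rewrite c_RintB// c_RintZ// Rint_sqr_tpoly// Rint_mul_tpoly//.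
rewrite (eq_bigr (fun k => coef k f ^+ 2)); last by [].
rewrite [in X in _ + (_ - X)](eq_bigr (fun k => coef k f ^+ 2)); last by move=> k _; rewrite expr2.
by lra.
Qed.

End Basis.

(** * A polynomial iteration converging to the sign *)

Section SignIteration.
Context {R : realType}.
Implicit Types y : R.

(* Iterating this cubic on [-1, 1] converges boundedly to the sign function. *)
Definition sgq y : R := 2^-1 * (3 * y - y ^+ 3).

Lemma sgq_bd y : `|y| <= 1 -> `|sgq y| <= 1.
Proof.
rewrite !ler_norml => /andP[h1 h2]; apply/andP; rewrite /sgq; split.
- have : 0 <= (1 + y) ^+ 2 * (2 - y) by rewrite mulr_ge0 ?sqr_ge0//; lra.
  by nra.
- have : 0 <= (1 - y) ^+ 2 * (2 + y) by rewrite mulr_ge0 ?sqr_ge0//; lra.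
  by nra.
Qed.

Lemma iter_sgq_bd n y : `|y| <= 1 -> `|iter n sgq y| <= 1.
Proof. by move=> hy; elim: n => //= n; exact: sgq_bd. Qed.

(** Each step multiplies the error 1 - z by (1 - z)(2 + z)/2, which is at most 1 - y/2 because the
    iterates never fall below y. *)
Lemma iter_sgq_pos y n : 0 < y <= 1 ->
  y <= iter n sgq y <= 1 /\ 1 - iter n sgq y <= (1 - y / 2) ^+ n.
Proof.
move=> /andP[y0 y1]; elim: n => [|n] /=.
  by rewrite expr0 lexx y1; split => //; lra.
set z := iter n sgq y; move=> [/andP[h1 h2] h3].
have z0 : 0 < z by exact: lt_le_trans h1.
have e : 1 - sgq z = (1 - z) * ((1 - z) * (2 + z) / 2) by rewrite /sgq; field.
have e2 : (1 - z) * (2 + z) / 2 <= 1 - y / 2 by nra.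
split.
  have q1 : sgq z <= 1.
    have := @sgq_bd z; rewrite !ler_norml h2 /=.
    by move=> /(_ _)/wrap[|/andP[]//]; rewrite andbT; lra.
  rewrite q1 andbT; apply: le_trans h1 _.
  rewrite -subr_ge0 (_ : sgq z - z = z * (1 - z) * (1 + z) / 2); last by rewrite /sgq; field.
  by rewrite divr_ge0// mulr_ge0// ?mulr_ge0//; lra.
rewrite e exprSr; apply: ler_pM => //; first by lra.
by rewrite divr_ge0// mulr_ge0//; lra.
Qed.

Lemma iter_sgqN n y : iter n sgq (- y) = - iter n sgq y.
Proof. by elim: n => //= n ->; rewrite /sgq; ring. Qed.

Lemma iter_sgq0 n : iter n sgq 0 = 0.
Proof. by elim: n => //= n ->; rewrite /sgq; ring. Qed.

Lemma cvg_iter_sgq y : `|y| <= 1 -> iter n sgq y @[n --> \oo] --> Num.sg y.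
Proof.
have pos (z : R) : 0 < z -> z <= 1 -> iter n sgq z @[n --> \oo] --> (1 : R).
  move=> z0 z1; apply/cvgrPdist_le => e e0.
  have g0 : (1 - z / 2) ^+ n @[n --> \oo] --> (0 : R).
    by apply: cvg_expr; rewrite ger0_norm; lra.
  have /cvgrPdist_le/(_ e e0) := g0; apply: filterS => n.
  rewrite sub0r normrN => h.
  have z01 : 0 < z <= 1 by apply/andP.
  have [/andP[_ h1] h2] := iter_sgq_pos n z01.
  rewrite ger0_norm ?subr_ge0//; apply: le_trans h2 _; exact: le_trans (ler_norm _) h.
move=> y1; have [y0|y0|->] := ltgtP y 0.
- rewrite ltr0_sg//; have := pos (- y); rewrite oppr_gt0 y0 => /(_ isT).
  rewrite -(ltr0_norm y0) y1 => /(_ isT) h.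
  rewrite -[y]opprK; under eq_fun do rewrite iter_sgqN.
  by rewrite -(ltr0_norm y0); exact: cvgN.
- rewrite gtr0_sg//; apply: pos => //; exact: le_trans (ler_norm _) y1.
- by rewrite sgr0; apply: cvg_near_cst; apply: nearW => n; rewrite iter_sgq0.
Qed.

End SignIteration.

(** * Completeness of the Hartley system *)

Section Completeness.
Context {R : realType}.
Local Notation R3 := (R * R * R)%type.
Local Notation K := (int * int * int)%type.
Local Notation leb := (@lebesgue_measure R).

Inductive trig : (R3 -> R) -> Prop :=
| trig_bas k : trig (bas k)
| trigD f g : trig f -> trig g -> trig (fun x => f x + g x)
| trigZ c f : trig f -> trig (fun x => c * f x).

Lemma eq_trig f g : (forall x, f x = g x) -> trig f -> trig g.
Proof. by move=> /funext ->. Qed.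

Lemma trigB f g : trig f -> trig g -> trig (fun x => f x - g x).
Proof.
move=> tf tg; have := trigD tf (trigZ (-1) tg).
by under eq_fun do rewrite mulN1r.
Qed.

Lemma trigM f g : trig f -> trig g -> trig (fun x => f x * g x).
Proof.
move=> tf tg; elim: tf => [k|f1 f2 _ h1 _ h2|c f1 _ h1].
- elim: tg => [l|g1 g2 _ h1 _ h2|c g1 _ h1].
  + under eq_fun do rewrite bas_mul; apply: trigZ; apply: trigB; last exact: trig_bas.
    by apply: trigD; [apply: trigD|]; exact: trig_bas.
  + by under eq_fun do rewrite mulrDr; exact: trigD.
  + by under eq_fun do rewrite mulrCA; exact: trigZ.
- by under eq_fun do rewrite mulrDl; exact: trigD.
- by under eq_fun do rewrite -mulrA; exact: trigZ.
Qed.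

Lemma trig_cst c : trig (fun=> c).
Proof.
have := trigZ c (trig_bas 0); rewrite (_ : (fun x => _) = fun=> c)//.
by apply/funext => x; rewrite bas0 mulr1.
Qed.

Lemma trig_cont f : trig f -> continuous f.
Proof.
elim=> [k|f1 f2 _ h1 _ h2|c f1 _ h1] x.
- exact: continuous_bas.
- exact: cvgD (h1 x) (h2 x).
- exact: cvgM (cvg_cst _) (h1 x).
Qed.

Lemma trig_bd f : trig f -> exists M : R, forall x, `|f x| <= M.
Proof.
elim=> [k|f1 f2 _ [M1 h1] _ [M2 h2]|c f1 _ [M1 h1]].
- by exists 2 => x; exact: bas_bd.
- by exists (M1 + M2) => x; apply: le_trans (ler_normD _ _) _; exact: lerD.
- by exists (`|c| * M1) => x; rewrite normrM ler_wpM2l.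
Qed.

Definition crd (i : 'I_3) (x : R3) : R :=
  if i == 0 then x.1.1 else if i == 1 then x.1.2 else x.2.

Definition kunit (i : 'I_3) : K := ((i == 0 : nat)%:Z, (i == 1 : nat)%:Z, (i == 2 : nat)%:Z).

Lemma dot_kunit i x : dot (kunit i) x = crd i x.
Proof. by elim/ord3P: i; rewrite /dot /crd /= !(mul1r, mul0r, addr0, add0r). Qed.

Lemma trig_cos_crd i c : trig (fun x => cos (crd i x - c)).
Proof.
have tc : trig (fun x => cos (crd i x)).
  have := trigZ 2^-1 (trigD (trig_bas (kunit i)) (trig_bas (- kunit i))).
  apply: eq_trig => x; rewrite /bas dotN casN dot_kunit /cas; lra.
have ts : trig (fun x => sin (crd i x)).
  have := trigZ 2^-1 (trigB (trig_bas (kunit i)) (trig_bas (- kunit i))).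
  apply: eq_trig => x; rewrite /bas dotN casN dot_kunit /cas; lra.
under eq_fun do rewrite cosB mulrC (mulrC (sin _)).
by apply: trigD; exact: trigZ.
Qed.

Lemma trig_iter n g : trig g -> trig (fun x => iter n sgq (g x)).
Proof.
move=> tg; elim: n => //= n IH; rewrite /sgq; apply: trigZ; apply: trigB.
  exact: trigZ.
under eq_fun do rewrite !exprS expr0 mulr1.
by apply: trigM => //; exact: trigM.
Qed.

Lemma measurable_crd i : measurable_fun setT (crd i).
Proof.
elim/ord3P: i; rewrite /crd /=.
- exact: (measurableT_comp measurable_fst measurable_fst).
- exact: (measurableT_comp measurable_snd measurable_fst).
- exact: measurable_snd.
Qed.

Lemma negligible_crd i (c : R) : leb3 [set x | crd i x = c] = 0%E.
Proof.
have lc : leb [set c] = 0%E by exact: lebesgue_measure_set1.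
have mc : measurable [set c] by exact: measurable_set1.
have e1 : (leb \x leb)%E ([set c] `*` setT) = 0%E.
  rewrite product_measure1E//.
  by rewrite [X in (X * _)%E](_ : _ = 0%E) ?mul0e//; exact: lc.
have e2 : (leb \x leb)%E (setT `*` [set c]) = 0%E.
  rewrite product_measure1E//.
  by rewrite [X in (_ * X)%E](_ : _ = 0%E) ?mule0//; exact: lc.
elim/ord3P: i; rewrite /crd /=.
- rewrite (_ : [set x | _] = ([set c] `*` setT) `*` setT); last first.
    by apply/seteqP; split => [[[x y] z]|[[x y] z]] //= [[]].
  rewrite /leb3 product_measure1E//; last exact: measurableX.
  by rewrite [X in (X * _)%E](_ : _ = 0%E) ?mul0e//; exact: e1.
- rewrite (_ : [set x | _] = (setT `*` [set c]) `*` setT); last first.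
    by apply/seteqP; split => [[[x y] z]|[[x y] z]] //= [[]].
  rewrite /leb3 product_measure1E//; last exact: measurableX.
  by rewrite [X in (X * _)%E](_ : _ = 0%E) ?mul0e//; exact: e2.
- rewrite (_ : [set x | _] = setT `*` [set c]); last first.
    by apply/seteqP; split => [[[x y] z]|[[x y] z]] //= [].
  rewrite /leb3 product_measure1E//.
  by rewrite [X in (_ * X)%E](_ : _ = 0%E) ?mule0//; exact: lc.
Qed.

Section Orthogonal.
Variable f : R3 -> R.
Hypothesis If : cinteg f.

Definition bm (h : R3 -> R) := measurable_fun setT h /\ exists M : R, forall x, `|h x| <= M.

Lemma bmM g h : bm g -> bm h -> bm (fun x => g x * h x).
Proof.
move=> [mg [M1 h1]] [mh [M2 h2]]; split; first exact: measurable_funM.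
by exists (M1 * M2) => x; rewrite normrM ler_pM.
Qed.

Lemma trig_bm g : trig g -> bm g.
Proof.
by move=> tg; split; [apply: measurable_cont3; exact: trig_cont|exact: trig_bd].
Qed.

Lemma integ_bm h : bm h -> cinteg (fun x => f x * h x).
Proof.
move=> [mh [M hM]]; apply: (c_integ_le (g := fun x => M * `|f x|)).
- by apply: measurable_funM; [exact: c_integ_mfun If|exact: measurable_funTS].
- by move=> x _; rewrite normrM mulrC ler_wpM2r.
- by apply: c_integZ; exact: c_integ_norm.
Qed.

Definition orth (h : R3 -> R) := bm h /\ \int[leb3]_(x in cube) (f x * h x) = 0.

Lemma orth_lim (h_ : nat -> R3 -> R) (h : R3 -> R) (M : R) :
  (forall n, orth (h_ n)) -> bm h -> (forall n x, `|h_ n x| <= M) ->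
  {ae leb3, forall x, cube x -> h_ n x @[n --> \oo] --> h x} -> orth h.
Proof.
move=> o_ bh hM cv; split => //.
have [||||n|_ cvi] := @c_Rint_dct (fun n x => f x * h_ n x) (fun x => f x * h x)
    (fun x => M * `|f x|).
- by move=> n; apply: c_integ_mfun; apply: integ_bm; exact: (o_ n).1.
- by apply: c_integ_mfun; exact: integ_bm.
- by apply: filterS cv => x cx /cx h1; apply: cvgM => //; exact: cvg_cst.
- by apply: c_integZ; exact: c_integ_norm.
- by apply: aeW => x _; rewrite normrM mulrC ler_wpM2r.
apply: esym; apply: (cvg_unique _ _ cvi) => //.
rewrite /= (_ : (fun n => _) = fun=> 0); first exact: cvg_cst.
by apply/funext => n; exact: (o_ n).2.
Qed.

Lemma orthD g h : orth g -> orth h -> orth (fun x => g x + h x).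
Proof.
move=> [bg og] [bh oh]; split.
  case: bg => mg [M1 h1]; case: bh => mh [M2 h2]; split; first exact: measurable_funD.
  by exists (M1 + M2) => x; apply: le_trans (ler_normD _ _) _; exact: lerD.
under eq_Rintegral do rewrite mulrDr.
by rewrite c_RintD ?og ?oh ?addr0//; exact: integ_bm.
Qed.

Lemma orthZ c h : orth h -> orth (fun x => c * h x).
Proof.
move=> [bh oh]; split.
  case: bh => mh [M2 h2]; split; first exact: measurable_funM.
  by exists (`|c| * M2) => x; rewrite normrM ler_wpM2l.
under eq_Rintegral do rewrite mulrCA.
by rewrite c_RintZ ?oh ?mulr0//; exact: integ_bm.
Qed.

Lemma bm_indic d' (T' : measurableType d') (p : R3 -> T') (A : set T') :
  measurable_fun setT p -> measurable A -> bm (fun x => \1_A (p x)).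
Proof.
move=> mp mA; split.
  have mi : measurable_fun setT (\1_A : T' -> R) by exact: measurable_indic.
  exact: (measurableT_comp mi mp).
exists 1 => x; rewrite indicE; case: (_ \in _); rewrite ?normr1 ?normr0//.
Qed.

(** Dynkin's pi-lambda argument: the sets with orthogonal indicator are stable under proper
    differences and, by dominated convergence, under increasing unions. The factor [t] is carried
    along so that the coordinates can be treated one after the other. *)
Lemma orth_gen d' (T' : measurableType d') (p : R3 -> T') (G : set (set T')) t :
  measurable_fun setT p -> @measurable _ T' = <<s G >> -> setI_closed G ->
  orth t -> (forall A, G A -> orth (fun x => \1_A (p x) * t x)) ->
  forall A, measurable A -> orth (fun x => \1_A (p x) * t x).
Proof.
move=> mp eG IG ot oG A mA.
pose H := [set A | measurable A /\ orth (fun x => \1_A (p x) * t x)].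
suff : <<s G >> `<=` H by move=> /(_ A); rewrite -eG => /(_ mA) [].
have GH : G `<=` H.
  by move=> B GB; split; [rewrite eG; exact: sub_sigma_algebra|exact: oG].
apply: (lambda_system_subset IG _ GH) => //.
split => //.
- split => //; rewrite (_ : (fun x => _) = t)//.
  by apply/funext => x; rewrite indicT /= mul1r.
- move=> B C CB [mB oB] [mC oC]; split; first exact: measurableD.
  have := orthD oB (orthZ (-1) oC); congr orth; apply/funext => x.
  rewrite mulN1r -mulrBl; congr (_ * _); rewrite !indicE in_setD.
  case: (boolP (p x \in C)) => pC; last by rewrite andbT subr0.
  by rewrite andbF (mem_set (CB _ (set_mem pC))) subrr.
- move=> F ndF HF; split; first by apply: bigcupT_measurable => n; exact: (HF n).1.
  have [bt [M tM]] := ot.1.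
  have mU : measurable (\bigcup_n F n) by apply: bigcupT_measurable => n; exact: (HF n).1.
  apply: (@orth_lim (fun n x => \1_(F n) (p x) * t x) _ M).
  + by move=> n; exact: (HF n).2.
  + by apply: bmM ot.1; exact: bm_indic.
  + move=> n x; rewrite normrM -[leRHS]mul1r ler_pM//.
    by rewrite indicE; case: (_ \in _); rewrite ?normr1 ?normr0.
  + apply: aeW => x _; apply: cvgM; last exact: cvg_cst.
    apply: cvg_near_cst.
    have [[N _ FN]|nF] := pselect ((\bigcup_n F n) (p x)).
      exists N => // n /= Nn; rewrite !indicE mem_set; last first.
        by have /subsetPset := ndF _ _ Nn; apply.
      by rewrite mem_set//; exists N.
    apply: nearW => n; rewrite !indicE memNset; last by move=> Fn; apply: nF; exists n.
    by rewrite memNset.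
Qed.

Lemma orth_ext h h' : orth h -> bm h' -> (forall x, cube x -> h x = h' x) -> orth h'.
Proof.
move=> [bh oh] bh' e; split => //; rewrite -[RHS]oh.
by apply: c_eq_Rint => x cx; rewrite e.
Qed.

Hypothesis f0 : forall k, coef k f = 0.

Lemma trig_orth g : trig g -> orth g.
Proof.
elim=> [k|g1 g2 _ h1 _ h2|c g1 _ h1]; [|exact: orthD|exact: orthZ].
split; first exact: trig_bm (trig_bas k).
by have /eqP := f0 k; rewrite mulf_eq0 invr_eq0 gt_eqF ?vol_gt0//= => /eqP.
Qed.

Lemma cube_crd i x : cube x -> 0 <= crd i x <= 2 * pi.
Proof.
move=> [[/= h1 h2] h3]; move: h1 h2 h3; rewrite !in_itv /= => h1 h2 h3.
by elim/ord3P: i.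
Qed.

Lemma bm_halfline i (a : R) : bm (fun x => \1_(`]a, +oo[) (crd i x)).
Proof. by apply: bm_indic; [exact: measurable_crd|exact: measurable_itv]. Qed.

(** For 0 <= a < 2 pi the indicator of x_i > a is, almost everywhere on the cube, (1 + sign)/2 of a
    trigonometric polynomial with the sign of x_i - a. Iterating [sgq] produces this sign as a
    bounded limit of trigonometric polynomials. *)
Lemma orth_halfline i (a : R) t : (forall g, trig g -> orth (fun x => t x * g x)) ->
  orth (fun x => \1_(`]a, +oo[) (crd i x) * t x).
Proof.
move=> ot.
have ot1 : orth t.
  by have := ot _ (trig_cst 1); congr orth; apply/funext => x; rewrite mulr1.
have bt : bm (fun x => \1_(`]a, +oo[) (crd i x) * t x).
  by apply: bmM; [exact: bm_halfline|exact: ot1.1].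
have [a0|a0] := ltP a 0.
  apply: (orth_ext ot1) => // x /(cube_crd i) /andP[x0 _].
  by rewrite indicE mem_set ?mul1r//= in_itv /= andbT (lt_le_trans a0).
have [a1|a1] := leP (2 * pi) a.
  apply: (orth_ext (orthZ 0 ot1)) => // x /(cube_crd i) /andP[_ x1].
  rewrite indicE memNset ?mul0r//= in_itv /= andbT.
  by apply/negP; rewrite -leNgt (le_trans x1).
have [mt [M tM]] := ot1.1.
(* [g] equals sin(x_i/2) sin((x_i - a)/2), whose first factor is positive for 0 < x_i < 2 pi; the
   prefactor keeps [g] in [-1, 1], where the iteration converges. *)
pose g x := 2^-1 * (cos (a / 2) - cos (crd i x - a / 2)).
have tg : trig g by apply: trigZ; apply: trigB; [exact: trig_cst|exact: trig_cos_crd].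
have g1 x : `|g x| <= 1.
  rewrite /g normrM ger0_norm ?invr_ge0// ler_pdivrMl// mulr1 -[leRHS]/(1 + 1).
  apply: le_trans (ler_normB _ _) _.
  by apply: lerD; rewrite ler_norml cos_geN1 cos_le1.
have th n : trig (fun x => 2^-1 * (1 + iter n sgq (g x))).
  by apply: trigZ; apply: trigD; [exact: trig_cst|exact: trig_iter].
apply: (@orth_lim (fun n x => t x * (2^-1 * (1 + iter n sgq (g x)))) _ (M * 1)) => //.
- by move=> n; exact: ot.
- move=> n x; rewrite normrM ler_pM//.
  have := iter_sgq_bd n (g1 x); rewrite !ler_norml; lra.
(* On these three hyperplanes [g] vanishes and the iteration yields 1/2 instead of the indicator;
   they are null sets. *)
pose N := [set x : R3 | crd i x = 0] `|` [set x | crd i x = a] `|` [set x | crd i x = 2 * pi].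
have mset c : measurable [set x : R3 | crd i x = c].
  rewrite -[X in measurable X]setTI.
  exact: (measurable_crd i measurableT (measurable_set1 c)).
have neg c : leb3.-negligible [set x : R3 | crd i x = c].
  exists [set x : R3 | crd i x = c]; split => //; first exact: mset.
  exact: negligible_crd.
have N0 : leb3.-negligible N.
  by apply: negligibleU; [apply: negligibleU|]; exact: neg.
apply: (negligibleS _ N0) => x /= hx; apply: contrapT => xN; apply: hx.
move=> /(cube_crd i)/andP[x0 x1].
have {}x0 : 0 < crd i x by rewrite lt_neqAle x0 andbT; apply/eqP => e; apply: xN; left; left.
have {}x1 : crd i x < 2 * pi by rewrite lt_neqAle x1 andbT; apply/eqP => e; apply: xN; right.
have xa : crd i x != a by apply/eqP => e; apply: xN; left; right.
set y := crd i x in x0 x1 xa *.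
have ge : g x = sin (y / 2) * sin ((y - a) / 2).
  rewrite /g -/y (_ : a / 2 = y / 2 - (y - a) / 2); last by field.
  rewrite (_ : y - (y / 2 - (y - a) / 2) = y / 2 + (y - a) / 2); last by field.
  by rewrite cosB cosD; field.
have sy : 0 < sin (y / 2) by apply: sin_gt0_pi; lra.
rewrite mulrC; apply: cvgM; first exact: cvg_cst.
suff -> : \1_(`]a, +oo[) y = 2^-1 * (1 + Num.sg (g x)).
  apply: cvgM; first exact: cvg_cst.
  by apply: cvgD; [exact: cvg_cst|exact: cvg_iter_sgq].
rewrite ge; move: xa; rewrite neq_lt => /orP[ya|ay].
  rewrite indicE memNset /=; last by rewrite in_itv /= andbT; apply/negP; rewrite -leNgt ltW.
  have s0 : sin ((y - a) / 2) < 0.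
    by rewrite -oppr_gt0 -sinN; apply: sin_gt0_pi; lra.
  by rewrite ltr0_sg ?subrr ?mulr0// nmulr_llt0.
rewrite indicE mem_set /=; last by rewrite in_itv /= andbT.
have s0 : 0 < sin ((y - a) / 2) by apply: sin_gt0_pi; lra.
by rewrite gtr0_sg ?mulr_gt0//; field.
Qed.

Lemma orth_crd i t (A : set R) : measurable A ->
  (forall g, trig g -> orth (fun x => t x * g x)) ->
  orth (fun x => \1_A (crd i x) * t x).
Proof.
move=> mA ot.
have ot1 : orth t.
  by have := ot _ (trig_cst 1); congr orth; apply/funext => x; rewrite mulr1.
apply: (@orth_gen _ (measurableTypeR R) (crd i) (@RGenOInfty.G R)) => //.
- exact: measurable_crd.
- exact: RGenOInfty.measurableE.
- move=> _ _ [y ->] [z ->]; exists (Num.max y z).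
  apply/seteqP; split => w /=; rewrite !in_itv /= !andbT gt_max.
    by move=> [-> ->].
  by move=> /andP.
- by move=> _ [y ->]; exact: orth_halfline.
Qed.

(** Indicators of boxes are built by adding one coordinate at a time, each step keeping a free
    trigonometric factor for the next one. Two Dynkin arguments then reach the product
    sigma-algebra, in two variables and in three. *)
Lemma orth_all (E : set R3) : measurable E -> orth \1_E.
Proof.
move=> mE.
have S1 A g : measurable A -> trig g -> orth (fun x => \1_A (crd 0 x) * g x).
  by move=> mA tg; apply: orth_crd => // g' tg'; apply: trig_orth; exact: trigM.
have S2 A B g : measurable A -> measurable B -> trig g ->
    orth (fun x => \1_B (crd 1 x) * (\1_A (crd 0 x) * g x)).
  move=> mA mB tg; apply: orth_crd => // g' tg'.
  by under eq_fun do rewrite -mulrA; apply: S1 => //; exact: trigM.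
have S3 A B C : measurable A -> measurable B -> measurable C ->
    orth (fun x => \1_C (crd 2 x) * (\1_B (crd 1 x) * (\1_A (crd 0 x) * 1))).
  move=> mA mB mC; apply: orth_crd => // g' tg'.
  have := S2 A B g' mA mB tg'; congr orth; apply/funext => x.
  by rewrite mulr1 -mulrA.
have one : orth (fun=> 1) := trig_orth (trig_cst 1).
have S4 (D : set (R * R)) C : measurable D -> measurable C ->
    orth (fun x => \1_D x.1 * \1_C (crd 2 x)).
  move=> mD mC.
  apply: (@orth_gen _ (measurableTypeR R * measurableTypeR R)%type fst
    [set A `*` B | A in measurable & B in measurable]) => //.
  - exact: measurable_prod_measurableType.
  - move=> _ _ [A mA [B mB <-]] [A' mA' [B' mB' <-]].
    exists (A `&` A'); first exact: measurableI.
    by exists (B `&` B'); [exact: measurableI|rewrite setXI].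
  - by have := S3 setT setT C measurableT measurableT mC; congr orth; apply/funext => x;
      rewrite !indicT !mulr1.
  - move=> _ [A mA [B mB <-]]; have := S3 A B C mA mB mC; congr orth; apply/funext => x.
    rewrite mulr1 mulrC; congr (_ * _); rewrite !indicE.
    by rewrite in_setX /crd /= mulrC; do 2 case: (_ \in _); rewrite ?mulr1 ?mulr0.
have := @orth_gen _ (measurableTypeR R * measurableTypeR R * measurableTypeR R)%type id
    [set A `*` B | A in measurable & B in measurable] (fun=> 1).
move=> /(_ _ _ _ one _ E mE)/wrap[].
- exact: measurable_id.
- exact: measurable_prod_measurableType.
- move=> _ _ [A mA [B mB <-]] [A' mA' [B' mB' <-]].
  exists (A `&` A'); first exact: measurableI.
  by exists (B `&` B'); [exact: measurableI|rewrite setXI].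
- move=> _ [A mA [B mB <-]]; have := S4 A B mA mB; congr orth; apply/funext => x.
  rewrite mulr1 !indicE in_setX /crd /=.
  by do 2 case: (_ \in _); rewrite ?mulr1 ?mulr0.
by congr orth; apply/funext => x; rewrite mulr1.
Qed.

End Orthogonal.

Lemma coef_eq0_ae (f : R3 -> R) : cinteg f -> (forall k, coef k f = 0) ->
  {ae @leb3 R, forall x, cube x -> f x = 0}.
Proof.
move=> If f0.
apply: c_ae_eq0_indic => // E mE; have [bE oE] := orth_all If f0 mE.
by split => //; exact: integ_bm.
Qed.

Lemma coef_eq_ae (f g : R3 -> R) : cinteg f -> cinteg g -> (forall k, coef k f = coef k g) ->
  {ae @leb3 R, forall x, cube x -> f x = g x}.
Proof.
move=> If Ig fg.
have : {ae @leb3 R, forall x, cube x -> f x - g x = 0}.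
  apply: coef_eq0_ae; first exact: c_integB.
  by move=> k; rewrite coefB// fg subrr.
by apply: filterS => x h /h /eqP; rewrite subr_eq0 => /eqP.
Qed.

End Completeness.

(** * Absolutely convergent sums over the integer lattice *)

Lemma cvg_le_bd (R : realType) (u : nat -> R) (l B : R) (N : nat) : u n @[n --> \oo] --> l ->
  (forall n, (N <= n)%N -> u n <= B) -> l <= B.
Proof.
move=> c h; rewrite -(cvg_lim _ c)//; apply: limr_le; first by apply/cvg_ex; exists l.
by exists N.
Qed.

Lemma cvg_ge_bd (R : realType) (u : nat -> R) (l B : R) (N : nat) : u n @[n --> \oo] --> l ->
  (forall n, (N <= n)%N -> B <= u n) -> B <= l.
Proof.
move=> c h; rewrite -lerN2; apply: (cvg_le_bd (N := N) (cvgN c)) => n Nn.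
by rewrite lerN2 h.
Qed.

Fact bx_key : unit. Proof. by []. Qed.

Section LatticeSums.
Context {R : realType}.
Local Notation K := (int * int * int)%type.
Implicit Types (f g : K -> R) (k : K) (n N : nat).

Definition zr n : seq int := [seq i%:Z - n%:Z | i <- iota 0 n.*2.+1].

Lemma mem_zr n (a : int) : (a \in zr n) = (`|a| <= n)%N.
Proof.
apply/mapP/idP => [[i]|an].
  by rewrite mem_iota => /andP[_]; rewrite add0n => h ->; lia.
exists `|(a + n%:Z)%R|%N; last by lia.
by rewrite mem_iota add0n; lia.
Qed.

Lemma uniq_zr n : uniq (zr n).
Proof. by rewrite map_inj_uniq ?iota_uniq// => i j /addIr []. Qed.

(** Locked, so that simplification never expands the enumeration. These boxes exhaust the lattice
    and are symmetric under negation, which the reflections of the Hartley calculus require. *)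
Definition bx := locked_with bx_key (fun n : nat =>
  [seq (p, c) | p <- [seq (a, b) | a <- zr n, b <- zr n], c <- zr n]).

Lemma bxE n : bx n = [seq (p, c) | p <- [seq (a, b) | a <- zr n, b <- zr n], c <- zr n].
Proof. by rewrite /bx unlock. Qed.

Lemma mem_pairs (S T : eqType) (s : seq S) (t : seq T) x :
  (x \in [seq (a, b) | a <- s, b <- t]) = (x.1 \in s) && (x.2 \in t).
Proof.
apply/allpairsP/andP => [[[a b] /= [hs ht ->]]|[hs ht]]; first by [].
by exists x; split => //; case: x {hs ht}.
Qed.

Lemma mem_bx n k : (k \in bx n) = [&& `|k.1.1| <= n, `|k.1.2| <= n & `|k.2| <= n]%N.
Proof.
by rewrite bxE !mem_pairs !mem_zr -andbA. Qed.

Lemma uniq_bx n : uniq (bx n).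
Proof.
rewrite bxE; apply: allpairs_uniq; rewrite ?uniq_zr//; last by move=> [? ?] [? ?] _ _ [-> ->].
by apply: allpairs_uniq; rewrite ?uniq_zr//; move=> [? ?] [? ?] _ _ [-> ->].
Qed.

Lemma bx_sub n n' : (n <= n')%N -> {subset bx n <= bx n'}.
Proof. by move=> nn k; rewrite !mem_bx => /and3P[*]; apply/and3P; split; lia. Qed.

Lemma bx_exhaust (s : seq K) : exists N, {subset s <= bx N}.
Proof.
elim: s => [|k s [N sN]]; first by exists 0%N.
exists (maxn N (`|k.1.1| + `|k.1.2| + `|k.2|)%N) => l; rewrite inE => /predU1P[->|/sN].
  by rewrite mem_bx; lia.
by apply: bx_sub; rewrite leq_maxl.
Qed.

Lemma bxN n : perm_eq [seq - k | k <- bx n] (bx n).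
Proof.
apply: uniq_perm; [by rewrite (map_inj_uniq oppr_inj) uniq_bx|exact: uniq_bx|move=> k].
rewrite -{1}[k]opprK (mem_map oppr_inj) !mem_bx /=; lia.
Qed.

Lemma sum_bxN f n : \sum_(k <- bx n) f (- k) = \sum_(k <- bx n) f k.
Proof. by rewrite -[RHS](perm_big _ (bxN n)) big_map. Qed.

Lemma sum_sub_le f (s s' : seq K) : (forall k, 0 <= f k) -> uniq s -> {subset s <= s'} ->
  \sum_(k <- s) f k <= \sum_(k <- s') f k.
Proof.
move=> f0; elim: s s' => [|k s IH] t /=.
  by move=> _ _; rewrite big_nil; exact: sumr_ge0.
move=> /andP[ks us] st; have kt : k \in t by apply: st; rewrite mem_head.
rewrite (perm_big _ (perm_to_rem kt)) !big_cons lerD2l; apply: IH => // l ls.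
have : l \in t by apply: st; rewrite inE ls orbT.
rewrite (perm_mem (perm_to_rem kt)) inE => /predU1P[e|//].
by move: ks; rewrite -e ls.
Qed.

(** Absolute summability with an explicit bound. Quantifying over duplicate-free finite lists makes
    it independent of any enumeration and stable under reindexing. *)
Definition kbd f (B : R) := forall s : seq K, uniq s -> \sum_(k <- s) `|f k| <= B.

Lemma kbd_le f g B : (forall k, `|f k| <= `|g k|) -> kbd g B -> kbd f B.
Proof. by move=> fg gB s us; apply: le_trans (gB s us); exact: ler_sum. Qed.

Lemma kbd_norm f B : kbd f B -> kbd (fun k => `|f k|) B.
Proof. by apply: kbd_le => k; rewrite normr_id. Qed.

Lemma kbd_ge0 f B : kbd f B -> 0 <= B.
Proof. by move=> /(_ [::] isT); rewrite big_nil. Qed.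

Lemma kbd1 f B k : kbd f B -> `|f k| <= B.
Proof. by move=> /(_ [:: k] isT); rewrite big_seq1. Qed.

Lemma kbdD f g B C : kbd f B -> kbd g C -> kbd (fun k => f k + g k) (B + C).
Proof.
move=> fB gC s us; apply: le_trans (lerD (fB s us) (gC s us)).
by rewrite -big_split; apply: ler_sum => k _; exact: ler_normD.
Qed.

Lemma kbdZ c f B : kbd f B -> kbd (fun k => c * f k) (`|c| * B).
Proof.
move=> fB s us; under eq_bigr do rewrite normrM.
by rewrite -mulr_sumr ler_wpM2l// fB.
Qed.

Lemma kbd_bx f B : (forall n, \sum_(k <- bx n) `|f k| <= B) -> kbd f B.
Proof.
move=> fB s us; have [N sN] := bx_exhaust s.
by apply: le_trans (fB N); apply: sum_sub_le.
Qed.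

Definition ksum f : R := limn (fun n => \sum_(k <- bx n) f k).

(** The family is the difference of |f| and |f| - f, which are nonnegative, so that their box sums
    are monotone and bounded. *)
Lemma cvg_ksum f B : kbd f B -> \sum_(k <- bx n) f k @[n --> \oo] --> ksum f.
Proof.
move=> fB.
have pos g C : (forall k, 0 <= g k) -> kbd g C -> cvgn (fun n => \sum_(k <- bx n) g k).
  move=> g0 gC; apply: nondecreasing_is_cvgn.
    by move=> n n' nn; apply: sum_sub_le (uniq_bx n) (bx_sub nn).
  exists C => _ [n _ <-]; have := gC _ (uniq_bx n).
  by under eq_bigr do rewrite ger0_norm//.
have c1 := pos (fun k => `|f k|) B (fun=> normr_ge0 _) (kbd_norm fB).
have c2 : cvgn (fun n => \sum_(k <- bx n) (`|f k| - f k)).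
  apply: (pos _ (B + `|-1| * B)); first by move=> k; rewrite subr_ge0 ler_norm.
  have := kbdD (kbd_norm fB) (kbdZ (-1) fB).
  by apply: kbd_le => k; rewrite mulN1r.
rewrite /ksum.
have -> : (fun n => \sum_(k <- bx n) f k) = (fun n => \sum_(k <- bx n) `|f k|) -
    (fun n => \sum_(k <- bx n) (`|f k| - f k)).
  by apply/funext => n /=; rewrite !fctE -sumrB; apply: eq_bigr => k _; rewrite opprB addrCA subrr addr0.
exact: is_cvgB c1 c2.
Qed.

Lemma ksum_le f B : kbd f B -> `|ksum f| <= B.
Proof.
move=> fB; have c : `|\sum_(k <- bx n) f k| @[n --> \oo] --> `|ksum f|.
  by apply: cvg_norm; exact: cvg_ksum fB.
apply: (cvg_le_bd (N := 0) c) => n _.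
by apply: le_trans (ler_norm_sum _ _ _) _; exact: fB (uniq_bx n).
Qed.

Lemma eq_ksum f g : f =1 g -> ksum f = ksum g.
Proof. by move=> /funext ->. Qed.

Lemma ksumD f g B C : kbd f B -> kbd g C -> ksum (fun k => f k + g k) = ksum f + ksum g.
Proof.
move=> fB gC; apply/cvg_lim => //; under eq_fun do rewrite big_split /=.
exact: cvgD (cvg_ksum fB) (cvg_ksum gC).
Qed.

Lemma ksumZ c f B : kbd f B -> ksum (fun k => c * f k) = c * ksum f.
Proof.
move=> fB; apply/cvg_lim => //; under eq_fun do rewrite -mulr_sumr.
exact: cvgM (cvg_cst _) (cvg_ksum fB).
Qed.

Lemma ksumB f g B C : kbd f B -> kbd g C -> ksum (fun k => f k - g k) = ksum f - ksum g.
Proof.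
move=> fB gC; rewrite -mulN1r -(ksumZ _ gC) -(ksumD fB (kbdZ (-1) gC)).
by apply: eq_ksum => k; rewrite mulN1r.
Qed.

Lemma ksumN f : ksum (fun k => f (- k)) = ksum f.
Proof. by congr (limn _); apply/funext => n; exact: sum_bxN. Qed.

Lemma le_ksum f g B C : kbd f B -> kbd g C -> (forall k, f k <= g k) -> ksum f <= ksum g.
Proof.
move=> fB gC fg; apply: ler_lim; [exact: cvg_ksum fB|exact: cvg_ksum gC|].
by apply: nearW => n; exact: ler_sum.
Qed.

Lemma bx_perm n n' : (n <= n')%N ->
  perm_eq (bx n') (bx n ++ [seq k <- bx n' | k \notin bx n]).
Proof.
move=> nn; apply: uniq_perm.
- exact: uniq_bx.
- rewrite cat_uniq uniq_bx filter_uniq ?uniq_bx// andbT andTb.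
  by apply/hasPn => k; rewrite mem_filter => /andP[].
- move=> k; rewrite mem_cat mem_filter.
  by case: (boolP (k \in bx n)) => //= kn; rewrite (bx_sub nn).
Qed.

Lemma bx_split f n n' : (n <= n')%N -> \sum_(k <- bx n') f k =
  \sum_(k <- bx n) f k + \sum_(k <- [seq k <- bx n' | k \notin bx n]) f k.
Proof. by move=> nn; rewrite -big_cat; apply: perm_big; exact: bx_perm. Qed.

(** Kept apart from [kbd] because continuity and termwise differentiation need an [N] that is
    uniform in a parameter. *)
Definition ktail f N (e : R) := forall s : seq K, uniq s -> {in s, forall k, k \notin bx N} ->
  \sum_(k <- s) `|f k| <= e.

Lemma kbd_ktail f B e : kbd f B -> 0 < e -> exists N, ktail f N e.
Proof.
move=> fB e0; have := cvg_ksum (kbd_norm fB) => /cvgrPdist_le/(_ e e0)[N _ hN].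
exists N => s us sN; have [N1 sN1] := bx_exhaust s.
have h n : \sum_(k <- bx n) `|f k| <= ksum (fun k => `|f k|).
  apply: (cvg_ge_bd (N := n) (cvg_ksum (kbd_norm fB))) => n' nn.
  exact: sum_sub_le (uniq_bx n) (bx_sub nn).
have := hN N (leqnn N); rewrite ger0_norm ?subr_ge0// => h1.
have us' : uniq (s ++ bx N).
  by rewrite cat_uniq us uniq_bx andbT; apply/hasPn => k kN; apply/negP => /sN; rewrite kN.
have [N2 sN2] := bx_exhaust (s ++ bx N).
have := sum_sub_le (f := fun k => `|f k|) (fun=> normr_ge0 _) us' sN2.
rewrite big_cat /=; have := h N2; lra.
Qed.

Lemma ktailS f N N' e : (N <= N')%N -> ktail f N e -> ktail f N' e.
Proof. by move=> NN t s us h; apply: t => // k /h; apply: contra; exact: bx_sub. Qed.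

Lemma ksum_ktail f B N e n : kbd f B -> ktail f N e -> (N <= n)%N ->
  `|ksum f - \sum_(k <- bx n) f k| <= e.
Proof.
move=> fB fN Nn.
have c : `|\sum_(k <- bx n') f k - \sum_(k <- bx n) f k| @[n' --> \oo] -->
    `|ksum f - \sum_(k <- bx n) f k|.
  by apply: cvg_norm; apply: cvgB; [exact: cvg_ksum fB|exact: cvg_cst].
apply: (cvg_le_bd (N := n) c) => n' nn; rewrite (bx_split _ nn) addrC addKr.
apply: le_trans (ler_norm_sum _ _ _) _; apply: fN; first by rewrite filter_uniq ?uniq_bx.
by move=> k; rewrite mem_filter => /andP[kn _]; apply: contra kn; exact: bx_sub.
Qed.

(** A nonnegative quadratic has nonpositive discriminant. In the degenerate case B = 0 a nonzero X
    is refuted at t = (A + 1)/(2X), where the value is -1. *)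
Lemma quad_discr (A B X : R) : 0 <= B -> (forall t, 0 <= A - 2 * t * X + t ^+ 2 * B) ->
  X ^+ 2 <= A * B.
Proof.
rewrite le_eqVlt => /predU1P[<-|B0] h.
  have [->|X0] := eqVneq X 0; first by rewrite expr0n mulr0.
  have := h ((A + 1) / (2 * X)).
  rewrite (_ : _ + _ = -1); last by field.
  by rewrite oppr_ge0 ler10.
have := h (X / B).
rewrite (_ : _ + _ = A - X ^+ 2 / B); last by field; rewrite gt_eqF.
by rewrite subr_ge0 ler_pdivrMr.
Qed.

Lemma cs_sum (I : Type) (s : seq I) (a b : I -> R) :
  (\sum_(i <- s) a i * b i) ^+ 2 <= (\sum_(i <- s) a i ^+ 2) * (\sum_(i <- s) b i ^+ 2).
Proof.
apply: quad_discr; first by apply: sumr_ge0 => i _; exact: sqr_ge0.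
move=> t; rewrite (_ : _ + _ = \sum_(i <- s) (a i - t * b i) ^+ 2).
  by apply: sumr_ge0 => i _; exact: sqr_ge0.
rewrite !mulr_sumr -sumrB -big_split /=; apply: eq_bigr => i _; ring.
Qed.

(** Cauchy-Schwarz between sqrt(w) |f| and 1/sqrt(w): the lattice form of the Sobolev embedding once
    the inverse weights are summable. *)
Lemma cs_weight (s : seq K) (w f : K -> R) (A W : R) : (forall k, 0 < w k) ->
  \sum_(k <- s) w k * f k ^+ 2 <= A -> \sum_(k <- s) (w k)^-1 <= W ->
  \sum_(k <- s) `|f k| <= Num.sqrt (W * A).
Proof.
move=> w0 hA hW.
have A0 : 0 <= A by apply: le_trans hA; apply: sumr_ge0 => k _; rewrite mulr_ge0 ?sqr_ge0 ?ltW.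
have W0 : 0 <= W by apply: le_trans hW; apply: sumr_ge0 => k _; rewrite invr_ge0 ltW.
rewrite -(ger0_norm (sumr_ge0 _ (fun k _ => normr_ge0 (f k)))) -sqrtr_sqr ler_wsqrtr//.
have := cs_sum s (fun k => Num.sqrt (w k)^-1) (fun k => Num.sqrt (w k) * `|f k|).
rewrite (eq_bigr (fun k => `|f k|)); last first.
  by move=> k _; rewrite mulrA -sqrtrM ?invr_ge0 ?ltW// mulVf ?gt_eqF// sqrtr1 mul1r.
move=> /le_trans; apply; apply: ler_pM; try by apply: sumr_ge0 => k _; exact: sqr_ge0.
  by under eq_bigr do rewrite sqr_sqrtr ?invr_ge0 ?ltW//.
by under eq_bigr do rewrite exprMn sqr_sqrtr ?ltW// real_normK ?num_real//.
Qed.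

(** The square of the Japanese bracket of [k], so that [jap k ^+ m] is the weight of H^m. *)
Definition jap k : R := 1 + lam k.

Lemma jap_ge1 k : 1 <= jap k.
Proof. by rewrite lerDl lam_ge0. Qed.

Lemma jap_gt0 k : 0 < jap k.
Proof. exact: lt_le_trans (jap_ge1 k). Qed.

Lemma japN k : jap (- k) = jap k.
Proof. by rewrite /jap lamN. Qed.

Lemma notin_bx_lam n k : k \notin bx n -> (n.+1%:R) ^+ 2 <= lam k :> R.
Proof.
move=> kn; have [i hi] : exists i, (n.+1)%:R <= `|kr k i| :> R.
  have h (a : int) : (n < `|a|)%N -> n.+1%:R <= `|a%:~R : R|.
    by move=> na; rewrite -intr_norm -abszE -[leRHS]/(`|a|%N%:R) ler_nat.
  move: kn; rewrite mem_bx !negb_and -!ltnNge => /or3P[] /h.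
  + by exists 0; rewrite kr0E.
  + by exists 1; rewrite kr1E.
  + by exists 2; rewrite kr2E.
rewrite /lam (bigD1 i)//= -[leLHS]addr0 lerD//; last first.
  by apply: sumr_ge0 => j _; exact: sqr_ge0.
by rewrite -(real_normK (num_real (kr k i))) lerXn2r ?nnegrE.
Qed.

Lemma size_zr n : size (zr n) = n.*2.+1.
Proof. by rewrite size_map size_iota. Qed.

Lemma size_bx n : size (bx n) = (n.*2.+1 ^ 3)%N.
Proof. by rewrite bxE !size_allpairs !size_zr !expnS expn0; lia. Qed.

(** The shell between two consecutive boxes has at most 26 (n+1)^2 points, each contributing at most
    (n+1)^-4; the sum converges because the decay exponent 4 exceeds the dimension 3. *)
Lemma kbd_jap2 : kbd (fun k => (jap k ^+ 2)^-1 : R) 53.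
Proof.
have p0 k : 0 <= (jap k ^+ 2)^-1 by rewrite invr_ge0 exprn_ge0// ltW// jap_gt0.
apply: kbd_bx => n; under eq_bigr do rewrite ger0_norm ?p0//.
(* The shell bound 26/(n+1)^2 is dominated by the telescoping difference 52/(n+1) - 52/(n+2), and 53
   - 52 is the term at the origin. *)
suff : \sum_(k <- bx n) (jap k ^+ 2)^-1 <= (53 : R) - 52 / n.+1%:R.
  by move=> /le_trans; apply; rewrite gerBl divr_ge0.
elim: n => [|n IH].
  rewrite (_ : bx 0 = [:: 0]) ?bxE// big_seq1 /jap lam0 addr0 expr1n invr1; lra.
rewrite (bx_split _ (leqnSn n)).
have n0 : 0 < n.+1%:R :> R by [].
have h : \sum_(k <- [seq k <- bx n.+1 | k \notin bx n]) (jap k ^+ 2)^-1 <=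
   26 / (n.+1%:R) ^+ 2.
  apply: (@le_trans _ _ (\sum_(k <- [seq k <- bx n.+1 | k \notin bx n]) (n.+1%:R ^+ 4)^-1)).
    rewrite big_seq [leRHS]big_seq; apply: ler_sum => k; rewrite mem_filter => /andP[kn _].
    rewrite lef_pV2 ?posrE ?exprn_gt0 ?jap_gt0//.
    rewrite (exprM _ 2 2) lerXn2r ?nnegrE ?exprn_ge0 ?ltW ?jap_gt0//.
    by have := notin_bx_lam kn; rewrite /jap; lra.
  rewrite big_const_seq count_predT iter_addr_0.
  have -> : size [seq k <- bx n.+1 | k \notin bx n] = (24 * n ^ 2 + 48 * n + 26)%N.
    have /perm_size := bx_perm (leqnSn n).
    by rewrite size_cat !size_bx !expnS expn0; lia.
  rewrite -[leLHS]mulr_natl ler_pdivrMr ?exprn_gt0//.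
  rewrite (exprM _ 2 2 : n.+1%:R ^+ 4 = _) expr2 mulrA mulfVK ?gt_eqF ?exprn_gt0//.
  by rewrite -!natrM ler_nat !expnS expn0; lia.
apply: le_trans (lerD IH h) _.
rewrite -subr_ge0 (_ : _ - _ = 26 * n%:R / (n.+1%:R ^+ 2 * n.+2%:R)).
  by rewrite divr_ge0// mulr_ge0.
rewrite -!natr1; field; rewrite !natr1 !pnatr_eq0//.
Qed.

End LatticeSums.

(** * Almost everywhere convergence of fast L2 Cauchy sequences *)

Section L2Cauchy.
Context {d : measure_display} {T : measurableType d} {R : realType}
  (mu : {measure set T -> \bar R}) (D : set T).
Hypotheses (mD : measurable D) (muD : (mu D < +oo)%E).

(** Young's inequality 2|f| <= t f^2 + 1/t, with the parameter left free so that it can be tuned to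
    the size of f. *)
Lemma Rint_norm_le (f : T -> R) (A t : R) : sqint mu D f -> 0 < t ->
  \int[mu]_(x in D) (f x ^+ 2) <= A ->
  \int[mu]_(x in D) `|f x| <= 2^-1 * (t * A + t^-1 * fine (mu D)).
Proof.
move=> sf t0 fA.
have i1 := integ_norm (sqint_integ mD muD sf).
have i2 := integZ mD (2^-1 * t) sf.2.
have i3 := integ_cst mD muD (2^-1 * t^-1).
apply: (@le_trans _ _ (\int[mu]_(x in D) (2^-1 * t * f x ^+ 2 + 2^-1 * t^-1))).
  apply: (le_Rint mD i1 (integD mD i2 i3)) => x _.
  rewrite -subr_ge0 -(real_normK (num_real (f x))).
  rewrite (_ : _ - _ = 2^-1 * t * (`|f x| - t^-1) ^+ 2); last by field; rewrite gt_eqF.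
  by rewrite mulr_ge0 ?sqr_ge0// mulr_ge0// ltW.
rewrite (RintD mD i2 i3) (RintZ mD _ sf.2) Rintegral_cst// mulrDr !mulrA lerD2r.
by rewrite ler_wpM2l// mulr_ge0// ltW.
Qed.

(** Young's inequality with t = 2^j turns the decay 4^-j of the squared norms into L1 decay 2^-j.
    The sum of the absolute increments is then integrable, hence finite almost everywhere, and the
    sequence converges there. *)
Lemma ae_cvg_of_L2 (G : nat -> T -> R) (A : R) : (forall j, sqint mu D (G j)) ->
  (forall j, \int[mu]_(x in D) ((G j.+1 x - G j x) ^+ 2) <= A * (4^-1) ^+ j) ->
  {ae mu, forall x, D x -> cvgn (fun j => G j x)}.
Proof.
move=> sG GA.
pose h j x : R := `|G j.+1 x - G j x|.
have sh j : sqint mu D (fun x => G j.+1 x - G j x) := sqintB mD (sG j.+1) (sG j).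
have ih j : integ mu D (h j) := integ_norm (sqint_integ mD muD (sh j)).
pose C := 2^-1 * (A + fine (mu D)).
have hC j : \int[mu]_(x in D) h j x <= C * 2^-1 ^+ j.
  have := Rint_norm_le (sh j) (_ : 0 < 2 ^+ j) (GA j); rewrite exprn_gt0// => /(_ isT).
  move=> /le_trans; apply; rewrite /C (_ : 4^-1 = 2^-1 * 2^-1 :> R); last by field.
  have p0 : 2 ^+ j != 0 :> R by rewrite expf_neq0.
  by rewrite exprMn !exprVn le_eqVlt; apply/orP; left; apply/eqP; field.
have mh j : measurable_fun D (EFin \o h j) by apply/measurable_EFinP; exact: integ_mfun (ih j).
pose H x := (\sum_(0 <= j <oo) (h j x)%:E)%E.
have h0 j x : D x -> (0 <= (h j x)%:E)%E by move=> _; rewrite lee_fin normr_ge0.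
have iH : mu.-integrable D H.
  apply/integrableP; split.
    by apply: (@ge0_emeasurable_sum _ _ _ D (fun j => EFin \o h j) predT) => // j x Dx _; exact: h0.
  rewrite (_ : (\int[mu]_(x in D) `|H x| = \int[mu]_(x in D) H x)%E); last first.
    apply: eq_integral => x /[!inE] Dx; rewrite gee0_abs//.
    by apply: nneseries_ge0 => j _ _; exact: h0.
  rewrite integral_nneseries//.
  apply: (@le_lt_trans _ _ (2 * C)%:E); last exact: ltry.
  apply: lime_le; first by apply: is_cvg_nneseries => j _ _; apply: integral_ge0 => x; exact: h0.
  apply: nearW => n.
  have -> : (\sum_(0 <= j < n) \int[mu]_(x in D) (h j x)%:E =
      (\sum_(0 <= j < n) \int[mu]_(x in D) h j x)%R%:E)%E.
    rewrite -sumEFin; apply: eq_bigr => j _; rewrite fineK//.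
    exact: integrable_fin_num (ih j).
  rewrite lee_fin; apply: (@le_trans _ _ (\sum_(0 <= j < n) C * 2^-1 ^+ j)).
    by apply: ler_sum => j _.
  have C0 : 0 <= C by have := hC 0%N; rewrite expr0 mulr1; apply: le_trans; apply: Rintegral_ge0 => x _; exact: normr_ge0.
  rewrite -mulr_sumr mulrC ler_wpM2r//.
  have -> : \sum_(0 <= i < n) 2^-1 ^+ i = 2 - 2 * 2^-1 ^+ n :> R.
    elim: n => [|n IH]; first by rewrite big_geq// expr0; ring.
    by rewrite big_nat_recr//= IH exprS; field.
  by rewrite gerBl mulr_ge0// exprn_ge0.
have := integrable_ae mD iH; apply: filterS => x hx Dx.
have {}hx := hx Dx.
have c1 : cvgn (series (fun j => G j.+1 x - G j x)).
  apply: normed_cvg => /=.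
  apply: nondecreasing_is_cvgn.
    by apply/nondecreasing_seqP => n; rewrite [leRHS]seriesSr lerDl; exact: normr_ge0.
  exists (fine (H x)) => _ [n _ <-].
  rewrite -lee_fin fineK// /series -sumEFin.
  by apply: (@nneseries_lim_ge _ (fun j => (h j x)%:E) predT 0 n) => j _ _; exact: h0.
have e : (fun j => G j x) = (fun j => G 0%N x + series (fun j => G j.+1 x - G j x) j).
  by apply/funext => n; rewrite /series /= telescope_sumr// addrC subrK.
by rewrite e; apply: is_cvgD => //; exact: is_cvg_cst.
Qed.

End L2Cauchy.

Lemma deriv_lip (R : realType) (f df : R -> R) (e a b : R) :
  (forall s : R, is_derive s (1 : R) f (df s)) -> (forall s, `|df s| <= e) ->
  `|f b - f a| <= e * `|b - a|.
Proof.
move=> fd fe.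
have cf : continuous f.
  by move=> x; apply: differentiable_continuous; apply/derivable1_diffP; apply: ex_derive; exact: fd.
wlog ab : a b / a <= b.
  move=> h; have [/h//|/ltW/h] := leP a b.
  by rewrite distrC (distrC b).
have [c _ ->] := MVT_segment ab (fun x _ => fd x) (continuous_subspaceT cf).
by rewrite normrM ler_wpM2r.
Qed.

(** * Continuity and termwise differentiation of lattice sums *)

Section UniformSums.
Context {R : realType}.
Local Notation K := (int * int * int)%type.

Lemma cvg_within_sum (X : topologicalType) (A : set X) (x0 : X) (s : seq K) (F : K -> X -> R) :
  (forall k, F k x @[x --> within A (nbhs x0)] --> F k x0) ->
  \sum_(k <- s) F k x @[x --> within A (nbhs x0)] --> \sum_(k <- s) F k x0.
Proof.
move=> h; elim: s => [|k s IH].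
  by rewrite big_nil; under eq_fun do rewrite big_nil; exact: cvg_cst.
by rewrite big_cons; under eq_fun do rewrite big_cons; apply: cvgD.
Qed.

Lemma ksum_within_continuous (X : topologicalType) (A : set X) (F : K -> X -> R) :
  (forall x, A x -> exists B, kbd (F^~ x) B) ->
  (forall e, 0 < e -> exists N, forall x, A x -> ktail (F^~ x) N e) ->
  (forall k, {within A, continuous (F k)}) -> {within A, continuous (fun x => ksum (F^~ x))}.
Proof.
move=> bF tF cF; apply/subspace_continuousP => x0 Ax0.
apply/cvgrPdist_le => e e0.
have e3 : 0 < e / 3 by rewrite divr_gt0.
have [N hN] := tF _ e3.
have cs : \sum_(k <- bx N) F k x @[x --> within A (nbhs x0)] --> \sum_(k <- bx N) F k x0.
  by apply: cvg_within_sum => k; have /subspace_continuousP := cF k; apply.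
move/cvgrPdist_le : cs => /(_ _ e3); rewrite !near_withinE; apply: filterS => x + Ax => /(_ Ax).
have tl y : A y -> `|ksum (F^~ y) - \sum_(k <- bx N) F k y| <= e / 3.
  by move=> Ay; have [B hB] := bF _ Ay; exact: ksum_ktail hB (hN _ Ay) (leqnn N).
rewrite /from_subspace; have := tl _ Ax0; have := tl _ Ax; rewrite !ler_norml; lra.
Qed.

(** The difference quotient splits into a finite box, differentiated term by term, and a tail that
    the mean value inequality bounds by the uniform tail of the derivatives. *)
Lemma is_derive_ksum (F dF : K -> R -> R) (s0 : R) :
  (forall k (s : R), is_derive s (1 : R) (F k) (dF k s)) ->
  (forall s, exists B, kbd (F^~ s) B) -> (forall s, exists B, kbd (dF^~ s) B) ->
  (forall e, 0 < e -> exists N, forall s, ktail (dF^~ s) N e) ->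
  is_derive s0 (1 : R) (fun s => ksum (F^~ s)) (ksum (dF^~ s0)).
Proof.
move=> dd bF bdF tF.
have dsum (s : seq K) (t : R) : is_derive t (1 : R) (fun t => \sum_(k <- s) F k t) (\sum_(k <- s) dF k t).
  elim: s => [|k s IH].
    by rewrite big_nil; under eq_fun do rewrite big_nil; exact: is_derive_cst.
  by rewrite big_cons; under eq_fun do rewrite big_cons; apply: is_deriveD.
suff q : h^-1 *: (((fun s => ksum (F^~ s)) \o shift s0) (h *: (1 : R)) - ksum (F^~ s0))
    @[h --> (0 : R)^'] --> ksum (dF^~ s0).
  by split; [apply/cvg_ex; eexists; exact: q|exact: (cvg_lim _ q)].
apply/cvgrPdist_le => e e0; have e3 : 0 < e / 3 by rewrite divr_gt0.
have [N hN] := tF _ e3.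
have [dv dE] := dsum (bx N) s0.
have cq : h^-1 *: (((fun t => \sum_(k <- bx N) F k t) \o shift s0) (h *: (1 : R)) -
    \sum_(k <- bx N) F k s0) @[h --> (0 : R)^'] --> \sum_(k <- bx N) dF k s0.
  by rewrite -dE; exact: dv.
move/cvgrPdist_le : cq => /(_ _ e3) cq.
near=> h.
have h0 : h != 0 by near: h; exact: nbhs_dnbhs_neq.
have cqh : `|\sum_(k <- bx N) dF k s0 - h^-1 *: (((fun t => \sum_(k <- bx N) F k t) \o shift s0) (h *: (1 : R)) -
    \sum_(k <- bx N) F k s0)| <= e / 3 by near: h; exact: cq.
have hA : h *: (1 : R) = h by exact: mulr1.
move: cqh; rewrite /= hA -![_ *: _]/(_ * _) => cqh.
have [B hB] := bdF s0.
have t1 := ksum_ktail hB (hN s0) (leqnn N).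
have [B1 hB1] := bF s0; have [B2 hB2] := bF (h + s0).
set S1 := ksum _ in t1 *; set S2 := ksum _; set S3 := ksum _.
(* The tail is first estimated on larger finite boxes, where the mean value inequality applies, and
   the estimate passes to the limit. *)
have t2 : `|(S2 - \sum_(k <- bx N) F k (h + s0)) - (S3 - \sum_(k <- bx N) F k s0)| <= e / 3 * `|h|.
  have c : `|(\sum_(k <- bx n) F k (h + s0) - \sum_(k <- bx N) F k (h + s0)) -
      (\sum_(k <- bx n) F k s0 - \sum_(k <- bx N) F k s0)| @[n --> \oo] -->
     `|(S2 - \sum_(k <- bx N) F k (h + s0)) - (S3 - \sum_(k <- bx N) F k s0)|.
    by apply: cvg_norm; apply: cvgB; apply: cvgB; try exact: cvg_cst; [exact: cvg_ksum hB2|exact: cvg_ksum hB1].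
  apply: (cvg_le_bd (N := N) c) => n Nn.
  rewrite !(bx_split _ Nn) ![_ + \sum_(k <- [seq _ <- _ | _]) _]addrC !addrK.
  have := @deriv_lip _ _ _ (e / 3) s0 (h + s0) (dsum [seq k <- bx n | k \notin bx N]).
  rewrite addrK; apply => s; apply: le_trans (ler_norm_sum _ _ _) _.
  apply: hN; first by rewrite filter_uniq ?uniq_bx.
  by move=> k; rewrite mem_filter => /andP[].
set A1 := \sum_(k <- bx N) F k (h + s0) in t2 cqh *.
set A0 := \sum_(k <- bx N) F k s0 in t2 cqh *.
have -> : S1 - h^-1 * (S2 - S3) = (S1 - \sum_(k <- bx N) dF k s0) +
  (\sum_(k <- bx N) dF k s0 - h^-1 * (A1 - A0)) - h^-1 * ((S2 - A1) - (S3 - A0)) by ring.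
apply: le_trans (ler_normB _ _) _; rewrite [leRHS](_ : e = e / 3 + e / 3 + e / 3); last by field.
apply: lerD; first by apply: le_trans (ler_normD _ _) _; exact: lerD.
by rewrite normrM normfV ler_pdivrMl ?normr_gt0// mulrC.
Unshelve. all: by end_near. Qed.

End UniformSums.

(** * The Cauchy-Schwarz inequality for integrals *)

Section CauchySchwarz.
Context {d : measure_display} {T : measurableType d} {R : realType}
  (mu : {measure set T -> \bar R}) (D : set T).
Hypothesis mD : measurable D.

Lemma cs_Rint (f g : T -> R) : sqint mu D f -> sqint mu D g ->
  (\int[mu]_(x in D) (f x * g x)) ^+ 2 <=
  \int[mu]_(x in D) (f x ^+ 2) * \int[mu]_(x in D) (g x ^+ 2).
Proof.
move=> sf sg; apply: quad_discr; first by apply: Rintegral_ge0 => x _; exact: sqr_ge0.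
move=> t.
have i1 := sf.2; have i2 := sqintM mD sf sg; have i3 := sg.2.
rewrite (_ : _ + _ = \int[mu]_(x in D) ((f x - t * g x) ^+ 2)).
  by apply: Rintegral_ge0 => x _; exact: sqr_ge0.
rewrite -(RintZ mD _ i2) -(RintZ mD _ i3) -(RintB mD i1 (integZ mD _ i2)).
rewrite -(RintD mD (integB mD i1 (integZ mD _ i2)) (integZ mD _ i3)).
by apply: eq_Rint => x _; ring.
Qed.

End CauchySchwarz.
Notation c_cs_Rint := (@cs_Rint _ _ _ leb3 cube mC).

(** * Synthesis from coefficients and the Riesz-Fischer theorem *)

Section Synthesis.
Context {R : realType}.
Local Notation R3 := (R * R * R)%type.
Local Notation K := (int * int * int)%type.
Implicit Types (c d : K -> R) (f g phi psi : R3 -> R) (x : R3) (k l : K) (i : 'I_3).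

Definition syn c x : R := ksum (fun k => c k * bas k x).

Lemma kbd_bas c (B : R) x : kbd c B -> kbd (fun k => c k * bas k x) (2 * B).
Proof.
move=> cB; have := kbdZ 2 cB; rewrite ger0_norm//; apply: kbd_le => k.
by rewrite !normrM mulrC (ger0_norm (_ : 0 <= 2 :> R))// ler_wpM2r// bas_bd.
Qed.

Lemma ktail_bas c N (e : R) x : ktail c N e -> ktail (fun k => c k * bas k x) N (2 * e).
Proof.
move=> cN s us sN; apply: le_trans (_ : 2 * \sum_(k <- s) `|c k| <= _); last first.
  by rewrite ler_wpM2l// cN.
rewrite mulr_sumr; apply: ler_sum => k _.
by rewrite normrM mulrC ler_wpM2r// bas_bd.
Qed.

Lemma cvg_syn c (B : R) x : kbd c B -> tpoly (bx n) c x @[n --> \oo] --> syn c x.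
Proof. by move=> cB; exact: cvg_ksum (kbd_bas x cB). Qed.

Lemma syn_bd c (B : R) x : kbd c B -> `|syn c x| <= 2 * B.
Proof. by move=> cB; exact: ksum_le (kbd_bas x cB). Qed.

Lemma syn_continuous c (B : R) : kbd c B -> continuous (syn c).
Proof.
move=> cB; have : {within setT, continuous (fun x => ksum (fun k => c k * bas k x))}.
  apply: (@ksum_within_continuous _ _ _ (fun k x => c k * bas k x)).
  - by move=> x _; exists (2 * B); exact: kbd_bas.
  - move=> e e0; have [|N hN] := kbd_ktail cB (_ : 0 < e / 2); first by rewrite divr_gt0.
    by exists N => x _; have := @ktail_bas _ _ _ x hN; rewrite mulrC divfK.
  - move=> k; apply: continuous_subspaceT => x.
    exact: cvgM (cvg_cst _) (@continuous_bas _ k x).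
by move=> /subspace_continuousP h x; have := h x I; rewrite withinET.
Qed.

Lemma syn_periodic c : torus_periodic (syn c).
Proof. by move=> x i; apply: eq_ksum => k; rewrite bas_periodic. Qed.

Lemma measurable_syn c (B : R) D : kbd c B -> measurable_fun D (syn c).
Proof.
by move=> cB; apply: measurable_funTS; apply: measurable_cont3; exact: syn_continuous cB.
Qed.

Lemma sqint_syn c (B : R) : kbd c B -> csqint (syn c).
Proof.
move=> cB; apply: (c_sqint_bd (M := 2 * B)); first exact: measurable_syn cB.
by move=> x _; exact: syn_bd.
Qed.

Lemma cvg_Rint_mul_syn c (B : R) f : cinteg f -> kbd c B ->
  \int[leb3]_(x in cube) (f x * tpoly (bx n) c x) @[n --> \oo] -->
  \int[leb3]_(x in cube) (f x * syn c x).
Proof.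
move=> If cB; have mf := c_integ_mfun If.
have [||||n|_ //] := @c_Rint_dct (fun n x => f x * tpoly (bx n) c x) (fun x => f x * syn c x)
    (fun x => 2 * B * `|f x|).
- by move=> n; apply: measurable_funM => //; exact: (sqint_tpoly _ _).1.
- by apply: measurable_funM => //; exact: measurable_syn cB.
- by apply: aeW => x _; apply: cvgM; [exact: cvg_cst|exact: cvg_syn cB].
- by apply: c_integZ; exact: c_integ_norm.
- apply: aeW => x _; rewrite normrM mulrC ler_wpM2r//.
  apply: le_trans (ler_norm_sum _ _ _) _; exact: (kbd_bas x cB) (uniq_bx n).
Qed.

Lemma ksum_delta k c : ksum (fun l => c l * (k == l)%:R) = c k.
Proof.
apply: cvg_lim => //; apply: cvg_near_cst.
have [N sN] := bx_exhaust [:: k]; exists N => // n /= Nn.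
have kn : k \in bx n by apply: (bx_sub Nn); apply: sN; rewrite mem_head.
rewrite (bigD1_seq k)//= ?uniq_bx// eqxx mulr1 big1 ?addr0// => l /negbTE lk.
by rewrite eq_sym lk mulr0.
Qed.

Lemma Rint_mul_syn c (B : R) f : csqint f -> kbd c B ->
  \int[leb3]_(x in cube) (f x * syn c x) = vol * ksum (fun k => c k * coef k f).
Proof.
move=> sf cB; have := cvg_Rint_mul_syn (c_sqint_integ sf) cB.
have -> : (fun n => \int[leb3]_(x in cube) (f x * tpoly (bx n) c x)) =
    (fun n => vol * \sum_(k <- bx n) c k * coef k f).
  by apply/funext => n; rewrite Rint_mul_tpoly.
move=> h; have v0 : vol != 0 :> R by rewrite gt_eqF// vol_gt0.
have h2 : vol^-1 * (vol * \sum_(k <- bx n) c k * coef k f) @[n --> \oo] -->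
    vol^-1 * \int[leb3]_(x in cube) (f x * syn c x).
  by apply: cvgM => //; exact: cvg_cst.
have e : (fun n => vol^-1 * (vol * \sum_(k <- bx n) c k * coef k f)) =
    (fun n => \sum_(k <- bx n) c k * coef k f) by apply/funext => n; rewrite mulKf.
by rewrite e in h2; rewrite /ksum (cvg_lim _ h2)// mulVKf.
Qed.

Lemma coef_syn c (B : R) k : kbd c B -> coef k (syn c) = c k.
Proof.
move=> cB; rewrite /coef.
under eq_Rintegral do rewrite mulrC.
rewrite (Rint_mul_syn (sqint_bas k) cB) mulKf ?gt_eqF ?vol_gt0//.
rewrite -[RHS]ksum_delta; apply: eq_ksum => l; by rewrite coef_bas.
Qed.

Lemma Rint_sqr_syn c (B A : R) : kbd c B -> kbd (fun k => c k ^+ 2) A ->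
  \int[leb3]_(x in cube) (syn c x ^+ 2) <= vol * A.
Proof.
move=> cB cA; under eq_Rintegral do rewrite expr2.
rewrite (Rint_mul_syn (sqint_syn cB) cB) ler_wpM2l ?(ltW vol_gt0)//.
rewrite (eq_ksum (g := fun k => c k ^+ 2)); last by move=> k; rewrite (coef_syn _ cB).
by apply: le_trans (ler_norm _) _; exact: ksum_le.
Qed.

Lemma tpoly_continuous (s : seq K) c : continuous (tpoly s c).
Proof.
move=> x; elim: s => [|k s IH].
  rewrite (_ : tpoly [::] c = fun=> 0); first exact: cvg_cst.
  by apply/funext => y; rewrite /tpoly big_nil.
rewrite (_ : tpoly (k :: s) c = fun y => c k * bas k y + tpoly s c y); last first.
  by apply/funext => y; rewrite /tpoly big_cons.
by apply: cvgD => //; exact: cvgM (cvg_cst _) (@continuous_bas _ k x).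
Qed.

(** Partial sums along a fast subsequence converge almost everywhere, and Fatou's lemma turns the
    Cauchy estimates into L2 estimates for the limit. *)
Lemma riesz_fischer d (A : R) : kbd (fun k => d k ^+ 2) A ->
  exists g, [/\ torus_periodic g, measurable_fun setT g, csqint g &
    forall e : R, 0 < e -> exists N, forall n, (N <= n)%N ->
    \int[leb3]_(x in cube) ((g x - tpoly (bx n) d x) ^+ 2) <= e].
Proof.
move=> dA.
have v0 : 0 < vol :> R := vol_gt0.
have diff n n' (e : R) : (n <= n')%N -> ktail (fun k => d k ^+ 2) n e ->
    \int[leb3]_(x in cube) ((tpoly (bx n') d x - tpoly (bx n) d x) ^+ 2) <= vol * e.
  move=> nn te.
  rewrite (c_eq_Rint (g := fun x => tpoly [seq k <- bx n' | k \notin bx n] d x ^+ 2)); last first.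
    by move=> x _; congr (_ ^+ 2); rewrite /tpoly (bx_split _ nn) addrC addKr.
  rewrite Rint_sqr_tpoly ?filter_uniq ?uniq_bx// ler_wpM2l ?(ltW v0)//.
  have := te [seq k <- bx n' | k \notin bx n].
  under eq_bigr do rewrite ger0_norm ?sqr_ge0//; apply.
    by rewrite filter_uniq ?uniq_bx.
  by move=> k; rewrite mem_filter => /andP[].
have /choice[Nf hNf] j : exists N, ktail (fun k => d k ^+ 2) N ((4^-1 : R) ^+ j).
  by apply: kbd_ktail dA _; rewrite exprn_gt0.
(* [M] is nondecreasing, dominates [Nf] and tends to infinity, so consecutive partial sums along it
   differ by at most vol 4^-j in squared norm. *)
pose M j := (\sum_(i < j.+1) Nf i + j)%N.
have MS j : (M j <= M j.+1)%N by rewrite /M (big_ord_recr j.+1) /=; lia.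
have Mj j : (j <= M j)%N by rewrite /M leq_addl.
have MN j : (Nf j <= M j)%N by rewrite /M big_ord_recr /= -addnA addnCA leq_addr.
pose G j := tpoly (bx (M j)) d.
have sG j : csqint (G j) by exact: sqint_tpoly.
have GA j : \int[leb3]_(x in cube) ((G j.+1 x - G j x) ^+ 2) <= vol * 4^-1 ^+ j.
  by apply: diff => //; exact: ktailS (MN j) (hNf j).
have cG := @ae_cvg_of_L2 _ _ _ leb3 cube mC fC G vol sG GA.
(* A limit superior taken at every point is measurable and exactly periodic, also on the null set
   where convergence fails. *)
pose g x : R := fine (limn_esup (fun j => (G j x)%:E)).
have mG j : measurable_fun setT (G j).
  by apply: measurable_cont3; exact: tpoly_continuous.
have mg : measurable_fun setT g.
  apply: (measurableT_comp (f := fine)); first exact: fine_measurable.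
  by apply: measurable_fun_limn_esup => j; apply/measurable_EFinP; exact: mG.
have cg : {ae (@leb3 R), forall x, cube x -> G j x @[j --> \oo] --> g x}.
  apply: filterS cG => x hx cx; have {}hx := hx cx.
  have cE : (G j x)%:E @[j --> \oo] --> (limn (fun j => G j x))%:E.
    by apply: cvg_EFin; [exact: nearW|exact: hx].
  have -> : g x = limn (fun j => G j x).
    rewrite /g is_cvg_limn_esupE; last by apply/cvg_ex; exists (limn (fun j => G j x))%:E.
    by rewrite (cvg_lim _ cE).
  exact: hx.
have main n (e : R) : ktail (fun k => d k ^+ 2) n e ->
   cinteg (fun x => (g x - tpoly (bx n) d x) ^+ 2) /\
   \int[leb3]_(x in cube) ((g x - tpoly (bx n) d x) ^+ 2) <= vol * e.
  move=> te.
  apply: (@c_fatou_bd (fun j x => (G (j + n)%N x - tpoly (bx n) d x) ^+ 2)).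
  - by move=> j; apply: (c_sqintB (sG _) (sqint_tpoly _ _)).2.
  - by move=> j x _; exact: sqr_ge0.
  - apply: measurable_funX; apply: measurable_funB; first exact: measurable_funTS.
    exact: (sqint_tpoly _ _).1.
  - apply: filterS cg => x hx cx; have {}hx := hx cx.
    have : G (j + n)%N x @[j --> \oo] --> g x by rewrite (cvg_shiftn n (fun j => G j x)).
    move=> h; have h2 : G (j + n)%N x - tpoly (bx n) d x @[j --> \oo] --> g x - tpoly (bx n) d x.
      by apply: cvgB => //; exact: cvg_cst.
    by rewrite expr2; under eq_fun do rewrite expr2; exact: (cvgM h2 h2).
  - move=> j; apply: diff => //; exact: leq_trans (leq_addl j n) (Mj _).
  - by apply: aeW => x _; exact: sqr_ge0.
exists g; split => //.
- move=> x i; rewrite /g; congr (fine (limn_esup _)); apply/funext => j; congr EFin.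
  by apply: eq_bigr => k _; rewrite bas_periodic.
- have [N te] := kbd_ktail dA (ltr01 : 0 < (1 : R)).
  have [iN _] := main N 1 te.
  have sB : csqint (fun x => g x - tpoly (bx N) d x).
    split => //; apply: measurable_funB; first exact: measurable_funTS.
    exact: (sqint_tpoly _ _).1.
  have := c_sqintD sB (sqint_tpoly (bx N) d).
  by under eq_fun do rewrite subrK.
- move=> e e0; have [|N te] := kbd_ktail dA (_ : 0 < e / vol); first by rewrite divr_gt0.
  exists N => n Nn; have [_] := main n _ (ktailS Nn te).
  by rewrite mulrC divfK// gt_eqF.
Qed.

End Synthesis.

(** * Parseval, weak derivatives and Sobolev norms on coefficients *)

Section WeakDerivatives.
Context {R : realType}.
Local Notation R3 := (R * R * R)%type.
Local Notation K := (int * int * int)%type.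
Implicit Types (c d : K -> R) (f g phi psi : R3 -> R) (x : R3) (k l : K) (i : 'I_3).

Lemma kbd_coef_sqr f : csqint f ->
  kbd (fun k => coef k f ^+ 2) (vol^-1 * \int[leb3]_(x in cube) (f x ^+ 2)).
Proof.
move=> sf s us; under eq_bigr do rewrite ger0_norm ?sqr_ge0//.
by rewrite ler_pdivlMl ?vol_gt0//; exact: bessel.
Qed.

(** Cauchy-Schwarz turns the L2 convergence of the partial sums into convergence of the pairings
    with any square integrable f; the choice f = [bas k] identifies the coefficients. *)
Lemma riesz_fischer_cvg d (A : R) : kbd (fun k => d k ^+ 2) A ->
  exists g, [/\ L2 g, forall k, coef k g = d k & forall f, csqint f ->
    vol * \sum_(k <- bx n) d k * coef k f @[n --> \oo] -->
    \int[leb3]_(x in cube) (f x * g x)].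
Proof.
move=> dA; have [g [pg mg sg hg]] := riesz_fischer dA.
have cv f : csqint f -> vol * \sum_(k <- bx n) d k * coef k f @[n --> \oo] -->
    \int[leb3]_(x in cube) (f x * g x).
  move=> sf; apply/cvgrPdist_le => e e0.
  set A2 := \int[leb3]_(x in cube) (f x ^+ 2).
  have A20 : 0 <= A2 by apply: Rintegral_ge0 => x _; exact: sqr_ge0.
  have [|N hN] := hg (e ^+ 2 / (A2 + 1)); first by rewrite divr_gt0 ?exprn_gt0//; lra.
  exists N => // n /= /hN h.
  have st := sqint_tpoly (bx n) d; have sB := c_sqintB sg st.
  rewrite -Rint_mul_tpoly// -(c_RintB (c_sqintM sf sg) (c_sqintM sf st)).
  rewrite (c_eq_Rint (g := fun x => f x * (g x - tpoly (bx n) d x))); last first.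
    by move=> x _; rewrite mulrBr.
  have := c_cs_Rint sf sB => cs.
  rewrite -(@ler_pXn2r _ 2)// ?nnegrE ?(ltW e0)// real_normK ?num_real//.
  apply: le_trans cs _; apply: (@le_trans _ _ (A2 * (e ^+ 2 / (A2 + 1)))).
    by rewrite ler_wpM2l.
  rewrite mulrCA ger_pMr ?exprn_gt0// ler_pdivrMr ?mul1r; lra.
exists g; split => //; first by split => //; case: sg.
move=> k; have := cv _ (sqint_bas k).
have e : (fun n => vol * \sum_(l <- bx n) d l * coef l (bas k)) @ \oo --> vol * d k.
  apply: cvgM; first exact: cvg_cst.
  rewrite -[d k]ksum_delta; apply: cvg_near_cst.
  have [N sN] := bx_exhaust [:: k]; exists N => // n /= Nn.
  have kn : k \in bx n by apply: (bx_sub Nn); apply: sN; rewrite mem_head.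
  rewrite ksum_delta (bigD1_seq k)//= ?uniq_bx// coef_bas eqxx mulr1 big1 ?addr0// => l lk.
  by rewrite coef_bas eq_sym (negbTE lk) mulr0.
move=> /(cvg_unique _ e) => /(_ (@norm_hausdorff _ _)) h.
rewrite /coef; under eq_Rintegral do rewrite mulrC.
by rewrite -h mulKf// gt_eqF// vol_gt0.
Qed.

Lemma L2_sqint f : L2 f -> csqint f.
Proof. by move=> [_ mf i2]; split => //; exact: measurable_funTS. Qed.

(** By completeness f agrees almost everywhere with the Riesz-Fischer function of its own
    coefficients, whose pairings are already known as limits. *)
Lemma parseval f g : csqint f -> csqint g ->
  vol * \sum_(k <- bx n) coef k f * coef k g @[n --> \oo] -->
  \int[leb3]_(x in cube) (f x * g x).
Proof.
move=> sf sg; have [h [Lh hk hc]] := riesz_fischer_cvg (kbd_coef_sqr sf).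
have sh := L2_sqint Lh.
have fh := coef_eq_ae (c_sqint_integ sf) (c_sqint_integ sh) (fun k => esym (hk k)).
rewrite (_ : \int[leb3]_(x in cube) _ = \int[leb3]_(x in cube) (g x * h x)); first exact: hc.
apply: c_Rint_ae.
- exact: c_integ_mfun (c_sqintM sf sg).
- exact: c_integ_mfun (c_sqintM sg sh).
- by apply: filterS fh => x e /e ->; rewrite mulrC.
Qed.

Lemma partial_periodic i f : torus_periodic f -> torus_periodic (partial i f).
Proof.
move=> pf x j; rewrite /partial /derive; set y := x + _.
have -> : (fun h : R => h^-1 *: ((f \o shift y) (h *: unit_vec i) - f y)) =
    (fun h : R => h^-1 *: ((f \o shift x) (h *: unit_vec i) - f x)) => //.
by apply/funext => h /=; rewrite /y addrA !pf.
Qed.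

Lemma Rint_by_parts i phi psi : torus_periodic phi -> torus_periodic psi ->
  (forall x, derivable phi x (unit_vec i)) -> (forall x, derivable psi x (unit_vec i)) ->
  continuous phi -> continuous psi -> continuous (partial i phi) -> continuous (partial i psi) ->
  \int[leb3]_(x in cube) (partial i phi x * psi x) =
  - \int[leb3]_(x in cube) (phi x * partial i psi x).
Proof.
move=> pp pq dp dq cp cq cdp cdq.
have bd f : continuous f -> csqint f.
  move=> cf; have [M hM] := cont3_bounded cf.
  by apply: (c_sqint_bd (M := M)) => //; apply: measurable_funTS; exact: measurable_cont3.
have dpq x : is_derive x (unit_vec i) (phi * psi) (phi x *: partial i psi x + psi x *: partial i phi x).
  by apply: is_deriveM; exact: derivableP.
have epq : partial i (phi * psi) = (fun x => partial i phi x * psi x + phi x * partial i psi x).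
  apply/funext => x; rewrite /partial (@derive_val _ _ _ _ _ _ _ (dpq x)) addrC.
  by rewrite -![_ *: _]/(_ * _) (mulrC (psi x)).
have := @Rint_partial_eq0 _ (phi * psi) i.
rewrite epq c_RintD; last 2 first.
- exact: c_sqintM (bd _ cdp) (bd _ cq).
- exact: c_sqintM (bd _ cp) (bd _ cdq).
move=> h; apply/eqP; rewrite -addr_eq0; apply/eqP; apply: h.
- by move=> x; apply: ex_derive; exact: (dpq x).
- move=> x; exact: cvgD (cvgM (cdp x) (cq x)) (cvgM (cp x) (cdq x)).
- by move=> x j; rewrite -[LHS]/(phi _ * psi _) pp pq.
Qed.

Lemma coef_partial i k phi : torus_periodic phi -> (forall x, derivable phi x (unit_vec i)) ->
  continuous phi -> continuous (partial i phi) ->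
  coef k (partial i phi) = - kr k i * coef (- k) phi.
Proof.
move=> pp dp cp cdp.
have db x : derivable (bas k : R3 -> R) x (unit_vec i) by apply: ex_derive; exact: is_derive_bas.
have cdb : continuous (partial i (bas k : R3 -> R)).
  rewrite partial_bas => x; exact: cvgM (cvg_cst _) (@continuous_bas _ (- k) x).
have := Rint_by_parts pp (@bas_periodic _ k) dp db cp (@continuous_bas _ k) cdp cdb.
rewrite partial_bas /coef => ->.
rewrite (c_eq_Rint (g := fun x => kr k i * (phi x * bas (- k) x))); last first.
  by move=> x _; rewrite mulrCA.
rewrite c_RintZ; first by rewrite mulrN mulrCA mulNr.
have [M hM] := cont3_bounded cp.
apply: integ_mul_bas; apply: (c_integ_bd (M := M)) => //.
by apply: measurable_funTS; exact: measurable_cont3.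
Qed.

(** A partial derivative has as k-th coefficient -k_i times the coefficient at -k. After n
    derivatives there remain the reflection [sg n] and the sign [sgn n], which has period four: +,
    -, -, +. *)
Definition sg (n : nat) k : K := if odd n then - k else k.
Definition sgn (n : nat) : R := (-1) ^+ uphalf n.
Definition kpow (al : 'I_3 -> nat) k : R := \prod_(i < 3) kr k i ^+ al i.

Lemma sgK n : involutive (sg n).
Proof. by move=> k; rewrite /sg; case: odd; rewrite ?opprK. Qed.

Lemma sgS n k : sg n.+1 k = sg n (- k).
Proof. by rewrite /sg /=; case: odd; rewrite ?opprK. Qed.

Lemma sgnS n : sgn n.+1 = - (sgn n * (-1) ^+ n).
Proof.
rewrite /sgn (_ : uphalf n.+1 = n./2.+1)// uphalf_half exprD exprS -(signr_odd _ n).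
by case: (odd n); rewrite ?expr0 ?expr1; ring.
Qed.

Lemma sgn_sqr n : sgn n ^+ 2 = 1.
Proof. by rewrite /sgn -exprM mulnC exprM sqrrN expr1n expr1n. Qed.

Lemma smooth_partial i f : smooth f -> smooth (partial i f).
Proof. by move=> sf s; have := sf (rcons s i); rewrite foldr_rcons. Qed.

Lemma smooth_continuous f : smooth f -> continuous f.
Proof. by move=> /(_ [::]) []. Qed.

Lemma smooth_derivable i f x : smooth f -> derivable f x (unit_vec i).
Proof. by move=> /(_ [::]) [_]; apply. Qed.

Lemma kpowE al k : kpow al k = kr k 0 ^+ al 0 * (kr k 1 ^+ al 1 * kr k 2 ^+ al 2).
Proof.
rewrite /kpow !big_ord_recl big_ord0 mulr1.
by congr (_ ^+ _ * (_ ^+ _ * _ ^+ _)); (congr (kr _ _) || congr (al _)); exact: val_inj.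
Qed.

(** [N] counts the derivatives taken so far and [p] is their accumulated monomial. The parity of [p]
    is part of the invariant because each further derivative evaluates it at -k. *)
Lemma iter_partial_coef i n N (p : K -> R) phi psi : smooth psi -> torus_periodic psi ->
  (forall k, coef k psi = sgn N * p k * coef (sg N k) phi) ->
  (forall k, p (- k) = (-1) ^+ N * p k) ->
  [/\ smooth (iter n (partial i) psi), torus_periodic (iter n (partial i) psi),
    forall k, coef k (iter n (partial i) psi) =
      sgn (n + N) * (kr k i ^+ n * p k) * coef (sg (n + N) k) phi &
    forall k, kr (- k) i ^+ n * p (- k) = (-1) ^+ (n + N) * (kr k i ^+ n * p k)].
Proof.
move=> s0 p0 h0 e0; elim: n => [|n [s1 p1 h1 e1]].
  by rewrite add0n; split => // k; rewrite !expr0 !mul1r.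
rewrite iterS addSn; split.
- exact: smooth_partial.
- exact: partial_periodic.
- move=> k; rewrite coef_partial//; last 3 first.
  + by move=> x; exact: smooth_derivable.
  + exact: smooth_continuous.
  + by apply: smooth_continuous; exact: smooth_partial.
  by rewrite h1 e1 sgS sgnS exprS; ring.
- by move=> k; rewrite !exprS -!mulrA e1 krN; ring.
Qed.

Lemma mpartial_coef al phi : smooth phi -> torus_periodic phi ->
  [/\ smooth (mpartial al phi), torus_periodic (mpartial al phi) &
    forall k, coef k (mpartial al phi) =
      sgn (mlen al) * kpow al k * coef (sg (mlen al) k) phi].
Proof.
move=> sp pp.
have [] := @iter_partial_coef 2 (al 2) 0 (fun=> 1) phi phi sp pp.
  by move=> k; rewrite /sgn /sg /= expr0 !mul1r.
  by move=> k; rewrite expr0 mulr1.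
move=> s2 p2 h2 e2.
have [s1 p1 h1 e1] := iter_partial_coef 1 (al 1) s2 p2 h2 e2.
have [s0 p0 h0 e0] := iter_partial_coef 0 (al 0) s1 p1 h1 e1.
rewrite /mpartial; split; [exact: s0|exact: p0|move=> k].
have <- : (al 0%R + (al 1%R + (al 2%R + 0)))%N = mlen al.
  by rewrite /mlen sum_ord3 addn0 addnA.
rewrite h0.
by rewrite mulr1 kpowE.
Qed.

Lemma kpowN al k : kpow al (- k) = (-1) ^+ mlen al * kpow al k.
Proof.
have h i : kr (- k) i ^+ al i = (-1) ^+ al i * kr k i ^+ al i :> R.
  by rewrite krN [LHS]exprNn.
rewrite !kpowE !h /mlen sum_ord3 !exprD; ring.
Qed.

Lemma kpow_sg al k : kpow al (sg (mlen al) k) = (-1) ^+ mlen al * kpow al k.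
Proof.
rewrite /sg; case: ifPn => h; first exact: kpowN.
by rewrite -signr_odd (negbTE h) expr0 mul1r.
Qed.

Lemma sum_bx_sg n N (F : K -> R) : \sum_(k <- bx n) F (sg N k) = \sum_(k <- bx n) F k.
Proof. by rewrite /sg; case: odd => //; exact: sum_bxN. Qed.

Lemma smooth_sqint phi : smooth phi -> csqint phi.
Proof.
move=> /smooth_continuous cp; have [M hM] := cont3_bounded cp.
by apply: (c_sqint_bd (M := M)) => //; apply: measurable_funTS; exact: measurable_cont3.
Qed.

Lemma smooth_bas k : smooth (bas k : R3 -> R).
Proof.
have h s : exists (c : R) l, foldr partial (bas k) s = (fun x : R3 => c * bas l x).
  elim: s => [|i s [c [l IH]]].
    by exists 1, k; apply/funext => x; rewrite mul1r.
  exists (c * kr l i), (- l); rewrite /= IH; apply/funext => x.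
  by apply: derive_val; exact: is_derive_Zbas.
move=> s; have [c [l ->]] := h s; split.
  by move=> x; exact: cvgM (cvg_cst _) (@continuous_bas _ l x).
by move=> i x; apply: ex_derive; exact: is_derive_Zbas.
Qed.

(** The test function is [bas k]: its derivative has a single nonzero coefficient, so Parseval's sum
    reduces to one term. *)
Lemma weak_deriv_coef al f g k : csqint f -> is_weak_deriv al f g ->
  coef k g = sgn (mlen al) * kpow al k * coef (sg (mlen al) k) f.
Proof.
move=> sf [Lg hg]; set N := mlen al.
have [sm pm hm] := mpartial_coef al (smooth_bas k) (@bas_periodic _ k).
have := hg _ (smooth_bas k) (@bas_periodic _ k).
have := parseval sf (smooth_sqint sm).
have e : (fun n => vol * \sum_(l <- bx n) coef l f * coef l (mpartial al (bas k))) @ \oo -->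
    vol * (coef (sg N k) f * (sgn N * kpow al (sg N k))).
  apply: cvgM; first exact: cvg_cst.
  apply: cvg_near_cst.
  have [M sM] := bx_exhaust [:: sg N k]; exists M => // n /= Mn.
  have kn : sg N k \in bx n by apply: (bx_sub Mn); apply: sM; rewrite mem_head.
  rewrite (bigD1_seq (sg N k))//= ?uniq_bx// hm -/N sgK coef_bas eqxx mulr1.
  rewrite big1 ?addr0// => l lk; rewrite hm -/N coef_bas.
  case: eqP => [el|_]; last by rewrite !mulr0.
  by move: lk; rewrite el sgK eqxx.
move=> /(cvg_unique _ e) => /(_ (@norm_hausdorff _ _)) <-.
rewrite /coef -/N => h.
have -> : \int[leb3]_(x in cube) (g x * bas k x) = (-1) ^+ N *
    (vol * (coef (sg N k) f * (sgn N * kpow al (sg N k)))).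
  by rewrite h mulrA -exprD addnn -mul2n exprM sqrrN expr1n expr1n mul1r.
rewrite mulrCA mulKf ?gt_eqF ?vol_gt0// kpow_sg -/N /coef.
rewrite [LHS](_ : _ = ((-1) ^+ N * (-1) ^+ N) * (sgn N * kpow al k * coef (sg N k) f)).
  by rewrite -exprD addnn -mul2n exprM sqrrN expr1n expr1n mul1r.
by rewrite /coef; ring.
Qed.

(** Parseval's identity on both sides of the defining identity, matched by reflecting k in the
    symmetric boxes. Weak derivatives are thus characterised by coefficients. *)
Lemma coef_weak_deriv al f g : csqint f -> L2 g ->
  (forall k, coef k g = sgn (mlen al) * kpow al k * coef (sg (mlen al) k) f) ->
  is_weak_deriv al f g.
Proof.
move=> sf Lg hg; split => // phi sp pp; set N := mlen al in hg *.
have [sm pm hm] := mpartial_coef al sp pp.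
have c1 := parseval sf (smooth_sqint sm).
have c2 := parseval (L2_sqint Lg) (smooth_sqint sp).
have c3 : (-1) ^+ N * (vol * \sum_(k <- bx n) coef k g * coef k phi) @[n --> \oo] -->
   (-1) ^+ N * \int[leb3]_(x in cube) (g x * phi x) by apply: cvgM => //; exact: cvg_cst.
apply: (cvg_unique _ c1) => //.
rewrite (_ : (fun n => _) = (fun n => (-1) ^+ N * (vol * \sum_(k <- bx n) coef k g * coef k phi)))//.
apply/funext => n; rewrite mulrCA; congr (_ * _).
rewrite -(sum_bx_sg n N) mulr_sumr; apply: eq_bigr => k _.
rewrite hm hg -/N !sgK kpow_sg -/N.
by ring.
Qed.

Lemma kbd_sg N (F : K -> R) (A : R) : kbd (fun k => F (sg N k)) A -> kbd F A.
Proof.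
move=> FA s us; have := FA [seq sg N k | k <- s].
rewrite (map_inj_uniq (inv_inj (sgK N))) us big_map => /(_ isT).
by under eq_bigr do rewrite sgK.
Qed.

Lemma sqr_weak al f k : (sgn (mlen al) * kpow al k * coef (sg (mlen al) k) f) ^+ 2 =
  (kpow al (sg (mlen al) k) * coef (sg (mlen al) k) f) ^+ 2.
Proof.
have h : ((-1) ^+ mlen al) ^+ 2 = 1 :> R by rewrite -exprM mulnC exprM sqrrN expr1n expr1n.
by rewrite kpow_sg !exprMn sgn_sqr h !mul1r.
Qed.

Lemma sobolev_kbd m f al : sobolev m f -> (mlen al <= m)%N ->
  exists A, kbd (fun k => (kpow al k * coef k f) ^+ 2) A.
Proof.
move=> [Lf wf] /wf[g wg].
exists (vol^-1 * \int[leb3]_(x in cube) (g x ^+ 2)).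
apply: (@kbd_sg (mlen al)) => s us.
have := kbd_coef_sqr (L2_sqint wg.1) us.
by under eq_bigr do rewrite (weak_deriv_coef _ (L2_sqint Lf) wg) sqr_weak.
Qed.

(** Riesz-Fischer constructs each weak derivative from its prescribed coefficients. *)
Lemma sobolev_of_kbd m f : L2 f ->
  (forall al, (mlen al <= m)%N -> exists A, kbd (fun k => (kpow al k * coef k f) ^+ 2) A) ->
  sobolev m f.
Proof.
move=> Lf h; split => // al /h[A hA].
have [|g [Lg hg _]] := @riesz_fischer_cvg
  (fun k => sgn (mlen al) * kpow al k * coef (sg (mlen al) k) f) A.
  apply: (@kbd_sg (mlen al)) => s us; have := hA _ us.
  rewrite (eq_bigr (fun k => `|(sgn (mlen al) * kpow al (sg (mlen al) k) *
    coef (sg (mlen al) (sg (mlen al) k)) f) ^+ 2|))// => k _.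
  by rewrite sqr_weak !sgK.
by exists g; apply: coef_weak_deriv => //; exact: L2_sqint.
Qed.

Lemma wderivP m f al : sobolev m f -> (mlen al <= m)%N -> is_weak_deriv al f (wderiv al f).
Proof. by move=> [_ wf] /wf; exact: xgetPex. Qed.

Lemma wderiv_coef m f al k : sobolev m f -> (mlen al <= m)%N ->
  coef k (wderiv al f) = sgn (mlen al) * kpow al k * coef (sg (mlen al) k) f.
Proof.
by move=> sf am; apply: weak_deriv_coef (wderivP sf am); apply: L2_sqint; case: sf.
Qed.

(** The exact Fourier symbol of the squared H^m norm. It is comparable with [jap k ^+ m] but kept
    separate, because the bound of the theorem leaves no room for comparison constants. *)
Definition Wm m k : R := \sum_(al : {ffun 'I_3 -> 'I_m.+1} | (mlen (fun i => al i) <= m)%N)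
  kpow (fun i => al i) k ^+ 2.

Lemma Wm_ge0 m k : 0 <= Wm m k.
Proof. by apply: sumr_ge0 => al _; exact: sqr_ge0. Qed.

Lemma Hnorm_sqr m f : Hnorm m f ^+ 2 =
  \sum_(al : {ffun 'I_3 -> 'I_m.+1} | (mlen (fun i => al i) <= m)%N)
     \int[leb3]_(x in cube) (wderiv (fun i => al i) f x) ^+ 2.
Proof.
rewrite sqr_sqrtr// sumr_ge0// => al _; apply: Rintegral_ge0 => x _; exact: sqr_ge0.
Qed.

Lemma cvg_sum_seq (I : Type) (s : seq I) (P : pred I) (u : I -> nat -> R) (l : I -> R) :
  (forall a, P a -> u a n @[n --> \oo] --> l a) ->
  \sum_(a <- s | P a) u a n @[n --> \oo] --> \sum_(a <- s | P a) l a.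
Proof.
move=> h; elim: s => [|a s IH].
  by rewrite big_nil; under eq_fun do rewrite big_nil; exact: cvg_cst.
rewrite big_cons; under eq_fun do rewrite big_cons.
by case: ifPn => // Pa; apply: cvgD => //; exact: h.
Qed.

(** Parseval's identity for each weak derivative; signs disappear in the squares and reflections in
    the symmetry of the boxes. *)
Lemma Hnorm_cvg m f : sobolev m f ->
  vol * \sum_(k <- bx n) Wm m k * coef k f ^+ 2 @[n --> \oo] --> Hnorm m f ^+ 2.
Proof.
move=> sf; rewrite Hnorm_sqr.
have -> : (fun n => vol * \sum_(k <- bx n) Wm m k * coef k f ^+ 2) =
  (fun n => \sum_(al : {ffun 'I_3 -> 'I_m.+1} | (mlen (fun i => al i) <= m)%N)
    vol * \sum_(k <- bx n) coef k (wderiv (fun i => al i) f) ^+ 2).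
  apply/funext => n; rewrite -mulr_sumr exchange_big /=; congr (_ * _).
  under eq_bigr do rewrite mulr_suml.
  rewrite exchange_big [RHS]exchange_big; apply: eq_bigr => al am.
  under [RHS]eq_bigr do rewrite (wderiv_coef _ sf am) sqr_weak.
  rewrite (sum_bx_sg n _ (fun k => (kpow (fun i => al i) k * coef k f) ^+ 2)).
  by apply: eq_bigr => k _; rewrite [RHS]exprMn.
apply: cvg_sum_seq => al am.
have sw := L2_sqint (wderivP sf am).1.
have := parseval sw sw.
under eq_fun do under eq_bigr do rewrite -expr2.
by under eq_Rintegral do rewrite -expr2.
Qed.

Lemma Hnorm_ge m f (s : seq K) : sobolev m f -> uniq s ->
  vol * \sum_(k <- s) Wm m k * coef k f ^+ 2 <= Hnorm m f ^+ 2.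
Proof.
move=> sf us; have [N sN] := bx_exhaust s.
apply: (cvg_ge_bd (N := N) (Hnorm_cvg sf)) => n Nn.
rewrite ler_pM2l ?vol_gt0//; apply: sum_sub_le => //.
  by move=> k; rewrite mulr_ge0 ?Wm_ge0 ?sqr_ge0.
by move=> k /sN; exact: bx_sub.
Qed.

Lemma Hnorm_ge0 m f : 0 <= Hnorm m f.
Proof. exact: sqrtr_ge0. Qed.

Lemma Hnorm_le m f (A : R) : sobolev m f -> 0 <= A ->
  (forall s : seq K, uniq s -> vol * \sum_(k <- s) Wm m k * coef k f ^+ 2 <= A ^+ 2) ->
  Hnorm m f <= A.
Proof.
move=> sf A0 h; rewrite -(@ler_pXn2r _ 2)// ?nnegrE ?Hnorm_ge0//.
by apply: (cvg_le_bd (N := 0) (Hnorm_cvg sf)) => n _; apply: h; exact: uniq_bx.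
Qed.

End WeakDerivatives.

(** * The energy on coefficients *)

Section Weights.
Context {R : realType}.
Local Notation R3 := (R * R * R)%type.
Local Notation K := (int * int * int)%type.
Implicit Types (c d : K -> R) (f g : R3 -> R) (x : R3) (k l : K) (i : 'I_3) (m : nat).

Lemma kpow_munit i k : kpow (munit i) k = kr k i :> R.
Proof.
by elim/ord3P: i; rewrite kpowE /munit /= !expr0 expr1 ?mulr1 ?mul1r.
Qed.

(** The energy differentiates a chosen representative of a weak derivative; comparison of
    coefficients shows that weak derivatives compose. *)
Lemma weak_deriv_partial al i f g h : csqint f -> is_weak_deriv al f g ->
  is_weak_deriv (fun j => al j + munit i j)%N f h -> is_weak_deriv (munit i) g h.
Proof.
move=> sf wg wh; apply: coef_weak_deriv; [exact: L2_sqint wg.1|exact: wh.1|move=> k].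
have lm : mlen (munit i) = 1%N by elim/ord3P: i {wh}; rewrite /mlen sum_ord3 /munit.
have la : mlen (fun j => al j + munit i j)%N = (mlen al).+1.
  by rewrite /mlen big_split /= -/(mlen al) -/(mlen (munit i)) lm addn1.
have lk : kpow (fun j => al j + munit i j)%N k = kpow al k * kr k i :> R.
  by rewrite -kpow_munit !kpowE !exprD; ring.
rewrite (weak_deriv_coef k sf wh) la lk lm kpow_munit.
rewrite (weak_deriv_coef _ sf wg) [sg 1 k]/(- k) kpowN sgS sgnS.
rewrite (_ : sgn 1 = -1 :> R); last by rewrite /sgn /= expr1.
ring.
Qed.

Lemma bessel_sg N (s : seq K) f : uniq s -> csqint f ->
  vol * \sum_(k <- s) coef (sg N k) f ^+ 2 <= \int[leb3]_(x in cube) (f x ^+ 2).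
Proof.
move=> us sf; have := bessel (s := [seq sg N k | k <- s]) _ sf.
by rewrite (map_inj_uniq (inv_inj (sgK N))) us big_map => /(_ isT).
Qed.

(** The energy density z^2 + Omega y z + Omega^2 y^2 / 2 + |k|^2 y^2 of one mode, with the square
    completed. *)
Definition energy_mode (Omega : R) k (y z : R) : R :=
  (z + Omega / 2 * y) ^+ 2 + (Omega ^+ 2 / 4 + lam k) * y ^+ 2.

(** After completing the square the integrand is a sum of squares, so Bessel's inequality for each
    of them gives the lower bound. *)
Lemma energy_ge m (Omega : R) f g (s : seq K) : sobolev m.+1 f -> sobolev m g -> uniq s ->
  vol * \sum_(k <- s) Wm m k * (2^-1 * energy_mode Omega k (coef k f) (coef k g)) <=
  energy m Omega f g ^+ 2.
Proof.
move=> sf sg' us.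
have sfm : sobolev m f by split; [case: sf|move=> al am; apply: sf.2; exact: leqW].
pose J (al : {ffun 'I_3 -> 'I_m.+1}) : R := \int[leb3]_(x in cube)
       (let Df := wderiv (fun i => al i) f in
        let Dg := wderiv (fun i => al i) g in
        Dg x ^+ 2 + Omega * (Df x * Dg x) + 2^-1 * Omega ^+ 2 * Df x ^+ 2
        + \sum_(i < 3) (wderiv (munit i) Df x) ^+ 2).
have key (al : {ffun 'I_3 -> 'I_m.+1}) : (mlen (fun i => al i) <= m)%N ->
    vol * \sum_(k <- s) kpow (fun i => al i) k ^+ 2 *
      energy_mode Omega k (coef k f) (coef k g) <= J al.
  move=> am; set a := fun i : 'I_3 => al i : nat; set N := mlen a.
  have wf := wderivP sfm am; have wg := wderivP sg' am.
  have sqf := L2_sqint wf.1; have sqg := L2_sqint wg.1.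
  (* [wderiv] defaults to zero in the absence of a weak derivative; the regularity m + 1 of f
     excludes this for the gradient of a derivative of order at most m. *)
  have wi i : is_weak_deriv (munit i) (wderiv a f) (wderiv (munit i) (wderiv a f)).
    have lm : mlen (munit i) = 1%N by elim/ord3P: i; rewrite /mlen sum_ord3 /munit.
    have la : (mlen (fun j => a j + munit i j)%N <= m.+1)%N.
      by rewrite /mlen big_split /= -/(mlen _) -/(mlen _) lm addn1 ltnS.
    have [h wh] := sf.2 _ la.
    apply: (@xgetPex _ (cst 0) [set g | is_weak_deriv (munit i) (wderiv a f) g]).
    by exists h; apply: weak_deriv_partial wf wh; exact: L2_sqint (sf.1).
  have sqi i := L2_sqint (wi i).1.
  have sqm := c_sqintD sqg (c_sqintZ (Omega / 2) sqf).
  have e : J al = \int[leb3]_(x in cube) ((wderiv a g x + Omega / 2 * wderiv a f x) ^+ 2) +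
     (Omega ^+ 2 / 4 * \int[leb3]_(x in cube) (wderiv a f x ^+ 2) +
      \sum_(i < 3) \int[leb3]_(x in cube) (wderiv (munit i) (wderiv a f) x ^+ 2)).
    rewrite -(c_RintZ _ sqf.2) -(c_Rint_sum _ (fun i => (sqi i).2)).
    rewrite -(c_RintD (c_integZ _ sqf.2) (c_integ_sum _ (fun i => (sqi i).2))).
    rewrite -(c_RintD sqm.2 (c_integD (c_integZ _ sqf.2) (c_integ_sum _ (fun i => (sqi i).2)))).
    by apply: c_eq_Rint => x _; rewrite -/a /=; set S := \sum_(i < 3) _; field.
  rewrite e.
  have b1 := bessel_sg N us sqm.
  have b2 := bessel_sg N us sqf.
  (* One more reflection than in the other terms, since the gradient adds one derivative. *)
  have b3 i := bessel_sg N.+1 us (sqi i).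
  apply: le_trans (lerD b1 (lerD (ler_wpM2l (_ : 0 <= Omega ^+ 2 / 4) b2) (ler_sum _ (fun i _ => b3 i)))).
    rewrite -mulr_sumr mulrCA -!mulrDr ler_wpM2l ?(ltW vol_gt0)//.
    rewrite exchange_big /= mulr_sumr -!big_split /= le_eqVlt; apply/orP; left; apply/eqP.
    apply: eq_bigr => k _.
    have cf : coef (sg N k) (wderiv a f) = sgn N * kpow a (sg N k) * coef k f.
      by rewrite (wderiv_coef _ sfm am) -/a -/N sgK.
    have cg : coef (sg N k) (wderiv a g) = sgn N * kpow a (sg N k) * coef k g.
      by rewrite (wderiv_coef _ sg' am) -/a -/N sgK.
    rewrite coefD; [|exact: c_sqint_integ sqg|exact: c_sqint_integ (c_sqintZ _ sqf)].
    rewrite coefZ; last exact: c_sqint_integ sqf.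
    rewrite cf cg (eq_bigr (fun i => kr k i ^+ 2 * (coef (sg N k) (wderiv a f)) ^+ 2)); last first.
      move=> i _; have sq1 : (-1 : R) ^+ 2 = 1 by rewrite sqrrN expr1n.
      have -> : coef (sg N.+1 k) (wderiv (munit i) (wderiv a f)) =
          sgn 1 * kr (sg N.+1 k) i * coef (sg N k) (wderiv a f).
        rewrite (weak_deriv_coef _ sqf (wi i)) kpow_munit.
        have -> : mlen (munit i) = 1%N by elim/ord3P: i; rewrite /mlen sum_ord3 /munit.
        have -> : sg 1 (sg N.+1 k) = sg N k by rewrite /sg /=; case: (odd N); rewrite /= ?opprK.
        by [].
      have -> : kr (sg N.+1 k) i = (-1) ^+ N.+1 * kr k i :> R.
        by rewrite -signr_odd /sg; case: (odd N.+1); rewrite ?krN ?mul1r// expr1 mulN1r.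
      by rewrite !exprMn sgn_sqr mul1r -exprM mulnC exprM sq1 expr1n mul1r.
    rewrite -mulr_suml -/(lam k) cf.
    have sN : sgn N ^+ 2 = 1 :> R := sgn_sqr N.
    have kN : kpow a (sg N k) ^+ 2 = kpow a k ^+ 2 :> R.
      by rewrite kpow_sg exprMn -exprM mulnC exprM sqrrN !expr1n mul1r.
    rewrite /energy_mode -kN.
    set p := kpow a (sg N k); set y := coef k f; set z := coef k g.
    rewrite (_ : sgn N * p * z + Omega / 2 * (sgn N * p * y) = sgn N * (p * (z + Omega / 2 * y))); last by ring.
    by rewrite !exprMn sN; ring.
  by rewrite divr_ge0 ?sqr_ge0.
rewrite /energy sqr_sqrtr; last first.
  apply: sumr_ge0 => al am; rewrite mulr_ge0 ?invr_ge0//.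
  apply: le_trans (key al am); rewrite mulr_ge0 ?(ltW vol_gt0)// sumr_ge0// => k _.
  rewrite mulr_ge0 ?sqr_ge0// addr_ge0 ?sqr_ge0// mulr_ge0 ?sqr_ge0// addr_ge0 ?lam_ge0//.
  by rewrite divr_ge0 ?sqr_ge0.
rewrite -[leRHS]/(\sum_(al : {ffun 'I_3 -> 'I_m.+1} | (mlen (fun i => al i) <= m)%N) 2^-1 * J al).
have -> : vol * \sum_(k <- s) Wm m k * (2^-1 * energy_mode Omega k (coef k f) (coef k g)) =
  \sum_(al : {ffun 'I_3 -> 'I_m.+1} | (mlen (fun i => al i) <= m)%N)
   2^-1 * (vol * \sum_(k <- s) kpow (fun i => al i) k ^+ 2 * energy_mode Omega k (coef k f) (coef k g)).
  rewrite -!mulr_sumr mulrCA; congr (_ * _); rewrite exchange_big /= mulr_sumr.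
  by apply: eq_bigr => k _; rewrite -mulr_suml mulrCA.
by apply: ler_sum => al am; rewrite ler_wpM2l ?invr_ge0// key.
Qed.

End Weights.

(** * Weighted l2 norms and the Sobolev embedding *)

Section WeightedSums.
Context {R : realType}.
Local Notation R3 := (R * R * R)%type.
Local Notation K := (int * int * int)%type.
Implicit Types (c d : K -> R) (f g : R3 -> R) (x : R3) (k l : K) (i : 'I_3) (m : nat) (A B : R).

Lemma minkowski_sum (s : seq K) (w f g : K -> R) A B : (forall k, 0 <= w k) -> 0 <= A -> 0 <= B ->
  \sum_(k <- s) w k * f k ^+ 2 <= A ^+ 2 -> \sum_(k <- s) w k * g k ^+ 2 <= B ^+ 2 ->
  \sum_(k <- s) w k * (f k + g k) ^+ 2 <= (A + B) ^+ 2.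
Proof.
move=> w0 A0 B0 fA gB.
have := cs_sum s (fun k => Num.sqrt (w k) * f k) (fun k => Num.sqrt (w k) * g k).
have e (h : K -> R) : \sum_(k <- s) (Num.sqrt (w k) * h k) ^+ 2 = \sum_(k <- s) w k * h k ^+ 2.
  by apply: eq_bigr => k _; rewrite exprMn sqr_sqrtr.
have e2 : \sum_(k <- s) Num.sqrt (w k) * f k * (Num.sqrt (w k) * g k) =
    \sum_(k <- s) w k * (f k * g k).
  by apply: eq_bigr => k _; rewrite mulrACA -expr2 sqr_sqrtr.
rewrite !e e2 => cs.
have p (h : K -> R) : 0 <= \sum_(k <- s) w k * h k ^+ 2.
  by apply: sumr_ge0 => k _; rewrite mulr_ge0// sqr_ge0.
have X : `|\sum_(k <- s) w k * (f k * g k)| <= A * B.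
  rewrite -(ler_pXn2r (n := 2))// ?nnegrE ?mulr_ge0// real_normK ?num_real// exprMn.
  by apply: le_trans cs _; apply: ler_pM.
have -> : \sum_(k <- s) w k * (f k + g k) ^+ 2 = \sum_(k <- s) w k * f k ^+ 2 +
    2 * \sum_(k <- s) w k * (f k * g k) + \sum_(k <- s) w k * g k ^+ 2.
  by rewrite mulr_sumr -!big_split /=; apply: eq_bigr => k _; ring.
rewrite sqrrD; have := le_trans (ler_norm _) X; lra.
Qed.

(** The H^m norm of coefficients up to constants. Bounding all finite sums makes the bound survive
    limits taken mode by mode. *)
Definition hbd m c A := 0 <= A /\ forall s : seq K, uniq s ->
  \sum_(k <- s) jap k ^+ m * c k ^+ 2 <= A ^+ 2.

Let japm0 m k : 0 <= (jap k ^+ m : R). Proof. by rewrite exprn_ge0// ltW// jap_gt0. Qed.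

Lemma hbd_le m m' c d A B : (m' <= m)%N -> A <= B -> (forall k, `|d k| <= `|c k|) ->
  hbd m c A -> hbd m' d B.
Proof.
move=> mm AB dc [A0 h]; split=> [|s us]; first exact: le_trans AB.
apply: le_trans (le_trans (h s us) _); last by rewrite ler_pXn2r ?nnegrE// (le_trans A0).
apply: ler_sum => k _; apply: ler_pM; rewrite ?sqr_ge0//.
  by apply: ler_weXn2l => //; exact: jap_ge1.
by rewrite -(real_normK (num_real (d k))) -(real_normK (num_real (c k))) ler_pXn2r ?nnegrE.
Qed.

Lemma hbdD m c d A B : hbd m c A -> hbd m d B -> hbd m (fun k => c k + d k) (A + B).
Proof.
move=> [A0 cA] [B0 dB]; split=> [|s us]; first exact: addr_ge0.
by apply: minkowski_sum => //; [exact: cA|exact: dB].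
Qed.

Lemma hbdZ m (a : R) c A : hbd m c A -> hbd m (fun k => a * c k) (`|a| * A).
Proof.
move=> [A0 cA]; split=> [|s us]; first exact: mulr_ge0.
rewrite exprMn real_normK ?num_real//.
under eq_bigr do rewrite exprMn mulrCA.
by rewrite -mulr_sumr ler_wpM2l ?sqr_ge0// cA.
Qed.

Lemma hbdB m c d A B : hbd m c A -> hbd m d B -> hbd m (fun k => c k - d k) (A + B).
Proof.
move=> cA dB; apply: hbdD => //.
by apply: hbd_le dB => // k; rewrite normrN.
Qed.

Lemma hbdN m c A : hbd m c A -> hbd m (fun k => c (- k)) A.
Proof.
move=> [A0 cA]; split=> // s us.
have := cA (map (fun k : K => - k) s); rewrite (map_inj_uniq oppr_inj) us => /(_ isT).
by rewrite big_map; under eq_bigr do rewrite japN.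
Qed.

Lemma hbd_norm m c A : hbd m c A -> hbd m (fun k => `|c k|) A.
Proof. by apply: hbd_le => // k; rewrite normr_id. Qed.

Lemma hbd_lim m (c_ : nat -> K -> R) c A : (forall n, hbd m (c_ n) A) ->
  (forall k, c_ n k @[n --> \oo] --> c k) -> hbd m c A.
Proof.
move=> h cv; split=> [|s us]; first exact: (h 0%N).1.
apply: (@cvg_le_bd _ (fun n => \sum_(k <- s) jap k ^+ m * c_ n k ^+ 2) _ _ 0%N) => [|n _].
  by apply: cvg_sum_seq => k _; apply: cvgM; [exact: cvg_cst|apply: cvgM].
exact: (h n).2.
Qed.

(** The Sobolev embedding in dimension 3 in the form of absolutely convergent series: weighted
    Cauchy-Schwarz, with inverse weights summing to at most 53 <= 8^2. *)
Lemma hbd_kbd m c A : (2 <= m)%N -> hbd m c A -> kbd c (8 * A).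
Proof.
move=> m2 /(hbd_le m2 (lexx A) (fun k => lexx _))[A0 h] s us.
apply: le_trans (cs_weight (w := fun k => jap k ^+ 2) (W := 53) _ (h s us) _) _.
- by move=> k; rewrite exprn_gt0// jap_gt0.
- apply: le_trans (kbd_jap2 us); apply: ler_sum => k _; exact: ler_norm.
rewrite -(ger0_norm (_ : 0 <= 8 * A)); last by rewrite mulr_ge0.
by rewrite -sqrtr_sqr ler_wsqrtr// exprMn ler_wpM2r ?sqr_ge0//; lra.
Qed.

(** [N] depends on the radius only, so all coefficients in a ball have uniformly small tails. *)
Lemma hbd_ktail A (e : R) : 0 < e ->
  exists N, forall m c, (2 <= m)%N -> hbd m c A -> ktail c N e.
Proof.
move=> e0; pose e' : R := (e / (`|A| + 1)) ^+ 2.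
have p : 0 < e / (`|A| + 1) by rewrite divr_gt0// ltr_wpDl.
have [N hN] : exists N, ktail (fun k => (jap k ^+ 2)^-1 : R) N e'.
  by apply: kbd_ktail kbd_jap2 _; rewrite exprn_gt0.
exists N => m c m2 /(hbd_le m2 (lexx A) (fun k => lexx _))[A0 h] s us sN.
apply: le_trans (cs_weight (w := fun k => jap k ^+ 2) (W := e') _ (h s us) _) _.
- by move=> k; rewrite exprn_gt0// jap_gt0.
- apply: le_trans (hN s us sN); apply: ler_sum => k _; exact: ler_norm.
rewrite -exprMn sqrtr_sqr ger0_norm; last by rewrite mulr_ge0// ltW.
rewrite mulrAC ler_pdivrMr ?ltr_wpDl// ler_wpM2l ?(ltW e0)// (ger0_norm A0); lra.
Qed.

Lemma kpow_sqr_le al k : kpow al k ^+ 2 <= jap k ^+ mlen al :> R.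
Proof.
rewrite /kpow -prodrXl /mlen (big_morph _ (exprD (jap k : R)) (expr0 _)).
apply: ler_prod => i _; rewrite sqr_ge0 /= -exprM mulnC exprM.
apply: lerXn2r; rewrite ?nnegrE ?sqr_ge0 ?(ltW (jap_gt0 _))//.
rewrite /jap /lam (bigD1 i)//= addrCA lerDl addr_ge0// sumr_ge0// => j _; exact: sqr_ge0.
Qed.

Definition NA m : R := #|[pred al : {ffun 'I_3 -> 'I_m.+1} | (mlen (fun i => al i) <= m)%N]|%:R.

Lemma Wm_le m k : Wm m k <= NA m * jap k ^+ m :> R.
Proof.
rewrite /NA -sum1_card natr_sum mulr_suml; apply: ler_sum => al am; rewrite mul1r.
by apply: le_trans (kpow_sqr_le _ _) _; apply: ler_weXn2l => //; exact: jap_ge1.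
Qed.

(** 1 + |k|^2 is at most four times the maximum of 1 and some k_i^2, and the m-th power of this
    maximum is the squared monomial of the multi-index 0 or m e_i. *)
Lemma Wm_ge m k : jap k ^+ m <= 4 ^+ m * Wm m k :> R.
Proof.
have [i hi] : exists i : 'I_3, jap k <= 4 * Num.max 1 (kr k i ^+ 2) :> R.
  pose q (i : 'I_3) : R := kr k i ^+ 2.
  have [i [h0 h1 h2]] : exists i, [/\ q 0 <= q i, q 1 <= q i & q 2 <= q i].
    have [a|a] := leP (q 0) (q 1); have [b|b] := leP (q 1) (q 2); have [cc|cc] := leP (q 0) (q 2).
    all: try by exists 0; split => //; lra.
    all: try by exists 1; split => //; lra.
    all: try by exists 2; split => //; lra.
  exists i; rewrite -/(q i) /jap /lam sum_ord3 -/(q 0) -/(q 1) -/(q 2).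
  have a1 : 1 <= Num.max 1 (q i) by rewrite le_max lexx.
  have a2 : q i <= Num.max 1 (q i) by rewrite le_max lexx orbT.
  lra.
apply: (@le_trans _ _ ((4 * Num.max 1 (kr k i ^+ 2)) ^+ m)).
  by apply: lerXn2r => //; rewrite nnegrE ?(ltW (jap_gt0 _))// mulr_ge0// le_max ler01.
rewrite exprMn ler_wpM2l ?exprn_ge0//.
pose al0 : {ffun 'I_3 -> 'I_m.+1} := [ffun=> ord0].
pose al1 : {ffun 'I_3 -> 'I_m.+1} := [ffun j => if j == i then ord_max else ord0].
have p al : 0 <= kpow al k ^+ 2 :> R by exact: sqr_ge0.
have l0 : (mlen (fun i => al0 i) <= m)%N.
  by rewrite /mlen big1// => j _; rewrite ffunE.
have e1 j : al1 j = (if j == i then m else 0%N) :> nat by rewrite ffunE; case: eqP.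
have l1 : (mlen (fun i => al1 i) <= m)%N.
  by rewrite /mlen (bigD1 i)//= e1 eqxx big1 ?addn0// => j /negPf ji; rewrite e1 ji.
have [hm|hm] := leP 1 (kr k i ^+ 2 : R).
  rewrite /Wm (bigD1 al1) //= -[leLHS]addr0 lerD//; last by apply: sumr_ge0 => al _; exact: p.
  rewrite /kpow (bigD1 i)//= e1 eqxx big1 ?mulr1; last first.
    by move=> j /negPf ji; rewrite e1 ji expr0.
  by rewrite -!exprM mulnC.
rewrite expr1n /Wm (bigD1 al0) //= -[leLHS]addr0 lerD//; last by apply: sumr_ge0 => al _; exact: p.
by rewrite /kpow big1 ?expr1n// => j _; rewrite ffunE expr0.
Qed.

Lemma vol_ge1 : 1 <= vol :> R.
Proof. by rewrite /vol exprn_ege1//; have := @pi_ge2 R; lra. Qed.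

(** The factor 2^m is the square root of the constant in [Wm_ge]; [vol] is dropped, being at least
    1. *)
Lemma sobolev_hbd m f (A : R) : sobolev m f -> Hnorm m f <= A -> hbd m (fun k => coef k f) (2 ^+ m * A).
Proof.
move=> sf fA; have A0 := le_trans (Hnorm_ge0 m f) fA; split=> [|s us].
  by rewrite mulr_ge0 ?exprn_ge0.
rewrite exprMn -exprM mulnC exprM (_ : 2 ^+ 2 = 4 :> R); last by rewrite -natrX.
apply: (@le_trans _ _ (4 ^+ m * Hnorm m f ^+ 2)); last first.
  by rewrite ler_wpM2l ?exprn_ge0// lerXn2r ?nnegrE ?Hnorm_ge0.
apply: le_trans (ler_wpM2l (exprn_ge0 m (ler0n _ 4)) (Hnorm_ge sf us)).
rewrite mulrCA -[leLHS]mul1r ler_pM ?vol_ge1//.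
  by apply: sumr_ge0 => k _; rewrite mulr_ge0 ?sqr_ge0.
rewrite mulr_sumr; apply: ler_sum => k _; rewrite [leRHS]mulrA ler_wpM2r ?sqr_ge0//.
exact: Wm_ge.
Qed.

Lemma L2_syn c A : kbd c A -> L2 (syn c).
Proof.
move=> cA; split; [exact: syn_periodic|exact: measurable_syn cA|].
exact: (sqint_syn cA).2.
Qed.

Lemma sobolev_syn m c A : (2 <= m)%N -> hbd m c A -> sobolev m (syn c).
Proof.
move=> m2 h; have cA := hbd_kbd m2 h; apply: sobolev_of_kbd; first exact: L2_syn cA.
move=> al am; exists (A ^+ 2) => s us; apply: le_trans (h.2 s us).
apply: ler_sum => k _; rewrite ger0_norm ?sqr_ge0// (coef_syn _ cA) exprMn ler_wpM2r ?sqr_ge0//.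
by apply: le_trans (kpow_sqr_le _ _) _; apply: ler_weXn2l => //; exact: jap_ge1.
Qed.

Lemma Hnorm_syn m c A : (2 <= m)%N -> hbd m c A -> Hnorm m (syn c) <= Num.sqrt (vol * NA m) * A.
Proof.
move=> m2 h; have cA := hbd_kbd m2 h; apply: Hnorm_le (sobolev_syn m2 h) _ _.
  by rewrite mulr_ge0 ?sqrtr_ge0 ?h.1.
move=> s us; rewrite exprMn sqr_sqrtr ?(mulr_ge0 (ltW vol_gt0) (ler0n _ _))//.
rewrite -[leRHS]mulrA ler_wpM2l ?(ltW vol_gt0)//.
apply: le_trans (ler_wpM2l (ler0n _ _) (h.2 s us)); rewrite mulr_sumr.
apply: ler_sum => k _; rewrite (coef_syn _ cA) [leRHS]mulrA ler_wpM2r ?sqr_ge0//; exact: Wm_le.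
Qed.

End WeightedSums.

(** * The product estimate in H^m *)

Section Product.
Context {R : realType}.
Local Notation R3 := (R * R * R)%type.
Local Notation K := (int * int * int)%type.
Implicit Types (c d : K -> R) (f g : R3 -> R) (x : R3) (k l : K) (i : 'I_3) (m : nat) (A B : R).

(** Cauchy-Schwarz with the kernel split evenly between the two factors; [P] bounds the row sums,
    and the column sums enter through the last hypothesis. *)
Lemma schur_test (s t : seq K) (y z : K -> K -> R) (P Q : R) : 0 <= P ->
  (forall k j, 0 <= y k j) -> (forall k, \sum_(j <- t) y k j <= P) ->
  \sum_(k <- s) \sum_(j <- t) y k j * z k j ^+ 2 <= P * Q ^+ 2 ->
  \sum_(k <- s) (\sum_(j <- t) y k j * z k j) ^+ 2 <= (P * Q) ^+ 2.
Proof.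
move=> P0 y0 yP h; rewrite exprMn expr2 -mulrA; apply: le_trans (ler_wpM2l P0 h).
rewrite mulr_sumr; apply: ler_sum => k _.
have := cs_sum t (fun j => Num.sqrt (y k j)) (fun j => Num.sqrt (y k j) * z k j).
rewrite (eq_bigr (fun j => y k j * z k j)); last first.
  by move=> j _; rewrite mulrA -expr2 sqr_sqrtr.
move=> cs; apply: (le_trans cs).
rewrite (eq_bigr (y k)) => [|j _]; last by rewrite sqr_sqrtr.
under [X in _ * X <= _]eq_bigr do rewrite exprMn sqr_sqrtr//.
apply: ler_wpM2r => //; apply: sumr_ge0 => j _; by rewrite mulr_ge0 ?sqr_ge0.
Qed.

Let w m k : R := Num.sqrt (jap k) ^+ m.

Let w_ge0 m k : 0 <= w m k. Proof. by rewrite exprn_ge0// sqrtr_ge0. Qed.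

Let w_sqr m k : w m k ^+ 2 = jap k ^+ m.
Proof. by rewrite -exprM mulnC exprM sqr_sqrtr// ltW// jap_gt0. Qed.

Lemma jap_peetre k j : jap k <= 2 * (jap j + jap (k - j)) :> R.
Proof.
rewrite /jap; suff : lam k <= 2 * (lam j + lam (k - j)) :> R by lra.
rewrite /lam -big_split mulr_sumr; apply: ler_sum => i _ /=.
rewrite krD krN; have := sqr_ge0 (kr k i - 2 * kr j i : R); nra.
Qed.

Let w_peetre m k j : w m k <= 2 ^+ m * (w m j + w m (k - j)).
Proof.
have h : Num.sqrt (jap k) <= 2 * Num.max (Num.sqrt (jap j)) (Num.sqrt (jap (k - j))) :> R.
  rewrite -(ler_pXn2r (n := 2))// ?nnegrE ?mulr_ge0 ?le_max ?sqrtr_ge0//.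
  rewrite exprMn sqr_sqrtr ?(ltW (jap_gt0 _))//.
  have := jap_peetre k j; case: (leP (Num.sqrt (jap j)) (Num.sqrt (jap (k - j)))) => hh.
    have : jap j <= jap (k - j) :> R by move: hh; rewrite ler_sqrt// ltW// jap_gt0.
    rewrite sqr_sqrtr ?(ltW (jap_gt0 _))//; lra.
  have : jap (k - j) <= jap j :> R.
    by move/ltW: hh; rewrite ler_sqrt// ltW// jap_gt0.
  rewrite sqr_sqrtr ?(ltW (jap_gt0 _))//; lra.
apply: (@le_trans _ _ ((2 * Num.max (Num.sqrt (jap j)) (Num.sqrt (jap (k - j)))) ^+ m)).
  by apply: lerXn2r; rewrite ?nnegrE ?mulr_ge0 ?le_max ?sqrtr_ge0.
rewrite exprMn ler_wpM2l ?exprn_ge0//.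
by case: (leP (Num.sqrt (jap j)) (Num.sqrt (jap (k - j)))) => _; rewrite -/(w m _) ?lerDl ?lerDr.
Qed.

(** By Peetre's inequality the weight at k passes, at the price 2^m, to j or to k - j. In either
    convolution the unweighted factor is summable by the Sobolev embedding, and the Schur test
    contributes 8 A B each time. *)
Lemma conv_bound m (F G : K -> R) A B (s t : seq K) : (2 <= m)%N ->
  (forall k, 0 <= F k) -> (forall k, 0 <= G k) -> hbd m F A -> hbd m G B -> uniq s -> uniq t ->
  \sum_(k <- s) jap k ^+ m * (\sum_(j <- t) F j * G (k - j)) ^+ 2 <= (2 ^+ m * (16 * A * B)) ^+ 2.
Proof.
move=> m2 F0 G0 hF hG us ut; have kF := hbd_kbd m2 hF; have kG := hbd_kbd m2 hG.
have A0 := hF.1; have B0 := hG.1.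
have tr (H : K -> R) (C : R) (k : K) : kbd H C -> (forall k, 0 <= H k) -> \sum_(j <- t) H (k - j) <= C.
  move=> hH H0; have := hH (map (fun j => k - j) t).
  rewrite map_inj_uniq; last exact: subrI.
  by move=> /(_ ut); rewrite big_map; under eq_bigr do rewrite ger0_norm//.
have tr2 (H : K -> R) (C : R) (j : K) : (forall s, uniq s -> \sum_(k <- s) H k <= C) ->
    \sum_(k <- s) H (k - j) <= C.
  move=> hH; have := hH (map (fun k => k - j) s).
  by rewrite map_inj_uniq ?us ?big_map//; [exact|exact: addIr].
pose Q1 k := \sum_(j <- t) G (k - j) * (w m j * F j).
pose Q2 k := \sum_(j <- t) F j * (w m (k - j) * G (k - j)).
have q1 : \sum_(k <- s) Q1 k ^+ 2 <= (8 * B * A) ^+ 2.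
  apply: schur_test => //; first by rewrite mulr_ge0.
    by move=> k; apply: tr.
  rewrite exchange_big /= (eq_bigr (fun j => (w m j * F j) ^+ 2 * \sum_(k <- s) G (k - j))); last first.
    by move=> j _; rewrite mulr_sumr; apply: eq_bigr => k _; rewrite mulrC.
  apply: (@le_trans _ _ (\sum_(j <- t) (w m j * F j) ^+ 2 * (8 * B))).
    apply: ler_sum => j _; rewrite ler_wpM2l ?sqr_ge0//; apply: tr2 => s' us'.
    by apply: le_trans (kG s' us'); apply: ler_sum => k _; exact: ler_norm.
  rewrite -mulr_suml mulrC ler_wpM2l ?mulr_ge0//.
  by apply: le_trans (hF.2 t ut); apply: ler_sum => k _; rewrite exprMn w_sqr.
have q2 : \sum_(k <- s) Q2 k ^+ 2 <= (8 * A * B) ^+ 2.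
  apply: schur_test => //; first by rewrite mulr_ge0.
    by move=> k; apply: le_trans (kF t ut); apply: ler_sum => j _; exact: ler_norm.
  rewrite exchange_big /= (eq_bigr (fun j => F j * \sum_(k <- s) (w m (k - j) * G (k - j)) ^+ 2)); last first.
    by move=> j _; rewrite mulr_sumr.
  apply: (@le_trans _ _ (\sum_(j <- t) F j * B ^+ 2)).
    apply: ler_sum => j _; rewrite ler_wpM2l//.
    apply: (tr2 (fun k => (w m k * G k) ^+ 2)) => s' us'.
    by apply: le_trans (hG.2 s' us'); apply: ler_sum => k _; rewrite exprMn w_sqr.
  rewrite -mulr_suml ler_wpM2r ?sqr_ge0//.
  by apply: le_trans (kF t ut); apply: ler_sum => j _; exact: ler_norm.
apply: (@le_trans _ _ (\sum_(k <- s) 4 ^+ m * (1 * (Q1 k + Q2 k) ^+ 2))).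
  apply: ler_sum => k _; rewrite -w_sqr -exprMn mul1r.
  have -> : 4 ^+ m = (2 ^+ m) ^+ 2 :> R by rewrite -exprM mulnC exprM (_ : 2 ^+ 2 = 4 :> R)// -natrX.
  rewrite -exprMn; apply: lerXn2r; rewrite ?nnegrE.
  - by rewrite mulr_ge0// sumr_ge0// => j _; rewrite mulr_ge0.
  - by rewrite mulr_ge0 ?exprn_ge0// addr_ge0// sumr_ge0// => j _; rewrite !mulr_ge0.
  rewrite /Q1 /Q2 -big_split !mulr_sumr; apply: ler_sum => j _ /=.
  apply: (@le_trans _ _ (2 ^+ m * (w m j + w m (k - j)) * (F j * G (k - j)))).
    by rewrite ler_wpM2r ?mulr_ge0// w_peetre.
  by rewrite le_eqVlt; apply/orP; left; apply/eqP; ring.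
rewrite -mulr_sumr exprMn -[X in _ <= X * _]exprM [(m * 2)%N]mulnC exprM (_ : 2 ^+ 2 = 4 :> R); last by rewrite -natrX.
rewrite ler_wpM2l ?exprn_ge0//.
have -> : 16 * A * B = 8 * B * A + 8 * A * B by ring.
by apply: minkowski_sum; rewrite ?mulr_ge0//; under eq_bigr do rewrite mul1r.
Qed.

Lemma coef_mul_bas j k g : csqint g -> coef j (fun x => g x * bas k x) =
  2^-1 * (coef (k - j) g + coef (j - k) g + coef (k + j) g - coef (- (k + j)) g).
Proof.
move=> sg; have ig l := integ_mul_bas l (c_sqint_integ sg).
rewrite /coef (@eq_Rint _ _ _ leb3 cube _ (fun x => 2^-1 * ((g x * bas (k - j) x + g x * bas (j - k) x +
  g x * bas (k + j) x) - g x * bas (- (k + j)) x))); last first.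
  by move=> x _; rewrite -mulrA bas_mul; ring.
rewrite c_RintZ; last by apply: c_integB => //; apply: c_integD => //; apply: c_integD.
rewrite c_RintB ?c_RintD//; [ring|exact: c_integD|].
by apply: c_integD => //; apply: c_integD.
Qed.

(** The coefficients of the product pair c_j with four shifted or reflected coefficients of g; [F]
    and [G] collect the reflections, so that a plain convolution dominates. The doubled radii, the
    16 of the convolution bound and the 1/2 of [bas_mul] make up 2^(m+5). *)
Lemma prod_hbd m c g A B : (2 <= m)%N -> hbd m c A -> csqint g -> hbd m (fun k => coef k g) B ->
  hbd m (fun k => coef k (fun x => syn c x * g x)) (2 ^+ (m + 5) * (A * B)).
Proof.
move=> m2 hc sg hg; have kc := hbd_kbd m2 hc; have kg := hbd_kbd m2 hg.
have A0 := hc.1; have B0 := hg.1.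
pose q k j : R := 2^-1 * (coef (k - j) g + coef (j - k) g + coef (k + j) g - coef (- (k + j)) g).
pose F k : R := `|c k| + `|c (- k)|.
pose G k : R := `|coef k g| + `|coef (- k) g|.
have hF : hbd m F (A + A) by apply: hbdD; apply: hbd_norm => //; exact: hbdN.
have hG : hbd m G (B + B).
  by apply: hbdD; apply: hbd_norm => //; exact: (hbdN hg).
have qG k j : `|q k j| <= 2^-1 * (G (k - j) + G (k + j)).
  rewrite /q /G normrM ger0_norm ?invr_ge0// ler_wpM2l ?invr_ge0// opprB.
  apply: le_trans (ler_normB _ _) _; rewrite addrA lerD2r.
  apply: le_trans (ler_normD _ _) _; rewrite lerD2r; exact: ler_normD.
have G0 k : 0 <= G k by rewrite addr_ge0.
have F0 k : 0 <= F k by rewrite addr_ge0.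
have lim k : \sum_(j <- bx n) c j * q k j @[n --> \oo] -->
    coef k (fun x => syn c x * g x).
  have -> : coef k (fun x => syn c x * g x) = ksum (fun j => c j * q k j).
    rewrite /coef (@eq_Rint _ _ _ leb3 cube _ (fun x => g x * bas k x * syn c x)); last by move=> x _; ring.
    have sgb : csqint (fun x => g x * bas k x).
      by apply: (c_sqint_Mbd (M := 2)) => // [|x _]; [exact: measurable_bas|exact: bas_bd].
    rewrite (Rint_mul_syn sgb kc) mulKf ?gt_eqF ?vol_gt0//.
    by apply: eq_ksum => j; rewrite coef_mul_bas.
  apply: (@cvg_ksum _ _ (32 * B * (8 * A))).
  apply: (@kbd_le _ _ (fun j => (32 * B) * c j)); last first.
    have := kbdZ (32 * B) kc; rewrite ger0_norm// mulr_ge0//.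
  move=> j; rewrite !normrM mulrC -normrM ler_wpM2r//; apply: le_trans (qG k j) _.
  have bG l : G l <= 16 * B.
    by have := kbd1 l kg; have := kbd1 (- l) kg; rewrite /G; lra.
  rewrite (ger0_norm (ler0n _ 32)) (ger0_norm B0); have := bG (k - j); have := bG (k + j); lra.
apply: (hbd_lim _ lim) => n; split=> [|s us].
  by rewrite mulr_ge0 ?exprn_ge0// mulr_ge0.
have -> : 2 ^+ (m + 5) * (A * B) = 2^-1 * (2 ^+ m * (16 * (A + A) * (B + B))).
  by rewrite exprD; set z := 2 ^+ m; field.
rewrite exprMn; apply: le_trans (ler_wpM2l (sqr_ge0 _) (conv_bound m2 F0 G0 hF hG us (uniq_bx n))).
rewrite mulr_sumr; apply: ler_sum => k _; rewrite [leRHS]mulrCA ler_wpM2l//.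
  by rewrite exprn_ge0// ltW// jap_gt0.
rewrite -exprMn -real_normK ?num_real//; apply: lerXn2r; rewrite ?nnegrE//.
  by rewrite mulr_ge0 ?invr_ge0// sumr_ge0// => j _; rewrite mulr_ge0.
apply: le_trans (ler_norm_sum _ _ _) _.
apply: (@le_trans _ _ (\sum_(j <- bx n) 2^-1 * (`|c j| * G (k - j) + `|c j| * G (k + j)))).
  by apply: ler_sum => j _; rewrite normrM -mulrDr mulrCA ler_wpM2l.
rewrite -mulr_sumr ler_wpM2l ?invr_ge0// big_split /=.
(* Replacing j by -j turns G(k + j) into G(k - j); the reflected |c| is the second summand of
   [F]. *)
rewrite -[X in _ + X]sum_bxN -big_split /=; apply: ler_sum => j _.
by rewrite /F mulrDl.
Qed.

End Product.

(** * Real powers and the binomial series *)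

Section Binomial.
Context {R : realType}.
Implicit Types (a b x y z p mu : R) (n : nat).

Lemma mvt_lip (f df : R -> R) a b (e : R) : (forall x, a <= x <= b -> is_derive x (1 : R) f (df x)) ->
  (forall x, a <= x <= b -> `|df x| <= e) ->
  forall x y, a <= x <= b -> a <= y <= b -> `|f y - f x| <= e * `|y - x|.
Proof.
move=> fd de; suff h x y : x <= y -> a <= x <= b -> a <= y <= b -> `|f y - f x| <= e * `|y - x|.
  move=> x y xab yab; have [xy|/ltW yx] := leP x y; first exact: h.
  by rewrite distrC [`|y - x|]distrC h.
move=> xy /andP[ax xb] /andP[ay yb].
have sub t : x <= t <= y -> a <= t <= b by move=> /andP[xt ty]; rewrite (le_trans ax)//= (le_trans ty).
have [|t|c] := @MVT_segment R f df x y xy.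
- move=> t; rewrite in_itv/= => /andP[xt ty]; apply: fd; apply: sub; rewrite !ltW//.
- apply: derivable_within_continuous => u; rewrite in_itv/= => /sub /fd h; exact: ex_derive.
rewrite in_itv/= => /sub cab ->; rewrite normrM ler_wpM2r//; exact: de.
Qed.

Lemma powR_bounded a b p : 0 < a -> exists2 M : R, 0 < M & forall y, a <= y <= b -> `|y `^ p| <= M.
Proof.
move=> a0; exists (expR (`|p| * (`|ln a| + `|ln b|))) => [|y /andP[ay yb]]; first exact: expR_gt0.
have y0 := lt_le_trans a0 ay; have b0 := lt_le_trans y0 yb.
rewrite /powR gt_eqF// ger0_norm ?expR_ge0// ler_expR.
apply: le_trans (ler_norm _) _; rewrite normrM ler_wpM2l//.
have h1 : ln a <= ln y by rewrite ler_ln.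
have h2 : ln y <= ln b by rewrite ler_ln.
rewrite ler_norml; have := ler_norm (ln b); have := ler_norm (- ln a); rewrite normrN.
have := normr_ge0 (ln a); have := normr_ge0 (ln b); lra.
Qed.

Lemma powR_lip a b p : 0 < a -> exists2 L : R, 0 < L & forall x y, a <= x <= b -> a <= y <= b ->
  `|y `^ p - x `^ p| <= L * `|y - x|.
Proof.
move=> a0; have [M M0 hM] := powR_bounded b (p - 1) a0.
exists (`|p| * M + 1) => [|x y xab yab]; first by rewrite ltr_wpDl// mulr_ge0// ltW.
have h := @mvt_lip (fun t => t `^ p) (fun t => p * t `^ (p - 1)) a b (`|p| * M + 1).
apply: h => // t tab.
  apply: is_derive1_powR; have /andP[at_ _] := tab; exact: lt_le_trans at_.
by rewrite normrM; apply: le_trans (ler_wpM2l (normr_ge0 _) (hM t tab)) _; rewrite lerDl.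
Qed.

(** The generalised binomial coefficient of mu over n; [bns] is the truncated binomial series of (1
    + x)^mu and [dbns] its derivative. *)
Definition bnc mu n : R := \prod_(i < n) ((mu - i%:R) / i.+1%:R).
Definition bns mu n x : R := \sum_(i < n) bnc mu i * x ^+ i.
Definition dbns mu n x : R := \sum_(i < n) bnc mu i * (x ^+ i.-1 *+ i).

Lemma bncS mu n : n.+1%:R * bnc mu n.+1 = bnc mu n * (mu - n%:R).
Proof. by rewrite /bnc big_ord_recr /= mulrCA [_ * (_ / _)]mulrCA divff ?mulr1// pnatr_eq0. Qed.

Lemma is_derive_bns mu n x : is_derive x (1 : R) (bns mu n) (dbns mu n x).
Proof.
elim: n => [|n IH].
  have -> : bns mu 0 = cst 0 by apply/funext => y; rewrite /bns big_ord0.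
  by rewrite /dbns big_ord0; exact: is_derive_cst.
have -> : bns mu n.+1 = bns mu n \+ (bnc mu n *: (fun y : R => y ^+ n)).
  by apply/funext => y; rewrite /bns big_ord_recr.
rewrite /dbns big_ord_recr /= -/(dbns mu n x).
have hX : is_derive x (1 : R) (fun y : R => y ^+ n) (x ^+ n.-1 *+ n).
  have -> : x ^+ n.-1 *+ n = 'D_1 (@GRing.exp R ^~ n) x.
    by rewrite exp_derive -mulr_natl -[LHS]mulr1.
  by apply: derivableP; exact: exprn_derivable.
by apply: is_deriveD; apply: is_deriveZ.
Qed.

(** The truncated series satisfies the differential equation (1 + x) y' = mu y of the power up to a
    single term of top degree. *)
Lemma bns_ode mu n x : (1 + x) * dbns mu n.+1 x - mu * bns mu n.+1 x = - (n.+1%:R * bnc mu n.+1 * x ^+ n).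
Proof.
elim: n => [|n IH].
  rewrite /dbns /bns !big_ord_recr !big_ord0 /= bncS /bnc big_ord0; ring.
rewrite /dbns /bns !(big_ord_recr n.+1) /= -/(dbns _ _ _) -/(bns _ _ _).
rewrite mulrDr [mu * _]mulrDr opprD addrACA IH [n.+2%:R * _]bncS -mulr_natr exprS; ring.
Qed.

(** The ratio of consecutive coefficients is at most (|mu| + n)/(n + 1), hence at most 3/2 once n >=
    2|mu|; the finitely many earlier ratios go into the constant. *)
Lemma bnc_le mu : exists2 C : R, 0 < C & forall n, `|bnc mu n| <= C * (3 / 2) ^+ n.
Proof.
pose n0 := Num.Def.archi_bound (2 * `|mu|).
have hn0 : 2 * `|mu| < n0%:R by apply: archi_boundP; rewrite mulr_ge0.
have m1 : 1 <= 1 + `|mu| by rewrite lerDl.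
exists ((1 + `|mu|) ^+ n0) => [|n]; first by rewrite exprn_gt0// ltr_wpDr.
suff : `|bnc mu n| <= (1 + `|mu|) ^+ minn n n0 * (3 / 2) ^+ n.
  move/le_trans; apply; rewrite ler_wpM2r ?exprn_ge0//.
  by apply: ler_weXn2l => //; exact: geq_minr.
elim: n => [|n IH]; first by rewrite /bnc big_ord0 normr1 min0n !expr0 mulr1.
rewrite /bnc big_ord_recr -/(bnc mu n) /= normrM normrM normfV.
have fac : `|mu - n%:R| <= `|mu| + n%:R by apply: le_trans (ler_normB _ _) _; rewrite normr_nat.
have p : 0 < n.+1%:R :> R by rewrite ltr0n.
rewrite (ger0_norm (ltW p)).
have [nn|nn] := ltnP n n0.
  rewrite (minn_idPl nn); rewrite (minn_idPl (ltnW nn)) in IH.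
  rewrite !exprS mulrACA mulrC.
  apply: ler_pM => //.
  rewrite ler_pdivrMr//; apply: le_trans fac _.
  apply: (@le_trans _ _ ((1 + `|mu|) * n.+1%:R)); last first.
    by rewrite ler_wpM2r ?(ltW p)//; have := m1; lra.
  by rewrite -natr1; have := ler0n R n; nra.
rewrite (minn_idPr (leqW nn)); rewrite (minn_idPr nn) in IH.
rewrite exprSr [leRHS]mulrA; apply: ler_pM => //.
rewrite ler_pdivrMr//; apply: le_trans fac _.
have : n0%:R <= n%:R :> R by rewrite ler_nat.
rewrite -natr1; lra.
Qed.

(** The quotient [D] of the truncated series by the power equals 1 at 0, and its derivative consists
    of the residual of the differential equation. With n + 1 <= 2^(n+1) that residual decays
    geometrically, at the ratio 2 (3/2) (1/4) = 3/4. *)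
Lemma bns_cvg mu : exists2 C : R, 0 < C & forall n x, `|x| <= 4^-1 ->
  `|bns mu n.+1 x - (1 + x) `^ mu| <= C * (3 / 4) ^+ n.
Proof.
have [C C0 hC] := bnc_le mu.
have q : 0 < 3 / 4 :> R by lra.
have [M M0 hM] := powR_bounded (5 / 4) (- mu - 1) q.
have [M' M'0 hM'] := powR_bounded (5 / 4) mu q.
have in1 (x : R) : - 4^-1 <= x <= 4^-1 -> 3 / 4 <= 1 + x <= 5 / 4 by lra.
exists (M' * (C * (3 / 2) * M)) => [|n x x4]; first by rewrite !mulr_gt0//; lra.
pose D (t : R) : R := bns mu n.+1 t * (1 + t) `^ (- mu).
pose dD (t : R) : R := - (n.+1%:R * bnc mu n.+1 * t ^+ n) * (1 + t) `^ (- mu - 1).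
have dDD (t : R) : - 4^-1 <= t <= 4^-1 -> is_derive t (1 : R) D (dD t).
  move=> /in1 /andP[t1 _]; have t0 : 0 < 1 + t by apply: lt_le_trans t1.
  have h1 : is_derive t (1 : R) (fun s => (1 + s) `^ (- mu)) (- mu * (1 + t) `^ (- mu - 1)).
    have -> : (fun s : R => (1 + s) `^ (- mu)) = (fun r : R => r `^ (- mu)) \o (fun s => 1 + s * 1).
      by apply/funext => s /=; rewrite mulr1.
    have h2 : is_derive (1 + t * 1) (1 : R) (fun r : R => r `^ (- mu)) (- mu * (1 + t) `^ (- mu - 1)).
      by rewrite mulr1; exact: is_derive1_powR.
    by have := @is_derive1_comp R _ (fun s : R => 1 + s * 1) t _ _ h2 (is_derive_affine 1 1 t); rewrite mulr1.
  have := is_deriveM (is_derive_bns mu n.+1 t) h1; congr is_derive.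
  rewrite /dD -bns_ode /GRing.scale /=.
  have -> : (1 + t) `^ (- mu) = (1 + t) `^ (- mu - 1) * (1 + t).
    rewrite -{3}(powRr1 (ltW t0)) -powRD; first by rewrite subrK.
    by apply/implyP => _; rewrite gt_eqF.
  ring.
have dDb (t : R) : - 4^-1 <= t <= 4^-1 -> `|dD t| <= 4 * (C * (3 / 2) * M) * (3 / 4) ^+ n.
  move=> tt; rewrite /dD normrM normrN !normrM.
  have h2 := hM _ (in1 _ tt); have h1 := hC n.+1.
  have h3 : `|t ^+ n| <= 4^-1 ^+ n.
    by rewrite normrX; apply: lerXn2r; rewrite ?nnegrE ?invr_ge0// ler_norml; lra.
  have h4 : n.+1%:R <= 2 ^+ n.+1 :> R by rewrite -natrX ler_nat ltnW// ltn_expl.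
  apply: (@le_trans _ _ ((2 ^+ n.+1 * (C * (3 / 2) ^+ n.+1) * 4^-1 ^+ n) * M)).
    by rewrite !ler_pM ?mulr_ge0// normr_nat.
  have e : (3 / 4) ^+ n = 2 ^+ n * (3 / 2) ^+ n * 4^-1 ^+ n :> R.
    by rewrite -!exprMn; congr (_ ^+ n); field.
  rewrite e !exprS; set u := 2 ^+ n; set v := (3 / 2) ^+ n; set w := 4^-1 ^+ n.
  rewrite (_ : _ * M = (2 * (C * (3 / 2) * M)) * (u * v * w)); last by ring.
  rewrite ler_wpM2r ?ler_wpM2r ?mulr_ge0 ?exprn_ge0 ?invr_ge0 ?ltW//; lra.
have xx : - 4^-1 <= x <= 4^-1 by rewrite -ler_norml.
have b1 : `|D x - D 0| <= (C * (3 / 2) * M) * (3 / 4) ^+ n.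
  have z0 : - 4^-1 <= (0 : R) <= 4^-1 by lra.
  apply: le_trans (mvt_lip dDD dDb z0 xx) _; rewrite subr0.
  apply: le_trans (ler_wpM2l _ x4) _.
    by rewrite !mulr_ge0 ?exprn_ge0 ?ltW//; lra.
  by rewrite le_eqVlt; apply/orP; left; apply/eqP; field.
have D0 : D 0 = 1.
  rewrite /D /bns big_ord_recl expr0 addr0 powR1 !mulr1 /bnc big_ord0 big1 ?addr0// => i _.
  by rewrite expr0n mulr0.
have x0 : 0 < 1 + x by lra.
have -> : bns mu n.+1 x - (1 + x) `^ mu = (1 + x) `^ mu * (D x - D 0).
  by rewrite D0 mulrBr mulr1 /D powRN [(1 + x) `^ mu * _]mulrCA divff ?mulr1// gt_eqF// powR_gt0.
rewrite normrM -mulrA; apply: ler_pM => //; exact: hM' (in1 _ xx).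
Qed.

End Binomial.

(** * Composition with the power in H^m *)

Section Composition.
Context {R : realType}.
Local Notation R3 := (R * R * R)%type.
Local Notation K := (int * int * int)%type.
Implicit Types (c d : K -> R) (f g : R3 -> R) (x : R3) (k l : K) (m n : nat) (A B rho : R).

Lemma coef_norm_le f k (M : R) : cinteg f -> (forall x, cube x -> `|f x| <= M) ->
  `|coef k f| <= 2 * M.
Proof.
move=> If fM; rewrite /coef normrM ger0_norm ?invr_ge0 ?(ltW vol_gt0)//.
rewrite ler_pdivrMl ?vol_gt0//.
have <- : \int[leb3]_(x in cube) (2 * M) = vol * (2 * M).
  rewrite (Rintegral_cst leb3 measurable_cube) [RHS]mulrC; congr (_ * _); exact: (congr1 fine leb3_cube).
apply: (c_norm_Rint_le (integ_mul_bas k If) (c_integ_cst _)) => x cx.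
by rewrite normrM mulrC ler_pM// ?bas_bd ?fM.
Qed.

Lemma cvg_coef_unif (f_ : nat -> R3 -> R) f k (e : nat -> R) :
  (forall n, cinteg (f_ n)) -> cinteg f ->
  (forall n x, cube x -> `|f_ n x - f x| <= e n) -> e n @[n --> \oo] --> 0 ->
  coef k (f_ n) @[n --> \oo] --> coef k f.
Proof.
move=> If_ If fe e0; apply/cvgrPdist_le => d d0.
have d2 : 0 < d / 2 by rewrite divr_gt0.
move/cvgrPdist_le: e0 => /(_ _ d2)[N _ hN]; exists N => // n Nn /=.
rewrite distrC -coefB//; have := hN n Nn; rewrite /= sub0r normrN => en.
apply: le_trans (@coef_norm_le _ k (e n) _ _) _ => [|x cx|]; [exact: c_integB|exact: fe|].
by have := ler_norm (e n); lra.
Qed.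

Lemma measurable_powR_syn c B (p : R) : kbd c B ->
  measurable_fun (@setT R3) (fun x => (1 + syn c x) `^ p).
Proof.
move=> cB; apply: (measurableT_comp (measurable_powR p)).
by apply: measurable_funD => //; exact: measurable_syn cB.
Qed.

Lemma syn_small m c rho x : (2 <= m)%N -> hbd m c rho -> 2 ^+ (m + 5) * rho <= 4^-1 ->
  `|syn c x| <= 4^-1.
Proof.
move=> m2 h hr; apply: le_trans (syn_bd x (hbd_kbd m2 h)) _.
have r0 := h.1; have : 16 <= 2 ^+ (m + 5) :> R.
  by rewrite exprD -[leLHS]mul1r ler_pM// ?exprn_ege1 ?ler1n// -natrX ler_nat.
by move=> h16; nra.
Qed.

Lemma hbd_coef1 m n : hbd m (fun k => coef k (fun=> 1 : R)) 1.
Proof.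
split=> // s us; rewrite expr1n.
have e : (fun=> 1 : R) = bas (0 : K) :> (R3 -> R) by apply/funext => x; rewrite bas0.
have [s0|s0] := boolP ((0 : K) \in s).
  rewrite (bigD1_seq 0)//= big1 ?addr0 => [|k /negPf k0].
    by rewrite e coef_bas eqxx expr1n mulr1 /jap lam0 addr0 expr1n.
  by rewrite e coef_bas eq_sym k0 expr0n mulr0.
rewrite big_seq big1// => k ks.
by rewrite e coef_bas; case: eqP => [k0|_]; rewrite ?expr0n ?mulr0//; rewrite k0 ks in s0.
Qed.

Lemma hbd_coef_exp m c rho n : (2 <= m)%N -> hbd m c rho ->
  hbd m (fun k => coef k (fun x => syn c x ^+ n)) ((2 ^+ (m + 5) * rho) ^+ n).
Proof.
move=> m2 h; have cB := hbd_kbd m2 h; elim: n => [|n IH].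
  by under eq_fun do under eq_fun do rewrite expr0; exact: hbd_coef1.
under eq_fun do under eq_fun do rewrite exprS.
rewrite exprS -mulrA; apply: prod_hbd => //.
apply: (c_sqint_bd (M := (2 * (8 * rho)) ^+ n)) => [|x _].
  by apply: measurable_funX; exact: measurable_syn cB.
by rewrite normrX; apply: lerXn2r; rewrite ?nnegrE ?mulr_ge0 ?h.1// (syn_bd x cB).
Qed.

(** The n-th power of [syn c] has norm at most (2^(m+5) rho)^n <= 4^-n by the product estimate,
    against binomial coefficients of size C (3/2)^n. The series is dominated by C (3/8)^n, whose sum
    is below 2 C, uniformly in m, c and rho. *)
Lemma comp_hbd (mu : R) : exists2 B, 0 < B & forall m c rho, (2 <= m)%N -> hbd m c rho ->
  2 ^+ (m + 5) * rho <= 4^-1 -> hbd m (fun k => coef k (fun x => (1 + syn c x) `^ mu)) B.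
Proof.
have [C C0 hC] := bnc_le mu; have [C' C'0 hC'] := bns_cvg mu.
exists (2 * C) => [|m c rho m2 h hr]; first by rewrite mulr_gt0.
have cB := hbd_kbd m2 h; have small x := syn_small x m2 h hr.
have q : 0 < 3 / 4 :> R by lra.
have [M M0 hM] := powR_bounded (5 / 4) mu q.
have Isyn n : cinteg (fun x => syn c x ^+ n).
  apply: (c_integ_bd (M := 4^-1 ^+ n)) => [|x _].
    by apply: measurable_funX; exact: measurable_syn cB.
  by rewrite normrX; apply: lerXn2r; rewrite ?nnegrE ?invr_ge0.
have Ibns n : cinteg (fun x => bns mu n (syn c x)).
  by rewrite /bns; apply: c_integ_sum => i; exact: c_integZ.
have cv k : coef k (fun x => bns mu n.+1 (syn c x)) @[n --> \oo] -->
    coef k (fun x => (1 + syn c x) `^ mu).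
  apply: (@cvg_coef_unif _ _ _ (fun n => C' * (3 / 4) ^+ n)) => //.
  - apply: (c_integ_bd (M := M)) => [|x _]; last by apply: hM; have := small x; rewrite ler_norml; lra.
    exact: measurable_funS (measurable_powR_syn mu cB).
  - by move=> n x _; exact: hC'.
  - rewrite -(mulr0 C'); apply: cvgM; first exact: cvg_cst.
    by apply: cvg_expr; rewrite ger0_norm; lra.
apply: (hbd_lim _ cv) => n; set N := n.+1.
have -> : (fun k => coef k (fun x => bns mu N (syn c x))) =
    (fun k => \sum_(i < N) bnc mu i * coef k (fun x => syn c x ^+ i)).
  apply/funext => k; rewrite /bns coef_sum => [|i]; last exact: c_integZ.
  by apply: eq_bigr => i _; rewrite coefZ.
suff : hbd m (fun k => \sum_(i < N) bnc mu i * coef k (fun x => syn c x ^+ i))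
    (\sum_(i < N) C * (3 / 8) ^+ i).
  apply: hbd_le => //; rewrite -mulr_sumr mulrC ler_wpM2r ?(ltW C0)//.
  have := subrX1 (3 / 8 : R) N; have : 0 <= (3 / 8 : R) ^+ N by rewrite exprn_ge0.
  lra.
elim: N => [|n' IH].
  under eq_fun do rewrite big_ord0; rewrite big_ord0; split=> // s us.
  by rewrite big1 ?expr0n// => k _; rewrite ?expr0n mulr0.
under eq_fun do rewrite big_ord_recr; rewrite big_ord_recr /=; apply: hbdD => //.
apply: hbd_le (hbdZ (bnc mu n') (hbd_coef_exp n' m2 h)) => //.
apply: (@le_trans _ _ (C * (3 / 2) ^+ n' * 4^-1 ^+ n')).
  apply: ler_pM => //; first by rewrite exprn_ge0// mulr_ge0 ?exprn_ge0 ?h.1.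
  by apply: lerXn2r; rewrite ?nnegrE ?invr_ge0// mulr_ge0 ?exprn_ge0 ?h.1.
by rewrite -mulrA -exprMn (_ : 3 / 2 * 4^-1 = 3 / 8)//; field.
Qed.

(** The first factor is replaced by the synthesis of its coefficients, with which it agrees almost
    everywhere. *)
Lemma prod_hbd_ae m f g A B : (2 <= m)%N -> csqint f -> csqint g ->
  hbd m (fun k => coef k f) A -> hbd m (fun k => coef k g) B ->
  hbd m (fun k => coef k (fun x => f x * g x)) (2 ^+ (m + 5) * (A * B)).
Proof.
move=> m2 sf sg hf hg; have kf := hbd_kbd m2 hf; have ss := sqint_syn kf.
have fe := coef_eq_ae (c_sqint_integ sf) (c_sqint_integ ss) (fun k => esym (coef_syn k kf)).
apply: hbd_le (prod_hbd m2 hf sg hg) => // k.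
rewrite (@coef_ae _ _ (fun x => syn (fun k => coef k f) x * g x))//.
- exact: c_sqintM sf sg.
- exact: c_sqintM ss sg.
- by apply: filterS fe => x h cx; rewrite h.
Qed.

End Composition.

(** * Integration in time and convolutions *)

Section TimeIntegrals.
Context {R : realType}.
Local Notation leb := (@lebesgue_measure R).
Implicit Types (f g h Y y : R -> R) (a b s t T : R).

Lemma fin_itv a b : (leb `[a, b]%classic < +oo)%E.
Proof. by rewrite lebesgue_measure_itv; case: ifP => _; rewrite ltry. Qed.

(** Locally bounded measurable functions: the class to which the modes of the forcing belong,
    integrable on every bounded interval. *)
Definition lbm f := measurable_fun setT f /\
  forall T, exists M : R, forall t, `|t| <= T -> `|f t| <= M.

Definition llip f := forall T, exists2 L : R, 0 <= L &
  forall s t, `|s| <= T -> `|t| <= T -> `|f t - f s| <= L * `|t - s|.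

Lemma llip_continuous f : llip f -> continuous f.
Proof.
move=> hf t; have [L L0 hL] := hf (`|t| + 1).
apply/cvgrPdist_le => e e0; near=> s.
have st : `|t - s| <= Num.min 1 (e / (L + 1)).
  near: s; exists (Num.min 1 (e / (L + 1))) => [|s /ltW//].
  by rewrite /= lt_min ltr01 divr_gt0// ltr_wpDl.
move: st; rewrite le_min => /andP[st1 ste].
have s1 : `|s| <= `|t| + 1.
  by rewrite -lerBlDl; apply: le_trans (lerB_dist _ _) _; rewrite distrC.
apply: le_trans (hL _ _ s1 _) _; first by rewrite lerDl.
apply: le_trans (ler_wpM2l L0 ste) _.
rewrite mulrCA ger_pMr// ler_pdivrMr ?mul1r ?lerDl// ltr_wpDl//.
Unshelve. all: by end_near. Qed.

Lemma continuous_lbm f : continuous f -> lbm f.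
Proof.
move=> cf; split; first exact: continuous_measurable_fun.
move=> T.
have /compact_bounded [M [_ hM]] : compact (f @` `[- T, T]).
  by apply: continuous_compact; [exact: continuous_subspaceT|exact: segment_compact].
exists (M + 1) => t tT; apply: (hM (M + 1)); first by rewrite ltrDl.
by exists t => //; rewrite /= in_itv/= -ler_norml.
Qed.

Lemma lbm_cst (c : R) : lbm (fun=> c).
Proof. by split => // T; exists `|c|. Qed.

Lemma lbmM f g : lbm f -> lbm g -> lbm (fun t => f t * g t).
Proof.
move=> [mf bf] [mg bg]; split=> [|T]; first exact: measurable_funM.
have [M hM] := bf T; have [N hN] := bg T; exists (M * N) => t tT.
by rewrite normrM ler_pM// ?hM ?hN.
Qed.

Lemma lbmD f g : lbm f -> lbm g -> lbm (fun t => f t + g t).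
Proof.
move=> [mf bf] [mg bg]; split=> [|T]; first exact: measurable_funD.
have [M hM] := bf T; have [N hN] := bg T; exists (M + N) => t tT.
by apply: le_trans (ler_normD _ _) _; rewrite lerD ?hM ?hN.
Qed.

Lemma lbmZ (c : R) f : lbm f -> lbm (fun t => c * f t).
Proof. by move=> hf; apply: lbmM => //; exact: lbm_cst. Qed.

Lemma lbmB f g : lbm f -> lbm g -> lbm (fun t => f t - g t).
Proof. 
move=> hf hg; have -> : (fun t => f t - g t) = (fun t => f t + -1 * g t).
  by apply/funext => t; rewrite [-1 * _]mulN1r.
by apply: lbmD => //; exact: lbmZ.
Qed.

Lemma lbm_bd f a b : lbm f -> exists2 M : R, 0 <= M & forall t, a <= t <= b -> `|f t| <= M.
Proof.
move=> [_ hf]; have [M hM] := hf (`|a| + `|b|).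
exists `|M| => // t /andP[at_ tb]; apply: le_trans (hM t _) (ler_norm _).
rewrite ler_norml; have := ler_norm b; have := ler_norm (- a); rewrite normrN.
have := normr_ge0 a; have := normr_ge0 b; lra.
Qed.

Lemma lbm_integ f a b : lbm f -> integ leb `[a, b] f.
Proof.
move=> hf; have [M _ hM] := lbm_bd a b hf.
have m1 : measurable_fun `[a, b] f by apply: measurable_funS hf.1.
apply: (@integ_bd _ _ _ leb _ _ (fin_itv a b) f M m1) => //.
Qed.

Lemma Rint_itv_cst a b (c : R) : a <= b -> \int[leb]_(x in `[a, b]) c = c * (b - a).
Proof.
move=> ab; have e : leb `[a, b]%classic = (b - a)%:E.
  rewrite lebesgue_measure_itv /= lte_fin.
  by move: ab; rewrite le_eqVlt => /predU1P[->|->//]; rewrite ltxx subrr.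
rewrite Rintegral_cst//; congr (_ * _); exact: (congr1 fine e).
Qed.

Lemma norm_itv_le f a b (M : R) : a <= b -> lbm f -> (forall t, a <= t <= b -> `|f t| <= M) ->
  `|\int[leb]_(x in `[a, b]) f x| <= M * (b - a).
Proof.
move=> ab hf fM; rewrite -Rint_itv_cst//.
apply: norm_Rint_le => //; [exact: lbm_integ|exact/lbm_integ/lbm_cst].
Qed.

Lemma itv_split f a b c : a <= b <= c -> lbm f ->
  \int[leb]_(x in `[a, c]) f x = \int[leb]_(x in `[a, b]) f x + \int[leb]_(x in `[b, c]) f x.
Proof.
move=> /andP[ab bc] hf; apply/eqP; rewrite addrC -subr_eq; apply/eqP.
rewrite Rintegral_itvB ?bnd_simp//; last exact: (lbm_integ a c hf).
rewrite Rintegral_itv_obnd_cbnd//.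
apply: (@integrableS _ _ _ leb `[b, c]%classic `]b, c]%classic) => //.
  exact: subset_itv_oc_cc.
exact: lbm_integ.
Qed.

Lemma Rint_restr (A E : set R) f : E `<=` A ->
  \int[leb]_(x in A) (\1_E x * f x) = \int[leb]_(x in E) f x.
Proof.
move=> EA; rewrite -[in RHS](setIidr EA) Rintegral_mkcondr.
apply: eq_Rint => x _; rewrite patchE indicE; case: ifP => xE; rewrite ?mul1r ?mul0r//.
Qed.


(** Minkowski's inequality for integrals in weighted l2. Cauchy-Schwarz gives (int G)^2 <= (int phi)
    (int G^2 / phi) for each mode, and the weighted sum over the modes of G^2 / phi is at most
    phi. *)
Lemma hbd_Rint m (G : int * int * int -> R -> R) (phi : R -> R) a b :
  continuous phi -> (forall t, 0 < phi t) -> (forall k, lbm (G k)) ->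
  (forall t, a <= t <= b -> hbd m (G^~ t) (phi t)) ->
  hbd m (fun k => \int[leb]_(t in `[a, b]) G k t) (\int[leb]_(t in `[a, b]) phi t).
Proof.
move=> cphi phi0 lG hG; have lphi := continuous_lbm cphi.
have I0 : 0 <= \int[leb]_(t in `[a, b]) phi t by apply: Rintegral_ge0 => t _; exact: ltW.
split=> // s us.
have crs : continuous (fun t => Num.sqrt (phi t)).
  by move=> t; apply: continuous_comp; [exact: cphi|exact: sqrt_continuous].
have lrs := continuous_lbm crs.
have lri : lbm (fun t => (Num.sqrt (phi t))^-1).
  apply: continuous_lbm => t; apply: (@cvgV _ _ _ _ _ (Num.sqrt (phi t))); last exact: crs.
  by rewrite gt_eqF// sqrtr_gt0.
have sq f : lbm f -> sqint leb `[a, b] f.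
  by move=> lf; split; [apply: measurable_funS lf.1|apply: lbm_integ; exact: lbmM].
pose q k t : R := (Num.sqrt (phi t))^-1 * G k t.
have lq k : lbm (q k) by exact: lbmM.
have lq2 k : lbm (fun t => q k t ^+ 2) by exact: lbmM.
have mab : @measurable _ (measurableTypeR R) `[a, b]%classic by exact: measurable_itv.
have cs k : (\int[leb]_(t in `[a, b]) G k t) ^+ 2 <=
    \int[leb]_(t in `[a, b]) phi t * \int[leb]_(t in `[a, b]) (q k t ^+ 2).
  have h := cs_Rint mab (sq _ lrs) (sq _ (lq k)).
  rewrite (@eq_Rint _ _ _ leb _ (fun t => Num.sqrt (phi t) ^+ 2) phi) in h; last by move=> t _; rewrite sqr_sqrtr// ltW.
  apply: le_trans h; rewrite (@eq_Rint _ _ _ leb _ (fun t => Num.sqrt (phi t) * q k t) (G k))// => t _.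
  by rewrite /q mulVKf// gt_eqF// sqrtr_gt0.
rewrite expr2; apply: (@le_trans _ _ (\int[leb]_(t in `[a, b]) phi t *
   \int[leb]_(t in `[a, b]) \sum_(k <- s) jap k ^+ m * q k t ^+ 2)).
  rewrite (Rint_sum mab (fin_itv a b) _ (fun k => lbm_integ a b (lbmZ (jap k ^+ m) (lq2 k)))).
  rewrite mulr_sumr; apply: ler_sum => k _.
  rewrite (RintZ mab _ (lbm_integ a b (lq2 k))) [leRHS]mulrCA ler_wpM2l//.
  by rewrite exprn_ge0// ltW// jap_gt0.
rewrite ler_wpM2l//; apply: le_Rint => //.
- exact: (integ_sum mab (fin_itv a b) _ (fun k => lbm_integ a b (lbmZ (jap k ^+ m) (lq2 k)))).
- exact: lbm_integ.
move=> t; rewrite /= in_itv/= => tab.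
have -> : \sum_(k <- s) jap k ^+ m * q k t ^+ 2 = (phi t)^-1 * \sum_(k <- s) jap k ^+ m * G k t ^+ 2.
  rewrite mulr_sumr; apply: eq_bigr => k _.
  by rewrite /q exprMn exprVn sqr_sqrtr ?(ltW (phi0 t))// mulrCA.
by rewrite ler_pdivrMl//; exact: (hG t tab).2.
Qed.

Definition conv Y g t : R := \int[leb]_(s in `[0, t]) (Y (t - s) * g s).

Lemma itv_lt0 f t : t < 0 -> \int[leb]_(s in `[0, t]) f s = 0.
Proof. by move=> t0; rewrite set_itv_ge ?Rintegral_set0// bnd_simp -ltNge. Qed.

Lemma lbm_shift Y g t : continuous Y -> lbm g -> lbm (fun s => Y (t - s) * g s).
Proof.
move=> cY lg; apply: lbmM => //; apply: continuous_lbm => s.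
apply: continuous_comp; last exact: cY.
by apply: cvgB; [exact: cvg_cst|exact: cvg_id].
Qed.

(** An increment consists of the change of the kernel on the common interval and of the integral
    over the remaining one; both are controlled by local bounds on [g]. *)
Lemma llip_conv Y y g : (forall t, is_derive t (1 : R) Y (y t)) -> continuous y -> lbm g ->
  llip (conv Y g).
Proof.
move=> dY cy lg T.
have cY : continuous Y by move=> t; apply/differentiable_continuous/derivable1_diffP; apply: ex_derive.
have [M M0 hM] := lbm_bd 0 `|T| lg.
have [B B0 hB] := lbm_bd 0 `|T| (continuous_lbm cY).
have [B' B'0 hB'] := lbm_bd 0 `|T| (continuous_lbm cy).
exists (B * M + B' * M * `|T|) => [|s t]; first by rewrite addr_ge0 ?mulr_ge0.
suff key s' t' : s' <= t' -> `|t'| <= T ->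
    `|conv Y g t' - conv Y g s'| <= (B * M + B' * M * `|T|) * `|t' - s'|.
  move=> sT tT; have [st|/ltW ts] := leP s t; first exact: key.
  by rewrite distrC [`|t - s|]distrC; exact: key.
move=> {s t} st tT; have tT' : t' <= `|T| by apply: le_trans (ler_norm _) (le_trans tT (ler_norm _)).
have L0 : 0 <= B * M + B' * M * `|T| by rewrite addr_ge0 ?mulr_ge0.
have [t0|t0] := ltP t' 0.
  by rewrite /conv !itv_lt0 ?(le_lt_trans st)// subrr normr0 mulr_ge0.
have [s0|s0] := ltP s' 0.
  rewrite {2}/conv itv_lt0// subr0; apply: (@le_trans _ _ (B * M * (t' - 0))).
    apply: norm_itv_le => //; first exact: lbm_shift.
    move=> r /andP[r0 rt]; rewrite normrM ler_pM// ?hB ?hM//; [lra|].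
    by rewrite r0 (le_trans rt).
  apply: ler_pM; rewrite ?mulr_ge0 ?subr0// ?lerDl ?mulr_ge0//.
  by rewrite ger0_norm ?subr_ge0//; lra.
have e : conv Y g t' - conv Y g s' = \int[leb]_(r in `[0, s']) ((Y (t' - r) - Y (s' - r)) * g r) +
    \int[leb]_(r in `[s', t']) (Y (t' - r) * g r).
  rewrite /conv (@itv_split _ 0 s' t') ?s0//; last exact: lbm_shift.
  rewrite addrAC; congr (_ + _).
  rewrite -(RintB _ (lbm_integ _ _ (lbm_shift t' cY lg)) (lbm_integ _ _ (lbm_shift s' cY lg)))//.
  by apply: eq_Rint => r _; rewrite mulrBl.
rewrite e [leRHS]mulrDl [leRHS]addrC; apply: le_trans (ler_normD _ _) _; apply: lerD.
  apply: (@le_trans _ _ (B' * `|t' - s'| * M * (s' - 0))).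
    apply: norm_itv_le => //.
      have -> : (fun r => (Y (t' - r) - Y (s' - r)) * g r) =
         (fun r => Y (t' - r) * g r - Y (s' - r) * g r) by apply/funext => r; rewrite mulrBl.
      by apply: lbmB; exact: lbm_shift.
    move=> r /andP[r0 rs]; rewrite normrM ler_pM//; last by apply: hM; rewrite r0/=; lra.
    rewrite (_ : t' - s' = (t' - r) - (s' - r)); last by ring.
    have hd := @mvt_lip _ Y y 0 `|T| B'.
    apply: hd => //; lra.
  rewrite subr0 (_ : _ * s' = B' * M * `|t' - s'| * s'); last by ring.
  rewrite [leRHS](_ : _ = B' * M * `|t' - s'| * `|T|); last by ring.
  by rewrite ler_wpM2l ?mulr_ge0//; lra.
rewrite [X in _ <= _ * X]ger0_norm ?subr_ge0//; apply: norm_itv_le => //; first exact: lbm_shift.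
move=> r /andP[r0 rt]; rewrite normrM ler_pM// ?hB ?hM//; lra.
Qed.

End TimeIntegrals.

(** * Integral equations for a single mode *)

Section Duhamel.
Context {R : realType}.
Local Notation leb := (@lebesgue_measure R).
Implicit Types (f g h Y y w z : R -> R) (a b s t T lam : R).

Lemma is_derive_shift Y y a t : (forall t, is_derive t (1 : R) Y (y t)) ->
  is_derive t (1 : R) (fun s => Y (a + s)) (y (a + t)).
Proof.
move=> dY; have -> : (fun s => Y (a + s)) = Y \o (fun s => a + s * 1).
  by apply/funext => s /=; rewrite mulr1.
have h2 : is_derive (a + t * 1) (1 : R) Y (y (a + t)) by rewrite mulr1; exact: dY.
by have := @is_derive1_comp R _ (fun s : R => a + s * 1) t _ _ h2 (is_derive_affine a 1 t); rewrite mulr1.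
Qed.

Lemma deriv_continuous Y y : (forall t, is_derive t (1 : R) Y (y t)) -> continuous Y.
Proof.
by move=> dY t; apply/differentiable_continuous/derivable1_diffP; apply: ex_derive.
Qed.

Lemma llip_lbm f : llip f -> lbm f.
Proof. by move=> /llip_continuous; exact: continuous_lbm. Qed.

(* Differentiation under a convolution in integrated form; the double integral is exchanged over the triangle. *)
Lemma conv_int Y y g t : (forall t, is_derive t (1 : R) Y (y t)) -> continuous y -> lbm g -> 0 <= t ->
  conv Y g t = Y 0 * \int[leb]_(s in `[0, t]) g s + \int[leb]_(s in `[0, t]) conv y g s.
Proof.
move=> dY cy lg t0; have cY := deriv_continuous dY.
have [M M0 hM] := lbm_bd 0 t lg.
have [B B0 hB] := lbm_bd (- t) t (continuous_lbm cy).
pose E : set (R * R) := [set p | p.1 <= p.2].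
pose f (p : R * R) : R := \1_E p * (y (p.2 - p.1) * g p.1).
have mE : measurable E.
  rewrite (_ : E = (fun p : R * R => p.2 - p.1) @^-1` `[0, +oo[); last first.
    by apply/seteqP; split=> p; rewrite /E /= in_itv/= andbT subr_ge0.
  rewrite -[X in measurable X]setTI; apply: measurable_funB => //.
have mf : measurable_fun (`[0, t] `*` `[0, t]) f.
  apply: measurable_funS (_ : measurable_fun setT f) => //.
  apply: measurable_funM; first exact: measurable_indic.
  apply: measurable_funM; last by apply: (measurableT_comp lg.1).
  by apply: (measurableT_comp (continuous_measurable_fun cy)); apply: measurable_funB.
have bf p : (`[0, t] `*` `[0, t])%classic p -> `|f p| <= B * M.
  case: p => p q [/= /[!in_itv]/= /andP[p0 pt] /andP[q0 qt]].
  rewrite /f normrM -[leRHS]mul1r ler_pM//.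
    by rewrite indicE; case: (_ \in _); rewrite ?normr1 ?normr0.
  rewrite /= normrM; apply: ler_pM => //; [apply: hB; lra|apply: hM; lra].
have mi : @measurable _ (measurableTypeR R) `[0, t]%classic by exact: measurable_itv.
have [e1 e2] := Rint_fubini mi mi (fin_itv 0 t) (fin_itv 0 t) mf bf.
move: e1; rewrite e2 => e.
have -> : \int[leb]_(s in `[0, t]) conv y g s = \int[leb]_(y0 in `[0, t]) \int[leb]_(x in `[0, t]) f (x, y0).
  apply: eq_Rint => r; rewrite /= in_itv/= => /andP[r0 rt].
  rewrite /conv -(@Rint_restr _ `[0, t]); last by apply: subset_itvl; rewrite bnd_simp.
  apply: eq_Rint => s; rewrite /= in_itv/= => /andP[s0 st].
  rewrite /f !indicE; congr ((_ : bool)%:R * _).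
  by apply/idP/idP; rewrite !inE /E /= in_itv/= s0.
rewrite e -(RintZ mi _ (lbm_integ 0 t lg)).
have ef s : 0 <= s <= t -> \int[leb]_(r in `[0, t]) f (s, r) = (Y (t - s) - Y 0) * g s.
  move=> /andP[s0 st].
  have -> : \int[leb]_(r in `[0, t]) f (s, r) = \int[leb]_(r in `[0, t]) (\1_(`[s, t]) r * (y (- s + r) * g s)).
    apply: eq_Rint => r; rewrite /= in_itv/= => /andP[r0 rt].
    rewrite /f !indicE [- s + r]addrC; congr ((_ : bool)%:R * _).
    by apply/idP/idP; rewrite !inE /E /= in_itv/= rt ?andbT.
  rewrite Rint_restr; last by apply: subset_itvr; rewrite bnd_simp.
  have cys : continuous (fun r => y (- s + r)).
    move=> r; apply: continuous_comp; last exact: cy.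
    by apply: cvgD; [exact: cvg_cst|exact: cvg_id].
  rewrite (@eq_Rint _ _ _ leb _ _ (fun r => g s * y (- s + r))); last by move=> r _; rewrite mulrC.
  rewrite (RintZ _ _ (lbm_integ s t (continuous_lbm cys)))//.
  rewrite (ftc2 st (fun r => is_derive_shift (- s) r dY) cys) addNr [- s + t]addrC; ring.
rewrite [X in _ + X](_ : _ = \int[leb]_(s in `[0, t]) (Y (t - s) * g s - Y 0 * g s)); last first.
  by apply: eq_Rint => s; rewrite /= in_itv/= => /ef ->; rewrite mulrBl.
rewrite (RintB mi (lbm_integ 0 t (lbm_shift t cY lg)) (lbm_integ 0 t (lbmZ _ lg))).
by rewrite addrC subrK.
Qed.

Lemma expR_cont (a : R) : continuous (fun s => expR (a * s)).
Proof.
move=> s; apply: continuous_comp; last exact: continuous_expR.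
by apply: cvgM; [exact: cvg_cst|exact: cvg_id].
Qed.

Lemma is_derive_expRZ a t : is_derive t (1 : R) (fun s => expR (a * s)) (a * expR (a * t)).
Proof.
have -> : (fun s => expR (a * s)) = expR \o (fun s => 0 + s * a).
  by apply/funext => s /=; rewrite add0r mulrC.
have h2 : is_derive (0 + t * a) (1 : R) expR (expR (a * t)) by rewrite add0r mulrC; exact: is_derive_expR.
by have := @is_derive1_comp R _ (fun s : R => 0 + s * a) t _ _ h2 (is_derive_affine 0 a t); rewrite mulrC.
Qed.

Lemma int_expR_le a t : 0 < a -> 0 <= t -> \int[leb]_(s in `[0, t]) expR (a * s) <= expR (a * t) / a.
Proof.
move=> a0 t0.
have h s : is_derive s (1 : R) (fun s => a^-1 * expR (a * s)) (expR (a * s)).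
  have -> : (fun s => a^-1 * expR (a * s)) = a^-1 *: (fun s => expR (a * s)) by [].
  have -> : expR (a * s) = a^-1 *: (a * expR (a * s)) by rewrite /GRing.scale /= mulKf ?gt_eqF.
  by apply: is_deriveZ; exact: is_derive_expRZ.
rewrite (ftc2 t0 h (@expR_cont a)) mulr0 expR0 mulr1 mulrC gerDl oppr_le0 invr_ge0 ltW//.
Qed.

Lemma geom_eq0 (x C : R) : (forall n, `|x| <= C * 2^-1 ^+ n) -> x = 0.
Proof.
move=> h; apply/eqP; rewrite -normr_le0.
apply: (@cvg_ge_bd _ (fun n => C * 2^-1 ^+ n) _ _ 0%N) => [|n _]; last exact: h.
rewrite -(mulr0 C); apply: cvgM; first exact: cvg_cst.
by apply: cvg_expr; rewrite ger0_norm ?invr_ge0// invf_lt1// ltr1n.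
Qed.

(** Takes the place of Gronwall's lemma: with the weight exp(l t), l = 2 (1 + |A| + |B|), each
    substitution into the integral equations halves the bound. *)
Lemma mode_unique (A B : R) w z T : lbm w -> lbm z ->
  (forall t, 0 <= t <= T -> w t = \int[leb]_(s in `[0, t]) z s) ->
  (forall t, 0 <= t <= T -> z t = \int[leb]_(s in `[0, t]) (A * w s + B * z s)) ->
  forall t, 0 <= t <= T -> w t = 0.
Proof.
move=> lw lz ew ez.
have [M1 M10 h1] := lbm_bd 0 T lw; have [M2 M20 h2] := lbm_bd 0 T lz.
pose l : R := 2 * (1 + `|A| + `|B|).
have l0 : 0 < l by rewrite mulr_gt0// -addrA ltr_pwDl.
pose C := M1 + M2; have C0 : 0 <= C by rewrite addr_ge0.
have key n : forall t, 0 <= t <= T -> `|w t| <= C * 2^-1 ^+ n * expR (l * t) /\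
    `|z t| <= C * 2^-1 ^+ n * expR (l * t).
  elim: n => [|n IH] t tT; have /andP[t0 tT'] := tT.
    rewrite expr0 mulr1; have e1 : 1 <= expR (l * t) by rewrite -expR0 ler_expR mulr_ge0// ltW.
    have := h1 t tT; have := h2 t tT; rewrite /C; split; nra.
  pose q := C * 2^-1 ^+ n; have q0 : 0 <= q by rewrite mulr_ge0// exprn_ge0 ?invr_ge0.
  have le := lbmZ q (continuous_lbm (@expR_cont l)).
  have st s : `[0, t]%classic s -> 0 <= s <= T.
    by rewrite /= in_itv/= => /andP[-> st]; rewrite (le_trans st).
  have Ie : \int[leb]_(s in `[0, t]) (q * expR (l * s)) <= q * (expR (l * t) / l).
    rewrite (RintZ _ _ (lbm_integ 0 t (continuous_lbm (@expR_cont l))))// ler_wpM2l//.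
    exact: int_expR_le.
  have x0 := expR_ge0 (l * t).
  have bnd (f : R -> R) (c : R) : lbm f -> 0 <= c -> 2 * c <= l ->
     (forall s, 0 <= s <= T -> `|f s| <= c * (q * expR (l * s))) ->
     `|\int[leb]_(s in `[0, t]) f s| <= C * 2^-1 ^+ n.+1 * expR (l * t).
    move=> lf c0 cl hf.
    apply: (@le_trans _ _ (\int[leb]_(s in `[0, t]) (c * (q * expR (l * s))))).
      apply: norm_Rint_le => //; [exact: lbm_integ|exact: (lbm_integ 0 t (lbmZ c le))|].
      by move=> s /st; exact: hf.
    rewrite (RintZ _ _ (lbm_integ 0 t le))//; apply: le_trans (ler_wpM2l c0 Ie) _.
    rewrite exprSr; have : c / l <= 2^-1 by rewrite ler_pdivrMr//; lra.
    move=> cl2; rewrite (_ : c * _ = c / l * (q * expR (l * t))); last by ring.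
    rewrite [leRHS](_ : _ = 2^-1 * (q * expR (l * t))); last by rewrite /q; ring.
    by rewrite ler_wpM2r// mulr_ge0.
  split.
    rewrite ew//; apply: (bnd _ 1) => //; first by rewrite /l; have := normr_ge0 A; have := normr_ge0 B; lra.
    by move=> s sT; rewrite mul1r; exact: (IH s sT).2.
  rewrite ez//; apply: (bnd _ (`|A| + `|B|)).
  - by apply: lbmD; exact: lbmZ.
  - exact: addr_ge0.
  - rewrite /l; lra.
  - move=> s sT; apply: le_trans (ler_normD _ _) _; rewrite !normrM mulrDl.
    by have [i1 i2] := IH s sT; rewrite lerD// ler_wpM2l.
move=> t tT; apply: (@geom_eq0 _ (C * expR (l * t))) => n.
by rewrite mulrAC; exact: (key n t tT).1.
Qed.

End Duhamel.

(** * The damped oscillators and their Duhamel formula *)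

Section Modes.
Context {R : realType}.
Local Notation leb := (@lebesgue_measure R).
Local Notation K := (int * int * int)%type.
Variable Om : R.
Hypotheses (Om0 : 0 < Om) (Om1 : Om < 1).
Implicit Types (k : K) (f g w z : R -> R) (s t T : R) (c d h : K -> R) (m : nat).

(** The frequency of an underdamped oscillator: lam k >= 1 > Om^2 for k <> 0. Only the zero mode,
    with exponents 0 and -2 Om, is not oscillatory, hence the case distinction in [Sm] and [Dm]. *)
Let om k : R := Num.sqrt (lam k - Om ^+ 2).

(* [Sm k] solves S'' + 2 Om S' + lam k S = 0, S(0) = 0, S'(0) = 1, and [Dm k] is its derivative. *)
Definition Sm k t : R := if k == 0 then (2 * Om)^-1 * (1 - expR (- (2 * Om) * t))
  else (om k)^-1 * (expR (- Om * t) * sin (om k * t)).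

Definition Dm k t : R := if k == 0 then expR (- (2 * Om) * t)
  else expR (- Om * t) * cos (om k * t) - Om * Sm k t.

Let Om2 : Om ^+ 2 < 1. Proof. by rewrite expr_lt1// ltW. Qed.

Let om_sqr k : k != 0 -> om k ^+ 2 = lam k - Om ^+ 2.
Proof. by move=> k0; rewrite sqr_sqrtr//; have := @lam_ge1 R k k0; have := Om2; lra. Qed.

Let om_gt0 k : k != 0 -> 0 < om k.
Proof. by move=> k0; rewrite sqrtr_gt0; have := @lam_ge1 R k k0; have := Om2; lra. Qed.

Let is_derive_lin (a t : R) : is_derive t (1 : R) (fun s => a * s) a.
Proof.
have -> : (fun s => a * s) = (fun s => 0 + s * a) by apply/funext => s; rewrite add0r mulrC.
exact: is_derive_affine.
Qed.

Lemma is_derive_Sm k t : is_derive t (1 : R) (Sm k) (Dm k t).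
Proof.
have [->|k0] := eqVneq k 0.
  rewrite /Dm eqxx; have -> : Sm 0 = (2 * Om)^-1 *: (cst 1 - (fun s => expR (- (2 * Om) * s))).
    by apply/funext => s; rewrite /Sm eqxx.
  have := is_deriveZ (2 * Om)^-1 (is_deriveB (is_derive_cst (1 : R) t 1) (is_derive_expRZ (- (2 * Om)) t)).
  congr is_derive; rewrite /GRing.scale /= sub0r -mulNr opprK mulKf// gt_eqF// mulr_gt0//.
have -> : Sm k = (om k)^-1 *: ((fun s => expR (- Om * s)) * (fun s => sin (om k * s))).
  by apply/funext => s; rewrite /Sm (negPf k0).
have hs : is_derive t (1 : R) (fun s => sin (om k * s)) (cos (om k * t) * om k).
  exact: (@is_derive1_comp R sin (fun s => om k * s) t _ _ (is_derive_sin _) (is_derive_lin _ _)).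
have := is_deriveZ (om k)^-1 (is_deriveM (is_derive_expRZ (- Om) t) hs).
congr is_derive; rewrite /Dm /Sm (negPf k0) /GRing.scale /=.
by field; rewrite gt_eqF// om_gt0.
Qed.

Lemma is_derive_Dm k t : is_derive t (1 : R) (Dm k) (- lam k * Sm k t - 2 * Om * Dm k t).
Proof.
have [->|k0] := eqVneq k 0.
  rewrite lam0 oppr0 mul0r sub0r; have := is_derive_expRZ (- (2 * Om)) t.
  have -> : Dm 0 = (fun s => expR (- (2 * Om) * s)) by apply/funext => s; rewrite /Dm eqxx.
  by congr is_derive; rewrite mulNr.
have hc : is_derive t (1 : R) (fun s => cos (om k * s)) (- sin (om k * t) * om k).
  exact: (@is_derive1_comp R cos (fun s => om k * s) t _ _ (is_derive_cos _) (is_derive_lin _ _)).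
have e : Dm k = ((fun s => expR (- Om * s)) * (fun s => cos (om k * s))) - Om *: Sm k.
  by apply/funext => s; rewrite {1}/Dm (negPf k0).
rewrite [X in is_derive _ _ X _]e.
have := is_deriveB (is_deriveM (is_derive_expRZ (- Om) t) hc) (is_deriveZ Om (is_derive_Sm k t)).
congr is_derive; rewrite /Dm /Sm (negPf k0) /GRing.scale /=.
have -> : lam k = om k ^+ 2 + Om ^+ 2 by rewrite om_sqr// subrK.
by field; rewrite gt_eqF// om_gt0.
Qed.

Lemma Sm0 k : Sm k 0 = 0.
Proof. by rewrite /Sm; case: ifP; rewrite !mulr0 ?expR0 ?sin0 ?subrr !mulr0. Qed.

Lemma Dm0 k : Dm k 0 = 1.
Proof. by rewrite /Dm; case: ifP; rewrite ?Sm0 !mulr0 ?expR0 ?cos0 ?mulr1 ?subr0. Qed.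

(** The derivative of the mode energy is -Om ((z + Om y / 2)^2 + 2 z^2 + (lam k - Om^2 / 4) y^2),
    nonpositive because lam k >= 1 > Om^2. *)
Lemma energy_decr k (y z : R -> R) t : k != 0 -> (forall t, is_derive t (1 : R) y (z t)) ->
  (forall t, is_derive t (1 : R) z (- lam k * y t - 2 * Om * z t)) -> 0 <= t ->
  energy_mode Om k (y t) (z t) <= energy_mode Om k (y 0) (z 0).
Proof.
move=> k0 dy dz t0; have l1 := @lam_ge1 R k k0.
pose a : R -> R := z + Om / 2 *: y.
pose E : R -> R := a * a + (Om ^+ 2 / 4 + lam k) *: (y * y).
have EE s : E s = energy_mode Om k (y s) (z s) by [].
have dE s : is_derive s (1 : R) E (- (3 * Om * z s ^+ 2 + Om ^+ 2 * z s * y s + Om * lam k * y s ^+ 2)).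
  have da := is_deriveD (dz s) (is_deriveZ (Om / 2) (dy s)).
  have := is_deriveD (is_deriveM da da) (is_deriveZ (Om ^+ 2 / 4 + lam k) (is_deriveM (dy s) (dy s))).
  congr is_derive; rewrite -/a; have -> : a s = z s + Om / 2 * y s by [].
  by rewrite /GRing.scale /=; field.
rewrite -!EE; have [|c _ e] := @MVT_segment R E (fun s => - (3 * Om * z s ^+ 2 + Om ^+ 2 * z s * y s + Om * lam k * y s ^+ 2)) 0 t t0 (fun s _ => dE s).
  by apply: continuous_subspaceT; exact: deriv_continuous dE.
rewrite -subr_le0 e subr0 mulNr oppr_le0 mulr_ge0//.
have : 0 <= (z c + Om / 2 * y c) ^+ 2 by exact: sqr_ge0.
have := sqr_ge0 (z c); have := sqr_ge0 (y c); set Y := y c ^+ 2; set Z := z c ^+ 2 => Y0 Z0 h.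
have -> : 3 * Om * Z + Om ^+ 2 * z c * y c + Om * lam k * Y =
  Om * ((z c + Om / 2 * y c) ^+ 2 + 2 * Z + (lam k - Om ^+ 2 / 4) * Y) by rewrite /Y /Z; field.
apply: mulr_ge0 (ltW Om0) _; apply: addr_ge0; first by apply: addr_ge0 => //; rewrite mulr_ge0.
by apply: mulr_ge0 => //; have := Om2; lra.
Qed.

Lemma mode_bd k t : k != 0 -> 0 <= t -> lam k * Sm k t ^+ 2 <= 1 /\ `|Dm k t| <= 2.
Proof.
move=> k0 t0; have l1 := @lam_ge1 R k k0.
have := energy_decr k0 (is_derive_Sm k) (is_derive_Dm k) t0.
rewrite Sm0 Dm0 /energy_mode; set S := Sm k t; set D := Dm k t.
rewrite !mulr0 addr0 expr0n mulr0 addr0 expr1n => h.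
have h1 : 0 <= (D + Om / 2 * S) ^+ 2 by exact: sqr_ge0.
have S0 : 0 <= S ^+ 2 by exact: sqr_ge0.
have O2 : 0 <= Om ^+ 2 / 4 by rewrite divr_ge0 ?sqr_ge0.
have a1 : lam k * S ^+ 2 <= 1 by nra.
split=> //; rewrite -(ler_pXn2r (n := 2))// ?nnegrE// real_normK ?num_real//.
have -> : D ^+ 2 = (D + Om / 2 * S) ^+ 2 - Om * (D + Om / 2 * S) * S + Om ^+ 2 / 4 * S ^+ 2 by field.
have b1 : (D + Om / 2 * S) ^+ 2 <= 1 by nra.
have b2 : S ^+ 2 <= 1 by nra.
move: b1 h1; set X := D + Om / 2 * S => b1 h1.
have := sqr_ge0 (X + Om / 2 * S); have : Om ^+ 2 / 4 * S ^+ 2 <= 1 by have := Om2; nra.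
by move=> q1 q2; lra.
Qed.

(** The summand 2 serves the modes k <> 0, where jap k <= 2 lam k. The summand 1/Om serves the zero
    mode, which has no restoring force and which the forcing may excite although the data do not. *)
Definition CS : R := 2 + Om^-1.

Let CS_gt0 : 0 < CS. Proof. by rewrite addr_gt0// invr_gt0. Qed.

Lemma mode0_bd t : 0 <= t -> `|Sm 0 t| <= Om^-1 /\ `|Dm 0 t| <= 1.
Proof.
move=> t0; rewrite /Sm /Dm eqxx.
have e0 := expR_ge0 (- (2 * Om) * t).
have e1 : expR (- (2 * Om) * t) <= 1 by rewrite -expR0 ler_expR mulNr oppr_le0 !mulr_ge0// ltW.
split; last by rewrite ger0_norm.
have i0 : 0 < (2 * Om)^-1 by rewrite invr_gt0 mulr_gt0.
rewrite ger0_norm ?mulr_ge0 ?subr_ge0 ?(ltW i0)//.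
have iO : 0 < Om^-1 by rewrite invr_gt0.
have : (2 * Om)^-1 = 2^-1 * Om^-1 by rewrite invfM.
nra.
Qed.

Lemma Sm_bd k t : 0 <= t -> jap k * Sm k t ^+ 2 <= CS ^+ 2.
Proof.
move=> t0; have iO : 0 < Om^-1 by rewrite invr_gt0.
have [->|k0] := eqVneq k 0.
  have [h _] := mode0_bd t0; rewrite /jap lam0 addr0 mul1r -real_normK ?num_real//.
  by apply: lerXn2r; rewrite ?nnegrE ?(ltW CS_gt0)// /CS; lra.
have [h _] := mode_bd k0 t0; have l1 := @lam_ge1 R k k0.
have S0 : 0 <= Sm k t ^+ 2 by exact: sqr_ge0.
rewrite /jap /CS; nra.
Qed.

Lemma Dm_bd k t : 0 <= t -> `|Dm k t| <= 2.
Proof.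
move=> t0; have [->|k0] := eqVneq k 0; last exact: (mode_bd k0 t0).2.
by apply: le_trans (mode0_bd t0).2 _; rewrite ler1n.
Qed.

(** The unforced flow with initial value [h0 k] and velocity [h1 k]: Dm + 2 Om Sm is the solution
    with data (1, 0). *)
Definition Ln h0 h1 k t : R := h0 k * (Dm k t + 2 * Om * Sm k t) + h1 k * Sm k t.
Definition Ld h0 h1 k t : R := h0 k * (- lam k * Sm k t) + h1 k * Dm k t.

Lemma is_derive_Ln h0 h1 k t : is_derive t (1 : R) (Ln h0 h1 k) (Ld h0 h1 k t).
Proof.
have -> : Ln h0 h1 k = h0 k *: (Dm k + (2 * Om) *: Sm k) + h1 k *: Sm k by [].
have := is_deriveD (is_deriveZ (h0 k) (is_deriveD (is_derive_Dm k t)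
  (is_deriveZ (2 * Om) (is_derive_Sm k t)))) (is_deriveZ (h1 k) (is_derive_Sm k t)).
by congr is_derive; rewrite /Ld /GRing.scale /=; ring.
Qed.

Lemma is_derive_Ld h0 h1 k t :
  is_derive t (1 : R) (Ld h0 h1 k) (- lam k * Ln h0 h1 k t - 2 * Om * Ld h0 h1 k t).
Proof.
have e : Ld h0 h1 k = (h0 k * - lam k) *: Sm k + h1 k *: Dm k.
  by apply/funext => s; rewrite /Ld mulrA.
rewrite [X in is_derive _ _ X _]e.
have := is_deriveD (is_deriveZ (h0 k * - lam k) (is_derive_Sm k t)) (is_deriveZ (h1 k) (is_derive_Dm k t)).
by congr is_derive; rewrite /Ld /Ln /GRing.scale /=; ring.
Qed.

Lemma Ln0 h0 h1 k : Ln h0 h1 k 0 = h0 k.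
Proof. by rewrite /Ln Sm0 Dm0 !mulr0 !addr0 mulr1. Qed.

Lemma Ld0 h0 h1 k : Ld h0 h1 k 0 = h1 k.
Proof. by rewrite /Ld Sm0 Dm0 !mulr0 add0r mulr1. Qed.

Lemma energy_Ln h0 h1 k t : h0 0 = 0 -> h1 0 = 0 -> 0 <= t ->
  energy_mode Om k (Ln h0 h1 k t) (Ld h0 h1 k t) <= energy_mode Om k (h0 k) (h1 k).
Proof.
move=> z0 z1 t0; have [->|k0] := eqVneq k 0.
  by rewrite /Ln /Ld z0 z1 !mul0r !addr0.
by have := energy_decr k0 (is_derive_Ln h0 h1 k) (is_derive_Ld h0 h1 k) t0; rewrite Ln0 Ld0.
Qed.

(** The energy of each mode does not increase and the zero mode is absent, so the position keeps the
    one order of regularity that it has over the velocity. *)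
Lemma Ln_hbd m h0 h1 (B0 B1 : R) t : h0 0 = 0 -> h1 0 = 0 -> 0 <= t ->
  hbd m.+1 h0 B0 -> hbd m h1 B1 ->
  hbd m.+1 (Ln h0 h1 ^~ t) (2 * (B0 + B1)) /\ hbd m (Ld h0 h1 ^~ t) (2 * (B0 + B1)).
Proof.
move=> z0 z1 t0 b0 b1; have B00 := b0.1; have B10 := b1.1.
have key k : jap k * Ln h0 h1 k t ^+ 2 <= 4 * h1 k ^+ 2 + 2 * (jap k * h0 k ^+ 2) /\
    Ld h0 h1 k t ^+ 2 <= 4 * h1 k ^+ 2 + 2 * (jap k * h0 k ^+ 2).
  have [->|k0] := eqVneq k 0.
    by rewrite /Ln /Ld z0 z1 !mul0r !addr0 expr0n !mulr0 addr0.
  have l1 := @lam_ge1 R k k0; have := energy_Ln k z0 z1 t0; rewrite /energy_mode /jap.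
  set y := Ln _ _ _ _; set z := Ld _ _ _ _; set a := h0 k; set b := h1 k => h.
  have oa : Om ^+ 2 * a ^+ 2 <= a ^+ 2 by rewrite -[leRHS]mul1r ler_wpM2r ?sqr_ge0// ltW.
  have a0 := sqr_ge0 a; have y0 := sqr_ge0 y; have o0 := sqr_ge0 Om.
  have oy : 0 <= Om ^+ 2 * y ^+ 2 by rewrite mulr_ge0.
  have ly : y ^+ 2 <= lam k * y ^+ 2 by rewrite ler_peMl.
  have up : (b + Om / 2 * a) ^+ 2 + (Om ^+ 2 / 4 + lam k) * a ^+ 2 <= 2 * b ^+ 2 + (1 + lam k) * a ^+ 2.
    have := sqr_ge0 (b - Om / 2 * a); lra.
  have z0' := sqr_ge0 (z + Om / 2 * y).
  split; first lra.
  have : z ^+ 2 <= 2 * (z + Om / 2 * y) ^+ 2 + 2 * (Om ^+ 2 / 4) * y ^+ 2.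
    have := sqr_ge0 (z + Om * y); lra.
  lra.
have sumb (F : K -> R) (s : seq K) : uniq s ->
    (forall k, F k <= jap k ^+ m * (4 * h1 k ^+ 2 + 2 * (jap k * h0 k ^+ 2))) ->
    \sum_(k <- s) F k <= (2 * (B0 + B1)) ^+ 2.
  move=> us hF; apply: (@le_trans _ _ (\sum_(k <- s)
     (4 * (jap k ^+ m * h1 k ^+ 2) + 2 * (jap k ^+ m.+1 * h0 k ^+ 2)))).
    by apply: ler_sum => k _; apply: le_trans (hF k) _; rewrite le_eqVlt [jap k ^+ m.+1]exprSr; apply/orP; left; apply/eqP; ring.
  rewrite big_split /= -!mulr_sumr; have := b0.2 s us; have := b1.2 s us.
  set X := \sum_(k <- s) _; set Y := \sum_(k <- s) _ => hX hY; nra.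
split; (split; first by rewrite mulr_ge0// addr_ge0) => s us; apply: sumb => // k.
  by rewrite [jap k ^+ m.+1]exprSr -mulrA ler_wpM2l ?(key k).1// exprn_ge0// ltW// jap_gt0.
by rewrite ler_wpM2l ?(key k).2// exprn_ge0// ltW// jap_gt0.
Qed.

Definition cc h0 h1 g k t : R := Ln h0 h1 k t + conv (Sm k) g t.
Definition vv h0 h1 g k t : R := Ld h0 h1 k t + conv (Dm k) g t.

Let dDm k t : R := - lam k * Sm k t - 2 * Om * Dm k t.

Let cDm k : continuous (Dm k). Proof. exact: deriv_continuous (is_derive_Dm k). Qed.
Let cSm k : continuous (Sm k). Proof. exact: deriv_continuous (is_derive_Sm k). Qed.
Let cdDm k : continuous (dDm k).
Proof.
move=> t; apply: cvgB; apply: cvgM; [exact: cvg_cst|exact: cSm|exact: cvg_cst|exact: cDm].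
Qed.

Lemma llip_convS g k : lbm g -> llip (conv (Sm k) g).
Proof. by move=> lg; apply: (llip_conv (is_derive_Sm k)). Qed.

Lemma llip_convD g k : lbm g -> llip (conv (Dm k) g).
Proof. by move=> lg; apply: (llip_conv (is_derive_Dm k) (@cdDm k)). Qed.

Lemma lbm_cc h0 h1 g k : lbm g -> lbm (cc h0 h1 g k).
Proof.
move=> lg; apply: lbmD; last exact/llip_lbm/llip_convS.
by apply: continuous_lbm; exact: deriv_continuous (is_derive_Ln h0 h1 k).
Qed.

Lemma lbm_vv h0 h1 g k : lbm g -> lbm (vv h0 h1 g k).
Proof.
move=> lg; apply: lbmD; last exact/llip_lbm/llip_convD.
by apply: continuous_lbm; exact: deriv_continuous (is_derive_Ld h0 h1 k).
Qed.

Lemma convS_int g k t : lbm g -> 0 <= t ->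
  conv (Sm k) g t = \int[leb]_(s in `[0, t]) conv (Dm k) g s.
Proof.
by move=> lg t0; rewrite (conv_int (is_derive_Sm k) (@cDm k) lg t0) Sm0 mul0r add0r.
Qed.

Lemma convD_int g k t : lbm g -> 0 <= t -> conv (Dm k) g t =
  \int[leb]_(s in `[0, t]) (g s - lam k * conv (Sm k) g s - 2 * Om * conv (Dm k) g s).
Proof.
move=> lg t0; rewrite (conv_int (is_derive_Dm k) (@cdDm k) lg t0) Dm0 mul1r.
have lS := llip_lbm (llip_convS k lg); have lD := llip_lbm (llip_convD k lg).
have e s : conv (dDm k) g s = - lam k * conv (Sm k) g s + - (2 * Om) * conv (Dm k) g s.
  have iS := lbm_integ 0 s (lbm_shift s (@cSm k) lg); have iD := lbm_integ 0 s (lbm_shift s (@cDm k) lg).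
  rewrite /conv -(RintZ _ _ iS)// -(RintZ _ _ iD)// -RintD//; [|exact: integZ|exact: integZ].
  by apply: eq_Rint => r _; rewrite /dDm; ring.
rewrite (@eq_Rint _ _ _ leb _ _ _ (fun s _ => e s)).
have l2 := lbmD (lbmZ (- lam k) lS) (lbmZ (- (2 * Om)) lD).
rewrite -(RintD _ (lbm_integ 0 t lg) (lbm_integ 0 t l2))//.
by apply: eq_Rint => r _; ring.
Qed.

Lemma cc_int h0 h1 g k t : lbm g -> 0 <= t ->
  cc h0 h1 g k t = h0 k + \int[leb]_(s in `[0, t]) vv h0 h1 g k s.
Proof.
move=> lg t0; rewrite /cc convS_int//.
have cL := deriv_continuous (is_derive_Ld h0 h1 k).
have := ftc2 t0 (is_derive_Ln h0 h1 k) cL; rewrite Ln0 => e.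
rewrite /vv (RintD _ (lbm_integ 0 t (continuous_lbm cL)) (lbm_integ 0 t (llip_lbm (llip_convD k lg))))//.
by rewrite e [RHS]addrA [h0 k + _]addrC subrK.
Qed.

(** The oscillator equation in integrated form, meaningful for a forcing that is only bounded and
    measurable in time. *)
Lemma vv_int h0 h1 g k t : lbm g -> 0 <= t -> vv h0 h1 g k t = h1 k +
  \int[leb]_(s in `[0, t]) (g s - lam k * cc h0 h1 g k s - 2 * Om * vv h0 h1 g k s).
Proof.
move=> lg t0; rewrite /vv convD_int//.
have cL := deriv_continuous (is_derive_Ln h0 h1 k).
have cL' := deriv_continuous (is_derive_Ld h0 h1 k).
have cLL : continuous (fun t => - lam k * Ln h0 h1 k t - 2 * Om * Ld h0 h1 k t).
  move=> s; apply: cvgB; apply: cvgM; [exact: cvg_cst|exact: cL|exact: cvg_cst|exact: cL'].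
have := ftc2 t0 (is_derive_Ld h0 h1 k) cLL; rewrite Ld0 => e.
have lS := llip_lbm (llip_convS k lg); have lD := llip_lbm (llip_convD k lg).
have l2 := lbmB (lbmB lg (lbmZ (lam k) lS)) (lbmZ (2 * Om) lD).
rewrite (_ : Ld _ _ _ _ = h1 k + (Ld h0 h1 k t - h1 k)); last by ring.
rewrite -e -addrA; congr (_ + _).
rewrite -(RintD _ (lbm_integ 0 t (continuous_lbm cLL)) (lbm_integ 0 t l2))//.
by apply: eq_Rint => s _; rewrite /cc; ring.
Qed.

Lemma duhamel_unique g k w z T : lbm g -> lbm w -> lbm z ->
  (forall t, 0 <= t <= T -> w t = \int[leb]_(s in `[0, t]) z s) ->
  (forall t, 0 <= t <= T -> z t = \int[leb]_(s in `[0, t]) (g s - lam k * w s - 2 * Om * z s)) ->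
  forall t, 0 <= t <= T -> w t = conv (Sm k) g t.
Proof.
move=> lg lw lz ew ez t tT; apply/eqP; rewrite -subr_eq0; apply/eqP; move: t tT.
have lS := llip_lbm (llip_convS k lg); have lD := llip_lbm (llip_convD k lg).
apply: (@mode_unique _ (- lam k) (- (2 * Om)) _ (fun t => z t - conv (Dm k) g t)).
- exact: lbmB.
- exact: lbmB.
- move=> t /andP[t0 tT]; rewrite ew ?t0// convS_int//.
  by rewrite -(RintB _ (lbm_integ 0 t lz) (lbm_integ 0 t lD)).
- move=> t /andP[t0 tT]; rewrite ez ?t0// convD_int//.
  have l1 := lbmB (lbmB lg (lbmZ (lam k) lw)) (lbmZ (2 * Om) lz).
  have l2 := lbmB (lbmB lg (lbmZ (lam k) lS)) (lbmZ (2 * Om) lD).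
  rewrite -(RintB _ (lbm_integ 0 t l1) (lbm_integ 0 t l2))//.
  by apply: eq_Rint => s _; ring.
Qed.

(** The kernel [Sm] gains one derivative since [jap k * Sm k t ^+ 2] is bounded uniformly in k and t
    >= 0, whereas [Dm] is merely bounded; Minkowski's inequality carries both bounds through the
    time integral. *)
Lemma conv_hbd m (g : K -> R -> R) (phi : R -> R) t : continuous phi -> (forall t, 0 < phi t) ->
  (forall k, lbm (g k)) -> 0 <= t ->
  (forall s, 0 <= s <= t -> hbd m (g^~ s) (phi s)) ->
  hbd m.+1 (fun k => conv (Sm k) (g k) t) (CS * \int[leb]_(s in `[0, t]) phi s) /\
  hbd m (fun k => conv (Dm k) (g k) t) (2 * \int[leb]_(s in `[0, t]) phi s).
Proof.
move=> cp p0 lg t0 hg; have ip := lbm_integ 0 t (continuous_lbm cp).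
rewrite -!(RintZ _ _ ip)//; split.
  apply: (@hbd_Rint _ _ (fun k s => Sm k (t - s) * g k s) (fun s => CS * phi s)).
  - by move=> s; apply: cvgM; [exact: cvg_cst|exact: cp].
  - by move=> s; rewrite mulr_gt0.
  - by move=> k; exact: lbm_shift.
  move=> s /[dup] st /hg [g0 hs]; split=> [|l ul]; first by rewrite mulr_ge0// ltW.
  rewrite exprMn; apply: le_trans (ler_wpM2l (sqr_ge0 _) (hs l ul)).
  rewrite mulr_sumr; apply: ler_sum => k _.
  have h := @Sm_bd k (t - s) ltac:(lra).
  rewrite exprMn [jap k ^+ m.+1]exprSr (_ : _ * _ = jap k ^+ m * g k s ^+ 2 * (jap k * Sm k (t - s) ^+ 2)); last by ring.
  by rewrite mulrC ler_wpM2r// mulr_ge0 ?sqr_ge0// exprn_ge0// ltW// jap_gt0.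
apply: (@hbd_Rint _ _ (fun k s => Dm k (t - s) * g k s) (fun s => 2 * phi s)).
- by move=> s; apply: cvgM; [exact: cvg_cst|exact: cp].
- by move=> s; rewrite mulr_gt0.
- by move=> k; exact: lbm_shift.
move=> s /[dup] st /hg [g0 hs]; split=> [|l ul]; first by rewrite mulr_ge0.
rewrite exprMn; apply: le_trans (ler_wpM2l (sqr_ge0 _) (hs l ul)).
rewrite mulr_sumr; apply: ler_sum => k _.
have h := @Dm_bd k (t - s) ltac:(lra).
rewrite exprMn mulrCA ler_wpM2r//; first by rewrite mulr_ge0 ?sqr_ge0// exprn_ge0// ltW// jap_gt0.
by rewrite -real_normK ?num_real//; apply: lerXn2r; rewrite ?nnegrE.
Qed.

End Modes.

(** * Coefficients as functions of time, and null sets on the torus *)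

Section TorusMeasure.
Context {R : realType}.
Local Notation R3 := (R * R * R)%type.
Local Notation K := (int * int * int)%type.
Local Notation leb := (@lebesgue_measure R).
Implicit Types (f g : R3 -> R) (x v : R3) (k : K) (t M : R).

(** Measurability in t comes from Tonelli's theorem for nonnegative functions: adding 2 M makes the
    integrand nonnegative, as |bas k| <= 2, and its integral is subtracted afterwards. *)
Lemma lbm_coef (f : R * R3 -> R) k M : measurable_fun setT f -> (forall p, `|f p| <= M) ->
  lbm (fun t => coef k (fun x => f (t, x))).
Proof.
move=> mf fM.
have mft t : measurable_fun setT (fun x => f (t, x)).
  exact: (measurableT_comp mf (measurable_pair1 t)).
have ift t : cinteg (fun x => f (t, x)).
  by apply: (@integ_bd _ _ _ leb3 cube mC fC _ M) => //; apply: measurable_funTS; exact: mft.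
split=> [|T]; last by exists (2 * M) => t _; apply: coef_norm_le.
have M0 : 0 <= M by apply: le_trans (fM (0, 0)).
pose h (p : R * R3) : R := \1_(@cube R) p.2 * (f p * bas k p.2 + 2 * M).
have h0 p : 0 <= h p.
  apply: mulr_ge0; first by rewrite indicE.
  have : `|f p * bas k p.2| <= M * 2 by rewrite normrM ler_pM// bas_bd.
  rewrite ler_norml; lra.
have mh : measurable_fun setT h.
  apply: measurable_funM.
    by apply: (measurableT_comp _ measurable_snd); apply: measurable_indic; exact: measurable_cube.
  apply: measurable_funD => //; apply: measurable_funM => //.
  by apply: (measurableT_comp (measurable_bas k (D := setT)) measurable_snd).
have mh' : measurable_fun setT (EFin \o h) by exact/measurable_EFinP.
have mG := @measurable_fun_fubini_tonelli_F _ _ _ _ R (prod_sf (prod_sf leb leb) leb) (EFin \o h)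
  mh' h0.
have mG2 : measurable_fun setT (fun t => vol^-1 * (fine (fubini_F (prod_sf (prod_sf leb leb) leb) (EFin \o h) t) - 2 * M * vol)).
  by apply: measurable_funM => //; apply: measurable_funB => //; exact: (measurableT_comp (fine_measurable measurableT) mG).
congr (measurable_fun _ _): mG2; apply/funext => t; rewrite /coef; congr (_ * _).
apply/eqP; rewrite subr_eq; apply/eqP.
have -> : 2 * M * vol = \int[leb3]_(x in cube) (2 * M : R).
  by rewrite (Rintegral_cst leb3 measurable_cube); congr (_ * _); rewrite (congr1 fine leb3_cube).
rewrite -(c_RintD (integ_mul_bas k (ift t)) (c_integ_cst _)) Rintegral_mkcond.
congr fine; apply: eq_integral => x _; rewrite /h /= patchE indicE.
by case: ifP => xc; rewrite ?mul1r ?mul0r.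
Qed.

Lemma shiftm (a : R) : measurable_fun setT (fun x : measurableTypeR R => (x + a : measurableTypeR R)).
Proof. by apply: measurable_funD. Qed.

Definition push d1 d2 (T1 : measurableType d1) (T2 : measurableType d2) (m : measure T1 R) (f : T1 -> T2)
  (mf : measurable_fun setT f) : measure T2 R :=
  measure_function_pushforward__canonical__measure_function_Measure m mf.

Lemma leb_shift (a : R) (A : set (measurableTypeR R)) : measurable A ->
  leb ((fun x : R => x + a) @^-1` A) = leb A.
Proof.
move=> mA; apply/esym; apply: (@lebesgue_measure_unique _ (push leb (shiftm a))) => // X [[p q] /= _ <-].
rewrite /push /= /pushforward.
have -> : (fun x : R => x + a) @^-1` `]p, q]%classic = `]p - a, q - a]%classic.
  by apply/seteqP; split=> x; rewrite /= !in_itv/= ltrBlDr lerBrDr.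
rewrite !lebesgue_measure_itv /= !lte_fin ltrD2r; case: ifP => // _.
by rewrite -!EFinD; congr EFin; ring.
Qed.

Let shift3 v x : R3 := x + v.

Local Notation mR := (measurableTypeR R).

Let leb3_shift v (A : set (mR * mR * mR)%type) : measurable A -> leb3 (shift3 v @^-1` A) = leb3 A.
Proof.
case: v => [[a b] c].
pose s2 (p : (mR * mR)%type) : (mR * mR)%type := (p.1 + a, p.2 + b).
have ms2 : measurable_fun setT s2.
  by apply/measurable_fun_pair; apply: measurable_funD.
pose s3 (p : (mR * mR * mR)%type) : (mR * mR * mR)%type := (s2 p.1, p.2 + c).
have ms3 : measurable_fun setT s3.
  apply/measurable_fun_pair; first exact: (measurableT_comp ms2).
  by apply: measurable_funD.
have e2 (A2 : set (mR * mR)%type) : measurable A2 -> (leb \x leb)%E (s2 @^-1` A2) = (leb \x leb)%E A2.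
  move=> mA; apply/esym; apply: (@product_measure_unique _ _ _ _ _ leb leb (push (leb \x leb)%E ms2)) => // X Y mX mY.
  rewrite /push /= /pushforward.
  have -> : s2 @^-1` (X `*` Y) = ((fun x : R => x + a) @^-1` X) `*` ((fun x : R => x + b) @^-1` Y) by [].
  rewrite product_measure1E; first by congr (_ * _)%E; exact: leb_shift.
    by rewrite -[X in measurable X]setTI; exact: (shiftm a).
  by rewrite -[X in measurable X]setTI; exact: (shiftm b).
move=> mA; apply/esym; apply: (@product_measure_unique _ _ _ _ _ (prod_sf leb leb) leb (push leb3 ms3)) => // X Y mX mY.
rewrite /push /= /pushforward.
have -> : s3 @^-1` (X `*` Y) = (s2 @^-1` X) `*` ((fun x : mR => x + c : mR) @^-1` Y) by [].
have m1 : measurable (s2 @^-1` X) by rewrite -[X in measurable X]setTI; exact: ms2.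
have m2 : measurable ((fun x : mR => (x + c : mR)) @^-1` Y).
  by rewrite -[X in measurable X]setTI; exact: (shiftm c).
apply: (eq_trans (@product_measure1E _ _ _ _ _ (prod_sf leb leb) leb _ _ m1 m2)).
congr (_ * _)%E; [exact: e2|exact: leb_shift].
Qed.

(** The exceptional set lies in the union of the translates of a null set by the countable lattice
    of periods, and translations preserve the measure. *)
Lemma ae_cube_periodic f g : torus_periodic f -> torus_periodic g ->
  {ae @leb3 R, forall x, cube x -> f x = g x} -> {ae @leb3 R, forall x, f x = g x}.
Proof.
move=> pf pg [N [mN N0 hN]].
pose tr k : R3 := (k.1.1%:~R * (2 * pi), k.1.2%:~R * (2 * pi), k.2%:~R * (2 * pi)).
have perZ (h : R3 -> R) i (z : int) x : torus_periodic h -> h (x + (z%:~R * (2 * pi)) *: unit_vec i) = h x.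
  move=> ph; have nat1 (n : nat) y : h (y + (n%:R * (2 * pi)) *: unit_vec i) = h y.
    elim: n y => [|n IH] y; first by rewrite mul0r scale0r addr0.
    by rewrite -natr1 mulrDl mul1r scalerDl addrA ph.
  case: z => n; first exact: nat1.
  by rewrite NegzE rmorphN /= mulNr scaleNr -(nat1 n.+1 (x - _)) subrK.
have per (h : R3 -> R) k x : torus_periodic h -> h (x + tr k) = h x.
  move=> ph; have -> : tr k = (k.1.1%:~R * (2 * pi)) *: unit_vec 0 + (k.1.2%:~R * (2 * pi)) *: unit_vec 1
      + (k.2%:~R * (2 * pi)) *: unit_vec 2.
    rewrite /tr /unit_vec; congr (_, _, _) => /=; rewrite ?eqxx /=;
    by rewrite /GRing.scale /= ?mulr1 ?mulr0 ?addr0 ?add0r.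
  by rewrite !addrA !perZ.
have fl (y : R) : exists z : int, 0 <= y + z%:~R * (2 * pi) <= 2 * pi.
  have p0 : 0 < 2 * pi :> R by rewrite mulr_gt0// pi_gt0.
  exists (- Num.floor (y / (2 * pi))).
  have h1 := floor_le (y / (2 * pi)); have h2 := floorD1_gt (y / (2 * pi)).
  rewrite rmorphN /= mulNr; set z := (Num.floor _)%:~R.
  move: h1 h2; rewrite intrD -/z ler_pdivlMr// ltr_pdivrMr// => h1 h2.
  by rewrite subr_ge0 h1 /= lerBlDr; lra.
have red x : exists k, cube (x + tr k).
  have [z1 h1] := fl x.1.1; have [z2 h2] := fl x.1.2; have [z3 h3] := fl x.2.
  by exists (z1, z2, z3); rewrite /cube /tr /= !in_itv/= h1 h2 h3.
pose F (n : nat) : set R3 := if unpickle n is Some k then shift3 (tr k) @^-1` N else set0.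
have nF n : (leb3 : {measure set _ -> \bar R}).-negligible (F n).
  rewrite /F; case: unpickle => [k|]; last exact: negligible_set0.
  apply/negligibleP.
    rewrite -[X in measurable X]setTI.
    have m3 : measurable_fun setT (shift3 (tr k)).
      apply/measurable_fun_pair; last by apply: measurable_funD.
      by apply/measurable_fun_pair; apply: measurable_funD => //; apply: measurableT_comp.
    exact: m3.
  by rewrite -[RHS]N0; exact: leb3_shift.
apply: negligibleS (negligible_bigcup nF) => x /= fg.
have [k hk] := red x; exists (pickle k); first exact: I.
rewrite /F pickleK; apply: hN => h.
by apply: fg; rewrite -(per f k x pf) -(per g k x pg); exact: h hk.
Qed.

(** Continuous functions that differ at a point differ on a small box, which has positive
    measure. *)
Lemma continuous_ae_eq f g : continuous f -> continuous g ->
  {ae @leb3 R, forall x, f x = g x} -> f =1 g.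
Proof.
move=> cf cg [N [mN N0 hN]] x; apply: contrapT => fg.
have /= nb : nbhs x [set y | f y != g y].
  have /cvgrPdist_lt c : (f y - g y) @[y --> x] --> f x - g x by apply: cvgB; [exact: cf|exact: cg].
  have : 0 < `|f x - g x| by rewrite normr_gt0 subr_eq0; apply/eqP.
  move=> /c; apply: filterS => y /=; apply: contraTneq => ->.
  by rewrite /= subrr subr0 ltxx.
have [e /= e0 he] := (nbhs_ballP _ _).1 nb.
pose B : set R3 := (`[x.1.1, x.1.1 + e / 2] `*` `[x.1.2, x.1.2 + e / 2]) `*` `[x.2, x.2 + e / 2].
have e2 : 0 < e / 2 by rewrite divr_gt0.
have BN : B `<=` N.
  move=> y [[/= + +] +]; rewrite !in_itv/= => /andP[a1 a2] /andP[b1 b2] /andP[c1 c2].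
  apply: hN => /= eq; have : f y != g y; last by rewrite eq eqxx.
  apply: he; split; first split; rewrite /= /ball /= ltr_norml; lra.
have mB : measurable B by apply: measurableX => //; apply: measurableX.
have : leb3 B = ((e / 2) ^+ 3)%:E.
  have li (a : R) : leb `[a, a + e / 2]%classic = (e / 2)%:E.
    by rewrite lebesgue_measure_itv /= lte_fin ltrDl e2 -EFinD addrAC subrr add0r.
  rewrite /leb3 (@product_measure1E _ _ _ _ _ (prod_sf leb leb) leb)//; last exact: measurableX.
  have q : (leb \x leb)%E (`[x.1.1, x.1.1 + e / 2]%classic `*` `[x.1.2, x.1.2 + e / 2]%classic) = ((e / 2) ^+ 2)%:E.
    by rewrite product_measure1E//; apply: (eq_trans (congr2 _ (li _) (li _))); rewrite -EFinM.
  by apply: (eq_trans (congr2 _ q (li _))); rewrite -EFinM -exprSr.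
have : (leb3 B <= leb3 N)%E by apply: (@le_measure _ _ _ leb3); rewrite ?inE.
rewrite N0 => h h2; move: h; rewrite h2 lee_fin leNgt exprn_gt0//.
Qed.

End TorusMeasure.

(** * The forcing term and Picard iteration *)

Section Forcing.
Context {R : realType}.
Local Notation R3 := (R * R * R)%type.
Local Notation K := (int * int * int)%type.
Local Notation leb := (@lebesgue_measure R).
Implicit Types (f g : R3 -> R) (x : R3) (k : K) (t : R) (C D : R -> K -> R).

(** Bessel's inequality carries a pointwise Lipschitz bound over to the coefficients in l2. *)
Lemma coef_lip f g (p q : R3 -> R) (L X : R) (s : seq K) : csqint f -> csqint g ->
  csqint p -> csqint q -> 0 <= L -> (forall x, cube x -> `|f x - g x| <= L * `|p x - q x|) ->
  \int[leb3]_(x in cube) ((p x - q x) ^+ 2) <= vol * X ^+ 2 -> uniq s ->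
  \sum_(k <- s) (coef k f - coef k g) ^+ 2 <= (L * X) ^+ 2.
Proof.
move=> sf sg sp sq L0 lip hX us; have sd := c_sqintB sf sg; have sd' := c_sqintB sp sq.
rewrite -(ler_pM2l (@vol_gt0 R)); under eq_bigr do rewrite -coefB ?(c_sqint_integ _)//.
apply: le_trans (bessel us sd) _.
apply: (@le_trans _ _ (\int[leb3]_(x in cube) (L ^+ 2 * (p x - q x) ^+ 2))).
  apply: (c_le_Rint sd.2 (c_integZ _ sd'.2)) => x cx.
  rewrite -exprMn -real_normK ?num_real// -[leRHS]real_normK ?num_real//.
  apply: lerXn2r; rewrite ?nnegrE// normrM (ger0_norm L0); exact: lip.
rewrite (c_RintZ _ sd'.2) exprMn mulrCA ler_wpM2l ?sqr_ge0//.
Qed.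

Lemma int_expRN_le (a t : R) : 0 < a -> 0 <= t -> \int[leb]_(s in `[0, t]) expR (- a * s) <= a^-1.
Proof.
move=> a0 t0.
have h s : is_derive s (1 : R) (fun s => (- a)^-1 * expR (- a * s)) (expR (- a * s)).
  have -> : (fun s => (- a)^-1 * expR (- a * s)) = (- a)^-1 *: (fun s => expR (- a * s)) by [].
  have e : expR (- a * s) = (- a)^-1 *: (- a * expR (- a * s)).
    by rewrite /GRing.scale /= mulKf// oppr_eq0 gt_eqF.
  by rewrite [X in is_derive _ _ _ X]e; apply: is_deriveZ; exact: is_derive_expRZ.
rewrite (ftc2 t0 h (@expR_cont _ _)) mulr0 expR0 mulr1 invrN mulNr opprK addrC gerDl oppr_le0.
by rewrite mulr_ge0 ?expR_ge0// invr_ge0 ltW.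
Qed.

Lemma geom_cvg (u : nat -> R) (B : R) : (forall n j, `|u (n + j)%N - u n| <= B * 2^-1 ^+ n) ->
  cvgn u.
Proof.
move=> h; apply/cauchy_cvgP/cauchyP => e e0.
have c0 : (B * 2^-1 ^+ n) @[n --> \oo] --> (0 : R).
  rewrite -(mulr0 B); apply: cvgM; first exact: cvg_cst.
  by apply: cvg_expr; rewrite ger0_norm ?invr_ge0// invf_lt1// ltr1n.
move/cvgrPdist_lt : c0 => /(_ e e0) [N _ hN]; exists (u N); exists N => // n /= Nn.
rewrite /ball /= distrC -(subnKC Nn); apply: le_lt_trans (h N _) _.
by have := hN N (leqnn N); rewrite /= sub0r normrN; apply: le_lt_trans; exact: ler_norm.
Qed.

(** The exact counterpart on coefficients of an H^m norm at most [X]; [hbd] is equivalent to it only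
    up to constants. *)
Definition Vbd m (c : K -> R) (X : R) := 0 <= X /\ forall s : seq K, uniq s ->
  vol * \sum_(k <- s) Wm m k * c k ^+ 2 <= X ^+ 2.

Lemma Vbd_hbd m c (X : R) : Vbd m c X -> hbd m c (2 ^+ m * X).
Proof.
move=> [X0 h]; split=> [|s us]; first by rewrite mulr_ge0 ?exprn_ge0.
rewrite exprMn -exprM mulnC exprM (_ : 2 ^+ 2 = 4 :> R); last by rewrite -natrX.
apply: le_trans (ler_wpM2l (exprn_ge0 m (ler0n _ 4)) (h s us)).
rewrite mulrCA -[leLHS]mul1r ler_pM ?vol_ge1//.
  by apply: sumr_ge0 => k _; rewrite mulr_ge0 ?sqr_ge0// exprn_ge0// ltW// jap_gt0.
rewrite mulr_sumr; apply: ler_sum => k _; rewrite [leRHS]mulrA ler_wpM2r ?sqr_ge0//; exact: Wm_ge.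
Qed.

Lemma hbd_Vbd m c (A : R) : hbd m c A -> Vbd m c (Num.sqrt (vol * NA m) * A).
Proof.
move=> [A0 h]; split=> [|s us]; first by rewrite mulr_ge0 ?sqrtr_ge0.
rewrite exprMn sqr_sqrtr ?(mulr_ge0 (ltW vol_gt0) (ler0n _ _))// -[leRHS]mulrA.
rewrite ler_wpM2l ?(ltW vol_gt0)//; apply: le_trans (ler_wpM2l (ler0n _ _) (h s us)).
rewrite mulr_sumr; apply: ler_sum => k _; rewrite [leRHS]mulrA ler_wpM2r ?sqr_ge0//; exact: Wm_le.
Qed.

Lemma VbdD m c d (X Y : R) : Vbd m c X -> Vbd m d Y -> Vbd m (fun k => c k + d k) (X + Y).
Proof.
move=> [X0 hc] [Y0 hd]; split=> [|s us]; first exact: addr_ge0.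
have e (b : K -> R) : vol * \sum_(k <- s) Wm m k * b k ^+ 2 = \sum_(k <- s) (vol * Wm m k) * b k ^+ 2.
  by rewrite mulr_sumr; apply: eq_bigr => k _; rewrite mulrA.
rewrite e; apply: minkowski_sum => //; rewrite -?e ?hc ?hd// => k.
exact: (mulr_ge0 (ltW vol_gt0) (Wm_ge0 m k)).
Qed.

Variables (m : nat) (kappa mu eps : R) (a : R -> R3 -> R).
Hypotheses (hm : (2 <= m)%N) (kap0 : 0 < kappa) (eps0 : 0 < eps).
Hypothesis ma : measurable_fun ([set t : R | 0 <= t] `*` [set: R3]) (fun p : R * R3 => a p.1 p.2).
Hypothesis sa : forall t, 0 <= t -> sobolev m (a t).
Hypothesis na : forall t, 0 <= t -> Hnorm m (a t) <= eps.
Variables (Bmu Mp Lp rho : R).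
Hypotheses (Bmu0 : 0 < Bmu) (Mp0 : 0 < Mp) (Lp0 : 0 < Lp).
Hypothesis hBmu : forall (c : K -> R), hbd m c rho ->
  hbd m (fun k => coef k (fun x => (1 + syn c x) `^ mu)) Bmu.
Hypothesis hMp : forall y, 3 / 4 <= y <= 5 / 4 -> `|y `^ mu| <= Mp.
Hypothesis hLp : forall y z, 3 / 4 <= y <= 5 / 4 -> 3 / 4 <= z <= 5 / 4 ->
  `|z `^ mu - y `^ mu| <= Lp * `|z - y|.
Hypothesis hr : 2 ^+ (m + 5) * rho <= 4^-1.

(** The supremum bound that the Sobolev embedding gives for norm at most eps: 2^m from
    [sobolev_hbd], 8 from [hbd_kbd] and 2 from |bas k| <= 2. *)
Definition clipM : R := 16 * (2 ^+ m * eps).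
(** The value zero at negative times makes the clipped function bounded and measurable on all of R x
    R^3. *)
Definition clipa t x : R := if 0 <= t then Num.max (- clipM) (Num.min clipM (a t x)) else 0.

Lemma clipM_gt0 : 0 < clipM.
Proof. by rewrite !mulr_gt0 ?exprn_gt0. Qed.

Lemma clipa_bd t x : `|clipa t x| <= clipM.
Proof.
have := clipM_gt0; rewrite /clipa; case: ifP => _ M0; last by rewrite normr0 ltW.
rewrite ler_norml le_max lexx /= ge_max ge_min lexx /= andbT; lra.
Qed.

Lemma clipa_meas : measurable_fun setT (fun p : R * R3 => clipa p.1 p.2).
Proof.
have mE : measurable ([set t : R | 0 <= t] `*` [set: R3]).
  apply: measurableX => //; rewrite (_ : [set t : R | 0 <= t] = `[0, +oo[%classic)//.
  by apply/seteqP; split=> t; rewrite /= in_itv/= andbT.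
have h : measurable_fun ([set t : R | 0 <= t] `*` [set: R3])
    (fun p : R * R3 => Num.max (- clipM) (Num.min clipM (a p.1 p.2))).
  by apply: measurable_maxr => //; apply: measurable_minr.
move/(measurable_restrictT _ mE) : h; congr (measurable_fun _ _).
apply/funext => -[t x]; rewrite patchE /clipa /=.
have [t0|t0] := boolP (0 <= t); first by rewrite mem_set.
by rewrite memNset// => -[/= h _]; rewrite h in t0.
Qed.

Lemma csq_a t : 0 <= t -> csqint (a t).
Proof. by move=> /sa [h _]; exact: L2_sqint. Qed.

Lemma clipa_ae t : 0 <= t -> {ae @leb3 R, forall x, cube x -> clipa t x = a t x}.
Proof.
move=> t0; have ha := sobolev_hbd (sa t0) (na t0); have ka := hbd_kbd hm ha.
have sq := csq_a t0.
have := coef_eq_ae (c_sqint_integ sq) (c_sqint_integ (sqint_syn ka)) (fun k => esym (coef_syn k ka)).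
apply: filterS => x h cx; rewrite /clipa t0 h//.
have := syn_bd x ka; rewrite (_ : 2 * (8 * _) = clipM); last by rewrite /clipM; ring.
by rewrite ler_norml => /andP[h1 h2]; rewrite (min_r h2) (max_r h1).
Qed.

Lemma csq_clipa t : csqint (clipa t).
Proof.
apply: (c_sqint_bd (M := clipM)) => [|x _]; last exact: clipa_bd.
by apply: measurable_funTS; exact: (measurableT_comp clipa_meas (measurable_pair1 t)).
Qed.

Lemma clipa_hbd t : 0 <= t -> hbd m (fun k => coef k (clipa t)) (2 ^+ m * eps).
Proof.
move=> t0; apply: hbd_le (sobolev_hbd (sa t0) (na t0)) => // k.
by rewrite (coef_ae k (c_sqint_integ (csq_clipa t)) (c_sqint_integ (csq_a t0)) (clipa_ae t0)).
Qed.

Definition good C := (forall k, lbm (C^~ k)) /\ forall t, 0 <= t -> hbd m (C t) rho.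

(** Time is truncated at 0, since [C] is controlled for nonnegative times only; the forcing is then
    bounded and jointly measurable for all real times. *)
Definition ff C (p : R * R3) : R := expR (- kappa * Num.max 0 p.1) *
  (clipa p.1 p.2 * (1 + syn (C (Num.max 0 p.1)) p.2) `^ mu).

Definition GG C k t : R := coef k (fun x => ff C (t, x)).

Lemma good_range C t x : good C -> 3 / 4 <= 1 + syn (C (Num.max 0 t)) x <= 5 / 4.
Proof.
move=> [_ h]; have := syn_small x hm (h (Num.max 0 t) _) hr.
by rewrite le_max lexx => /(_ isT); rewrite ler_norml; lra.
Qed.

Lemma syn_curve_meas C : good C -> measurable_fun setT (fun p : R * R3 => syn (C (Num.max 0 p.1)) p.2).
Proof.
move=> [lC hC]; apply: (@measurable_fun_cvg _ _ _ _
  (fun n (p : R * R3) => tpoly (bx n) (C (Num.max 0 p.1)) p.2)) => [n|p _].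
  apply: measurable_sum => k; apply: measurable_funM.
    apply: (measurableT_comp (lC k).1 (measurable_maxr _ _)) => //.
  by apply: (measurableT_comp (measurable_bas k (D := setT)) measurable_snd).
apply: (cvg_syn (B := 8 * rho)); apply: (hbd_kbd hm); apply: hC.
by rewrite le_max lexx.
Qed.

Lemma ff_meas C : good C -> measurable_fun setT (ff C).
Proof.
move=> gC; apply: measurable_funM.
  apply: (measurableT_comp (continuous_measurable_fun (@expR_cont R (- kappa))) (measurable_maxr _ _)) => //.
apply: measurable_funM; first exact: clipa_meas.
apply: (measurableT_comp (measurable_powR mu)); apply: measurable_funD => //.
exact: syn_curve_meas.
Qed.

Lemma expN_le1 t : 0 <= expR (- kappa * Num.max 0 t) <= 1.
Proof.
rewrite expR_ge0 /= -expR0 ler_expR mulNr oppr_le0 mulr_ge0 ?(ltW kap0)//.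
by rewrite le_max lexx.
Qed.

Lemma ff_bd C p : good C -> `|ff C p| <= clipM * Mp.
Proof.
move=> gC; have /andP[e0 e1] := expN_le1 p.1.
rewrite /ff normrM (ger0_norm e0) -[leRHS]mul1r ler_pM// normrM ler_pM// ?clipa_bd// hMp//.
exact: good_range.
Qed.

Lemma csq_ff C t : good C -> csqint (fun x => ff C (t, x)).
Proof.
move=> gC; apply: (c_sqint_bd (M := clipM * Mp)) => [|x _]; last exact: ff_bd.
by apply: measurable_funTS; exact: (measurableT_comp (ff_meas gC) (measurable_pair1 t)).
Qed.

Lemma GG_lbm C k : good C -> lbm (GG C k).
Proof. by move=> gC; apply: (lbm_coef k (ff_meas gC)) => p; exact: ff_bd. Qed.

Definition AF : R := 2 ^+ (m + 5) * (2 ^+ m * eps * Bmu).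

Lemma AF_gt0 : 0 < AF.
Proof. by rewrite !mulr_gt0 ?exprn_gt0. Qed.

Lemma csq_pow C t : good C -> csqint (fun x => (1 + syn (C (Num.max 0 t)) x) `^ mu).
Proof.
move=> gC; apply: (c_sqint_bd (M := Mp)) => [|x _]; last by apply: hMp; exact: good_range.
apply: measurable_funTS; apply: (@measurable_powR_syn _ _ (8 * rho)).
by apply: (hbd_kbd hm); apply: gC.2; rewrite le_max lexx.
Qed.

Lemma GG_hbd C t : good C -> 0 <= t -> hbd m (GG C ^~ t) (AF * expR (- kappa * t)).
Proof.
move=> gC t0; have tt : Num.max 0 t = t by exact: max_r.
have hp : hbd m (fun k => coef k (fun x => (1 + syn (C (Num.max 0 t)) x) `^ mu)) Bmu.
  by rewrite tt; apply: hBmu; exact: gC.2.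
have := hbdZ (expR (- kappa * t)) (prod_hbd_ae hm (csq_clipa t) (csq_pow t gC) (clipa_hbd t0) hp).
rewrite ger0_norm ?expR_ge0// [X in hbd _ _ X]mulrC; apply: hbd_le => // k.
rewrite /GG /ff /= tt coefZ ?tt//.
by have := c_sqintM (csq_clipa t) (csq_pow t gC); rewrite tt.
Qed.

Definition LF : R := clipM * Lp.

Lemma LF_gt0 : 0 < LF. Proof. by rewrite mulr_gt0// clipM_gt0. Qed.

Lemma hbd0P (c : K -> R) (X : R) : hbd 0 c X <->
  0 <= X /\ forall s : seq K, uniq s -> \sum_(k <- s) c k ^+ 2 <= X ^+ 2.
Proof.
have e (s : seq K) : \sum_(k <- s) jap k ^+ 0 * c k ^+ 2 = \sum_(k <- s) c k ^+ 2.
  by apply: eq_bigr => k _; rewrite expr0 mul1r.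
by split=> -[X0 h]; split=> // s us; have := h s us; rewrite e.
Qed.

(** The high norms enter only through the range of 1 + u; the difference is measured in l2, where
    the pointwise Lipschitz bound of the power is enough. *)
Lemma GG_lip C D t (X : R) : good C -> good D -> 0 <= t ->
  hbd 0 (fun k => C t k - D t k) X -> hbd 0 (fun k => GG C k t - GG D k t) (LF * X).
Proof.
move=> gC gD t0 /hbd0P [X0 h]; apply/hbd0P; split=> [|s us].
  by rewrite mulr_ge0// ltW// LF_gt0.
have tt : Num.max 0 t = t by exact: max_r.
have kC := hbd_kbd hm (gC.2 t t0); have kD := hbd_kbd hm (gD.2 t t0).
apply: (coef_lip (p := syn (C t)) (q := syn (D t)) (csq_ff t gC) (csq_ff t gD)
  (sqint_syn kC) (sqint_syn kD)) => //; first exact: (ltW LF_gt0).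
  move=> x _; have /andP[e0 e1] := expN_le1 t; have rC := good_range t x gC; have rD := good_range t x gD.
  rewrite /ff /= -mulrBr normrM (ger0_norm e0) -mulrBr normrM -[leRHS]mul1r ler_pM//.
  rewrite /LF -mulrA ler_pM ?clipa_bd//; apply: le_trans (hLp rD rC) _.
  by rewrite tt (_ : 1 + syn (C t) x - (1 + syn (D t) x) = syn (C t) x - syn (D t) x)//; ring.
have kB := kbdD kC (kbdZ (-1) kD).
rewrite (@eq_Rint _ _ _ leb3 cube _ (fun x => syn (fun k => C t k + -1 * D t k) x ^+ 2)); last first.
  move=> x _; congr (_ ^+ 2); rewrite /syn -(ksumB (kbd_bas x kC) (kbd_bas x kD)).
  by apply: eq_ksum => k; ring.
apply: (Rint_sqr_syn kB) => l ul; apply: le_trans (h l ul).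
by apply: ler_sum => k _; rewrite ger0_norm ?sqr_ge0// mulN1r.
Qed.


Variables (Om : R) (h0 h1 : K -> R) (Xs q0 : R).
Hypotheses (Om0 : 0 < Om) (Om1 : Om < 1) (hrho : 2 ^+ m * Xs = rho).
Hypothesis hLn : forall t, 0 <= t -> Vbd m (Ln Om h0 h1 ^~ t) q0.
Hypothesis hslack : q0 + Num.sqrt (vol * NA m) * (CS Om * (AF / kappa)) <= Xs.

Let CS0 : 0 < CS Om. Proof. by rewrite addr_gt0// invr_gt0. Qed.

Definition Phi C t k : R := cc Om h0 h1 (GG C k) k t.

Let phiF (t : R) : R := AF * expR (- kappa * t).

Let phiF_cont : continuous phiF.
Proof. by move=> t; apply: cvgM; [exact: cvg_cst|exact: expR_cont]. Qed.

Let phiF_gt0 t : 0 < phiF t. Proof. by rewrite mulr_gt0 ?AF_gt0 ?expR_gt0. Qed.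

Let phiF_int t : 0 <= t -> 0 <= \int[leb]_(s in `[0, t]) phiF s <= AF / kappa.
Proof.
move=> t0; apply/andP; split; first by apply: Rintegral_ge0 => s _; exact: ltW.
rewrite (RintZ _ _ (lbm_integ 0 t (continuous_lbm (@expR_cont R (- kappa)))))//.
by rewrite ler_wpM2l ?(ltW AF_gt0)//; exact: int_expRN_le.
Qed.

Lemma convG_hbd C t : good C -> 0 <= t ->
  hbd m.+1 (fun k => conv (Sm Om k) (GG C k) t) (CS Om * (AF / kappa)) /\
  hbd m (fun k => conv (Dm Om k) (GG C k) t) (2 * (AF / kappa)).
Proof.
move=> gC t0; have /andP[i0 i1] := phiF_int t0.
have [h h'] := conv_hbd Om0 Om1 phiF_cont phiF_gt0 (fun k => GG_lbm k gC) t0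
  (fun s (hs : 0 <= s <= t) => GG_hbd gC (andP hs).1).
split; [apply: hbd_le h|apply: hbd_le h'] => //; by rewrite ler_wpM2l// ltW.
Qed.

(** The linear flow uses up [q0] and the Duhamel term the rest of [Xs]. Only the Duhamel term passes
    through the conversion from [hbd] to [Vbd]. *)
Lemma Phi_Vbd C t : good C -> 0 <= t -> Vbd m (Phi C t) Xs.
Proof.
move=> gC t0; have [h _] := convG_hbd gC t0.
have [V0 V1] := VbdD (hLn t0) (hbd_Vbd (hbd_le (leqnSn m) (lexx _) (fun k => lexx _) h)).
have X0 : 0 <= Xs := le_trans V0 hslack.
by split=> // s us; apply: le_trans (V1 s us) _; apply: lerXn2r; rewrite ?nnegrE.
Qed.

Lemma Phi_good C : good C -> good (Phi C).
Proof.
move=> gC; split=> [k|t t0]; first by apply: lbm_cc => //; exact: GG_lbm.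
by rewrite -hrho; apply: Vbd_hbd; exact: Phi_Vbd.
Qed.

Let lmb : R := 2 * CS Om * LF.

Let lmb0 : 0 < lmb. Proof. by rewrite !mulr_gt0 ?LF_gt0. Qed.

(** Integrating exp(lmb s) up to t gives at most exp(lmb t)/lmb, and lmb = 2 CS LF leaves the factor
    1/2 on the whole half-line. *)
Lemma Phi_contract C D (X : R) : good C -> good D -> 0 < X ->
  (forall s, 0 <= s -> hbd 0 (fun k => C s k - D s k) (X * expR (lmb * s))) ->
  forall t, 0 <= t -> hbd 0 (fun k => Phi C t k - Phi D t k) (X / 2 * expR (lmb * t)).
Proof.
move=> gC gD X0 h t t0.
have lGC k := GG_lbm k gC; have lGD k := GG_lbm k gD.
pose phi s : R := LF * X * expR (lmb * s).
have cphi : continuous phi by move=> s; apply: cvgM; [exact: cvg_cst|exact: expR_cont].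
have phi0 s : 0 < phi s by rewrite mulr_gt0 ?mulr_gt0 ?LF_gt0 ?expR_gt0.
have hg s : 0 <= s <= t -> hbd 0 (fun k => GG C k s - GG D k s) (phi s).
  by move=> /andP[s0 _]; rewrite /phi -mulrA; apply: GG_lip => //; exact: h.
have [hS _] := conv_hbd Om0 Om1 cphi phi0 (fun k => lbmB (lGC k) (lGD k)) t0 hg.
apply: hbd_le hS => //.
  rewrite (RintZ _ _ (lbm_integ 0 t (continuous_lbm (@expR_cont R lmb))))//.
  have e1 := int_expR_le lmb0 t0.
  apply: (@le_trans _ _ (CS Om * (LF * X * (expR (lmb * t) / lmb)))).
    by rewrite ler_wpM2l ?(ltW CS0)// ler_wpM2l// ltW// mulr_gt0 ?LF_gt0.
  rewrite le_eqVlt; apply/orP; left; apply/eqP; rewrite /lmb; field.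
  by rewrite !gt_eqF ?LF_gt0.
move=> k; rewrite /Phi /cc opprD addrACA subrr add0r /conv.
have cS : continuous (Sm Om k) := deriv_continuous (is_derive_Sm Om0 Om1 k).
rewrite -(RintB _ (lbm_integ 0 t (lbm_shift t cS (lGC k))) (lbm_integ 0 t (lbm_shift t cS (lGD k))))//.
by rewrite le_eqVlt; apply/orP; left; apply/eqP; congr `|_|; apply: eq_Rint => s _; rewrite mulrBr.
Qed.

Let Cn n : R -> K -> R := iter n Phi (fun t k => Ln Om h0 h1 k t).

Let Cn_good n : good (Cn n).
Proof.
elim: n => [|n IH]; last exact: Phi_good.
split=> [k|t t0]; first by apply: continuous_lbm; exact: deriv_continuous (is_derive_Ln Om0 Om1 h0 h1 k).
rewrite -hrho; apply: Vbd_hbd; have [V0 V1] := hLn t0.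
have q0X : q0 <= Xs.
  apply: le_trans hslack; rewrite lerDl.
  exact: (mulr_ge0 (sqrtr_ge0 _) (mulr_ge0 (ltW CS0) (divr_ge0 (ltW AF_gt0) (ltW kap0)))).
split=> [|s us]; first exact: le_trans q0X.
by apply: le_trans (V1 s us) _; apply: lerXn2r; rewrite ?nnegrE// (le_trans V0).
Qed.

Let B : R := CS Om * (AF / kappa).

Let B0 : 0 < B. Proof. by rewrite mulr_gt0// divr_gt0// AF_gt0. Qed.

Let p2 n : 0 < 2^-1 ^+ n :> R. Proof. by rewrite exprn_gt0// invr_gt0. Qed.

Let Cn_step n t : 0 <= t -> hbd 0 (fun k => Cn n.+1 t k - Cn n t k) (B * 2^-1 ^+ n * expR (lmb * t)).
Proof.
elim: n t => [|n IH] t t0; last first.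
  rewrite exprSr mulrA; apply: Phi_contract (Cn_good n.+1) (Cn_good n) _ IH _ t0.
  exact: (mulr_gt0 B0 (p2 n)).
have [h _] := convG_hbd (Cn_good 0) t0; apply: hbd_le h => //.
  by rewrite expr0 mulr1 ler_peMr ?(ltW B0)// -expR0 ler_expR mulr_ge0// ltW.
by move=> k; rewrite /= /Phi /cc addrC addKr.
Qed.

Let Cn_far n j t : 0 <= t ->
  hbd 0 (fun k => Cn (n + j) t k - Cn n t k) (2 * B * 2^-1 ^+ n * expR (lmb * t)).
Proof.
move=> t0; set E := expR _; have E0 : 0 < E by exact: expR_gt0.
have p0 : 0 < B * 2^-1 ^+ n * E := mulr_gt0 (mulr_gt0 B0 (p2 n)) E0.
suff : hbd 0 (fun k => Cn (n + j) t k - Cn n t k) (B * 2^-1 ^+ n * E * (2 - 2 * 2^-1 ^+ j)).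
  apply: hbd_le => //; rewrite (_ : 2 * B * _ * E = B * 2^-1 ^+ n * E * 2); last by ring.
  by rewrite ler_wpM2l ?(ltW p0)// gerBl mulr_ge0// exprn_ge0 ?invr_ge0.
elim: j => [|j IH].
  rewrite addn0 expr0 mulr1 subrr mulr0; apply/hbd0P; split=> // s us.
  by rewrite big1 ?expr0n// => k _; rewrite subrr expr0n.
have := hbdD (Cn_step (n + j) t0) IH; rewrite -/E -addnS; apply: hbd_le => //.
  rewrite exprD exprS le_eqVlt; apply/orP; left; apply/eqP; by field.
by move=> k; rewrite addnS addrA subrK.
Qed.

(** Each mode of the iterates converges geometrically and the exact bound passes to the limit on
    finite sums. The limit is a fixed point because [C] and [Phi C] are both within 2^-n, up to
    constants, of the same iterate. *)
Lemma picard : exists C, [/\ good C, forall t, 0 <= t -> Vbd m (C t) Xs &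
  forall t k, 0 <= t -> C t k = Phi C t k].
Proof.
have hb0 (c : K -> R) (X : R) k : hbd 0 c X -> `|c k| <= X.
  move=> /hbd0P [X0 /(_ [:: k] isT)]; rewrite big_seq1 => h.
  by rewrite -(ler_pXn2r (n := 2))// ?nnegrE// real_normK ?num_real.
have cvk t k : cvgn (fun n => Cn n t k).
  have [t0|t0] := leP 0 t.
    apply: (@geom_cvg _ (2 * B * expR (lmb * t))) => n j.
    by rewrite mulrAC; apply: (hb0 (fun k => Cn (n + j) t k - Cn n t k)); exact: Cn_far.
  (* For negative times the interval of integration is empty, so all iterates equal the linear
     flow. *)
  rewrite (_ : (fun n => Cn n t k) = cst (Ln Om h0 h1 k t)); first exact: is_cvg_cst.
  by apply/funext => -[|n]//=; rewrite /Phi /cc /conv itv_lt0// addr0.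
pose C t k : R := limn (fun n => Cn n t k).
have cC t k : Cn n t k @[n --> \oo] --> C t k by exact: cvk.
have VC t : 0 <= t -> Vbd m (C t) Xs.
  move=> t0; have Vn n : Vbd m (Cn n.+1 t) Xs by apply: Phi_Vbd => //; exact: Cn_good.
  split=> [|s us]; first exact: (Vn 0%N).1.
  apply: (@cvg_le_bd _ (fun n => vol * \sum_(k <- s) Wm m k * Cn n t k ^+ 2) _ _ 1%N) => [|[//|n] _].
    apply: cvgM; first exact: cvg_cst.
    by apply: cvg_sum_seq => k _; apply: cvgM; [exact: cvg_cst|apply: cvgM].
  exact: (Vn n).2.
have gC : good C.
  split=> [k|t t0]; last by rewrite -hrho; exact: Vbd_hbd (VC t t0).
  split.
    by apply: (@measurable_fun_cvg _ _ _ _ (fun n t => Cn n t k)) => [n|t _]; [exact: ((Cn_good n).1 k).1|exact: cC].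
  move=> T; have [M hM] := ((Cn_good 0).1 k).2 T; exists (8 * rho + `|M|) => t tT.
  have r0 : 0 <= rho by apply: le_trans ((Cn_good 0).2 0 (lexx _)).1 _.
  have [t0|t0] := leP 0 t.
    apply: (@le_trans _ _ (8 * rho)); last by rewrite lerDl.
    by apply: kbd1; apply: (hbd_kbd hm); rewrite -hrho; exact: Vbd_hbd (VC t t0).
  apply: (@le_trans _ _ `|M|); last by rewrite lerDr mulr_ge0.
  have -> : C t k = Cn 0 t k.
    rewrite /C (_ : (fun n => Cn n t k) = cst (Ln Om h0 h1 k t)); first exact: lim_cst.
    by apply/funext => -[|n]//=; rewrite /Phi /cc /conv itv_lt0// addr0.
  by apply: le_trans (hM t tT) (ler_norm _).
exists C; split=> // t k t0; apply/eqP; rewrite -subr_eq0; apply/eqP.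
have dC n s : 0 <= s -> hbd 0 (fun k => C s k - Cn n s k) (2 * B * 2^-1 ^+ n * expR (lmb * s)).
  move=> s0; apply: (hbd_lim (fun j => Cn_far n j s0)) => l.
  apply: cvgB; last exact: cvg_cst.
  by have := cC s l; rewrite -(cvg_shiftn n) /=; under eq_fun do rewrite addnC.
apply: (@geom_eq0 _ _ (2 * (2 * B * expR (lmb * t)))) => n.
have p0 : 0 < 2 * B * 2^-1 ^+ n := mulr_gt0 (mulr_gt0 (ltr0Sn R 1) B0) (p2 n).
have h2 := hb0 _ _ k (Phi_contract gC (Cn_good n) p0 (dC n) t0).
have h1' := hb0 _ _ k (dC n.+1 t t0).
rewrite (_ : C t k - Phi C t k = (C t k - Cn n.+1 t k) - (Phi C t k - Phi (Cn n) t k)); last first.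
  have -> : Cn n.+1 t k = Phi (Cn n) t k by [].
  by move: (C t k) (Phi C t k) (Phi (Cn n) t k) => x y z; ring.
apply: le_trans (ler_normB _ _) _; apply: le_trans (lerD h1' h2) _.
rewrite exprS (_ : _ + _ = 2 * B * expR (lmb * t) * 2^-1 ^+ n); last by field.
rewrite ler_wpM2r ?exprn_ge0 ?invr_ge0//; have := expR_gt0 (lmb * t) => e0.
have := mulr_gt0 (mulr_gt0 (ltr0Sn R 1) B0) e0; lra.
Qed.

End Forcing.

(** * From curves of coefficients to functions of space and time *)

Section Curves.
Context {R : realType}.
Local Notation R3 := (R * R * R)%type.
Local Notation K := (int * int * int)%type.
Local Notation leb := (@lebesgue_measure R).
Implicit Types (c d : K -> R) (x : R3) (k : K) (i j : 'I_3) (t s r A : R).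

Lemma syn_hbd_bd m c A x : (2 <= m)%N -> hbd m c A -> `|syn c x| <= 16 * A.
Proof. by move=> m2 /(hbd_kbd m2) /(syn_bd x); rewrite mulrA -natrM. Qed.

Lemma synB c d A B x : kbd c A -> kbd d B -> syn (fun k => c k - d k) x = syn c x - syn d x.
Proof.
move=> kc kd; rewrite /syn -(ksumB (kbd_bas x kc) (kbd_bas x kd)).
by apply: eq_ksum => k; rewrite mulrBl.
Qed.

Lemma synZ (a : R) c A x : kbd c A -> syn (fun k => a * c k) x = a * syn c x.
Proof.
move=> kc; rewrite /syn -(ksumZ a (kbd_bas x kc)).
by apply: eq_ksum => k; rewrite mulrA.
Qed.

Lemma synD c d A B x : kbd c A -> kbd d B -> syn (fun k => c k + d k) x = syn c x + syn d x.
Proof.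
move=> kc kd; rewrite /syn -(ksumD (kbd_bas x kc) (kbd_bas x kd)).
by apply: eq_ksum => k; rewrite mulrDl.
Qed.

Lemma kbdB c d A B : kbd c A -> kbd d B -> kbd (fun k => c k - d k) (A + B).
Proof.
move=> cA dB s us; apply: le_trans (lerD (cA s us) (dB s us)).
by rewrite -big_split; apply: ler_sum => k _; exact: ler_normB.
Qed.

Lemma continuous_future_eq (u w : R -> R3 -> R) : (forall t x, 0 <= t -> u t x = w t x) ->
  continuous_future u -> continuous_future w.
Proof.
move=> e /subspace_continuousP h; apply/subspace_continuousP => p Ap.
rewrite /from_subspace -(e p.1 p.2 Ap); apply: cvg_trans (h p Ap); apply: near_eq_cvg.
by rewrite near_withinE; apply: nearW => q Aq; exact: e.
Qed.

Lemma hbd_jap m c A : hbd m.+2 c A -> hbd m (fun k => jap k * c k) A.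
Proof.
move=> [A0 h]; split=> // s us; apply: le_trans (h s us); apply: ler_sum => k _.
by rewrite exprMn mulrA -exprD addn2.
Qed.

(** The coefficients of the i-th partial derivative of [syn c]. *)
Definition dk i c k : R := - kr k i * c (- k).

Lemma dk_hbd m i c A : hbd m.+1 c A -> hbd m (dk i c) A.
Proof.
move=> /hbdN [A0 h]; split=> // s us; apply: le_trans (h s us); apply: ler_sum => k _.
rewrite /dk exprMn sqrrN [jap k ^+ m.+1]exprSr -mulrA.
rewrite ler_wpM2l ?exprn_ge0 ?(ltW (jap_gt0 _))// ler_wpM2r ?sqr_ge0//.
by rewrite /jap /lam (bigD1 i)//= addrCA lerDl addr_ge0// sumr_ge0// => j _; exact: sqr_ge0.
Qed.

(** Along a line in direction i the series is differentiated term by term; order 3 leaves order 2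
    for the derivative, which is absolutely summable. *)
Lemma is_derive_syn i c A x : hbd 3 c A -> is_derive x (unit_vec i) (syn c) (syn (dk i c) x).
Proof.
move=> hc; have kc := hbd_kbd (isT : (2 <= 3)%N) hc.
have hd := dk_hbd i hc; have kd := hbd_kbd (leqnn 2) hd.
have h2 : hbd 2 (fun k => kr k i * c k) A.
  by apply: hbd_le (hbdN hd) => // k; rewrite /dk krN !opprK.
have k2 := hbd_kbd (leqnn 2) h2.
have e : x = x + 0 *: unit_vec i by rewrite scale0r addr0.
rewrite [X in is_derive X]e; apply/is_derive_line.
pose F k s : R := c k * bas k (x + s *: unit_vec i).
pose dF k s : R := c k * kr k i * bas (- k) (x + s *: unit_vec i).
have -> : syn (dk i c) x = ksum (dF^~ 0).
  rewrite /syn -ksumN; apply: eq_ksum => k; rewrite /dk /dF scale0r addr0 krN !opprK; ring.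
apply: (@is_derive_ksum _ F dF 0).
- by move=> k s; apply: (is_derive_line (fun x => c k * bas k x) _ _ _ _).1; exact: is_derive_Zbas.
- by move=> s; exists (2 * (8 * A)); exact: kbd_bas kc.
- move=> s; exists (2 * (8 * A)); apply: (@kbd_le _ _ (fun k => 2 * (kr k i * c k))).
    move=> k; rewrite /dF !normrM mulrC (mulrC `|c k|) ler_wpM2r ?mulr_ge0//.
    by rewrite (ger0_norm (ler0n _ 2)); exact: bas_bd.
  by have := kbdZ 2 k2; rewrite (ger0_norm (ler0n _ 2)).
- move=> e0 e0p; have [N hN] := hbd_ktail A (divr_gt0 e0p (ltr0Sn R 1)).
  exists N => s l ul lN; apply: (@le_trans _ _ (\sum_(k <- l) 2 * `|kr k i * c k|)).
    apply: ler_sum => k _; rewrite /dF normrM [c k * _]mulrC [leRHS]mulrC ler_wpM2l//; exact: bas_bd.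
  by rewrite -mulr_sumr mulrC -ler_pdivlMr//; exact: (hN 2 _ (leqnn 2) h2 l ul lN).
Qed.

Lemma partial_syn i c A : hbd 3 c A -> partial i (syn c) = syn (dk i c).
Proof. by move=> hc; apply/funext => x; apply: derive_val; exact: is_derive_syn hc. Qed.

Lemma laplacian_syn c A x : hbd 4 c A -> laplacian (syn c) x = syn (fun k => - (lam k * c k)) x.
Proof.
move=> hc; have h3 : hbd 3 c A by apply: hbd_le hc.
rewrite /laplacian (eq_bigr (fun i => syn (dk i (dk i c)) x)); last first.
  by move=> i _; rewrite (partial_syn i h3) (partial_syn i (dk_hbd i hc)).
have kd i := hbd_kbd (leqnn 2) (dk_hbd i (dk_hbd i hc)).
rewrite sum_ord3 -(synD x (kd 0) (kd 1)) -(synD x (kbdD (kd 0) (kd 1)) (kd 2)).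
congr (syn _ x); apply/funext => k; rewrite /dk /lam sum_ord3 !krN !opprK; ring.
Qed.

Lemma curve_future (C : R -> K -> R) A : (forall k, continuous (C^~ k)) ->
  (forall t, 0 <= t -> hbd 2 (C t) A) -> continuous_future (fun t => syn (C t)).
Proof.
move=> cC hC.
apply: (@ksum_within_continuous _ _ [set p : R * R3 | 0 <= p.1] (fun k p => C p.1 k * bas k p.2)).
- by move=> p /= p0; exists (2 * (8 * A)); apply: kbd_bas; exact: hbd_kbd (hC _ p0).
- move=> e e0; have [N hN] := hbd_ktail A (divr_gt0 e0 (ltr0Sn R 1)).
  exists N => p /= p0; have := ktail_bas p.2 (hN 2 _ (leqnn 2) (hC _ p0)).
  by rewrite mulrC divfK.
- move=> k; apply: continuous_subspaceT => p; apply: cvgM.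
    by apply: (@continuous_comp _ _ _ fst (C^~ k)); [exact: cvg_fst|exact: cC].
  by apply: (@continuous_comp _ _ _ snd (bas k)); [exact: cvg_snd|exact: continuous_bas].
Qed.

Lemma int_hbd m (F : K -> R -> R) A s t : s <= t -> 0 < A -> (forall k, lbm (F k)) ->
  (forall r, s <= r <= t -> hbd m (F^~ r) A) ->
  hbd m (fun k => \int[leb]_(r in `[s, t]) F k r) (A * (t - s)).
Proof.
move=> st A0 lF hF; rewrite -Rint_itv_cst//.
by apply: (@hbd_Rint _ _ F (fun=> A)) => //; move=> r; exact: cvg_cst.
Qed.

Lemma curve_lip m (Y : R -> K -> R) (F : K -> R -> R) A : 0 < A -> (forall k, lbm (F k)) ->
  (forall r, 0 <= r -> hbd m (F^~ r) A) ->
  (forall k t, 0 <= t -> Y t k = Y 0 k + \int[leb]_(r in `[0, t]) F k r) ->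
  forall s t, 0 <= s -> 0 <= t -> hbd m (fun k => Y t k - Y s k) (A * `|t - s|).
Proof.
move=> A0 lF hF eY; suff h s t : 0 <= s -> s <= t -> hbd m (fun k => Y t k - Y s k) (A * `|t - s|).
  move=> s t s0 t0; have [st|/ltW ts] := leP s t; first exact: h.
  by rewrite distrC; apply: hbd_le (h _ _ t0 ts) => // k; rewrite distrC.
move=> s0 st; rewrite ger0_norm ?subr_ge0//.
apply: hbd_le (int_hbd st A0 lF (fun r rs => hF r (le_trans s0 (andP rs).1))) => // k.
rewrite (eY k s s0) (eY k t (le_trans s0 st)) (itv_split (b := s) _ (lF k)) ?s0//.
by rewrite opprD addrACA subrr add0r addrAC subrr add0r.
Qed.

(** The remainder is the integral of V(r) - V(t) over an interval of length |h|, where the integrand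
    is at most B |h|; ordering the end points covers both signs of h. *)
Lemma curve_C1 m (Y V : R -> K -> R) B : 0 < B -> (forall k, lbm (V^~ k)) ->
  (forall k t, 0 <= t -> Y t k = Y 0 k + \int[leb]_(r in `[0, t]) V r k) ->
  (forall s t, 0 <= s -> 0 <= t -> hbd m (fun k => V t k - V s k) (B * `|t - s|)) ->
  forall t h, 0 <= t -> 0 <= t + h ->
  hbd m (fun k => Y (t + h) k - Y t k - h * V t k) (B * h ^+ 2).
Proof.
move=> B0 lV eY hV t h t0 th.
have [->|h0] := eqVneq h 0.
  split=> [|s us]; first by rewrite expr0n mulr0.
  by rewrite big1 ?expr0n ?mulr0 ?expr0n// => k _; rewrite addr0 subrr mul0r subrr expr0n mulr0.
have nh : 0 < `|h| by rewrite normr_gt0.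
have lW k : lbm (fun r => V r k - V t k) by apply: lbmB => //; exact: lbm_cst.
have key (p q : R) : 0 <= p -> p <= q -> q - p = `|h| -> p <= t <= q ->
    hbd m (fun k => Y q k - Y p k - (q - p) * V t k) (B * h ^+ 2).
  move=> p0 pq e ptq.
  have := @int_hbd m (fun k r => V r k - V t k) (B * `|h|) p q pq (mulr_gt0 B0 nh) lW.
  rewrite e -mulrA -normrM -expr2 ger0_norm ?sqr_ge0// => H.
  apply: hbd_le (H _) => //.
    move=> k; rewrite (eY k q (le_trans p0 pq)) (eY k p p0) (itv_split (b := p) _ (lV k)) ?p0//.
    rewrite (RintB _ (lbm_integ p q (lV k)) (lbm_integ p q (lbm_cst (V t k))))// Rint_itv_cst// e.
    rewrite le_eqVlt; apply/orP; left; apply/eqP; congr `|_|.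
    by rewrite [Y 0 k + (_ + _)]addrA [_ + _ - (Y 0 k + _)]addrAC subrr add0r [`|h| * _]mulrC.
  move=> r /andP[pr rq]; apply: hbd_le (hV t r t0 (le_trans p0 pr)) => //.
  by rewrite ler_wpM2l ?(ltW B0)// -e ler_norml; lra.
have [hp|hn] := ltP 0 h.
  have := key t (t + h) t0; rewrite lerDl addrAC subrr add0r (ltW hp) (gtr0_norm hp) lexx.
  by apply.
have hl : h < 0 by rewrite lt_neqAle h0.
have e1 : t - (t + h) = - h by rewrite opprD addrA subrr add0r.
have H := key (t + h) t th; rewrite e1 (ltr0_norm hl) in H.
have pq : t + h <= t by rewrite gerDl.
apply: hbd_le (H pq (erefl _) _) => //; last by rewrite pq lexx.
move=> k; rewrite le_eqVlt; apply/orP; left; apply/eqP.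
by rewrite -normrN; congr `|_|; ring.
Qed.

(** Tannery's theorem along a filter: modewise limits together with uniform tails give the limit of
    the sum. *)
Lemma cvg_ksum_filter (T : Type) (Fl : set_system T) {FF : Filter Fl} (F : K -> T -> R) (l : K -> R) B :
  (forall k, F k h @[h --> Fl] --> l k) -> kbd l B ->
  (\forall h \near Fl, kbd (F^~ h) B) ->
  (forall e, 0 < e -> exists2 N, ktail l N e & \forall h \near Fl, ktail (F^~ h) N e) ->
  ksum (F^~ h) @[h --> Fl] --> ksum l.
Proof.
move=> cF kl kF tF; apply/cvgrPdist_le => e e0.
have e3 : 0 < e / 3 by rewrite divr_gt0.
have [N tl tN] := tF _ e3.
have cs : \sum_(k <- bx N) F k h @[h --> Fl] --> \sum_(k <- bx N) l k.
  elim: (bx N) => [|k s IH].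
    by under eq_fun do rewrite big_nil; rewrite big_nil; exact: cvg_cst.
  by under eq_fun do rewrite big_cons; rewrite big_cons; exact: cvgD.
move/cvgrPdist_le : cs => /(_ _ e3) cs.
near=> h.
have h1 : `|\sum_(k <- bx N) l k - \sum_(k <- bx N) F k h| <= e / 3 by near: h.
have h2 : `|ksum (F^~ h) - \sum_(k <- bx N) F k h| <= e / 3.
  by apply: (@ksum_ktail _ _ B N _ N) => //; near: h.
have h3 := ksum_ktail kl tl (leqnn N).
by move: h1 h2 h3; rewrite !ler_norml; lra.
Unshelve. all: by end_near. Qed.

(** Lebesgue differentiation gives a null set of times for each mode; the lattice is countable, so
    one null set serves all modes. *)
Lemma ae_all_modes (F : K -> R -> R) : (forall k, lbm (F k)) ->
  {ae leb, forall t, 0 < t -> forall k,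
     is_derive t (1 : R) (fun s => \int[leb]_(r in `[0, s]) F k r) (F k t)}.
Proof.
move=> lF.
have one k : {ae leb, forall t, 0 < t ->
     is_derive t (1 : R) (fun s => \int[leb]_(r in `[0, s]) F k r) (F k t)}.
  have li : locally_integrable setT (F k).
    split; [exact: (lF k).1|exact: openT|move=> Q _ cQ].
    have [M [_ hM]] := compact_bounded cQ.
    have QT : Q `<=` `[- (M + 1), M + 1]%classic.
      move=> q Qq; rewrite /= in_itv/= -ler_norml.
      by apply: (hM (M + 1)); rewrite ?ltrDl.
    have /integrableP[_] : leb.-integrable Q (EFin \o F k).
      apply: (@integrableS _ _ _ leb `[- (M + 1), M + 1]%classic) => //.
        exact: compact_measurable.
      exact: lbm_integ.
    by [].
  have := @FTC1 R (F k) (BLeft 0) (fun y => lbm_integ 0 y (lF k)) li.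
  apply: filterS; first exact: (ae_filter_ringOfSetsType leb).
  move=> t h t0; have [|d e] := h; first by rewrite lte_fin.
  by rewrite -e derive1E; exact: derivableP.
pose P n (t : R) : Prop := if unpickle n is Some k then 0 < t ->
     is_derive t (1 : R) (fun s => \int[leb]_(r in `[0, s]) F k r) (F k t) else True.
have aP n : {ae leb, forall t, P n t}.
  by rewrite /P; case: unpickle => [k|]; [exact: one|exact: aeW].
have := negligible_bigcup (fun n => aP n); apply: negligibleS => t /= nt.
apply: contrapT => nU; apply: nt => t0 k; apply: contrapT => nk.
apply: nU; exists (pickle k); first exact: I.
by rewrite /P pickleK => h; apply: nk; exact: h.
Qed.

End Curves.

(** * Assembling the modes into a solution *)

Section Solution.
Context {R : realType}.
Local Notation R3 := (R * R * R)%type.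
Local Notation K := (int * int * int)%type.
Local Notation leb := (@lebesgue_measure R).
Variables (n : nat) (Om kappa mu : R) (h0 h1 : K -> R) (g : K -> R -> R).
Variables (a : R -> R3 -> R) (u0 u1 : R3 -> R) (A1 A2 A3 : R).
Hypotheses (n2 : (2 <= n)%N) (Om0 : 0 < Om) (Om1 : Om < 1).
Hypotheses (A10 : 0 < A1) (A20 : 0 < A2) (A30 : 0 < A3).
Hypothesis lg : forall k, lbm (g k).

Let c (t : R) (k : K) : R := cc Om h0 h1 (g k) k t.
Let v (t : R) (k : K) : R := vv Om h0 h1 (g k) k t.

Hypothesis Hc : forall t, 0 <= t -> hbd n.+2 (c t) A1.
Hypothesis Hv : forall t, 0 <= t -> hbd n.+1 (v t) A2.
Hypothesis Hg : forall t, 0 <= t -> hbd n.+1 (g^~ t) A3.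
Hypothesis Hsmall : forall t x, 0 <= t -> `|syn (c t) x| <= 4^-1.

Let F t x : R := expR (- (kappa * t)) * a t x * (1 + syn (c t) x) `^ mu.

Hypothesis HF : forall t, 0 <= t ->
  [/\ csqint (F t), torus_periodic (F t) & forall k, coef k (F t) = g k t].
Hypotheses (Hu0 : [/\ csqint u0, torus_periodic u0 & forall k, coef k u0 = h0 k]).
Hypotheses (Hu1 : [/\ csqint u1, torus_periodic u1 & forall k, coef k u1 = h1 k]).

Let lv k : lbm (v^~ k). Proof. exact: lbm_vv. Qed.
Let lc k : lbm (c^~ k). Proof. exact: lbm_cc. Qed.

Let cont_c k : continuous (c^~ k).
Proof.
move=> t; apply: cvgD; first exact: (deriv_continuous (is_derive_Ln Om0 Om1 h0 h1 k)).
exact: (llip_continuous (llip_convS Om0 Om1 k (lg k))).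
Qed.

Let cont_v k : continuous (v^~ k).
Proof.
move=> t; apply: cvgD; first exact: (deriv_continuous (is_derive_Ld Om0 Om1 h0 h1 k)).
exact: (llip_continuous (llip_convD Om0 Om1 k (lg k))).
Qed.

(** The acceleration of the mode as prescribed by the equation; it is the actual second derivative
    at almost every time. *)
Let fm (k : K) (t : R) : R := g k t - lam k * c t k - 2 * Om * v t k.

Let lfm k : lbm (fm k).
Proof. by apply: lbmB; [apply: lbmB => //; exact: lbmZ|exact: lbmZ]. Qed.

Let int00 (f : R -> R) : \int[leb]_(s in `[0, 0]) f s = 0.
Proof. by rewrite set_itv1 Rintegral_set1. Qed.

Let c0E k : c 0 k = h0 k. Proof. by rewrite /c cc_int// int00 addr0. Qed.
Let v0E k : v 0 k = h1 k. Proof. by rewrite /v vv_int// int00 addr0. Qed.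

Let cE k t : 0 <= t -> c t k = c 0 k + \int[leb]_(r in `[0, t]) v r k.
Proof. by move=> t0; rewrite c0E /c cc_int. Qed.

Let vE k t : 0 <= t -> v t k = v 0 k + \int[leb]_(r in `[0, t]) fm k r.
Proof. by move=> t0; rewrite v0E /v vv_int. Qed.

Let A4 : R := A3 + A1 + 2 * Om * A2.

Let A40 : 0 < A4. Proof. by rewrite !addr_gt0// !mulr_gt0. Qed.

Let lamc_hbd t : 0 <= t -> hbd n (fun k => lam k * c t k) A1.
Proof.
move=> t0; apply: hbd_le (hbd_jap (Hc t0)) => // k; rewrite !normrM ler_wpM2r//.
by rewrite !ger0_norm ?lam_ge0 ?(ltW (jap_gt0 _))// /jap lerDr.
Qed.

Let fm_hbd t : 0 <= t -> hbd n (fm^~ t) A4.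
Proof.
move=> t0; apply: hbdB; first apply: hbdB; first exact: (hbd_le (leqnSn n) (lexx _) (fun k => lexx _) (Hg t0)).
  exact: lamc_hbd.
have := hbdZ (2 * Om) (Hv t0); rewrite (ger0_norm (mulr_ge0 (ler0n _ 2) (ltW Om0))).
exact: hbd_le.
Qed.

Let c_lip := curve_lip A20 lv Hv cE.
Let v_lip := curve_lip A40 lfm fm_hbd vE.
Let c_C1 := curve_C1 A40 lv cE v_lip.

Let kc t : 0 <= t -> kbd (c t) (8 * A1).
Proof. by move=> /Hc; exact: hbd_kbd. Qed.
Let kv t : 0 <= t -> kbd (v t) (8 * A2).
Proof. by move=> /Hv; apply: hbd_kbd; exact: leqW. Qed.
Let kg t : 0 <= t -> kbd (g^~ t) (8 * A3).
Proof. by move=> /Hg; apply: hbd_kbd; exact: leqW. Qed.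

Let hcm t : 0 <= t -> hbd n.+1 (c t) A1.
Proof. by move=> /Hc; apply: hbd_le. Qed.

(** Off one null set of times all modes of the velocity are differentiable. The Lipschitz bound in
    the space of order n >= 2 controls the difference quotients, giving uniform tails, so the series
    may be differentiated term by term at every x. *)
Let ae_derive_v : {ae leb, forall t, (0 : R) < t -> forall x : R3,
  is_derive t (1 : R) (fun s : R => syn (v s) x) (syn (fm^~ t) x)}.
Proof.
have := ae_all_modes lfm; apply: filterS; first exact: (ae_filter_ringOfSetsType leb).
move=> t ht t0 x; have {}ht := ht t0; have t0' := ltW t0.
have near_pos : \forall h \near (0 : R)^', `|h| <= t by apply: dnbhs0_le.
have qk k : h^-1 * (v (t + h) k - v t k) @[h --> (0 : R)^'] --> fm k t.
  have [d e] := ht k.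
  have := d; rewrite /derivable => /cvg_ex [l hl].
  have el : l = fm k t by rewrite -e; apply/esym/cvg_lim.
  rewrite -el; apply: cvg_trans hl; apply: near_eq_cvg; near=> h.
  have ht' : `|h| <= t by near: h.
  have th : 0 <= t + h by move: ht'; rewrite ler_norml; lra.
  rewrite /= [h *: 1]mulr1 [h + t]addrC (vE k th) (vE k t0') /GRing.scale /=.
  by rewrite opprD addrACA subrr add0r.
have lim : ksum (fun k => h^-1 * (v (t + h) k - v t k) * bas k x) @[h --> (0 : R)^'] --> syn (fm^~ t) x.
  have hq (h : R) : h != 0 -> `|h| <= t -> hbd n (fun k => h^-1 * (v (t + h) k - v t k)) A4.
    move=> hn ht'; have th : 0 <= t + h by move: ht'; rewrite ler_norml; lra.
    have := hbdZ h^-1 (v_lip t0' th); rewrite [t + h - t]addrAC subrr add0r normfV mulrCA mulVf ?normr_eq0//.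
    by rewrite mulr1.
  apply: (@cvg_ksum_filter _ _ _ _ (fun k h => h^-1 * (v (t + h) k - v t k) * bas k x) _ (2 * (8 * A4))).
  - by move=> k; apply: cvgM; [exact: qk|exact: cvg_cst].
  - exact: kbd_bas (hbd_kbd n2 (fm_hbd t0')).
  - near=> h; apply: kbd_bas; apply: (hbd_kbd n2); apply: hq; near: h => //; exact: nbhs_dnbhs_neq.
  - move=> e e0; have [N hN] := hbd_ktail A4 (divr_gt0 e0 (ltr0Sn R 1)).
    have e2 : 2 * (e / 2) = e by field.
    exists N; first by rewrite -e2; apply: ktail_bas; exact: hN n2 (fm_hbd t0').
    near=> h; rewrite -e2; apply: ktail_bas; apply: (hN n _ n2); apply: hq; near: h => //; exact: nbhs_dnbhs_neq.
have lim2 : h^-1 *: (((fun s => syn (v s) x) \o shift t) (h *: 1) - syn (v t) x) @[h --> (0 : R)^'] --> syn (fm^~ t) x.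
  apply: cvg_trans lim; apply: near_eq_cvg; near=> h.
  have ht' : `|h| <= t by near: h.
  have th : 0 <= t + h by move: ht'; rewrite ler_norml; lra.
  rewrite /= [h *: 1]mulr1 [h + t]addrC /GRing.scale /= -(synB x (kv th) (kv t0')).
  rewrite -(synZ h^-1 x (kbdB (kv th) (kv t0'))).
  by [].
split; first by apply/cvg_ex; eexists; exact: lim2.
by apply/cvg_lim.
Unshelve. all: by end_near. Qed.

(** The regularity index of the solution is n + 1: position, velocity and acceleration have
    coefficients of order n + 2, n + 1 and n. With n >= 2 these series and those of the second space
    derivatives converge absolutely. *)
Lemma solution_of_modes : solution_with_deriv n.+1 Om kappa mu a u0 u1
  (fun t => syn (c t)) (fun t => syn (v t)).
Proof.
have n3 : (2 <= n.+1)%N by exact: leqW.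
have n4 : (2 <= n.+2)%N by exact: leqW.
have hc3 t : 0 <= t -> hbd 3 (c t) A1 by move=> t0; apply: hbd_le (Hc t0) => //; rewrite ltnS (leq_trans n2).
have hc4 t : 0 <= t -> hbd 4 (c t) A1 by move=> t0; apply: hbd_le (Hc t0).
split.
- move=> T T0; exists (Num.sqrt (vol * NA n.+2) * A1); apply: aeW => t /andP[t0 _].
  by split; [exact: sobolev_syn n4 (Hc t0)|exact: Hnorm_syn n4 (Hc t0)].
- move=> T T0; split=> [t /andP[t0 _]|]; first exact: sobolev_syn n3 (hcm t0).
  exists (Num.sqrt (vol * NA n.+1) * A2) => s t /andP[s0 _] /andP[t0 _].
  have -> : (fun x => syn (c t) x - syn (c s) x) = syn (fun k => c t k - c s k).
    by apply/funext => x; rewrite (synB x (kc t0) (kc s0)).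
  rewrite -mulrA; apply: Hnorm_syn n3 _; exact: c_lip.
- by apply: (@curve_future _ _ A1) => // t t0; apply: hbd_le (Hc t0).
- move=> t x t0; apply/cvgrPdist_le => e e0; rewrite near_withinE; near=> h => /= th.
  have hn : h != 0 by near: h; exact: nbhs_dnbhs_neq.
  (* The second order remainder [c_C1] and the supremum bound with factor 16 make the error of the
     quotient at most 16 A4 |h|. *)
  have hd : `|h| <= e / (16 * A4) by near: h; apply: dnbhs0_le; rewrite divr_gt0 ?mulr_gt0.
  have := syn_hbd_bd x n2 (c_C1 t0 th).
  rewrite (synB x (kbdB (kc th) (kc t0)) (kbdZ h (kv t0))) (synB x (kc th) (kc t0)) (synZ h x (kv t0)).
  set X := _ - _ - _ => hX.
  have -> : syn (v t) x - h^-1 * (syn (c (t + h)) x - syn (c t) x) = - (h^-1 * X) by rewrite /X; move: (syn (v t) x) (syn (c (t + h)) x) (syn (c t) x) => p q r; field.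
  rewrite normrN normrM normfV ler_pdivrMl ?normr_gt0//; apply: le_trans hX _.
  rewrite -[h ^+ 2]real_normK ?num_real// expr2 mulrA mulrA.
  by rewrite [leRHS]mulrC ler_wpM2r// mulrC -ler_pdivlMr ?mulr_gt0// .
- by apply: (@curve_future _ _ A2) => // t t0; apply: hbd_le (Hv t0).
- move=> T T0; exists (16 * A4) => s t x /andP[s0 _] /andP[t0 _].
  by rewrite -(synB x (kv t0) (kv s0)) -mulrA; apply: syn_hbd_bd n2 _; exact: v_lip.
- move=> i; split=> [t x t0|].
    by apply: ex_derive; exact: (is_derive_syn i x (hc3 t t0)).
  have cd k : continuous (fun t => dk i (c t) k).
    by move=> t; apply: cvgM; [exact: cvg_cst|exact: cont_c].
  apply: continuous_future_eq (curve_future cd (fun t t0 => dk_hbd i (hc3 t t0))) => t x t0.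
  by rewrite (partial_syn i (hc3 t t0)).
- move=> i j; split=> [t x t0|].
    rewrite (partial_syn i (hc3 t t0)); apply: ex_derive; exact: (is_derive_syn j x (dk_hbd i (hc4 t t0))).
  have cd k : continuous (fun t => dk j (dk i (c t)) k).
    by move=> t; do 2 (apply: cvgM; first exact: cvg_cst); exact: cont_c.
  apply: continuous_future_eq (curve_future cd (fun t t0 => dk_hbd j (dk_hbd i (hc4 t t0)))) => t x t0.
  by rewrite (partial_syn i (hc3 t t0)) (partial_syn j (dk_hbd i (hc4 t t0))).
- move=> t x t0; have := Hsmall x t0; rewrite ler_norml; lra.
- have ini (d : K -> R) (A : R) (w : R3 -> R) : kbd d A ->
      [/\ csqint w, torus_periodic w & forall k, coef k w = d k] ->
      {ae @leb3 R, forall x, syn d x = w x}.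
    move=> kd [sw pw cw]; apply: ae_cube_periodic => //; first exact: syn_periodic.
    apply: (coef_eq_ae (c_sqint_integ (sqint_syn kd)) (c_sqint_integ sw)) => k.
    by rewrite (coef_syn k kd) cw.
  have e0 : {ae @leb3 R, forall x, syn (c 0) x = u0 x}.
    by apply: ini (kc (lexx 0)) _; have [? ? h] := Hu0; split=> // k; rewrite h c0E.
  have e1 : {ae @leb3 R, forall x, syn (v 0) x = u1 x}.
    by apply: ini (kv (lexx 0)) _; have [? ? h] := Hu1; split=> // k; rewrite h v0E.
  by apply: filterS2 e0 e1 => x.
have := ae_derive_v; apply: filterS; first exact: (ae_filter_ringOfSetsType leb).
move=> t ht t0; have {}ht := ht t0; have t0' := ltW t0; have [sF pF cF] := HF t0'.
(* The forcing agrees with its synthesis almost everywhere only; this is the null set of x allowed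
   in the equation. *)
have eF : {ae @leb3 R, forall x, syn (g^~ t) x = F t x}.
  apply: ae_cube_periodic => //; first exact: syn_periodic.
  apply: (coef_eq_ae (c_sqint_integ (sqint_syn (kg t0'))) (c_sqint_integ sF)) => k.
  by rewrite (coef_syn k (kg t0')) cF.
apply: filterS eF => x eF; have d := ht x; split; first exact: ex_derive.
have -> : 'D_1 (fun s => syn (v s) x) t = syn (fm^~ t) x by apply: derive_val.
have kl := hbd_kbd n2 (lamc_hbd t0').
rewrite (laplacian_syn x (hc4 t t0')).
have -> : syn (fm^~ t) x = syn (g^~ t) x - syn (fun k => lam k * c t k) x - 2 * Om * syn (v t) x.
  by rewrite -(synZ (2 * Om) x (kv t0')) -(synB x (kg t0') kl) -(synB x (kbdB (kg t0') kl) (kbdZ (2 * Om) (kv t0'))).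
have -> : syn (fun k => - (lam k * c t k)) x = - syn (fun k => lam k * c t k) x.
  by rewrite -mulN1r -(synZ (-1) x kl); apply: eq_ksum => k; rewrite mulN1r.
rewrite eF /F; ring.
Unshelve. all: by end_near. Qed.

End Solution.

(** * Lipschitz functions as integrals of their derivatives *)

Section LipschitzIntegral.
Context {R : realType}.
Local Notation leb := (@lebesgue_measure R).
Implicit Types (f y rho : R -> R) (s t T : R).

Lemma lbm_translate f (e : R) : lbm f -> lbm (fun x => f (x + e)).
Proof.
move=> [mf bf]; split=> [|T]; first exact: (measurableT_comp mf (shiftm e)).
have [M hM] := bf (T + `|e|); exists M => t tT; apply: hM.
by apply: le_trans (ler_normD _ _) _; rewrite lerD2r.
Qed.

Lemma Rint_shift f (e a b : R) : lbm f ->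
  \int[leb]_(x in `[a, b]) f (x + e) = \int[leb]_(x in `[a + e, b + e]) f x.
Proof.
move=> lf; congr fine.
have mi : @measurable _ (measurableTypeR R) `[a + e, b + e]%classic by exact: measurable_itv.
have pre : (fun x : R => x + e) @^-1` `[a + e, b + e]%classic = `[a, b]%classic.
  by apply/seteqP; split=> x; rewrite /= !in_itv/= !lerD2r.
rewrite [RHS](@eq_measure_integral _ _ _ _ (push leb (shiftm e))); last first.
  by move=> A mA _; apply/esym; exact: leb_shift.
have mf : measurable_fun setT (EFin \o f) by apply/measurable_EFinP; exact: lf.1.
have := @integral_pushforward _ _ _ _ R _ (shiftm e) leb _ _ mf _ mi.
rewrite pre => h; apply/esym; apply: h.
exact: (lbm_integ a b (lbm_translate e lf)).
Qed.

(** Dominated convergence for the difference quotients, with the Lipschitz constant as dominating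
    function. The quotients look ahead by at most 1, hence the Lipschitz bound up to T + 1. *)
Lemma lipschitz_int y rho T (L : R) : 0 <= L -> lbm y -> lbm rho ->
  (forall s t, 0 <= s <= T + 1 -> 0 <= t <= T + 1 -> `|y t - y s| <= L * `|t - s|) ->
  {ae leb, forall s, 0 < s -> s <= T ->
    (n.+1%:R * (y (s + n.+1%:R^-1) - y s)) @[n --> \oo] --> rho s} ->
  forall t, 0 <= t <= T -> y t = y 0 + \int[leb]_(s in `[0, t]) rho s.
Proof.
move=> L0 ly lr lip ae t /andP[t0 tT].
pose q n s : R := n.+1%:R * (y (s + n.+1%:R^-1) - y s).
have d0 n : 0 < n.+1%:R^-1 :> R by rewrite invr_gt0.
have d1 n : n.+1%:R^-1 <= 1 :> R by rewrite invf_le1// ler1n.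
have lq n : lbm (q n) by apply: lbmZ; apply: lbmB => //; exact: lbm_translate.
have mi : @measurable _ (measurableTypeR R) `[0, t]%classic by exact: measurable_itv.
have [|||||_ cv] := @Rint_dct _ _ _ leb _ mi q rho (fun=> L).
- by move=> n; apply: measurable_funS (lq n).1.
- by apply: measurable_funS lr.1.
- have a0 : {ae leb, forall s, s != 0}.
    exists [set 0]; split => //; first exact: lebesgue_measure_set1.
    by move=> s /= /negP; rewrite negbK => /eqP.
  move: ae a0; apply: filterS2; first exact: (ae_filter_ringOfSetsType leb).
  move=> s h s0; rewrite /= in_itv/= => /andP[s1 s2].
  by apply: h; [rewrite lt_neqAle eq_sym s0|exact: le_trans tT].
- exact: (lbm_integ 0 t (lbm_cst L)).
- move=> n; apply: aeW => s; rewrite /= in_itv/= => /andP[s1 s2].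
  rewrite /q normrM normr_nat -ler_pdivlMl// mulrC.
  have := d0 n; have := d1 n; set d : R := n.+1%:R^-1 => e1 e0.
  have := lip s (s + d); rewrite addrAC subrr add0r (gtr0_norm e0).
  by apply; apply/andP; split; lra.
have lim : \int[leb]_(s in `[0, t]) q n s @[n --> \oo] --> y t - y 0.
  apply/cvgrPdist_le => e e0.
  have c0 : 2 * L * n.+1%:R^-1 @[n --> \oo] --> (0 : R).
    by rewrite -(mulr0 (2 * L)); apply: cvgM; [exact: cvg_cst|exact: cvg_harmonic].
  move/cvgrPdist_le : c0 => /(_ e e0); apply: filterS => n /=; rewrite sub0r normrN => hn.
  apply: le_trans (le_trans (ler_norm _) hn); set d : R := n.+1%:R^-1.
  have dd : 0 < d := d0 n; have d1' : d <= 1 := d1 n.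
  (* After a shift only the two end pieces survive, so the integral of the quotient is a difference
     of averages of [y] next to t and next to 0. *)
  have e1 : \int[leb]_(s in `[0, t]) q n s =
      n.+1%:R * (\int[leb]_(s in `[t, t + d]) y s - \int[leb]_(s in `[0, d]) y s).
    rewrite /q (RintZ mi _ (lbm_integ 0 t (lbmB (lbm_translate d ly) ly))).
    rewrite (RintB mi (lbm_integ 0 t (lbm_translate d ly)) (lbm_integ 0 t ly)).
    congr (_ * _); have := Rint_shift d 0 t ly; rewrite add0r => E.
    rewrite [X in X - _](_ : _ = \int[leb]_(x in `[d, t + d]) y x)//.
    have s1 := @itv_split _ y 0 d (t + d) ltac:(lra) ly.
    have s2 := @itv_split _ y 0 t (t + d) ltac:(lra) ly.
    by apply/eqP; rewrite subr_eq addrAC eq_sym subr_eq [X in X == _]addrC -s2 s1 addrC.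
  have av (p : R) : 0 <= p <= T -> `|n.+1%:R * \int[leb]_(s in `[p, p + d]) y s - y p| <= L * d.
    move=> /andP[p0 pT].
    have -> : n.+1%:R * \int[leb]_(s in `[p, p + d]) y s - y p =
        n.+1%:R * \int[leb]_(s in `[p, p + d]) (y s - y p).
      have mp : @measurable _ (measurableTypeR R) `[p, p + d]%classic by exact: measurable_itv.
      rewrite (RintB mp (lbm_integ _ _ ly) (lbm_integ _ _ (lbm_cst (y p)))) Rint_itv_cst; last by lra.
      by rewrite mulrBr addrAC subrr add0r mulrCA divff ?mulr1.
    rewrite normrM normr_nat -ler_pdivlMl// mulrC.
    apply: le_trans (norm_itv_le (M := L * d) _ _ _) _.
    - lra.
    - by apply: lbmB => //; exact: lbm_cst.
    - move=> s ps; apply: le_trans (lip p s _ _) _; [lra|lra|].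
      by rewrite ler_wpM2l// ger0_norm; lra.
    - by rewrite addrAC subrr add0r.
  rewrite e1 mulrBr; have := av t; have := av 0; rewrite add0r t0 tT lexx (le_trans t0 tT).
  move=> /(_ isT) + /(_ isT); rewrite !ler_norml; set I1 := n.+1%:R * _; set I2 := n.+1%:R * _.
  move=> h1 h2; rewrite -mulrA; lra.
have := cvg_unique _ cv lim => /(_ (@norm_hausdorff _ _)) ->.
by rewrite addrC subrK.
Qed.

End LipschitzIntegral.

(** * Extension in time by clamping *)

Section ClampedTime.
Context {R : realType}.
Local Notation R3 := (R * R * R)%type.
Implicit Types (w : R -> R3 -> R) (t T : R) (x : R3).

(** Freezing time outside [0, T] turns a function continuous on the closed half-line into one
    continuous on the whole line, to which global measurability and continuity results apply. *)
Definition clamp T t : R := Num.max 0 (Num.min T t).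

Lemma clamp_ge0 T t : 0 <= clamp T t. Proof. by rewrite le_max lexx. Qed.

Lemma clamp_le T t : 0 <= T -> clamp T t <= T.
Proof. by move=> T0; rewrite ge_max T0 ge_min lexx. Qed.

Lemma clampE T t : 0 <= t <= T -> clamp T t = t.
Proof. by move=> /andP[t0 tT]; rewrite /clamp (min_r tT) (max_r t0). Qed.

Lemma clamp_continuous T : continuous (clamp T).
Proof.
move=> t; apply: continuous_max; first exact: cvg_cst.
by apply: continuous_min; [exact: cvg_cst|exact: cvg_id].
Qed.

Lemma clamp_future T w : continuous_future w -> continuous (fun p : R * R3 => w (clamp T p.1) p.2).
Proof.
move=> /subspace_continuousP h p.
have cphi : continuous (fun p : R * R3 => (clamp T p.1, p.2)).
  move=> r; have c1 : {for r, continuous (fun p : R * R3 => clamp T p.1)}.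
    by apply: (@continuous_comp _ _ _ fst (clamp T)); [exact: cvg_fst|exact: clamp_continuous].
  have c2 : {for r, continuous (fun p : R * R3 => p.2)} by exact: cvg_snd.
  exact: (continuous_pair c1 c2).
have hp := h (clamp T p.1, p.2) (clamp_ge0 _ _).
move=> P /= /hp hP; suff : nbhs p [set r : R * R3 | P (w (clamp T r.1) r.2)] by [].
have hP' : nbhs (clamp T p.1, p.2) [set q : R * R3 | 0 <= q.1 -> P (w q.1 q.2)] := hP.
have hq := cphi p _ hP'; apply: (@filterS _ (nbhs p) _ _ _ _ hq) => r hr.
by apply: hr; exact: clamp_ge0.
Qed.

Lemma future_slice t w : 0 <= t -> continuous_future w -> continuous (w t).
Proof.
move=> t0 h x; have := @clamp_future t w h (t, x) => c.
have : (fun p : R * R3 => w (clamp t p.1) p.2) \o (fun y => (t, y)) = w t.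
  by apply/funext => y /=; rewrite clampE// t0 lexx.
move=> <-; apply: continuous_comp; last exact: c.
by apply: continuous_pair; [exact: cvg_cst|exact: cvg_id].
Qed.

Lemma measurable_joint (W : R * R3 -> R) : continuous W -> measurable_fun setT W.
Proof.
move=> cW; pose f (q : R3 * R) : R := W (q.2, q.1).
have mf : measurable_fun setT f.
  apply: measurable_caratheodory => [t|x].
    apply: measurable_cont3 => x; apply: (@continuous_comp _ _ _ (fun y : R3 => (t, y)) W); last exact: cW.
    have c1 : {for x, continuous (fun _ : R3 => t)} by exact: cvg_cst.
    have c2 : {for x, continuous (fun y : R3 => y)} by exact: cvg_id.
    exact: (continuous_pair c1 c2).
  move=> t; apply: (@continuous_comp _ _ _ (fun r : R => (r, x)) W); last exact: cW.
  have c1 : {for t, continuous (fun y : R => y)} by exact: cvg_id.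
  have c2 : {for t, continuous (fun _ : R => x)} by exact: cvg_cst.
  exact: (continuous_pair c1 c2).
have -> : W = f \o (fun p : R * R3 => (p.2, p.1)) by apply/funext => -[].
by apply: (measurableT_comp mf); apply/measurable_fun_pair.
Qed.

Lemma bounded_joint (W : R * R3 -> R) T : continuous W ->
  exists2 M, 0 < M & forall t x, 0 <= t <= T -> cube x -> `|W (t, x)| <= M.
Proof.
move=> cW.
have /compact_bounded [M [_ hM]] : compact (W @` (`[0, T]%classic `*` @cube R)).
  apply: continuous_compact; first exact: continuous_subspaceT.
  by apply: compact_setX; [exact: segment_compact|exact: compact_cube].
exists (`|M| + 1) => [|t x tT cx]; first by rewrite ltr_wpDl.
apply: (hM (`|M| + 1)); first by rewrite (le_lt_trans (ler_norm M))// ltrDl.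
by exists (t, x) => //; split=> //=; rewrite in_itv.
Qed.

End ClampedTime.

(** * The modes of an arbitrary solution *)

Section SolutionModes.
Context {R : realType}.
Local Notation R3 := (R * R * R)%type.
Local Notation K := (int * int * int)%type.
Local Notation leb := (@lebesgue_measure R).
Implicit Types (x : R3) (k : K) (i : 'I_3) (s t : R).

Lemma lbm_coef_cube (f : R * R3 -> R) k M : measurable_fun setT f ->
  (forall t x, cube x -> `|f (t, x)| <= M) -> lbm (fun t => coef k (fun x => f (t, x))).
Proof.
move=> mf fM; have M0 : 0 <= M.
  by apply: le_trans (fM 0 (0, 0, 0) _) => //; rewrite /cube /= !in_itv/= lexx mulr_ge0// pi_ge0.
have e : (fun t => coef k (fun x => f (t, x))) = (fun t => coef k (fun x => \1_(@cube R) x * f (t, x))).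
  apply/funext => t; rewrite /coef; congr (_ * _); apply: c_eq_Rint => x cx.
  by rewrite indicE mem_set// mul1r.
rewrite e; apply: (@lbm_coef _ (fun p => \1_(@cube R) p.2 * f p) k M) => [|[t x]].
  apply: measurable_funM => //; apply: (measurableT_comp _ measurable_snd).
  by apply: measurable_indic; exact: measurable_cube.
rewrite indicE; case: (boolP (_ \in _)) => [/set_mem cx|_]; last by rewrite mul0r normr0.
by rewrite mul1r; exact: fM.
Qed.

Lemma cvg_coef_dom (f_ : nat -> R3 -> R) (f : R3 -> R) (M : R) k :
  (forall j, measurable_fun setT (f_ j)) -> measurable_fun setT f ->
  {ae @leb3 R, forall x, cube x -> f_ j x @[j --> \oo] --> f x} ->
  (forall j x, cube x -> `|f_ j x| <= M) -> coef k (f_ j) @[j --> \oo] --> coef k f.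
Proof.
move=> mf_ mf cv fM; apply: cvgM; first exact: cvg_cst.
have [|||||_ //] := @Rint_dct _ _ _ leb3 cube mC (fun j x => f_ j x * bas k x) (fun x => f x * bas k x) (fun=> M * 2).
- by move=> j; apply: measurable_funM; [apply: measurable_funTS; exact: mf_|exact: measurable_bas].
- by apply: measurable_funM; [exact: measurable_funTS|exact: measurable_bas].
- by apply: filterS cv => x h cx; apply: cvgM; [exact: h|exact: cvg_cst].
- exact: c_integ_cst.
- by move=> j; apply: aeW => x cx; rewrite normrM ler_pM// ?fM// bas_bd.
Qed.

Lemma is_derive_time (u v : R -> R3 -> R) t x : time_deriv u v -> 0 < t ->
  h^-1 *: (((fun s => u s x) \o shift t) (h *: 1) - u t x) @[h --> (0 : R)^'] --> v t x.
Proof.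
move=> td t0; apply/cvgrPdist_le => e e0.
have near_pos : \forall h \near (0 : R)^', `|h| <= t by apply: dnbhs0_le.
have /cvgrPdist_le /(_ e e0) := td t x (ltW t0); rewrite near_withinE => H.
apply: filterS2 H near_pos => h hh ht /=.
rewrite [h *: 1]mulr1 [h + t]addrC; apply: hh => /=.
by move: ht; rewrite ler_norml; lra.
Qed.

Lemma seq_quot (f : R -> R) t (l : R) :
  h^-1 *: ((f \o shift t) (h *: 1) - f t) @[h --> (0 : R)^'] --> l ->
  n.+1%:R * (f (t + n.+1%:R^-1) - f t) @[n --> \oo] --> l.
Proof.
move=> h; apply/cvgrPdist_le => e e0.
move/cvgrPdist_le : h => /(_ e e0) [d /= d0 hd].
have := @cvg_harmonic R; move/cvgrPdist_lt => /(_ d d0); apply: filterS => n /= hn.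
have := hd n.+1%:R^-1 hn; rewrite /= invr_eq0 pnatr_eq0 => /(_ isT).
by rewrite [_ *: 1]mulr1 [_ + t]addrC /GRing.scale /= invrK.
Qed.

Lemma coef_laplacian (f : R3 -> R) k : torus_periodic f -> continuous f ->
  (forall i, (forall x, derivable f x (unit_vec i)) /\ continuous (partial i f)) ->
  (forall i j, (forall x, derivable (partial i f) x (unit_vec j)) /\ continuous (partial j (partial i f))) ->
  coef k (laplacian f) = - lam k * coef k f.
Proof.
move=> pf cf d1 d2; rewrite coef_sum => [|i]; last first.
  have [_ c2] := d2 i i; have [M hM] := cont3_bounded c2.
  by apply: (c_integ_bd (M := M)) => //; apply: measurable_funTS; exact: measurable_cont3.
rewrite (eq_bigr (fun i => - kr k i ^+ 2 * coef k f)) => [|i _].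
  by rewrite -mulr_suml sumrN.
have [e1 c1] := d1 i; have [e2 c2] := d2 i i.
rewrite (coef_partial k (partial_periodic i pf) e2 c1 c2) (coef_partial _ pf e1 cf c1).
by rewrite krN [- - k]opprK; ring.
Qed.

Variables (m : nat) (Om kappa mu eps : R) (a : R -> R3 -> R) (u0 u1 : R3 -> R).
Hypotheses (hm : (2 <= m)%N) (kap0 : 0 < kappa) (eps0 : 0 < eps).
Hypothesis ma : measurable_fun ([set t : R | 0 <= t] `*` [set: R3]) (fun p : R * R3 => a p.1 p.2).
Hypothesis sa : forall t, 0 <= t -> sobolev m (a t).
Hypothesis na : forall t, 0 <= t -> Hnorm m (a t) <= eps.
Hypotheses (su0 : csqint u0) (su1 : csqint u1).
Variable T : R.
Hypothesis T0 : 0 <= T.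

(** One unit of room for the forward difference quotients of [lipschitz_int]. *)
Let T1 : R := T + 1.
Let T10 : 0 <= T1. Proof. by rewrite addr_ge0. Qed.
Let cl t : R := clamp T1 t.
Let cl_in t : 0 <= cl t <= T1. Proof. by rewrite clamp_ge0 clamp_le. Qed.

(** The forcing along a given solution, with [a] clipped and time clamped, so that it is jointly
    measurable and bounded over the cube. *)
Definition forced (u : R -> R3 -> R) t x : R :=
  expR (- (kappa * cl t)) * clipa m eps a (cl t) x * (1 + u (cl t) x) `^ mu.

(** What the uniqueness argument extracts from a solution: a range for 1 + u on a bounded time
    interval, and the integrated mode equations with velocity modes [z]. *)
Definition modes_ok (u : R -> R3 -> R) (lo hi : R) : Prop :=
  [/\ (forall t, 0 <= t -> torus_periodic (u t) /\ continuous (u t)),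
  (forall t x, 0 <= t <= T1 -> cube x -> lo <= 1 + u t x <= hi),
  (forall k, lbm (fun t => coef k (u (cl t)))),
  measurable_fun setT (fun p : R * R3 => forced u p.1 p.2) &
  exists z : K -> R -> R, [/\ (forall k, lbm (z k)),
   (forall k t, 0 <= t <= T -> coef k (u (cl t)) = coef k u0 + \int[leb]_(s in `[0, t]) z k s) &
   (forall k t, 0 <= t <= T -> z k t = coef k u1 + \int[leb]_(s in `[0, t])
       (coef k (forced u s) - lam k * coef k (u (cl s)) - 2 * Om * z k s))]].

(** The difference quotients of a coefficient are coefficients of difference quotients, which are
    bounded by Lipschitz constants in time. Dominated convergence in space and [lipschitz_int] in
    time then give the integrated mode equations. *)
Lemma modes_of_solution u v : solution_with_deriv m Om kappa mu a u0 u1 u v ->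
  exists lo hi, 0 < lo /\ modes_ok u lo hi.
Proof.
move=> S; have cu := sol_continuous S; have cv := sol_time_deriv_continuous S.
have cU := clamp_future (T := T1) cu; have cV := clamp_future (T := T1) cv.
have [MU MU0 hU] := bounded_joint T1 cU; have [MV MV0 hV] := bounded_joint T1 cV.
have uM t x : 0 <= t <= T1 -> cube x -> `|u t x| <= MU by move=> tT cx; have := hU t x tT cx; rewrite /= clampE.
have vM t x : 0 <= t <= T1 -> cube x -> `|v t x| <= MV by move=> tT cx; have := hV t x tT cx; rewrite /= clampE.
have pos p : 0 < 1 + u (cl p.1) p.2 by apply: (sol_positive S); exact: clamp_ge0.
(* Positivity of 1 + u is only pointwise; bounding its reciprocal on a compact set yields a uniform
   lower bound. *)
have cI : continuous (fun p : R * R3 => (1 + u (cl p.1) p.2)^-1).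
  move=> p; apply: (@cvgV _ _ _ _ _ (1 + u (cl p.1) p.2)); first by rewrite gt_eqF.
  by apply: cvgD; [exact: cvg_cst|exact: cU].
have [MI MI0 hI] := bounded_joint T1 cI.
have range t x : 0 <= t <= T1 -> cube x -> MI^-1 <= 1 + u t x <= 1 + MU.
  move=> tT cx; have := hI t x tT cx; have := pos (t, x); rewrite /= /cl clampE// => p.
  rewrite ger0_norm ?invr_ge0 ?(ltW p)// => h; apply/andP; split.
    by rewrite -[leRHS]invrK lef_pV2 ?posrE ?invr_gt0.
  by rewrite lerD2l; apply: le_trans (ler_norm _) (uM t x tT cx).
have lo0 : 0 < MI^-1 by rewrite invr_gt0.
have su t : 0 <= t -> sobolev m (u t).
  move=> t0; have t1 : 0 < t + 1 by rewrite ltr_wpDl.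
  by apply: (sol_Lip S t1).1; rewrite t0 /= lerDl ler01.
have pu t : 0 <= t -> torus_periodic (u t) by move=> /su [[]].
have cut t : 0 <= t -> continuous (u t) by move=> t0; exact: future_slice cu.
have cvt t : 0 <= t -> continuous (v t) by move=> t0; exact: future_slice cv.
have mut t : 0 <= t -> measurable_fun setT (u t) by move=> /cut; exact: measurable_cont3.
have mvt t : 0 <= t -> measurable_fun setT (v t) by move=> /cvt; exact: measurable_cont3.
have iu t : 0 <= t <= T1 -> cinteg (u t).
  move=> tT; apply: (c_integ_bd (M := MU)) => [|x cx]; last exact: uM.
  by apply: measurable_funTS; apply: mut; case/andP: tT.
have iv t : 0 <= t <= T1 -> cinteg (v t).
  move=> tT; apply: (c_integ_bd (M := MV)) => [|x cx]; last exact: vM.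
  by apply: measurable_funTS; apply: mvt; case/andP: tT.
have lipu s t x : 0 <= s <= T1 -> 0 <= t <= T1 -> cube x -> `|u t x - u s x| <= MV * `|t - s|.
  suff h s' t' : 0 <= s' -> s' <= t' -> t' <= T1 -> cube x -> `|u t' x - u s' x| <= MV * `|t' - s'|.
    move=> /andP[s0 sT] /andP[t0 tT] cx; have [st|/ltW ts] := leP s t; first exact: h.
    by rewrite distrC [`|t - s|]distrC; exact: h.
  move=> s0 st tT cx.
  have [||r] := @MVT_segment R (fun r => u r x) (fun r => v r x) s' t' st.
  - move=> r; rewrite in_itv/= => /andP[sr rt].
    have lim := @is_derive_time u v r x (sol_time_deriv S) (le_lt_trans s0 sr).
    by split; [apply/cvg_ex; eexists; exact: lim|apply/cvg_lim].
  - apply: (@subspace_eq_continuous _ _ _ (fun r => u (cl r) x)).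
      move=> r; rewrite inE /= in_itv/= => /andP[sr rt].
      by rewrite /cl clampE// (le_trans s0 sr) (le_trans rt tT).
    apply: continuous_subspaceT => r.
    apply: (@continuous_comp _ _ _ (fun r : R => (r, x)) (fun p : R * R3 => u (cl p.1) p.2)); last exact: cU.
    have c1 : {for r, continuous (fun y : R => y)} by exact: cvg_id.
    have c2 : {for r, continuous (fun _ : R => x)} by exact: cvg_cst.
    exact: (continuous_pair c1 c2).
  rewrite in_itv/= => /andP[sr rt] ->; rewrite normrM ler_wpM2r//; apply: vM => //.
  by rewrite (le_trans s0 sr) (le_trans rt tT).
have [Lv hLv] := sol_time_deriv_Lip S (ltr_wpDl T0 ltr01 : 0 < T1).
have ly k : lbm (fun t => coef k (u (cl t))).
  apply: (@lbm_coef_cube (fun p => u (cl p.1) p.2) k MU); first exact: measurable_joint.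
  by move=> t x cx; apply: uM.
have lz k : lbm (fun t => coef k (v (cl t))).
  apply: (@lbm_coef_cube (fun p => v (cl p.1) p.2) k MV); first exact: measurable_joint.
  by move=> t x cx; apply: vM.
have mF : measurable_fun setT (fun p : R * R3 => forced u p.1 p.2).
  have mc : measurable_fun setT cl by apply: continuous_measurable_fun; exact: clamp_continuous.
  apply: measurable_funM; first apply: measurable_funM.
  - apply: (measurableT_comp (continuous_measurable_fun (@continuous_expR R))) => /=.
    apply: measurable_funN; apply: measurable_funM => //; exact: (measurableT_comp mc measurable_fst).
  - apply: (@measurableT_comp _ _ _ _ _ _ (fun p : R * R3 => clipa m eps a p.1 p.2) _ (fun p : R * R3 => (cl p.1, p.2)) (clipa_meas m eps ma)).
    by apply/measurable_fun_pair => //; exact: (measurableT_comp mc measurable_fst).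
  apply: (measurableT_comp (measurable_powR mu)); apply: measurable_funD => //.
  exact: (measurable_joint cU).
have [Mp Mp0 hMp] := powR_bounded (1 + MU) mu lo0.
have FM t x : cube x -> `|forced u t x| <= clipM m eps * Mp.
  move=> cx; rewrite /forced !normrM ler_pM//; last by apply: hMp; exact: range.
  rewrite -[leRHS]mul1r ler_pM ?clipa_bd// ger0_norm ?expR_ge0//.
  by rewrite -expR0 ler_expR oppr_le0 mulr_ge0 ?(ltW kap0)// clamp_ge0.
have lF k : lbm (fun t => coef k (forced u t)).
  exact: (@lbm_coef_cube (fun p => forced u p.1 p.2) k (clipM m eps * Mp) mF FM).
have d0 n : 0 < n.+1%:R^-1 :> R by rewrite invr_gt0.
have d1 n : n.+1%:R^-1 <= 1 :> R by rewrite invf_le1// ler1n.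
have ns n s : 0 < s -> s <= T -> 0 <= s + n.+1%:R^-1 <= T1.
  by move=> s0 sT; rewrite /T1 lerD// addr_ge0// ltW.
have ini (w : R -> R3 -> R) (w0 : R3 -> R) k : csqint w0 -> cinteg (w 0) ->
    {ae @leb3 R, forall x, w 0 x = w0 x} -> coef k (w (cl 0)) = coef k w0.
  move=> sw iw e; rewrite /cl clampE ?lexx//; apply: (coef_ae k iw (c_sqint_integ sw)).
  by apply: filterS e => x ->.
have c00 : 0 <= (0 : R) <= T1 by rewrite lexx.
exists MI^-1, (1 + MU); split=> //; split=> //; first by move=> t t0; split; [exact: pu|exact: cut].
exists (fun k t => coef k (v (cl t))); split=> // k t tT.
  have Lip (s r : R) : 0 <= s <= T + 1 -> 0 <= r <= T + 1 ->
      `|coef k (u (cl r)) - coef k (u (cl s))| <= 2 * MV * `|r - s|.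
    move=> sT rT; rewrite /cl !clampE// -coefB; [|exact: iu|exact: iu].
    rewrite -mulrA; apply: coef_norm_le => [|x cx]; last exact: lipu.
    by apply: c_integB; exact: iu.
  have e0 : coef k (u (cl 0)) = coef k u0.
    by apply: ini => //; [exact: iu|apply: filterS (sol_initial S) => x []].
  rewrite -e0; apply: (lipschitz_int _ (ly k) (lz k) Lip _ tT); first by rewrite mulr_ge0// ltW.
  apply: aeW => s s0 sT.
  have sT1 : 0 <= s <= T1 by rewrite (ltW s0) (le_trans sT)// lerDl.
  rewrite /cl (clampE sT1).
  have -> : (fun n => n.+1%:R * (coef k (u (clamp T1 (s + n.+1%:R^-1))) - coef k (u s))) =
      (fun n => coef k (fun x => n.+1%:R * (u (s + n.+1%:R^-1) x - u s x))).
    apply/funext => n; rewrite clampE ?ns// coefZ ?coefB//.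
    - exact: iu (ns n s s0 sT).
    - exact: iu.
    - by apply: c_integB; [exact: iu (ns n s s0 sT)|exact: iu].
  apply: (@cvg_coef_dom _ _ MV).
  - move=> n; apply: measurable_funM => //; apply: measurable_funB; apply: mut; last exact: ltW.
    by case/andP: (ns n s s0 sT).
  - exact: mvt (ltW s0).
  - by apply: aeW => x _; exact: (@seq_quot (fun r => u r x) s (v s x) (@is_derive_time u v s x (sol_time_deriv S) s0)).
  - move=> n x cx; rewrite normrM normr_nat -ler_pdivlMl// mulrC.
    by have := lipu s (s + n.+1%:R^-1) x sT1 (ns n s s0 sT) cx; rewrite addrAC subrr add0r (gtr0_norm (d0 n)).
have Lip (s r : R) : 0 <= s <= T + 1 -> 0 <= r <= T + 1 ->
    `|coef k (v (cl r)) - coef k (v (cl s))| <= 2 * `|Lv| * `|r - s|.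
  move=> sT rT; rewrite /cl !clampE// -coefB; [|exact: iv|exact: iv].
  rewrite -mulrA; apply: coef_norm_le => [|x cx]; first by apply: c_integB; exact: iv.
  by apply: le_trans (hLv s r x sT rT) _; rewrite ler_wpM2r// ler_norm.
have e0 : coef k (v (cl 0)) = coef k u1.
  by apply: ini => //; [exact: iv|apply: filterS (sol_initial S) => x []].
rewrite -e0; have lr := lbmB (lbmB (lF k) (lbmZ (lam k) (ly k))) (lbmZ (2 * Om) (lz k)).
apply: (lipschitz_int _ (lz k) lr Lip _ tT); first by rewrite mulr_ge0.
have := sol_equation S; apply: filterS; first exact: (ae_filter_ringOfSetsType leb).
move=> s hs s0 sT; have {}hs := hs s0; have s0' := ltW s0.
have sT1 : 0 <= s <= T1 by rewrite s0' (le_trans sT)// lerDl.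
have p1 i : (forall x, derivable (u s) x (unit_vec i)) /\ continuous (partial i (u s)).
  have [h1 h2] := sol_partial S i; split=> [x|]; first exact: h1.
  exact: (future_slice s0' h2).
have p2 i j : (forall x, derivable (partial i (u s)) x (unit_vec j)) /\ continuous (partial j (partial i (u s))).
  have [h1 h2] := sol_partial2 S i j; split=> [x|]; first exact: h1.
  exact: (future_slice s0' h2).
have clap : continuous (laplacian (u s)).
  have lapE : laplacian (u s) = (fun x => partial 0 (partial 0 (u s)) x + partial 1 (partial 1 (u s)) x + partial 2 (partial 2 (u s)) x) by apply/funext => y; rewrite /laplacian sum_ord3.
move=> x; rewrite lapE.
  by apply: cvgD; [apply: cvgD|]; apply: (p2 _ _).2.
have mlap := measurable_cont3 clap.
have ilap : cinteg (laplacian (u s)).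
  have [M hM] := cont3_bounded clap.
  by apply: (c_integ_bd (M := M)) => //; exact: measurable_funTS.
have mFs : measurable_fun setT (forced u s) by exact: (measurableT_comp mF (measurable_pair1 s)).
have iF : cinteg (forced u s).
  by apply: (c_integ_bd (M := clipM m eps * Mp)) => //; [exact: measurable_funTS|exact: FM].
(* The mode equation is reassembled as one coefficient of the function that the equation prescribes
   for v_t; integration by parts turns the Laplacian into -lam k. *)
have -> : coef k (forced u s) - lam k * coef k (u (cl s)) - 2 * Om * coef k (v (cl s)) =
    coef k (fun x => forced u s x + laplacian (u s) x - 2 * Om * v s x).
  rewrite coefB; [|exact: c_integD|by apply: c_integZ; exact: iv].
  rewrite coefD// coefZ; last exact: iv.
  by rewrite (coef_laplacian k (pu s s0') (cut s s0') p1 p2) /cl (clampE sT1) mulNr.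
rewrite /cl (clampE sT1).
have -> : (fun n => n.+1%:R * (coef k (v (clamp T1 (s + n.+1%:R^-1))) - coef k (v s))) =
    (fun n => coef k (fun x => n.+1%:R * (v (s + n.+1%:R^-1) x - v s x))).
  apply/funext => n; rewrite clampE ?ns// coefZ ?coefB//.
  - exact: iv (ns n s s0 sT).
  - exact: iv.
  - by apply: c_integB; [exact: iv (ns n s s0 sT)|exact: iv].
apply: (@cvg_coef_dom _ _ `|Lv|).
- move=> n; apply: measurable_funM => //; apply: measurable_funB; apply: mvt => //.
  by case/andP: (ns n s s0 sT).
- by apply: measurable_funB; [apply: measurable_funD|apply: measurable_funM => //; exact: mvt].
(* The equation holds almost everywhere in space for the original [a]; a further null set replaces
   it by its clipped version. *)
- have ca := clipa_ae hm sa na s0'; apply: filterS2 hs ca => x [dv e] ca cx.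
  have -> : forced u s x + laplacian (u s) x - 2 * Om * v s x = 'D_1 (fun r => v r x) s.
    by rewrite /forced /cl (clampE sT1) (ca cx); apply/eqP; rewrite eq_sym -subr_eq0; apply/eqP;
       move/eqP: e; rewrite subr_eq => /eqP ->; ring.
  exact: (@seq_quot (fun r => v r x) s _ dv).
- move=> n x cx; rewrite normrM normr_nat -ler_pdivlMl// mulrC.
  have := hLv s (s + n.+1%:R^-1) x sT1 (ns n s s0 sT); rewrite addrAC subrr add0r (gtr0_norm (d0 n)).
  by move=> /le_trans; apply; rewrite ler_wpM2r ?ler_norm// ltW.
Qed.

End SolutionModes.

(** * Uniqueness of the solution *)

Section Uniqueness.
Context {R : realType}.
Local Notation R3 := (R * R * R)%type.
Local Notation K := (int * int * int)%type.
Local Notation leb := (@lebesgue_measure R).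
Variables (m : nat) (Om kappa mu eps : R) (a : R -> R3 -> R) (u0 u1 : R3 -> R).
Hypotheses (hm : (2 <= m)%N) (kap0 : 0 < kappa) (eps0 : 0 < eps) (Om0 : 0 < Om) (Om1 : Om < 1).
Hypothesis ma : measurable_fun ([set t : R | 0 <= t] `*` [set: R3]) (fun p : R * R3 => a p.1 p.2).
Hypothesis sa : forall t, 0 <= t -> sobolev m (a t).
Hypothesis na : forall t, 0 <= t -> Hnorm m (a t) <= eps.
Hypotheses (su0 : csqint u0) (su1 : csqint u1).

Lemma parseval_le (f : R3 -> R) (X : R) : csqint f -> 0 <= X ->
  (forall s : seq K, uniq s -> \sum_(k <- s) coef k f ^+ 2 <= X ^+ 2) ->
  \int[leb3]_(x in cube) (f x ^+ 2) <= vol * X ^+ 2.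
Proof.
move=> sf X0 h; apply: (cvg_le_bd (N := 0%N) (parseval sf sf)) => j _.
by rewrite ler_wpM2l ?(ltW vol_gt0)//; apply: h; exact: uniq_bx.
Qed.

(** The difference [W] of the modes of two solutions has zero data and satisfies Duhamel's formula
    with the difference [G] of the forcings. Under the exponential weight each substitution halves
    the bound, so the coefficients agree; continuity then gives equality at every point. *)
Lemma solution_unique u v u' v' : solution_with_deriv m Om kappa mu a u0 u1 u v ->
  solution_with_deriv m Om kappa mu a u0 u1 u' v' ->
  forall t x, 0 <= t -> u' t x = u t x.
Proof.
move=> S S' T x T0.
have [lo [hi [lo0 [pc range ly mF [z [lz ey ez]]]]]] := modes_of_solution hm kap0 eps0 ma sa na su0 su1 T0 S.
have [lo' [hi' [lo'0 [pc' range' ly' mF' [z' [lz' ey' ez']]]]]] := modes_of_solution hm kap0 eps0 ma sa na su0 su1 T0 S'.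
pose l := Num.min lo lo'; pose r := Num.max hi hi'.
have l0 : 0 < l by rewrite lt_min lo0.
have [Lp Lp0 hLp] := powR_lip r mu l0.
have [Mp Mp0 hMp] := powR_bounded r mu l0.
pose cl t := clamp (T + 1) t.
have cl_in t : 0 <= cl t <= T + 1 by rewrite clamp_ge0 clamp_le// addr_ge0.
have cl0 t : 0 <= cl t by exact: clamp_ge0.
have rg t y : cube y -> l <= 1 + u (cl t) y <= r.
  by move=> cy; have /andP[h1 h2] := range _ y (cl_in t) cy; rewrite ge_min h1 le_max h2.
have rg' t y : cube y -> l <= 1 + u' (cl t) y <= r.
  by move=> cy; have /andP[h1 h2] := range' _ y (cl_in t) cy; rewrite ge_min h1 le_max h2 !orbT.
have csq (w : R -> R3 -> R) : (forall t, 0 <= t -> torus_periodic (w t) /\ continuous (w t)) ->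
    forall t, csqint (w (cl t)).
  move=> h t; have [_ c] := h _ (cl0 t); have [M hM] := cont3_bounded c.
  by apply: (c_sqint_bd (M := M)) => //; apply: measurable_funTS; exact: measurable_cont3.
have su := csq u pc; have su' := csq u' pc'.
pose LL := clipM m eps * Lp.
have cM0 := clipM_gt0 m eps0.
have LL0 : 0 < LL by rewrite mulr_gt0.
have eb t : 0 <= expR (- (kappa * cl t)) <= 1.
  by rewrite expR_ge0 /= -expR0 ler_expR oppr_le0 mulr_ge0 ?(ltW kap0).
have sF (w : R -> R3 -> R) t : measurable_fun setT (fun p : R * R3 => forced m kappa mu eps a T w p.1 p.2) ->
    (forall y, cube y -> l <= 1 + w (cl t) y <= r) -> csqint (forced m kappa mu eps a T w t).
  move=> mw hw; apply: (c_sqint_bd (M := clipM m eps * Mp)) => [|y cy].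
    by apply: measurable_funTS; exact: (measurableT_comp mw (measurable_pair1 t)).
  have /andP[e0 e1] := eb t; rewrite /forced -/(cl t) !normrM ler_pM//; last by apply: hMp; exact: hw.
  by rewrite -[leRHS]mul1r ler_pM ?clipa_bd// ger0_norm.
have lFk (w : R -> R3 -> R) k : measurable_fun setT (fun p : R * R3 => forced m kappa mu eps a T w p.1 p.2) ->
    (forall t y, cube y -> l <= 1 + w (cl t) y <= r) -> lbm (fun t => coef k (forced m kappa mu eps a T w t)).
  move=> mw hw; apply: (@lbm_coef_cube _ (fun p => forced m kappa mu eps a T w p.1 p.2) k (clipM m eps * Mp) mw) => t y cy.
  have /andP[e0 e1] := eb t; rewrite /forced /= -/(cl t) !normrM ler_pM//; last by apply: hMp; exact: hw.
  by rewrite -[leRHS]mul1r ler_pM ?clipa_bd// ger0_norm.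
pose W k t := coef k (u (cl t)) - coef k (u' (cl t)).
pose G k t := coef k (forced m kappa mu eps a T u t) - coef k (forced m kappa mu eps a T u' t).
have lG k : lbm (G k) by apply: lbmB; apply: lFk.
have WE k : forall t, 0 <= t <= T -> W k t = conv (Sm Om k) (G k) t.
  have lw : lbm (W k) := lbmB (ly k) (ly' k); have lzz := lbmB (lz k) (lz' k).
  apply: (duhamel_unique Om0 Om1 (lG k) lw lzz) => t tT.
    rewrite /W ey// ey'// (RintB _ (lbm_integ 0 t (lz k)) (lbm_integ 0 t (lz' k)))//.
    by rewrite opprD addrACA subrr add0r.
  have l1 := lbmB (lbmB (lFk u k mF rg) (lbmZ (lam k) (ly k))) (lbmZ (2 * Om) (lz k)).
  have l2 := lbmB (lbmB (lFk u' k mF' rg') (lbmZ (lam k) (ly' k))) (lbmZ (2 * Om) (lz' k)).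
  rewrite ez// ez'// opprD addrACA subrr add0r.
  rewrite -(RintB _ (lbm_integ 0 t l1) (lbm_integ 0 t l2))//.
  by apply: eq_Rint => s _; rewrite /G /W; ring.
have CS0 : 0 < CS Om by rewrite addr_gt0// invr_gt0.
(* The length of the common range bounds the difference of the two solutions and starts the
   iteration; the 1 keeps [B] positive. *)
pose B := r - l + 1.
have B0 : 0 < B.
  have c0 : cube ((0, 0, 0) : R3) by split; [split|]; rewrite /= in_itv /= lexx mulr_ge0 ?pi_ge0.
  by have /andP[h1 h2] := rg 0 _ c0; rewrite ltr_pwDr// subr_ge0 (le_trans h1).
pose lmb := 2 * CS Om * LL; have lmb0 : 0 < lmb by rewrite !mulr_gt0.
have key n : forall t, 0 <= t <= T -> hbd 0 (W^~ t) (B * 2^-1 ^+ n * expR (lmb * t)).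
  elim: n => [|n IH] t tT; have /andP[t0 tT'] := tT.
    rewrite expr0 mulr1; apply/hbd0P; split=> [|s us]; first by rewrite mulr_ge0 ?expR_ge0// ltW.
    have h := @coef_lip _ (u (cl t)) (u' (cl t)) (fun=> B) (fun=> 0) 1 B s (su t) (su' t) (c_sqint_cst B) (c_sqint_cst 0) ler01.
    apply: le_trans (h _ _ us) _.
    - move=> y cy; rewrite mul1r subr0 (gtr0_norm B0); have := rg t y cy; have := rg' t y cy.
      by rewrite ler_norml /B; lra.
    - rewrite subr0 (Rintegral_cst leb3 measurable_cube) mulrC ler_wpM2r ?sqr_ge0//.
      by rewrite (congr1 fine leb3_cube).
    rewrite mul1r; apply: lerXn2r; rewrite ?nnegrE ?mulr_ge0 ?expR_ge0 ?(ltW B0)//.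
    by rewrite ler_peMr ?(ltW B0)// -expR0 ler_expR mulr_ge0// ltW.
  pose X := B * 2^-1 ^+ n; have X0 : 0 < X by rewrite mulr_gt0// exprn_gt0// invr_gt0.
  pose phi s := LL * X * expR (lmb * s).
  have cphi : continuous phi by move=> s; apply: cvgM; [exact: cvg_cst|exact: expR_cont].
  have phi0 s : 0 < phi s by rewrite mulr_gt0 ?mulr_gt0 ?expR_gt0.
  have hg s : 0 <= s <= t -> hbd 0 (G^~ s) (phi s).
    move=> /andP[s0 st]; have sT : 0 <= s <= T by rewrite s0 (le_trans st).
    have /hbd0P [Y0 hY] := IH s sT; apply/hbd0P; split=> [|q uq]; first exact: ltW.
    rewrite /phi -mulrA; apply: (coef_lip (p := u (cl s)) (q := u' (cl s)) (sF u s mF (rg s)) (sF u' s mF' (rg' s)) (su s) (su' s) (ltW LL0)) => //.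
      move=> y cy; have /andP[e0 e1] := eb s.
      rewrite /forced -/(cl s) -mulrBr normrM /LL -mulrA ler_pM//.
        by rewrite normrM -[leRHS]mul1r ler_pM ?clipa_bd// ger0_norm.
      apply: le_trans (hLp _ _ (rg' s y cy) (rg s y cy)) _.
      by rewrite (_ : 1 + u (cl s) y - (1 + u' (cl s) y) = u (cl s) y - u' (cl s) y)//; ring.
    apply: (parseval_le (c_sqintB (su s) (su' s)) Y0) => p up; apply: le_trans (hY p up).
    by apply: ler_sum => k _; rewrite coefB ?(c_sqint_integ _).
  have [hS _] := conv_hbd Om0 Om1 cphi phi0 lG t0 hg; apply: hbd_le hS => //.
    rewrite (RintZ _ _ (lbm_integ 0 t (continuous_lbm (@expR_cont R lmb))))//.
    apply: (@le_trans _ _ (CS Om * (LL * X * (expR (lmb * t) / lmb)))).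
      by rewrite ler_wpM2l ?(ltW CS0)// ler_wpM2l ?(ltW (mulr_gt0 LL0 X0))// int_expR_le.
    rewrite le_eqVlt; apply/orP; left; apply/eqP; rewrite exprSr /lmb /X; field.
    by rewrite !gt_eqF.
  by move=> k; rewrite WE.
have TT : 0 <= T <= T by rewrite T0 lexx.
have clT : cl T = T by rewrite /cl clampE// T0 lerDl ler01.
have W0 k : coef k (u' T) = coef k (u T).
  apply/eqP; rewrite eq_sym -subr_eq0; apply/eqP; rewrite -clT.
  apply: (@geom_eq0 _ _ (B * expR (lmb * T))) => n.
  have /hbd0P [X0 /(_ [:: k] isT)] := key n T TT; rewrite big_seq1 => h.
  by rewrite mulrAC -(ler_pXn2r (n := 2))// ?nnegrE// real_normK ?num_real.
have [p c] := pc T T0; have [p' c'] := pc' T T0.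
have sT := su T; have sT' := su' T; rewrite clT in sT sT'.
have ae := coef_eq_ae (c_sqint_integ sT') (c_sqint_integ sT) W0.
by apply: continuous_ae_eq => //; exact: ae_cube_periodic.
Qed.

End Uniqueness.

(** * The sharp bound for the linear flow *)

Section LinearFlowBound.
Context {R : realType}.
Local Notation R3 := (R * R * R)%type.
Local Notation K := (int * int * int)%type.
Implicit Types (f : R3 -> R) (c : K -> R) (m : nat).

Lemma Vbd_le m c (X Y : R) : X <= Y -> Vbd m c X -> Vbd m c Y.
Proof.
move=> XY [X0 h]; have Y0 : 0 <= Y by exact: le_trans X0 XY.
split=> // s us; apply: le_trans (h s us) _.
by apply: lerXn2r; rewrite ?nnegrE.
Qed.

Lemma coef0_mean_zero f : mean_zero f -> coef 0 f = 0.
Proof.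
move=> f0; rewrite /coef; have -> : (fun x : R3 => f x * bas 0 x) = f.
  by apply/funext => x; rewrite bas0 mulr1.
by rewrite f0 mulr0.
Qed.

(** For k <> 0 the mode energy is at least (Om^2/4 + |k|^2) y^2 >= (1 + Om^2/4) y^2 and does not
    increase; the numerator 2 undoes the 1/2 in the energy. As [energy_ge] carries the exact
    weights, no comparison constant appears. *)
Lemma linear_flow_Vbd m (Om : R) (u0 u1 : R3 -> R) (E : R) : 0 < Om -> Om < 1 ->
  sobolev m.+1 u0 -> sobolev m u1 -> mean_zero u0 -> mean_zero u1 ->
  energy m Om u0 u1 <= E -> forall t, 0 <= t ->
  Vbd m ((Ln Om (fun k => coef k u0) (fun k => coef k u1))^~ t) (Num.sqrt (2 / (1 + Om ^+ 2 / 4)) * E).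
Proof.
move=> Om0 Om1 s0 s1 z0 z1 EE t t0.
have h00 := coef0_mean_zero z0; have h10 := coef0_mean_zero z1.
have E0 : 0 <= E := le_trans (sqrtr_ge0 _) EE.
have d0 : 0 < 1 + Om ^+ 2 / 4 by rewrite addr_gt0// divr_gt0// exprn_gt0.
have q0 : 0 < 2 / (1 + Om ^+ 2 / 4) by rewrite divr_gt0.
split=> [|s us]; first by rewrite mulr_ge0 ?sqrtr_ge0.
rewrite exprMn (sqr_sqrtr (ltW q0)).
have h := energy_ge Om s0 s1 us.
apply: (@le_trans _ _ (2 / (1 + Om ^+ 2 / 4) * energy m Om u0 u1 ^+ 2)); last first.
  by rewrite ler_wpM2l ?(ltW q0)//; apply: lerXn2r; rewrite ?nnegrE ?sqrtr_ge0.
rewrite -(ler_pdivrMl _ _ q0); apply: le_trans h.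
rewrite mulrCA (ler_wpM2l (ltW vol_gt0))// mulr_sumr.
apply: ler_sum => k _; rewrite mulrCA; apply: ler_wpM2l.
  exact: Wm_ge0.
have e : (1 + Om ^+ 2 / 4) * Ln Om (fun k => coef k u0) (fun k => coef k u1) k t ^+ 2 <=
    energy_mode Om k (coef k u0) (coef k u1).
  have eg0 : forall y z : R, (Om ^+ 2 / 4 + lam k) * y ^+ 2 <= energy_mode Om k y z.
    by move=> y z; rewrite /energy_mode lerDr sqr_ge0.
  have [k0|kn] := eqVneq k 0.
    rewrite {1}/Ln k0 h00 h10 !mul0r addr0 expr0n mulr0 /energy_mode.
    by rewrite addr_ge0 ?sqr_ge0// mulr_ge0 ?sqr_ge0// addr_ge0 ?lam_ge0// divr_ge0 ?sqr_ge0.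
  have hen := @energy_Ln _ _ Om0 Om1 (fun k => coef k u0) (fun k => coef k u1) k t h00 h10 t0.
  apply: (le_trans _ hen); apply: (le_trans _ (eg0 _ _)).
  by rewrite ler_wpM2r ?sqr_ge0// addrC lerD2l lam_ge1.
by rewrite invf_div mulrAC [leRHS]mulrC ler_wpM2r.
Qed.

End LinearFlowBound.

(* The smallness of the data only has to keep [1 + u] in the range where
   [(1 + u) `^ mu] is controlled; the factor 2 / (1 + Om^2 / 4) < 2 in the linear
   energy estimate leaves the room that the forcing needs. *)
Theorem mainTheorem1 (R : realType) (m : nat) (hm : (3 <= m)%N) :
  exists2 delta : R, 0 < delta &
  forall (Omega kappa mu : R) (u0 u1 : R * R * R -> R),
    0 < Omega < 1 -> 0 < kappa ->
    sobolev m.+1 u0 -> sobolev m u1 ->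
    mean_zero u0 -> mean_zero u1 ->
    4^-1 * Hnorm m u0 <= energy m Omega u0 u1 ->
    energy m Omega u0 u1 <= delta * Omega ->
  exists2 eps0 : R, 0 < eps0 &
  forall (eps : R) (a : R -> R * R * R -> R),
    0 < eps <= eps0 ->
    measurable_fun ([set t : R | 0 <= t] `*` [set: R * R * R])
      (fun p : R * (R * R * R) => a p.1 p.2) ->
    (forall t, 0 <= t -> sobolev m (a t)) ->
    (forall t, 0 <= t -> Hnorm m (a t) <= eps) ->
  exists u : R -> R * R * R -> R,
    [/\ global_solution m Omega kappa mu a u0 u1 u,
        (forall u' : R -> R * R * R -> R,
          global_solution m Omega kappa mu a u0 u1 u' ->
          forall t x, 0 <= t -> u' t x = u t x)
      & forall t, 0 <= t -> Hnorm m (u t) <= Num.sqrt 2 * delta * Omega].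
Proof.
pose P : R := 2 ^+ m; have P0 : 0 < P by rewrite exprn_gt0.
have Pn : P != 0 by rewrite gt_eqF.
(* With rho = 2^m sqrt(2) delta Omega this gives 2^(m+5) rho = sqrt(2) Omega / 8 <= 1/4, the
   smallness that the product and power estimates require. *)
exists (256 * P ^+ 2)^-1; first by rewrite invr_gt0 mulr_gt0// exprn_gt0.
set delta := (256 * P ^+ 2)^-1.
have dl0 : 0 < delta by rewrite invr_gt0 mulr_gt0// exprn_gt0.
move=> Om kappa mu u0 u1 /andP[Om0 Om1] kap0 s0 s1 z0 z1 _ hE.
(* With m = n + 1 the acceleration lives in the weighted space of order n >= 2, whose elements are
   absolutely summable. *)
case: m hm @P P0 Pn @delta dl0 s0 s1 hE => // n hm P P0 Pn delta dl0 s0 s1 hE.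
have n2 : (2 <= n)%N by [].
have hm2 : (2 <= n.+1)%N by exact: ltnW.
pose Xs := Num.sqrt 2 * delta * Om.
have sq2 : 0 < Num.sqrt (2 : R) by rewrite sqrtr_gt0.
have sq2' : Num.sqrt (2 : R) <= 2.
  have h4 : Num.sqrt ((2 : R) ^+ 2) = 2 by rewrite sqrtr_sqr ger0_norm.
  rewrite -[leRHS]h4; apply: ler_wsqrtr; rewrite expr2; lra.
have Xs0 : 0 < Xs by rewrite !mulr_gt0.
pose rho := 2 ^+ n.+1 * Xs.
have hr : 2 ^+ (n.+1 + 5) * rho <= 4^-1.
  have -> : 2 ^+ (n.+1 + 5) * rho = Num.sqrt 2 * Om / 8.
    rewrite /rho /Xs /delta exprD -/P; have -> : (2 : R) ^+ 5 = 32 by rewrite !exprS expr0; lra.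
    by field.
  have : Num.sqrt 2 * Om <= 2 * 1 by rewrite ler_pM// ltW.
  by lra.
(* The bound of the linear flow, strictly below the target [Xs]; the gap [D] is the budget of the
   forcing. *)
pose q0 := Num.sqrt (2 / (1 + Om ^+ 2 / 4)) * (delta * Om).
have d1 : 1 < 1 + Om ^+ 2 / 4 by rewrite ltrDl divr_gt0// exprn_gt0.
have q0X : q0 < Xs.
  rewrite /q0 /Xs -mulrA ltr_pM2r ?mulr_gt0// ltr_sqrt// ltr_pdivrMr; last exact: lt_trans d1.
  by rewrite ltr_pMr.
pose D := Xs - q0; have D0 : 0 < D by rewrite subr_gt0.
have hLn := linear_flow_Vbd Om0 Om1 s0 s1 z0 z1 hE.
have [Bmu Bmu0 hB] := @comp_hbd R mu.
have hBmu : forall c : int * int * int -> R, hbd n.+1 c rho ->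
    hbd n.+1 (coef^~ (fun x : R * R * R => (1 + syn c x) `^ mu)) Bmu.
  by move=> c hc; exact: hB hm2 hc hr.
have p34 : 0 < (3 / 4 : R) by rewrite divr_gt0.
have [Mp Mp0 hMp] := powR_bounded (5 / 4) mu p34.
have [Lp Lp0 hLp0] := powR_lip (5 / 4) mu p34.
have hLp : forall y z : R, 3 / 4 <= y <= 5 / 4 -> 3 / 4 <= z <= 5 / 4 -> `|z `^ mu - y `^ mu| <= Lp * `|z - y|.
  by move=> y z hy hz; exact: hLp0.
have CS0 : 0 < CS Om by rewrite addr_gt0// invr_gt0.
(* The cost of the Duhamel term per unit of eps: conversion to the exact norm, kernel bound, product
   and power constants, and 1/kappa from the time integral. Then eps Kc <= D whenever eps <= D / (Kc
   + 1). *)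
pose Kc := Num.sqrt (vol * NA n.+1) * (CS Om * (2 ^+ (n.+1 + 5) * (2 ^+ n.+1 * Bmu) / kappa)).
have Kc0 : 0 <= Kc.
  by rewrite mulr_ge0 ?sqrtr_ge0// mulr_ge0 ?(ltW CS0)// divr_ge0 ?(ltW kap0)// !mulr_ge0 ?exprn_ge0 ?(ltW Bmu0).
have Kc1 : 0 < Kc + 1 by rewrite ltr_wpDl.
exists (D / (Kc + 1)); first by rewrite divr_gt0.
move=> eps a /andP[eps0 epsD] ma sa na.
have hslack : q0 + Num.sqrt (vol * NA n.+1) * (CS Om * (AF n.+1 eps Bmu / kappa)) <= Xs.
  have -> : Num.sqrt (vol * NA n.+1) * (CS Om * (AF n.+1 eps Bmu / kappa)) = eps * Kc.
    by rewrite /Kc /AF; move: (Num.sqrt (vol * NA n.+1)) (CS Om) (2 ^+ (n.+1 + 5)) (2 ^+ n.+1) => w1 w2 w3 w4; field; rewrite gt_eqF.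
  have : eps * (Kc + 1) <= D by rewrite -ler_pdivlMr.
  by rewrite /D mulrDr mulr1; lra.
have [C [gC VC CE]] := picard hm2 kap0 eps0 ma sa na Bmu0 Lp0 hBmu hMp hLp hr Om0 Om1 (erefl rho) hLn hslack.
pose h0 k := coef k u0; pose h1 k := coef k u1.
pose G := GG n.+1 kappa mu eps a C.
have h00 : h0 0 = 0 := coef0_mean_zero z0.
have h10 : h1 0 = 0 := coef0_mean_zero z1.
have cC t : 0 <= t -> (fun k => cc Om h0 h1 (G k) k t) = C t.
  by move=> t0; apply/funext => k; rewrite (CE _ _ t0).
have hb0 := sobolev_hbd s0 (lexx _); have hb1 := sobolev_hbd s1 (lexx _).
pose B0 := 2 ^+ n.+2 * Hnorm n.+2 u0; pose B1 := 2 ^+ n.+1 * Hnorm n.+1 u1.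
have AF0 : 0 <= AF n.+1 eps Bmu by rewrite /AF !mulr_ge0 ?exprn_ge0 ?(ltW Bmu0) ?(ltW eps0).
have B00 : 0 <= B0 by rewrite mulr_ge0 ?exprn_ge0 ?sqrtr_ge0.
have B10 : 0 <= B1 by rewrite mulr_ge0 ?exprn_ge0 ?sqrtr_ge0.
(* The bounds of the linear flow and of the Duhamel term; the added 1 secures strict positivity. *)
pose A1 := 2 * (B0 + B1) + CS Om * (AF n.+1 eps Bmu / kappa) + 1.
pose A2 := 2 * (B0 + B1) + 2 * (AF n.+1 eps Bmu / kappa) + 1.
pose A3 := AF n.+1 eps Bmu + 1.
have AFk : 0 <= AF n.+1 eps Bmu / kappa by rewrite divr_ge0 ?(ltW kap0).
have BB : 0 <= 2 * (B0 + B1) by rewrite mulr_ge0// addr_ge0.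
have A10 : 0 < A1 by rewrite ltr_wpDl// addr_ge0// mulr_ge0// ltW.
have A20 : 0 < A2 by rewrite ltr_wpDl// addr_ge0// mulr_ge0.
have A30 : 0 < A3 by rewrite ltr_wpDl.
have lg k : lbm (G k) := GG_lbm hm2 kap0 eps0 ma hMp hr k gC.
have Hc t : 0 <= t -> hbd n.+2 (fun k => cc Om h0 h1 (G k) k t) A1.
  move=> t0; have [hl _] := Ln_hbd Om0 Om1 h00 h10 t0 hb0 hb1.
  have [hc _] := convG_hbd hm2 kap0 eps0 ma sa na Bmu0 hBmu hMp hr Om0 Om1 gC t0.
  by apply: hbd_le (hbdD hl hc) => //; rewrite lerDl.
have Hv t : 0 <= t -> hbd n.+1 (fun k => vv Om h0 h1 (G k) k t) A2.
  move=> t0; have [_ hl] := Ln_hbd Om0 Om1 h00 h10 t0 hb0 hb1.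
  have [_ hc] := convG_hbd hm2 kap0 eps0 ma sa na Bmu0 hBmu hMp hr Om0 Om1 gC t0.
  by apply: hbd_le (hbdD hl hc) => //; rewrite lerDl.
have Hg t : 0 <= t -> hbd n.+1 (G^~ t) A3.
  move=> t0; apply: hbd_le (GG_hbd kappa hm2 eps0 ma sa na hBmu hMp hr gC t0) => //.
  apply: (@le_trans _ _ (AF n.+1 eps Bmu)); last by rewrite lerDl.
  by rewrite ler_piMr// -expR0 ler_expR mulNr oppr_le0 mulr_ge0// ltW.
have Hsmall t x : 0 <= t -> `|syn (fun k => cc Om h0 h1 (G k) k t) x| <= 4^-1.
  by move=> t0; rewrite (cC t t0); exact: syn_small x hm2 (gC.2 t t0) hr.
(* The modes [G] were computed with the clipped [a]; the original forcing differs from it on a null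
   set of the cube and has the same coefficients. *)
have HF t : 0 <= t ->
  [/\ sqint leb3 cube (fun x => expR (- (kappa * t)) * a t x * (1 + syn (fun k => cc Om h0 h1 (G k) k t) x) `^ mu),
      torus_periodic (fun x => expR (- (kappa * t)) * a t x * (1 + syn (fun k => cc Om h0 h1 (G k) k t) x) `^ mu)
    & forall k, coef k (fun x => expR (- (kappa * t)) * a t x * (1 + syn (fun k => cc Om h0 h1 (G k) k t) x) `^ mu) = G k t].
  move=> t0; rewrite (cC t t0).
  have mt : Num.max 0 t = t by exact: max_r.
  have kt := hbd_kbd hm2 (gC.2 t t0).
  have sff := csq_ff hm2 kap0 eps0 ma hMp hr t gC.
  have ae : {ae leb3, forall x : R * R * R, cube x -> ff n.+1 kappa mu eps a C (t, x) =
      expR (- (kappa * t)) * a t x * (1 + syn (C t) x) `^ mu}.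
    by apply: filterS (clipa_ae hm2 sa na t0) => x h cx; rewrite /ff /= mt (h cx) mulNr mulrA.
  have [[pa mpa ia] _] := sa t t0.
  have mF : measurable_fun (cube : set (R * R * R)) (fun x : R * R * R => expR (- (kappa * t)) * a t x * (1 + syn (C t) x) `^ mu).
    apply: measurable_funM; first by apply: measurable_funM => //; exact: measurable_funTS.
    by apply: measurable_funTS; exact: measurable_powR_syn mu kt.
  have sF : sqint leb3 cube (fun x : R * R * R => expR (- (kappa * t)) * a t x * (1 + syn (C t) x) `^ mu).
    exact: c_sqint_ae mF ae sff.
  split=> // [x i|k].
    by rewrite pa (syn_periodic (C t)).
  by rewrite /G /GG (coef_ae k (c_sqint_integ sff) (c_sqint_integ sF) ae).
have [su0 pu0] : sqint leb3 cube u0 /\ torus_periodic u0 by have [l2 _] := s0; split; [exact: L2_sqint|case: l2].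
have [su1 pu1] : sqint leb3 cube u1 /\ torus_periodic u1 by have [l2 _] := s1; split; [exact: L2_sqint|case: l2].
have S := solution_of_modes n2 Om0 Om1 A10 A20 A30 lg Hc Hv Hg Hsmall HF
  (And3 su0 pu0 (fun k => erefl (h0 k))) (And3 su1 pu1 (fun k => erefl (h1 k))).
exists (fun t => syn (fun k => cc Om h0 h1 (G k) k t)); split.
- by eexists; exact: S.
- move=> u' [v' S'] t x t0.
  exact: (solution_unique hm2 kap0 eps0 Om0 Om1 ma sa na su0 su1 S S').
- move=> t t0; rewrite (cC t t0); have kt := hbd_kbd hm2 (gC.2 t t0).
  (* The exact weights in [Vbd] turn membership in the ball into the claimed norm bound without
     loss. *)
  apply: Hnorm_le (ltW Xs0) _.
    by have := sobolev_syn (leqW hm2) (Hc t t0); rewrite (cC t t0) => -[l2 hs]; split=> // al hal; apply: hs; exact: leqW.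
  move=> s us; have [_ /(_ s us)] := VC t t0.
  by congr (_ <= _); congr (_ * _); apply: eq_bigr => k _; rewrite (coef_syn k kt).
Qed.
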